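(* Let $r>0$, $x_0>0$, and let $P:[0,\infty)\to[0,\infty)$ satisfy the regularity hypothesis (R) given in the context. Define $\varphi:(0,x_0]\to(0,\infty)$ by $$\varphi(z)=\sup_{K\ge z}\frac{K-z}{P(K)},$$ and extend $\varphi$ to $(0,\infty)$ in any way such that the extended $\varphi$ is convex, strictly positive, twice continuously differentiable with strictly positive second derivative, and $\lim_{x\to\infty}\varphi(x)=0$. Define $\sigma:(0,\infty)\to(0,\infty)$ by $$\sigma^2(x)=2r\,\frac{\varphi(x)-x\varphi'(x)}{x^2\varphi''(x)}.$$ Let $X$ solve $dX_t=rX_t\,dt+\sigma(X_t)X_t\,dW_t$, $X_0=x_0$, with $W$ a standard Brownian motion and with $0$ an absorbing barrier for $X$, and let $$\hat P(K)=\sup_\tau\mathbb{E}^{x_0}\bigl[e^{-r\tau}(K-X_\tau)^+\bigr],\qquad K>0.$$ Then $\hat P(K)=P(K)$ for all $K>0$. That is, with the volatility function $\sigma$ the model's perpetual American put prices coincide with the given prices $P$.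
   Context: Hypothesis (R) on $P:[0,\infty)\to[0,\infty)$: (i) $(K-x_0)^+\le P(K)\le K$ for all $K$; (ii) there exists $K^*$ such that $P(K)>(K-x_0)^+$ for all $0<K<K^*$ and $P(K)=K-x_0$ for all $K\ge K^*$; (iii) $P$ is continuously differentiable on $(0,\infty)$ and twice continuously differentiable on $(0,\infty)\setminus\{K^*\}$; (iv) $P$ is strictly increasing on $(0,\infty)$ with strictly positive second derivative on $(0,K^* )$, and $P''(K^*-):=\lim_{K\uparrow K^*}P''(K)$ exists and lies in $(0,\infty)$. In the definition of $\hat P$ the supremum is over all random times $\tau$ that are stopping times for the filtration generated by $W$; $\mathbb{E}^{x_0}$ is expectation with $X_0=x_0$, $y^+=\max(y,0)$, and $e^{-r\tau}(K-X_\tau)^+$ is interpreted as $0$ on $\{\tau=\infty\}$. *)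

(* Defs.v *)
From HB Require Import structures.
From mathcomp Require Import all_boot all_order all_algebra.
From mathcomp Require Import all_classical all_reals all_analysis.

Set Implicit Arguments.
Unset Strict Implicit.
Unset Printing Implicit Defensive.

Import Order.TTheory GRing.Theory Num.Theory.
Import numFieldNormedType.Exports.

Local Open Scope classical_set_scope.
Local Open Scope ring_scope.

(* Meant for open sets [A], on which [f^`()] only depends on [f] restricted
   to [A]. *)
Definition C1_on {R : realType} (A : set R) (f : R -> R) : Prop :=
  forall x, A x -> derivable f x 1 /\ {for x, continuous (f^`())%classic}.

Definition C2_on {R : realType} (A : set R) (f : R -> R) : Prop :=
  C1_on A f /\ C1_on A (f^`())%classic.

(* Only the values of [P] on [0, +oo[ are constrained. [Kstar] is forced to be
   greater than [x0], since [P] is nonnegative and strictly increasing. *)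
Definition regular_put_prices {R : realType} (x0 : R) (P : R -> R) : Prop :=
  (forall K : R, 0 <= K -> Num.max (K - x0) 0 <= P K <= K) /\
  exists Kstar : R,
    [/\ (forall K : R, 0 < K -> K < Kstar -> Num.max (K - x0) 0 < P K)
        /\ (forall K : R, 0 <= K -> Kstar <= K -> P K = K - x0),
        C1_on [set K | 0 < K] P
        /\ C2_on [set K | 0 < K /\ K != Kstar] P,
        {in [pred K | 0 < K] &, {homo P : K L / K < L}},
        forall K : R, 0 < K -> K < Kstar -> 0 < (P^`(2))%classic K
      & exists2 l : R, 0 < l & (P^`(2))%classic K @[K --> Kstar^'-] --> l].

(* The admissible [phi]: prescribed on ]0, x0] by the prices, and extended
   smoothly and convexly to ]0, +oo[. Values outside ]0, +oo[ are irrelevant. *)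
Definition admissible_phi {R : realType} (x0 : R) (P phi : R -> R) : Prop :=
  [/\ forall z : R, 0 < z -> z <= x0 ->
        (phi z)%:E = ereal_sup [set ((K - z) / P K)%:E | K in [set K | z <= K]],
      convex_function (`]0, +oo[%classic : set R) phi
      /\ (forall x : R, 0 < x -> 0 < phi x),
      C2_on [set x | 0 < x] phi,
      forall x : R, 0 < x -> 0 < (phi^`(2))%classic x
    & phi x @[x --> +oo] --> (0 : R)].

Definition is_volatility {R : realType} (r : R) (phi sigma : R -> R) : Prop :=
  forall x : R, 0 < x -> 0 < sigma x /\
    sigma x ^+ 2
    = 2 * r * ((phi x - x * (phi^`())%classic x)
               / (x ^+ 2 * (phi^`(2))%classic x)).

Section StochasticCalculus.
Context {d : measure_display} {Omega : measurableType d} {R : realType}.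
Variable Pr : probability Omega R.

Implicit Types (F : R -> set (set Omega)) (W X H M : R -> Omega -> R).

Definition history W (t : R) : set (set Omega) :=
  [set A | exists (s : R) (B : set R),
    [/\ 0 <= s <= t, measurable B & A = W s @^-1` B]].

(* Completed by the null events of the underlying sigma-algebra, so that it
   remains a family of sub-sigma-algebras of events. *)
Definition brownian_filtration W (t : R) : set (set Omega) :=
  <<s history W t `|` [set N | measurable N /\ Pr N = 0%E] >>.

Definition continuous_paths X : Prop :=
  forall w, {within `[0, +oo[%classic, continuous (fun t => X t w)}.

Definition increment W (s t : R) (w : Omega) : R := W t w - W s w.

Definition standard_brownian W : Prop :=
  [/\ forall t : R, 0 <= t -> measurable_fun setT (W t),
      {ae Pr, forall w, W 0 w = 0},
      continuous_paths W,
      forall (s t : R) (B : set R), 0 <= s -> s < t -> measurable B ->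
        Pr (increment W s t @^-1` B) = normal_prob 0 (Num.sqrt (t - s)) B
    & forall (s t : R) (A : set Omega) (B : set R), 0 <= s -> s < t ->
        <<s history W s >> A -> measurable B ->
        Pr (A `&` increment W s t @^-1` B)
        = (Pr A * Pr (increment W s t @^-1` B))%E].

Definition adapted F X : Prop :=
  forall (t : R) (B : set R), 0 <= t -> measurable B -> F t (X t @^-1` B).

Definition progressively_measurable F H : Prop :=
  forall t : R, 0 <= t ->
    measurable_fun
      (`[0, t]%classic `*` setT : set (R * g_sigma_algebraType (F t)))
      (fun p => H p.1 p.2).

(* The simple process \sum_(i < sp_size) sp_val i * 1_{]sp_time i, sp_time i.+1]} *)
Record simple_process F := SimpleProcess {
  sp_size : nat;
  sp_time : nat -> R;
  sp_val : nat -> Omega -> R;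
  sp_time_ge0 : 0 <= sp_time 0%N;
  sp_time_nd : forall i, sp_time i <= sp_time i.+1;
  sp_val_measurable : forall i B, measurable B ->
    F (sp_time i) (sp_val i @^-1` B);
  sp_val_bounded : forall i, exists C : R, forall w, `|sp_val i w| <= C }.

Definition sp_eval F (S : simple_process F) (s : R) (w : Omega) : R :=
  \sum_(i < sp_size S)
    sp_val S i w * ((sp_time S i < s) && (s <= sp_time S i.+1))%:R.

Definition sp_integral F W (S : simple_process F) (t : R) (w : Omega) : R :=
  \sum_(i < sp_size S)
    sp_val S i w * (W (Num.min t (sp_time S i.+1)) w
                    - W (Num.min t (sp_time S i)) w).

(* [M t] is the Ito integral of [H] against [W] over [0, t]: [H] is a
   progressively measurable process with locally square integrable paths, and
   [M] is the continuous adapted process obtained as the limit in probability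
   of the integrals of simple processes approximating [H], the paths being
   compared in L^2([0, t], ds). [F] is meant to be a filtration with respect
   to which [W] is a Brownian motion; the limit does not depend on [S]. *)
Definition is_ito_integral F W H M : Prop :=
  [/\ progressively_measurable F H,
      {ae Pr, forall w, forall t : R, 0 <= t ->
        (\int[lebesgue_measure]_(s in `[0%R, t]) ((H s w ^+ 2)%R)%:E < +oo)%E},
      adapted F M, continuous_paths M
    & exists S : nat -> simple_process F, forall t eps : R, 0 <= t -> 0 < eps ->
        (Pr [set w | eps%:E <
            \int[lebesgue_measure]_(s in `[0%R, t])
               ((sp_eval (S n) s w - H s w) ^+ 2)%R%:E]%E
          @[n --> \oo] --> 0%E)
        /\ (Pr [set w | eps < `|sp_integral W (S n) t w - M t w|]
          @[n --> \oo] --> 0%E)].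

(* [X] solves dX = r X dt + sigma(X) X dW, X_0 = x0, with 0 absorbing; with
   [F] the filtration of [W], [X] is a strong solution. At 0 the diffusion
   coefficient [sigma x * x] vanishes whatever [sigma 0] is. *)
Definition is_price_process F W (r x0 : R) (sigma : R -> R) X : Prop :=
  [/\ adapted F X, continuous_paths X,
      (forall (t : R) w, 0 <= t -> 0 <= X t w),
      {ae Pr, forall w, X 0 w = x0 /\ forall s t : R, 0 <= s -> s <= t ->
        X s w = 0 -> X t w = 0}
    & exists2 M, is_ito_integral F W (fun s w => sigma (X s w) * X s w) M &
        {ae Pr, forall w, forall t : R, 0 <= t ->
          X t w = x0 + \int[lebesgue_measure]_(s in `[0%R, t]) (r * X s w)
                  + M t w}].

Definition is_stopping_time F (tau : Omega -> \bar R) : Prop :=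
  (forall w, (0 <= tau w)%E) /\
  forall t : R, 0 <= t -> F t [set w | (tau w <= t%:E)%E].

Definition discounted_payoff (r K : R) X (tau : Omega -> \bar R)
    (w : Omega) : R :=
  match tau w with
  | t%:E => expR (- (r * t)) * Num.max (K - X t w) 0
  | _ => 0
  end.

Definition put_price F (r : R) X (K : R) : \bar R :=
  ereal_sup [set 'E_Pr[discounted_payoff r K X tau]%E
            | tau in [set tau | is_stopping_time F tau]].

End StochasticCalculus.

(* Main.v *)
(* Let [L f = s^2 f'' / 2 + r x f' - r f] with [s(x) = x sigma(x)]. The choice of
   [sigma] makes both [phi] and the identity solve [L f = 0] on ]0, +oo[.

   Upper bound: convex duality between [P] and [phi] gives [a, b >= 0] such that
   [a phi + b x] dominates [K - x] on ]0, +oo[ and equals [P K] at [x0]; its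
   discounted value along [X] is a supermartingale dominating the payoff.

   Lower bound: either [P K = K - x0], and immediate exercise is optimal, or the
   supremum defining [phi z] is attained at [K] for some [z < x0], and exercising
   at the first passage of [X] below [z] yields [(K - z) / phi z = P K]; the
   passage is monitored on finer and finer deterministic grids.

   Instead of Ito's formula, only a Dynkin inequality for bounded C^2 functions
   [G] is used. It is proved for Euler schemes driven by the simple processes
   that approximate the integrand, and passed to the limit. The integrand is only
   locally square integrable: the role of localising stopping times is played by
   the weights [exp (- lam \sum h (xi^2 + b))], which bound the weighted quadratic
   variation by [1 / lam], and [lam] tends to [0] at the end. The functions [phi]
   and [x] become admissible by composition with smooth caps, at the price of an
   arbitrarily small error. *)

(* The coefficient [x sigma(x)] is only known to be continuous on ]0, +oo[, so no stability estimate
   for the equation is at hand. The Euler schemes therefore do not discretise the equation: they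
   take the drift from the given path [X] and the noise coefficient from the simple processes, and
   they are close to [X] by the equation that [X] satisfies.

   Those simple processes converge in probability only. Errors are truncated by [1], a diagonal
   sequence with summable mean errors is chosen, and limits are taken path by path; the weights
   provide the uniform bound that carries them over to expectations.

   A one-sided inequality serves both bounds because the lower one uses it for a constant minus a
   truncation of [phi]. Boundedness of the generator forces test functions to be flat near [0] and
   at infinity. In the upper bound this rests on [phi >= 1] on ]0, x0]: a small multiple of [phi]
   lifts the supersolution above its cap near [0], as a small multiple of [x] does at infinity.

   Grids reduce optional stopping to finitely many inequalities on events, at the price of the time
   spent below [z] unnoticed. *)
Require Import Defs.
From HB Require Import structures.
From mathcomp Require Import all_boot all_order all_algebra.
From mathcomp Require Import all_classical all_reals all_analysis.
From mathcomp Require Import measurable_realfun ring lra.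

Set Implicit Arguments.
Unset Strict Implicit.
Unset Printing Implicit Defensive.

Import Order.TTheory GRing.Theory Num.Theory.
Import numFieldNormedType.Exports.

Local Open Scope classical_set_scope.
Local Open Scope ring_scope.

(** * Moments of the normal distribution *)

Section density.
Import HBNNSimple.
Context d (T : measurableType d) {R : realType}.
Variables (mu nu : {measure set T -> \bar R}) (p : T -> R).
Hypothesis mp : measurable_fun setT p.
Hypothesis p0 : forall x, 0 <= p x.
Hypothesis nuE : forall A, measurable A ->
  nu A = (\int[mu]_(x in A) (p x)%:E)%E.

Let mulp (f : {nnsfun T >-> R}) :
  (\int[nu]_x (f x)%:E = \int[mu]_x ((f x)%:E * (p x)%:E))%E.
Proof.
under eq_integral do rewrite fimfunE -fsumEFin//.
rewrite ge0_integral_fsum//; last 2 first.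
- by move=> r; exact/measurable_EFinP/measurableT_comp.
- by move=> n x _; exact: nnfun_muleindic_ge0.
under [RHS]eq_integral => x _.
  rewrite fimfunE -fsumEFin// ge0_mule_fsuml; last first.
    by move=> r; rewrite EFinM; exact: nnfun_muleindic_ge0.
  over.
rewrite ge0_integral_fsum//; last 2 first.
- move=> r; apply: emeasurable_funM; last exact/measurable_EFinP.
  by exact/measurable_EFinP/measurableT_comp.
- by move=> n x _; apply: mule_ge0; [exact: nnfun_muleindic_ge0|rewrite lee_fin].
apply: eq_fsbigr => r rf.
have [r0|r0] := ltP r 0.
  rewrite preimage_nnfun0// integral0_eq; last first.
    by move=> x _; rewrite indic0 mulr0.
  by rewrite integral0_eq// => x _; rewrite indic0 mulr0 mul0e.
under [RHS]eq_integral do rewrite EFinM -muleA.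
rewrite ge0_integralZl//; last 2 first.
- apply: emeasurable_funM; exact/measurable_EFinP.
- by move=> x _; rewrite mule_ge0// lee_fin.
under [LHS]eq_integral do rewrite EFinM.
rewrite ge0_integralZl//; last exact/measurable_EFinP.
rewrite integral_indic// setIT nuE//; congr (_ * _)%E.
rewrite integral_mkcond; apply: eq_integral => x _.
rewrite patchE indicE; case: ifPn => //= xf; first by rewrite mul1e.
by rewrite mul0e.
Qed.

(** On indicators this is [nuE], hence it holds for simple functions ([mulp]), and monotone
    convergence along [nnsfun_approx] does the rest. It turns integrals against [normal_prob] into
    Lebesgue integrals. *)
Lemma ge0_integral_density (f : T -> \bar R) : measurable_fun setT f ->
  (forall x, 0 <= f x)%E ->
  (\int[nu]_x f x = \int[mu]_x (f x * (p x)%:E))%E.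
Proof.
move=> mf f0; pose g := nnsfun_approx measurableT mf.
transitivity (limn (fun n => \int[nu]_x (g n x)%:E))%E.
  rewrite -monotone_convergence//; last 3 first.
  - by move=> n; exact/measurable_EFinP.
  - by move=> n x _; rewrite lee_fin.
  - by move=> x _ a b ab; rewrite lee_fin; exact/lefP/nd_nnsfun_approx.
  by apply: eq_integral => x _; apply/esym/cvg_lim => //; exact: cvg_nnsfun_approx.
under eq_fun do rewrite mulp.
rewrite -monotone_convergence//; last 3 first.
- by move=> n; apply: emeasurable_funM; exact/measurable_EFinP.
- by move=> n x _; rewrite mule_ge0// lee_fin.
- move=> x _ a b ab; rewrite lee_wpmul2r ?lee_fin//.
  exact/lefP/nd_nnsfun_approx.
apply: eq_integral => x _; apply/cvg_lim => //.
by apply: cvgeZr=> //; exact: cvg_nnsfun_approx.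
Qed.
End density.

Section gaussian.
Context {R : realType}.
Variable (s : R).
Hypothesis s0 : 0 < s.
Notation mu := (@lebesgue_measure R).
Notation pdf := (normal_pdf 0 s).

Let pdfE x : pdf x = normal_peak s * expR (- x ^+ 2 / (s ^+ 2 *+ 2)).
Proof. by rewrite normal_pdfE ?gt_eqF// /normal_fun subr0. Qed.

Let pdfN x : pdf (- x) = pdf x.
Proof. by rewrite !pdfE sqrrN. Qed.

Let dpdf (x : R) : is_derive x 1 pdf (- (x / s ^+ 2) * pdf x).
Proof.
have -> : pdf = (fun x => normal_peak s * expR (- x ^+ 2 / (s ^+ 2 *+ 2))).
  by apply/funext => y; exact: pdfE.
apply: is_derive_eq; rewrite /GRing.scale/=.
by field; rewrite gt_eqF.
Qed.

Let cpdf : continuous pdf.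
Proof. by apply: continuous_normal_pdf; rewrite gt_eqF. Qed.

Let pdf0 x : 0 <= pdf x. Proof. exact: normal_pdf_ge0. Qed.

Lemma normal_density (f : R -> \bar R) : measurable_fun setT f ->
  (forall x, 0 <= f x)%E ->
  (\int[normal_prob 0 s]_x f x = \int[mu]_x (f x * (pdf x)%:E))%E.
Proof.
move=> mf f0; apply: ge0_integral_density => //.
exact: measurable_normal_pdf.
Qed.

(** With [v = x^2 / (4 s^2)] the density decays like [exp (- 2 v)]. One factor [exp (- v)] absorbs
    [x^4 = 16 s^4 v^2], because [v^2 exp (- v) <= 2]; the other one is, up to the factor
    [Num.sqrt 2 <= 2], the density of variance [2 s^2]. Hence [64 = 16 * 2 * 2], larger than the
    true moment [3 s^4], but any multiple of [s^4] will do. *)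
Let x4_bound (x : R) :
  x ^+ 4 * pdf x <= 64 * s ^+ 4 * normal_pdf 0 (Num.sqrt 2 * s) x.
Proof.
have s20 : 0 < Num.sqrt 2 * s by rewrite mulr_gt0// sqrtr_gt0.
rewrite pdfE normal_pdfE ?gt_eqF// /normal_fun subr0.
set v := x ^+ 2 / (4 * s ^+ 2).
have v0 : 0 <= v by rewrite divr_ge0// ?sqr_ge0// mulr_ge0// sqr_ge0.
have -> : - x ^+ 2 / (s ^+ 2 *+ 2) = - v - v by rewrite /v; field; rewrite gt_eqF.
have -> : - x ^+ 2 / ((Num.sqrt 2 * s) ^+ 2 *+ 2) = - v.
  by rewrite exprMn sqr_sqrtr// /v; field; rewrite gt_eqF.
have -> : x ^+ 4 = 16 * s ^+ 4 * v ^+ 2 by rewrite /v; field; rewrite gt_eqF.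
have pk : normal_peak s = Num.sqrt 2 * normal_peak (Num.sqrt 2 * s).
  rewrite /normal_peak exprMn sqr_sqrtr//.
  rewrite (_ : 2 * s ^+ 2 * pi *+ 2 = 2 * (s ^+ 2 * pi *+ 2)); last by ring.
  rewrite (sqrtrM _ (ler0n _ 2)) invfM mulrA mulfV ?mul1r//.
have sq2 : Num.sqrt 2 <= 2 :> R.
  by rewrite -ler_sqr ?nnegrE ?sqrtr_ge0// sqr_sqrtr//; lra.
rewrite pk expRD.
have ev : v ^+ 2 * expR (- v) <= 2.
  rewrite expRN ler_pdivrMr ?expR_gt0//.
  by have := expR_ge1Dxn 1 v0; rewrite (_ : 2`!%:R = 2 :> R)//; lra.
have p0 := normal_peak_ge0 (Num.sqrt 2 * s).
set p := normal_peak _ in p0 *; set e := expR (- v).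
have e0 : 0 <= e by exact: expR_ge0.
have -> : 16 * s ^+ 4 * v ^+ 2 * (Num.sqrt 2 * p * (e * e)) =
  (16 * s ^+ 4 * p * e) * (Num.sqrt 2 * (v ^+ 2 * e)) by ring.
have -> : 64 * s ^+ 4 * (p * e) = (16 * s ^+ 4 * p * e) * (2 * 2) by ring.
apply: ler_wpM2l; first by rewrite mulr_ge0// mulr_ge0// mulr_ge0// exprn_ge0// ltW.
by apply: ler_pM => //; rewrite ?sqrtr_ge0// mulr_ge0// sqr_ge0.
Qed.

Lemma normal_moment4 :
  (\int[normal_prob 0 s]_x (x ^+ 4)%:E <= (64 * s ^+ 4)%:E)%E.
Proof.
have mx4 n : measurable_fun setT (fun x : R => (x ^+ n)%:E).
  by apply/measurable_EFinP; exact: exprn_measurable.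
rewrite normal_density//; last first.
  by move=> x; rewrite lee_fin (_ : x ^+ 4 = (x ^+ 2) ^+ 2) ?sqr_ge0// -exprM.
apply: (@le_trans _ _ (\int[mu]_x ((64 * s ^+ 4)%:E * (normal_pdf 0 (Num.sqrt 2 * s) x)%:E))%E).
  apply: ge0_le_integral => //=.
  - move=> x _; rewrite lee_fin mulr_ge0//.
    by rewrite (_ : x ^+ 4 = (x ^+ 2) ^+ 2) ?sqr_ge0// -exprM.
  - apply: emeasurable_funM; [exact: mx4|].
    by apply/measurable_EFinP; exact: measurable_normal_pdf.
  - apply: measurable_funeM; apply/measurable_EFinP.
    exact: measurable_normal_pdf.
  - by move=> x _; rewrite -!EFinM lee_fin; exact: x4_bound.
rewrite ge0_integralZl//.
- by rewrite integral_normal_pdf mule1.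
- by apply/measurable_EFinP; exact: measurable_normal_pdf.
- by move=> x _; rewrite lee_fin normal_pdf_ge0.
- by rewrite lee_fin mulr_ge0// exprn_ge0// ltW.
Qed.

Let integral_even (f : R -> R) : (forall x, 0 <= f x) -> continuous f ->
  f =1 f \o -%R ->
  (\int[normal_prob 0 s]_x (f x)%:E =
   2%:E * \int[mu]_(x in `[0%R, +oo[) (f x * pdf x)%:E)%E.
Proof.
move=> f0 cf fN; rewrite normal_density//; last first.
  by apply/measurable_EFinP; exact: continuous_measurable_fun.
under eq_integral do rewrite -EFinM.
rewrite ge0_symfun_integralT.
- by rewrite set_itvcy.
- by move=> x; rewrite mulr_ge0.
- by move=> x; apply: cvgM; [exact: cf|exact: cpdf].
- by move=> x /=; rewrite pdfN [in RHS](fN (- x))/= opprK.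
Qed.

(** A primitive of [(x^2 - s^2) * pdf x] that vanishes at [0] and at infinity, which is the identity
    for the variance. The fundamental theorem on a half-line asks for an integrand of constant sign,
    whence the split at [s], where both pieces equal [K]. *)
Let F x := - s ^+ 2 * (x * pdf x).

Let cvg_F : F x @[x --> +oo] --> (0:R).
Proof.
set C := 64 * s ^+ 4 * normal_peak (Num.sqrt 2 * s).
have C0 : 0 <= C.
  by rewrite mulr_ge0 ?normal_peak_ge0// mulr_ge0// exprn_ge0// ltW.
have xC (x : R) : 1 <= x -> x * pdf x <= C / x.
  move=> x1; have x0 : 0 < x by lra.
  rewrite ler_pdivlMr//.
  apply: (@le_trans _ _ (x ^+ 4 * pdf x)).
    rewrite mulrAC; apply: ler_wpM2r => //.
    by rewrite -expr2; apply: ler_weXn2l.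
  apply: (le_trans (x4_bound x)); rewrite /C; apply: ler_wpM2l.
    by rewrite mulr_ge0// exprn_ge0// ltW.
  by apply: normal_pdf_ub; rewrite gt_eqF// mulr_gt0// sqrtr_gt0.
apply/cvgrPdist_le => e e0; near=> x.
have x1 : 1 <= x by near: x; apply: nbhs_pinfty_ge; rewrite num_real.
have x2 : s ^+ 2 * C / e <= x by near: x; apply: nbhs_pinfty_ge; rewrite num_real.
have x0 : 0 < x by lra.
rewrite sub0r normrN /F mulNr normrN ger0_norm; last first.
  by rewrite mulr_ge0 ?sqr_ge0// mulr_ge0// ltW.
apply: (@le_trans _ _ (s ^+ 2 * (C / x))).
  by apply: ler_wpM2l; [exact: sqr_ge0|exact: xC].
by rewrite mulrA ler_pdivrMr// -ler_pdivrMl// mulrC.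
Unshelve. all: by end_near. Qed.

Let dF (x : R) : is_derive x 1 F ((x ^+ 2 - s ^+ 2) * pdf x).
Proof.
have h := dpdf x.
by rewrite /F; apply: is_derive_eq; rewrite /GRing.scale/=; field; rewrite gt_eqF.
Qed.

Let F'E : (F^`())%classic = fun x => (x ^+ 2 - s ^+ 2) * pdf x.
Proof. by apply/funext => x; rewrite derive1E; exact: derive_val. Qed.

Let cF : continuous F.
Proof.
move=> x; apply: differentiable_continuous; apply/derivable1_diffP.
by have := dF x => /@ex_derive.
Qed.

Let cf : continuous (fun x : R => (x ^+ 2 - s ^+ 2) * pdf x).
Proof.
move=> x; apply: cvgM; last exact: cpdf.
by apply: cvgB; [exact: exprn_continuous|exact: cvg_cst].
Qed.

Let K := s ^+ 2 * (s * pdf s).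

Let int1 : (\int[mu]_(x in `[s, +oo[) ((x ^+ 2 - s ^+ 2) * pdf x)%:E = K%:E)%E.
Proof.
rewrite (@ge0_continuous_FTC2y _ _ F s 0).
- by rewrite -EFinB sub0r /F mulNr opprK.
- move=> x sx; rewrite mulr_ge0// subr_ge0.
  by rewrite ler_sqr ?nnegrE// ltW// (lt_le_trans s0).
- by apply: continuous_subspaceT; exact: cf.
- exact: cvg_F.
- by move=> x _; have := dF x => /@ex_derive.
- by apply: cvg_at_right_filter; exact: cF.
- by move=> x _; rewrite F'E.
Qed.

Let int2 : (\int[mu]_(x in `[0%R, s]) ((s ^+ 2 - x ^+ 2) * pdf x)%:E = K%:E)%E.
Proof.
rewrite (@continuous_FTC2 _ _ (\- F) 0 s)//.
- by rewrite /F /= -EFinB mul0r mulr0 oppr0 subr0 mulNr opprK.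
- apply: continuous_subspaceT => x; apply: cvgM; last exact: cpdf.
  by apply: cvgB; [exact: cvg_cst|exact: exprn_continuous].
- split.
  + move=> x _; apply: derivableN.
    by have := dF x => /@ex_derive.
  + by apply: cvg_at_right_filter; apply: cvgN; exact: cF.
  + by apply: cvg_at_left_filter; apply: cvgN; exact: cF.
- move=> x _; rewrite derive1E; have h := dF x.
  by rewrite deriveN; [rewrite derive_val; ring|exact: ex_derive].
Qed.

Let mX n : measurable_fun setT (fun x : R => (x ^+ n * pdf x)%:E).
Proof.
apply/measurable_EFinP; apply: measurable_funM.
  exact: exprn_measurable.
exact: measurable_normal_pdf.
Qed.

Let int3 : (\int[mu]_(x in `[0%R, +oo[) (x ^+ 2 * pdf x)%:E =
  \int[mu]_(x in `[0%R, +oo[) (s ^+ 2 * pdf x)%:E)%E.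
Proof.
have split (f : R -> R) : measurable_fun setT f -> (forall x, 0 <= f x) ->
  (\int[mu]_(x in `[0%R, +oo[) (f x)%:E =
   \int[mu]_(x in `[0%R, s]) (f x)%:E + \int[mu]_(x in `[s, +oo[) (f x)%:E)%E.
  move=> mf f0.
  have -> : `[0, +oo[%classic = `[0, s[ `|` `[s, +oo[ :> set R.
    by rewrite (@itv_bndbnd_setU _ _ (BLeft 0) (BLeft s))// bnd_simp ltW.
  rewrite ge0_integral_setU//=.
  - rewrite integral_itv_bndo_bndc//.
    exact/measurable_EFinP/measurable_funTS.
  - exact/measurable_EFinP/measurable_funTS.
  - by move=> x _; rewrite lee_fin.
  - apply/disj_setPS => x [] /=; rewrite !in_itv/= andbT => /andP[_ xs] sx.
    by have := lt_le_trans xs sx; rewrite ltxx.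
have m2 : measurable_fun setT (fun x : R => x ^+ 2 * pdf x).
  by apply/measurable_EFinP; exact: mX.
have m0 : measurable_fun setT (fun x : R => s ^+ 2 * pdf x).
  by apply: measurable_funM => //; exact: measurable_normal_pdf.
rewrite !split//; last 2 first.
  by move=> x; rewrite mulr_ge0// sqr_ge0.
  by move=> x; rewrite mulr_ge0// sqr_ge0.
have -> : (\int[mu]_(x in `[s, +oo[) (x ^+ 2 * pdf x)%:E =
   K%:E + \int[mu]_(x in `[s, +oo[) (s ^+ 2 * pdf x)%:E)%E.
  rewrite -int1 -ge0_integralD//=.
  - by apply: eq_integral => x _; rewrite -EFinD; congr EFin; ring.
  - move=> x; rewrite in_itv/= andbT => sx; rewrite lee_fin mulr_ge0// subr_ge0.
    by rewrite ler_sqr ?nnegrE// ltW// (lt_le_trans s0).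
  - apply/measurable_EFinP/measurable_funTS; exact: continuous_measurable_fun.
  - by move=> x _; rewrite lee_fin mulr_ge0// sqr_ge0.
  - exact/measurable_EFinP/measurable_funTS.
rewrite addeA; congr (_ + _)%E.
rewrite -int2 -ge0_integralD//=.
- by apply: eq_integral => x _; rewrite -EFinD; congr EFin; ring.
- by move=> x _; rewrite lee_fin mulr_ge0// sqr_ge0.
- exact/measurable_EFinP/measurable_funTS.
- move=> x; rewrite in_itv/= => /andP[x0 xs]; rewrite lee_fin mulr_ge0// subr_ge0.
  by rewrite ler_sqr ?nnegrE// ltW.
- apply/measurable_EFinP/measurable_funTS; apply: measurable_funM.
    apply: measurable_funB => //; exact: exprn_measurable.
  exact: measurable_normal_pdf.
Qed.

Lemma normal_moment2 : (\int[normal_prob 0 s]_x (x ^+ 2)%:E = (s ^+ 2)%:E)%E.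
Proof.
have h : (\int[normal_prob 0 s]_x 1%:E = 1 :> \bar R)%E.
  by rewrite integral_cst//= probability_setT mule1.
rewrite integral_even//.
- rewrite int3; under eq_integral do rewrite EFinM.
  rewrite ge0_integralZl//.
  + rewrite muleCA; rewrite -[RHS]mule1; congr (_ * _)%E; rewrite -[RHS]h.
    rewrite (integral_even (f := cst 1))//=; last by move=> x; exact: cvg_cst.
    by congr (_ * _)%E; apply: eq_integral => x _; rewrite mul1r.
  + apply/measurable_EFinP/measurable_funTS; exact: measurable_normal_pdf.
  + by move=> x _; rewrite lee_fin.
  + by rewrite lee_fin sqr_ge0.
- by move=> x; rewrite sqr_ge0.
- exact: exprn_continuous.
- by move=> x /=; rewrite sqrrN.
Qed.

Lemma normal_integrable (f : R -> R) C : measurable_fun setT f ->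
  (forall x, `|f x| <= C * (1 + x ^+ 4)) ->
  (normal_prob 0 s).-integrable setT (EFin \o f).
Proof.
move=> mf fC; have C0 : 0 <= C.
  by have := fC 0; rewrite expr0n/= addr0 mulr1; apply: le_trans.
apply/integrableP; split; first exact/measurable_EFinP.
have m4 : measurable_fun setT (fun x : R => (x ^+ 4)%:E).
  by apply/measurable_EFinP; exact: exprn_measurable.
have x4 (x : R) : 0 <= x ^+ 4 by rewrite (_ : x ^+ 4 = (x ^+ 2) ^+ 2) ?sqr_ge0// -exprM.
apply: (@le_lt_trans _ _ (\int[normal_prob 0 s]_x (C%:E * (1 + (x ^+ 4)%:E)))%E).
  apply: ge0_le_integral => //=.
  - by apply/measurable_EFinP; exact: measurableT_comp.
  - by apply: measurable_funeM; apply: emeasurable_funD.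
  - by move=> x _; rewrite -EFinD -EFinM lee_fin.
rewrite ge0_integralZl//; last 2 first.
- by apply: emeasurable_funD.
- by move=> x _; rewrite -EFinD lee_fin addr_ge0.
have h : (\int[normal_prob 0 s]_x 1%:E = 1 :> \bar R)%E.
  by rewrite integral_cst//= probability_setT mule1.
rewrite (_ : (\int[_]_x _ = 1 + \int[normal_prob 0 s]_x (x ^+ 4)%:E)%E); last first.
  by rewrite ge0_integralD//; [congr (_ + _)%E; exact: h|by move=> x _; rewrite lee_fin].
rewrite lte_mul_pinfty// lte_add_pinfty ?ltry//.
by apply: le_lt_trans normal_moment4 _; rewrite ltry.
Qed.

(** Positive and negative parts have the same integral by the reflection [x -> - x]. They are
    compared separately because [normal_density] is stated for nonnegative functions. *)
Lemma normal_moment1 : (\int[normal_prob 0 s]_x x%:E = 0)%E.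
Proof.
pose p (x : R) := Num.max x 0.
have cp : continuous p.
  by move=> x; apply: continuous_max => //; exact: cvg_cst.
have mp : measurable_fun setT p by exact: continuous_measurable_fun.
have mq : measurable_fun setT (fun x : R => p (- x)).
  by apply: measurableT_comp.
have p0 x : 0 <= p x by rewrite /p le_max lexx orbT.
have px x : p x <= 1 * (1 + x ^+ 4).
  have := sqr_ge0 (x - 1); have := sqr_ge0 (x ^+ 2 - 1).
  rewrite /p; case: (leP x 0) => _; nra.
have E : (\int[normal_prob 0 s]_x (p x)%:E = \int[normal_prob 0 s]_x (p (- x))%:E)%E.
  have mpp : measurable_fun setT (fun x => p x * pdf x).
    by apply: measurable_funM => //; exact: measurable_normal_pdf.
  have mqq : measurable_fun setT (fun x : R => p (- x) * pdf x).
    by apply: measurable_funM => //; exact: measurable_normal_pdf.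
  rewrite !normal_density//; last 3 first.
  - exact/measurable_EFinP.
  - by move=> x; rewrite lee_fin.
  - exact/measurable_EFinP.
  transitivity (\int[mu]_(x in `]-oo, 0%R]) (p (- x) * pdf x)%:E)%E.
    have := @ge0_integration_by_substitutionNy R (fun x => p (- x) * pdf x) 0.
    rewrite oppr0 => ->; last 2 first.
    - apply: continuous_subspaceT => x; apply: cvgM; last exact: cpdf.
      by apply: continuous_comp; [exact: opp_continuous|exact: cp].
    - by move=> x _; rewrite mulr_ge0.
    rewrite [RHS]integral_mkcond/=; apply: eq_integral => x _.
    rewrite !patchE; case: ifPn => /=.
      by rewrite opprK pdfN.
    rewrite notin_setE /= in_itv/= andbT => /negP; rewrite -ltNge => x0.
    by rewrite /p (max_idPr _) ?mul0e// ltW.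
  rewrite integral_mkcond; apply: eq_integral => x _.
  rewrite !patchE; case: ifPn => //=.
  rewrite notin_setE /= in_itv/= => /negP; rewrite -ltNge => x0.
  by rewrite /p (max_idPr _) ?mul0e// oppr_le0 ltW.
have i1 : (normal_prob 0 s).-integrable setT (EFin \o p).
  by apply: (@normal_integrable _ 1) => // x; rewrite ger0_norm.
have i2 : (normal_prob 0 s).-integrable setT (EFin \o (fun x : R => p (- x))).
  apply: (@normal_integrable _ 1) => // x; rewrite ger0_norm//.
  by have := px (- x); rewrite (_ : (- x) ^+ 4 = x ^+ 4)//; ring.
transitivity (\int[normal_prob 0 s]_x ((p x)%:E - (p (- x))%:E))%E.
  apply: eq_integral => x _; rewrite -EFinB; congr EFin; rewrite /p.
  case: (leP x 0); case: (leP (- x) 0); lra.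
rewrite integralB// -E subee//.
exact: integrable_fin_num i1.
Qed.
End gaussian.

(** * Real-valued expectations *)

Definition Ex {d} {T : measurableType d} {R : realType} (Pr : probability T R)
  (U : T -> R) : R := \int[Pr]_w U w.

Section expectation.
Context {d : measure_display} {T : measurableType d} {R : realType}.
Variable Pr : probability T R.
Implicit Types (U V : T -> R).

Local Notation Ex := (Ex Pr).
Local Notation L1 U := (Pr.-integrable setT (EFin \o U)).

Lemma Ex_EFin U : L1 U -> (Ex U)%:E = (\int[Pr]_w (U w)%:E)%E.
Proof. by move=> iU; rewrite /Ex/Rintegral fineK//; exact: integrable_fin_num. Qed.

Lemma L1_bounded U (C : R) : measurable_fun setT U -> (forall w, `|U w| <= C) -> L1 U.
Proof.
move=> mU UC; apply: measurable_bounded_integrable => //.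
  by rewrite (le_lt_trans (probability_le1 _ _))// ltry.
by exists C; split; rewrite ?num_real// => M CM w _; rewrite /= (le_trans (UC w))// ltW.
Qed.

Lemma L1_dom U V : measurable_fun setT U -> (forall w, `|U w| <= V w) -> L1 V -> L1 U.
Proof.
move=> mU UV iV; apply: (le_integrable _ _ _ iV) => //; first exact/measurable_EFinP.
by move=> w _; rewrite lee_fin (le_trans (UV w))// ler_norm.
Qed.

Lemma L1D U V : L1 U -> L1 V -> L1 (fun w => U w + V w).
Proof. by move=> iU iV; have := integrableD measurableT iU iV. Qed.

Lemma L1B U V : L1 U -> L1 V -> L1 (fun w => U w - V w).
Proof. by move=> iU iV; have := integrableB measurableT iU iV. Qed.

Lemma L1Z (k : R) U : L1 U -> L1 (fun w => k * U w).
Proof. by move=> iU; have := integrableZl measurableT k iU. Qed.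

Lemma L1_sum n (U : nat -> T -> R) : (forall i, (i < n)%N -> L1 (U i)) ->
  L1 (fun w => \sum_(i < n) U i w).
Proof.
elim: n => [_|n ih h].
  rewrite (_ : (fun w => _) = cst 0); last by apply/funext => w; rewrite big_ord0.
  by apply: (@L1_bounded _ 0) => // w; rewrite normr0.
under eq_fun do rewrite big_ord_recr/=.
by apply: L1D; [apply: ih => i /ltnW; exact: h|exact: h].
Qed.

Lemma ExD U V : L1 U -> L1 V -> Ex (fun w => U w + V w) = Ex U + Ex V.
Proof. by move=> iU iV; rewrite /Ex RintegralD. Qed.

Lemma ExB U V : L1 U -> L1 V -> Ex (fun w => U w - V w) = Ex U - Ex V.
Proof. by move=> iU iV; rewrite /Ex RintegralB. Qed.

Lemma ExZ (k : R) U : L1 U -> Ex (fun w => k * U w) = k * Ex U.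
Proof. by move=> iU; rewrite /Ex RintegralZl. Qed.

Lemma Ex_cst k : Ex (fun=> k) = k.
Proof. by rewrite /Ex Rintegral_cst//= probability_setT mulr1. Qed.

Lemma Ex_sum n (U : nat -> T -> R) : (forall i, (i < n)%N -> L1 (U i)) ->
  Ex (fun w => \sum_(i < n) U i w) = \sum_(i < n) Ex (U i).
Proof.
elim: n => [_|n ih h].
  by under [X in Ex X]eq_fun do rewrite big_ord0; rewrite Ex_cst big_ord0.
under [X in Ex X]eq_fun do rewrite big_ord_recr/=.
rewrite ExD; [|apply: L1_sum => i /ltnW; exact: h|exact: h].
by rewrite big_ord_recr/= ih// => i /ltnW; exact: h.
Qed.

Lemma Ex_le U V : L1 U -> L1 V -> (forall w, U w <= V w) -> Ex U <= Ex V.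
Proof. by move=> iU iV UV; apply: le_Rintegral. Qed.

Lemma Ex_ge0 U : (forall w, 0 <= U w) -> 0 <= Ex U.
Proof. by move=> U0; apply: Rintegral_ge0. Qed.

Lemma eq_Ex_ae U V : measurable_fun setT U -> measurable_fun setT V ->
  {ae Pr, forall w, U w = V w} -> Ex U = Ex V.
Proof.
move=> mU mV UV; congr fine; apply: ae_eq_integral => //; try exact/measurable_EFinP.
by apply: filterS UV => w h _; rewrite h.
Qed.

Lemma Ex_dct (U_ : nat -> T -> R) U (C : R) :
  (forall n, measurable_fun setT (U_ n)) -> measurable_fun setT U ->
  (forall n w, `|U_ n w| <= C) ->
  {ae Pr, forall w, U_ ^~ w @ \oo --> U w} -> Ex (U_ n) @[n --> \oo] --> Ex U.
Proof.
move=> mU_ mU UC cU.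
have [| | | | |iU _ h] := @dominated_convergence _ T R Pr setT measurableT
  (fun n => EFin \o U_ n) (EFin \o U) (cst C%:E).
- by move=> n; exact/measurable_EFinP.
- exact/measurable_EFinP.
- by apply: filterS cU => w h _; apply: cvg_EFin => //; exact: nearW.
- by apply: (@L1_bounded (cst C) `|C|).
- by apply: aeW => w n _; rewrite lee_fin.
by apply: fine_cvg; rewrite Ex_EFin.
Qed.

End expectation.

(** * Independent increments and the completed filtration *)

Section independence.
Context {d : measure_display} {T : measurableType d} {R : realType}.
Variable Pr : probability T R.
Implicit Types (U V : T -> R).
Local Notation Ex := (Ex Pr).
Local Notation L1 U := (Pr.-integrable setT (EFin \o U)).

Section product_law.
Context {d2 : measure_display} {T2 : measurableType d2}.
Variables (N : probability T2 R) (U : T -> R) (D : T -> T2).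
Hypotheses (mU : measurable_fun setT U) (mD : measurable_fun setT D).
Hypothesis ind : forall A B, measurable A -> measurable B ->
  Pr (U @^-1` A `&` D @^-1` B) = (Pr (U @^-1` A) * N B)%E.

Let UD w := (U w, D w).

Let mUD : measurable_fun setT UD.
Proof. exact: measurable_fun_pair. Qed.

HB.instance Definition _ := isMeasurableFun.Build _ _ _ _ UD mUD.
HB.instance Definition _ := isMeasurableFun.Build _ _ _ _ U mU.
HB.instance Definition _ := isMeasurableFun.Build _ _ _ _ D mD.

Let lawU := distribution Pr U.
Let J := distribution Pr UD.

(** Independence is agreement of the two laws on rectangles, and rectangles determine a finite
    measure. *)
Let JE X : measurable X -> (lawU \x N)%E X = J X.
Proof.
by move=> mX; apply: product_measure_unique => // A B mA mB; exact: ind.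
Qed.

Let DE B : measurable B -> Pr (D @^-1` B) = N B.
Proof.
move=> mB; have := ind (@measurableT _ R) mB.
by rewrite preimage_setT setTI probability_setT mul1e.
Qed.

Lemma indep_integrable (f : T2 -> R) : measurable_fun setT f ->
  N.-integrable setT (EFin \o f) -> L1 (f \o D).
Proof.
move=> mf /integrableP[_ h]; apply/integrableP; split.
  by apply/measurable_EFinP; exact: measurableT_comp.
rewrite (_ : (\int[Pr]_x _)%E = \int[N]_x `|f x|%:E)%E//.
rewrite (eq_measure_integral (distribution Pr D)); last first.
  by move=> A mA _; rewrite /= -DE.
rewrite ge0_integral_pushforward//.
by apply/measurable_EFinP; exact: measurableT_comp.
Qed.

(** The law of [(U, D)] is a product, so the expectation is an iterated integral by Fubini. In the
    applications [f] is a power up to the fourth, hence unbounded; this is why integrability is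
    asked of [f] and boundedness of [U]. *)
Lemma indep_Ex (f : T2 -> R) (C : R) : measurable_fun setT f ->
  (forall w, `|U w| <= C) ->
  N.-integrable setT (EFin \o f) ->
  Ex (fun w => U w * f (D w)) = Ex U * fine (\int[N]_x (f x)%:E)%E.
Proof.
move=> mf UC iN.
have ifD := indep_integrable mf iN.
have iUf : L1 (fun w => U w * f (D w)).
  apply: (@L1_dom _ _ _ _ _ (fun w => C * `|f (D w)|)).
  - by apply: measurable_funM => //; exact: measurableT_comp.
  - by move=> w; rewrite normrM ler_wpM2r.
  - apply: L1Z; exact: (integrable_abse ifD).
pose g (p : R * T2) := (p.1 * f p.2)%:E.
have mg : measurable_fun setT g.
  apply/measurable_EFinP; apply: measurable_funM => //.
  by apply: measurableT_comp.
have gJ : J.-integrable setT g.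
  by apply: integrable_pushforward.
have gP : (lawU \x N)%E.-integrable setT g.
  apply/integrableP; split => //.
  rewrite (eq_measure_integral J); last by move=> A mA _; exact: JE.
  by case/integrableP : gJ.
have iU : L1 U by exact: (L1_bounded _ mU UC).
pose c := fine (\int[N]_x (f x)%:E)%E.
have cE : (\int[N]_x (f x)%:E)%E = c%:E.
  by rewrite /c fineK//; exact: integrable_fin_num iN.
rewrite -/c; apply: EFin_inj; rewrite Ex_EFin// EFinM Ex_EFin//.
transitivity (\int[J]_p g p)%E.
  by rewrite integral_pushforward.
transitivity (\int[lawU \x N]_p g p)%E.
  by apply/esym/eq_measure_integral => A mA _; exact: JE.
rewrite -integral12_prod_meas1//= /fubini_F/=.
transitivity (\int[lawU]_x (x * c)%:E)%E.
  apply: eq_integral => x _; rewrite EFinM -cE -integralZl//.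
transitivity (\int[Pr]_w (U w * c)%:E)%E.
  rewrite integral_pushforward//.
    by apply/measurable_EFinP; exact: measurable_funM.
  by have := integrableZr measurableT c iU.
by rewrite -integralZr.
Qed.

End product_law.

Lemma indep_moments (U D : T -> R) (h C c : R) (h0 : 0 < h) (c0 : 0 <= c) :
  measurable_fun setT U -> measurable_fun setT D ->
  (forall A B, measurable A -> measurable B ->
    Pr (U @^-1` A `&` D @^-1` B) =
    (Pr (U @^-1` A) * normal_prob 0 (Num.sqrt h) B)%E) ->
  (forall w, `|U w| <= C) ->
  [/\ L1 (fun w => U w * D w), L1 (fun w => U w * D w ^+ 2),
      L1 (fun w => c * D w ^+ 4),
      Ex (fun w => U w * D w) = 0 /\ Ex (fun w => U w * D w ^+ 2) = h * Ex U
    & Ex (fun w => c * D w ^+ 4) <= 64 * c * h ^+ 2].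
Proof.
move=> mU mD ind UC.
have s0 : 0 < Num.sqrt h by rewrite sqrtr_gt0.
pose N : probability (measurableTypeR R) R := normal_prob 0 (Num.sqrt h).
have indN A B : measurable A -> measurable B ->
    Pr (U @^-1` A `&` D @^-1` B) = (Pr (U @^-1` A) * N B)%E by exact: ind.
have mX n : measurable_fun setT (fun x : R => x ^+ n) by exact: exprn_measurable.
have x4 (x : R) : 0 <= x ^+ 4.
  by rewrite (_ : x ^+ 4 = (x ^+ 2) ^+ 2) ?sqr_ge0// -exprM.
have i1 : N.-integrable setT (EFin \o (fun x : R => x ^+ 1)).
  apply: (@normal_integrable _ _ s0 _ 1) => // x; rewrite expr1 mul1r.
  have a1 := sqr_ge0 (x ^+ 2 - 1); have a2 := sqr_ge0 (x - 1).
  have a3 := sqr_ge0 (x + 1); have a4 := x4 x.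
  by rewrite ler_norml; apply/andP; split; nra.
have i2 : N.-integrable setT (EFin \o (fun x : R => x ^+ 2)).
  apply: (@normal_integrable _ _ s0 _ 1) => // x; rewrite mul1r.
  rewrite ger0_norm ?sqr_ge0//.
  have := sqr_ge0 (x ^+ 2 - 1); nra.
have i4 : N.-integrable setT (EFin \o (fun x : R => x ^+ 4)).
  apply: (@normal_integrable _ _ s0 _ 1) => // x; rewrite mul1r.
  by rewrite ger0_norm//; lra.
have L1U (f : R -> R) : measurable_fun setT f -> N.-integrable setT (EFin \o f) ->
    L1 (fun w => U w * f (D w)).
  move=> mf fi; have ifD := indep_integrable (N := N) mD indN mf fi.
  apply: (@L1_dom _ _ _ _ _ (fun w => C * `|f (D w)|)).
  - by apply: measurable_funM => //; exact: measurableT_comp.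
  - by move=> w; rewrite normrM ler_wpM2r.
  - apply: L1Z; exact: (integrable_abse ifD).
have U1 := L1U _ (mX 1) i1.
have U2 := L1U _ (mX 2) i2.
have D4 := indep_integrable (N := N) mD indN (mX 4) i4.
have cD4 : L1 (fun w => c * D w ^+ 4) by apply: L1Z; exact: D4.
split => //.
  split.
  - have := indep_Ex (N := N) mU mD indN (mX 1) UC i1.
    under [in X in _ * fine X]eq_integral do rewrite expr1.
    by rewrite (normal_moment1 s0) mulr0.
  - have := indep_Ex (N := N) mU mD indN (mX 2) UC i2.
    by rewrite (normal_moment2 s0) sqr_sqrtr ?(ltW h0)// mulrC.
(* The fourth moment reuses the product formula with the constant [c] in the role of [U], a constant
   being trivially independent of [D]. *)
have ind1 A B : measurable A -> measurable B ->
    Pr (cst c @^-1` A `&` D @^-1` B) =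
    (Pr (cst c @^-1` A) * N B)%E.
  move=> mA mB; rewrite preimage_cst; case: ifPn => _.
    rewrite setTI probability_setT mul1e.
    have := indN setT B (@measurableT _ R) mB.
    by rewrite preimage_setT setTI probability_setT mul1e.
  by rewrite set0I measure0 mul0e.
rewrite (indep_Ex (N := N) (measurable_cst c) mD ind1 (mX 4) _ i4 (C := `|c|))// Ex_cst.
rewrite (mulrC 64) -mulrA ler_wpM2l//.
have := normal_moment4 s0; rewrite (_ : Num.sqrt h ^+ 4 = h ^+ 2); last first.
  by rewrite (_ : 4 = 2 * 2)%N// exprM sqr_sqrtr// ltW.
move=> /fine_le; apply => //.
exact: integrable_fin_num i4.
Qed.
End independence.

Section filtration.
Context {d : measure_display} {Omega : measurableType d} {R : realType}.
Variable Pr : probability Omega R.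
Variable W : R -> Omega -> R.

(** The generators of [brownian_filtration] are named so that [g_sigma_algebraType (filt_gen t)] is
    a measurable type. Being known at time [t] then is an instance of [measurable_fun], and [Fm]
    inherits all its closure lemmas. *)
Definition filt_gen (t : R) : set (set Omega) :=
  history W t `|` [set N | measurable N /\ Pr N = 0%E].

Local Notation Ft t := (g_sigma_algebraType (filt_gen t)).
Local Notation Fil := (brownian_filtration Pr W).

Definition Fm (t : R) (U : Omega -> R) : Prop :=
  @measurable_fun _ _ (Ft t) R setT U.

Lemma ae_eq_measure (A B : set Omega) : measurable A -> measurable B ->
  {ae Pr, forall w, A w <-> B w} -> Pr A = Pr B.
Proof.
move=> mA mB AB; rewrite -(setIT A) -(setIT B) -!integral_indic//.
apply: ae_eq_integral => //; try exact/measurable_EFinP.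
apply: filterS AB => w h _; congr EFin; rewrite !indicE; congr (nat_of_bool _)%:R.
by apply/idP/idP; rewrite !inE => /h.
Qed.

Lemma filt_mono (s t : R) : s <= t -> Fil s `<=` Fil t.
Proof.
move=> st; apply: sub_sigma_algebra2 => A [[u [B [/andP[u0 us] mB ->]]]|h].
  by left; exists u, B; split => //; rewrite u0 (le_trans us).
by right.
Qed.

Lemma Fm_mono (s t : R) U : s <= t -> Fm s U -> Fm t U.
Proof.
move=> st h _ B mB; have := h measurableT B mB.
exact: (filt_mono st).
Qed.

Lemma Fm_indic (t : R) A : Fil t A -> Fm t \1_A.
Proof. by move=> FA; apply: measurable_indic. Qed.

Lemma FmP (t : R) U : (forall B, measurable B -> Fil t (U @^-1` B)) <-> Fm t U.
Proof.
split=> [h _ B mB|h B mB]; first by rewrite setTI; exact: h.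
by have := h measurableT B mB; rewrite setTI.
Qed.

Section brownian.
Hypothesis hW : standard_brownian Pr W.

Lemma measurable_brownian (t : R) : 0 <= t -> measurable_fun setT (W t).
Proof. by case: hW => h *; exact: h. Qed.

Lemma filt_measurable (t : R) : Fil t `<=` measurable.
Proof.
apply: smallest_sub; first exact: sigma_algebra_measurable.
move=> A [[u [B [/andP[u0 us] mB ->]]]|[]//].
by rewrite -[_ @^-1` _]setTI; exact: measurable_brownian.
Qed.

Lemma Fm_measurable (t : R) U : Fm t U -> measurable_fun setT U.
Proof. by move=> h _ B mB; have := h measurableT B mB; exact: filt_measurable. Qed.

Lemma Fm_brownian (s t : R) : 0 <= s -> s <= t -> Fm t (W s).
Proof.
move=> s0 st; apply/FmP => B mB; apply: sub_sigma_algebra; left.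
by exists s, B; rewrite s0.
Qed.

Lemma measurable_increment (s t : R) : 0 <= s -> s <= t ->
  measurable_fun setT (increment W s t).
Proof.
move=> s0 st; apply: measurable_funB; apply: measurable_brownian => //.
exact: le_trans st.
Qed.

(** [standard_brownian] gives independence from the raw history only. The events that agree almost
    surely with a history event form a sigma-algebra, and it contains the generators, a null event
    agreeing with [set0]. So independence survives the completion, which is [filt_indep]. *)
Lemma filt_history (s : R) A : Fil s A ->
  exists2 B, <<s history W s >> B & {ae Pr, forall w, A w <-> B w}.
Proof.
move: A; apply: smallest_sub; last first.
  move=> A [hA|[mA A0]].
    by exists A; [exact: sub_sigma_algebra|exact: aeW].
  exists set0; first exact: sigma_algebra0.
  exists A; split => // w /= h; apply: contrapT => nA.
  by apply: h; split.
split.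
- by exists set0; [exact: sigma_algebra0|exact: aeW].
- move=> A [B hB AB]; exists (setT `\` B); first exact: sigma_algebraCD.
  by apply: filterS AB => w h; split=> -[_ nA]; split => // /h.
- move=> A hA; have /choice[B hB] : forall n, exists B,
      <<s history W s >> B /\ {ae Pr, forall w, A n w <-> B w}.
    by move=> n; have [B ? ?] := hA n; exists B.
  exists (\bigcup_n B n).
    by apply: sigma_algebra_bigcup => n; have [] := hB n.
  have : {ae Pr, forall w n, A n w <-> B n w}.
    by apply: ae_foralln => n; have [] := hB n.
  by apply: filterS => w h; split=> -[n _ /h ?]; exists n.
Qed.

Lemma filt_indep (s t : R) A B : 0 <= s -> s < t -> Fil s A -> measurable B ->
  Pr (A `&` increment W s t @^-1` B)
  = (Pr A * normal_prob 0 (Num.sqrt (t - s)) B)%E.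
Proof.
move=> s0 st FA mB; have [A' hA' AA'] := filt_history FA.
have mA' : measurable A'.
  have : Fil s A' by move: A' hA' {AA'}; apply: sub_sigma_algebra2; left.
  exact: filt_measurable.
have mA := filt_measurable FA.
have mI : measurable (increment W s t @^-1` B).
  by rewrite -[_ @^-1` _]setTI; apply: measurable_increment => //; exact: ltW.
rewrite (ae_eq_measure mA mA' AA').
rewrite (@ae_eq_measure _ (A' `&` increment W s t @^-1` B)); last 3 first.
- exact: measurableI.
- exact: measurableI.
- by apply: filterS AA' => w h; split=> -[/h].
by case: hW => _ _ _ hl hi; rewrite hi// hl.
Qed.

Lemma brownian_moments (s t : R) (U : Omega -> R) (C c : R) :
  0 <= s -> s < t -> 0 <= c -> Fm s U -> (forall w, `|U w| <= C) ->
  [/\ Pr.-integrable setT (EFin \o (fun w => U w * increment W s t w)),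
      Pr.-integrable setT (EFin \o (fun w => U w * increment W s t w ^+ 2)),
      Pr.-integrable setT (EFin \o (fun w => c * increment W s t w ^+ 4)),
      Ex Pr (fun w => U w * increment W s t w) = 0
      /\ Ex Pr (fun w => U w * increment W s t w ^+ 2) = (t - s) * Ex Pr U
    & Ex Pr (fun w => c * increment W s t w ^+ 4) <= 64 * c * (t - s) ^+ 2].
Proof.
move=> s0 st c0 FU UC; apply: (@indep_moments _ _ _ _ _ _ _ C) => //.
- by rewrite subr_gt0.
- exact: Fm_measurable FU.
- by apply: measurable_increment => //; exact: ltW.
- by move=> A B mA mB; apply: filt_indep => //; exact: (FmP _ _).2.
Qed.

End brownian.
End filtration.

(** * Discrete Dynkin inequality along an Euler scheme *)

(** [G1] and [G2] play the role of the first two derivatives, but only through the one-sided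
    expansion [tf_taylor]. Its error has to be uniform in [y] and valid for every [z], Gaussian
    increments being unbounded: [e] pays for small steps, and [C * z ^+ 2] for large ones, at the
    price of a fourth moment, which is of order [h^2]. *)
Record test_fun {R : realType} (G G1 G2 : R -> R) (K : R) : Prop := TestFun {
  tf_cG : continuous G; tf_cG1 : continuous G1; tf_cG2 : continuous G2;
  tf_ge0 : forall x, 0 <= G x; tf_le : forall x, G x <= K;
  tf_le1 : forall x, `|G1 x| <= K; tf_le2 : forall x, `|G2 x| <= K;
  tf_taylor : forall e, 0 < e -> exists2 C, 0 <= C & forall y z,
    G (y + z) <= G y + G1 y * z + 2^-1 * G2 y * z ^+ 2
                 + (e + C * z ^+ 2) * z ^+ 2 }.

Lemma ler_norm_sub {R : realDomainType} (x y K : R) : 0 <= x -> x <= K ->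
  0 <= y -> y <= K -> `|x - y| <= K.
Proof. by move=> *; rewrite ler_norml; apply/andP; split; lra. Qed.

Section discrete.
Context {d : measure_display} {Omega : measurableType d} {R : realType}.
Variable Pr : probability Omega R.
Variable W : R -> Omega -> R.
Hypothesis hW : standard_brownian Pr W.
Local Notation Fm := (Fm Pr W).
Local Notation Ex := (Ex Pr).
Local Notation Fil := (brownian_filtration Pr W).
Variables (G G1 G2 : R -> R) (Kg : R).
Hypothesis hG : test_fun G G1 G2 Kg.

Let mG : measurable_fun setT G.
Proof. by apply: continuous_measurable_fun; exact: tf_cG hG. Qed.
Let mG1 : measurable_fun setT G1.
Proof. by apply: continuous_measurable_fun; exact: tf_cG1 hG. Qed.
Let mG2 : measurable_fun setT G2.
Proof. by apply: continuous_measurable_fun; exact: tf_cG2 hG. Qed.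

Let Kg0 : 0 <= Kg. Proof. exact: le_trans (tf_ge0 hG 0) (tf_le hG 0). Qed.

(** Insert [z = b h + xi D] in the expansion and sort by powers of the increment [D]: its first
    moment kills the linear term, its second moment is [h]. The weight [th], known at time [s],
    replaces conditioning. Constants: [z^2 <= 2 B^2 (h^2 + D^2)] and [z^4 <= 8 B^4 (h^4 + D^4)].
    Then [4 e B^2] comes from [h^2 + h <= 2 h], and [520 = 8 * (64 + 1)], with [64] from the fourth
    moment of [D] and [1] from [h^4 <= h^2]. *)
Lemma scheme_step (s h B e C : R) (th Y b xi : Omega -> R) :
  0 <= s -> 0 < h -> h <= 1 -> 0 <= B -> 0 < e -> 0 <= C ->
  (forall y z, G (y + z) <= G y + G1 y * z + 2^-1 * G2 y * z ^+ 2
                 + (e + C * z ^+ 2) * z ^+ 2) ->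
  Fm s th -> Fm s Y -> Fm s b -> Fm s xi ->
  (forall w, 0 <= th w <= 1) -> (forall w, `|b w| <= B) ->
  (forall w, `|xi w| <= B) ->
  Ex (fun w => th w * (G (Y w + (b w * h + xi w * increment W s (s + h) w)) - G (Y w)))
  <= h * Ex (fun w => th w * (b w * G1 (Y w) + 2^-1 * xi w ^+ 2 * G2 (Y w)))
     + h * (4 * e * B ^+ 2 + h * (Kg * B ^+ 2 + 520 * C * B ^+ 4)).
Proof.
move=> s0 h0 h1 B0 e0 C0 taylor Fth FY Fb Fxi th01 bB xiB.
set D := increment W s (s + h).
have FG1 : Fm s (G1 \o Y) by exact: (measurableT_comp mG1 FY).
have FG2 : Fm s (G2 \o Y) by exact: (measurableT_comp mG2 FY).
have g1 w : `|G1 (Y w)| <= Kg by exact: tf_le1 hG _.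
have g2 w : `|G2 (Y w)| <= Kg by exact: tf_le2 hG _.
have nth w : `|th w| <= 1 by have /andP[a c] := th01 w; rewrite ger0_norm.
have bnd (p q x y : R) : `|x| <= p -> `|y| <= q -> `|x * y| <= p * q.
  by move=> ? ?; rewrite normrM ler_pM.
(* [A0], [Q1] and [Q2] are the coefficients of [1], [D] and [D^2] in the upper bound, all known at
   time [s]; that of [D^4] is the constant [8 C B^4]. *)
pose A0 w := h * (th w * (b w * G1 (Y w))) + 2^-1 * h ^+ 2 * (th w * (b w * b w * G2 (Y w)))
             + (2 * e * B ^+ 2 * h ^+ 2 + 8 * C * B ^+ 4 * h ^+ 4).
pose Q1 w := th w * (xi w * G1 (Y w)) + h * (th w * (b w * xi w * G2 (Y w))).
pose Q2 w := 2^-1 * (th w * (xi w * xi w * G2 (Y w))) + 2 * e * B ^+ 2.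
have FthbG1 : Fm s (fun w => th w * (b w * G1 (Y w))).
  by apply: measurable_funM => //; apply: measurable_funM.
have FthbbG2 : Fm s (fun w => th w * (b w * b w * G2 (Y w))).
  by apply: measurable_funM => //; apply: measurable_funM => //; apply: measurable_funM.
have FthxG1 : Fm s (fun w => th w * (xi w * G1 (Y w))).
  by apply: measurable_funM => //; apply: measurable_funM.
have FthbxG2 : Fm s (fun w => th w * (b w * xi w * G2 (Y w))).
  by apply: measurable_funM => //; apply: measurable_funM => //; apply: measurable_funM.
have FthxxG2 : Fm s (fun w => th w * (xi w * xi w * G2 (Y w))).
  by apply: measurable_funM => //; apply: measurable_funM => //; apply: measurable_funM.
have B1 w : `|th w * (b w * G1 (Y w))| <= 1 * (B * Kg) by do 2 apply: (bnd) => //.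
have B2 w : `|th w * (b w * b w * G2 (Y w))| <= 1 * (B * B * Kg) by do 3 apply: (bnd) => //.
have B3 w : `|th w * (xi w * G1 (Y w))| <= 1 * (B * Kg) by do 2 apply: (bnd) => //.
have B4 w : `|th w * (b w * xi w * G2 (Y w))| <= 1 * (B * B * Kg) by do 3 apply: (bnd) => //.
have B5 w : `|th w * (xi w * xi w * G2 (Y w))| <= 1 * (B * B * Kg) by do 3 apply: (bnd) => //.
have FQ1 : Fm s Q1 by apply: measurable_funD => //; exact: measurable_funM.
have FQ2 : Fm s Q2 by apply: measurable_funD => //; exact: measurable_funM.
have bQ1 w : `|Q1 w| <= B * Kg + h * (B * B * Kg).
  rewrite (le_trans (ler_normD _ _))// lerD//; first by have := B3 w; rewrite mul1r.
  by rewrite normrM (gtr0_norm h0) ler_pM2l//; have := B4 w; rewrite mul1r.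
have bQ2 w : `|Q2 w| <= 2^-1 * (B * B * Kg) + 2 * e * B ^+ 2.
  rewrite (le_trans (ler_normD _ _))// lerD//.
    by rewrite normrM ger0_norm ?invr_ge0// ler_pM2l//; have := B5 w; rewrite mul1r.
  by rewrite ger0_norm// mulr_ge0 ?sqr_ge0// mulr_ge0// ltW.
have cc0 : 0 <= 8 * C * B ^+ 4 by rewrite mulr_ge0 ?exprn_ge0// mulr_ge0.
have sh : s < s + h by rewrite ltrDl.
have [I1 _ I4 [E1 _] E4] := brownian_moments hW s0 sh cc0 FQ1 bQ1.
have [_ I2 _ [_ E2] _] := brownian_moments hW s0 sh cc0 FQ2 bQ2.
have shs : s + h - s = h by rewrite addrC addKr.
rewrite shs in E2 E4.
have L1b (U : Omega -> R) M : Fm s U -> (forall w, `|U w| <= M) ->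
    Pr.-integrable setT (EFin \o U).
  by move=> FU; apply: L1_bounded; exact: (Fm_measurable hW FU).
have i1 := L1b _ _ FthbG1 B1; have i2 := L1b _ _ FthbbG2 B2.
have i5 := L1b _ _ FthxxG2 B5.
have icst (k : R) : Pr.-integrable setT (EFin \o (fun=> k)).
  by apply: (L1b _ `|k|) => //; exact: measurable_cst.
have iA0 : Pr.-integrable setT (EFin \o A0).
  by apply: L1D => //; apply: L1D; exact: L1Z.
have iQ2 := L1b _ _ FQ2 bQ2.
set c := 8 * C * B ^+ 4 in cc0 I4 E4.
have iall : Pr.-integrable setT
    (EFin \o (fun w => A0 w + Q1 w * D w + Q2 w * D w ^+ 2 + c * D w ^+ 4)).
  by apply: L1D => //; apply: L1D => //; apply: L1D.
apply: (@le_trans _ _ (Ex (fun w => A0 w + Q1 w * D w + Q2 w * D w ^+ 2 + c * D w ^+ 4))).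
  apply: Ex_le => //.
    apply: (@L1_bounded _ _ _ _ _ Kg).
      apply: measurable_funM; first exact: (Fm_measurable hW Fth).
      have mY := Fm_measurable hW FY; have mb := Fm_measurable hW Fb.
      have mx := Fm_measurable hW Fxi.
      apply: measurable_funB; last exact: measurableT_comp.
      apply: measurableT_comp => //; apply: measurable_funD => //.
      apply: measurable_funD; apply: measurable_funM => //.
      exact: (measurable_increment hW s0 (ltW sh)).
    move=> w; rewrite normrM -[leRHS]mul1r ler_pM//.
    by apply: ler_norm_sub; [exact: (tf_ge0 hG)|exact: (tf_le hG)|exact: (tf_ge0 hG)|exact: (tf_le hG)].
  move=> w; set z := b w * h + xi w * D w.
  have t1 := taylor (Y w) z.
  have b2 : b w ^+ 2 <= B ^+ 2 by rewrite -real_normK ?num_real// ler_sqr ?nnegrE.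
  have x2 : xi w ^+ 2 <= B ^+ 2 by rewrite -real_normK ?num_real// ler_sqr ?nnegrE.
  have z2 : z ^+ 2 <= 2 * B ^+ 2 * (h ^+ 2 + D w ^+ 2).
    have : z ^+ 2 <= 2 * (b w ^+ 2 * h ^+ 2 + xi w ^+ 2 * D w ^+ 2).
      by rewrite /z; have := sqr_ge0 (b w * h - xi w * D w); nra.
    have := ler_wpM2r (sqr_ge0 h) b2; have := ler_wpM2r (sqr_ge0 (D w)) x2; lra.
  have z4 : z ^+ 2 * z ^+ 2 <= 8 * B ^+ 4 * (h ^+ 4 + D w ^+ 4).
    have B20 := sqr_ge0 B; have h20 := sqr_ge0 h; have D20 := sqr_ge0 (D w).
    apply: (@le_trans _ _ (2 * B ^+ 2 * (h ^+ 2 + D w ^+ 2) * (2 * B ^+ 2 * (h ^+ 2 + D w ^+ 2)))).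
      by apply: ler_pM => //; exact: sqr_ge0.
    have -> : 8 * B ^+ 4 * (h ^+ 4 + D w ^+ 4) =
      (2 * B ^+ 2 * (h ^+ 2 + D w ^+ 2)) * (2 * B ^+ 2 * (h ^+ 2 + D w ^+ 2))
      + (2 * B ^+ 2 * (h ^+ 2 - D w ^+ 2)) ^+ 2 by ring.
    by rewrite lerDl sqr_ge0.
  have rest : (e + C * z ^+ 2) * z ^+ 2 <= 2 * e * B ^+ 2 * (h ^+ 2 + D w ^+ 2)
      + c * (h ^+ 4 + D w ^+ 4).
    rewrite mulrDl -mulrA /c; apply: lerD.
      by rewrite mulrAC (mulrC 2 e) -!mulrA ler_pM2l//; move: z2; lra.
    have := ler_wpM2l C0 z4; lra.
  have rest0 : 0 <= (e + C * z ^+ 2) * z ^+ 2.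
    by rewrite mulr_ge0 ?sqr_ge0// addr_ge0 ?(ltW e0)// mulr_ge0// sqr_ge0.
  have /andP[th0 th1] := th01 w.
  have : th w * (G (Y w + z) - G (Y w)) <=
      th w * (G1 (Y w) * z + 2^-1 * G2 (Y w) * z ^+ 2) + (e + C * z ^+ 2) * z ^+ 2.
    apply: (@le_trans _ _ (th w * (G1 (Y w) * z + 2^-1 * G2 (Y w) * z ^+ 2
       + (e + C * z ^+ 2) * z ^+ 2))); first by rewrite ler_wpM2l//; lra.
    by rewrite mulrDr lerD2l ler_piMl.
  move/le_trans; apply.
  have -> : A0 w + Q1 w * D w + Q2 w * D w ^+ 2 + c * D w ^+ 4 =
    th w * (G1 (Y w) * z + 2^-1 * G2 (Y w) * z ^+ 2) +
    (2 * e * B ^+ 2 * (h ^+ 2 + D w ^+ 2) + c * (h ^+ 4 + D w ^+ 4)).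
    by rewrite /A0 /Q1 /Q2 /z /c; field.
  by rewrite lerD2l.
rewrite ExD; [|by apply: L1D => //; apply: L1D|exact: I4].
rewrite ExD; [|by apply: L1D|exact: I2].
rewrite ExD; [|exact: iA0|exact: I1].
rewrite E1 E2 addr0.
have EA0 : Ex A0 <= h * Ex (fun w => th w * (b w * G1 (Y w))) +
   (2^-1 * h ^+ 2 * (B * B * Kg) + (2 * e * B ^+ 2 * h ^+ 2 + c * h ^+ 4)).
  rewrite /A0 ExD; [|by apply: L1D; exact: L1Z|exact: icst].
  rewrite ExD; [|exact: L1Z|exact: L1Z].
  rewrite (ExZ _ i1) (ExZ _ i2) Ex_cst -!addrA lerD2l lerD2r ler_wpM2l//.
    by rewrite mulr_ge0 ?invr_ge0 ?sqr_ge0.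
  rewrite -[leRHS](Ex_cst Pr); apply: Ex_le => // w.
  by have := B2 w; rewrite mul1r; apply: le_trans; exact: ler_norm.
have EQ2 : Ex Q2 = 2^-1 * Ex (fun w => th w * (xi w * xi w * G2 (Y w))) + 2 * e * B ^+ 2.
  by rewrite /Q2 ExD; [rewrite (ExZ _ i5) Ex_cst|exact: L1Z|exact: icst].
have -> : Ex (fun w => th w * (b w * G1 (Y w) + 2^-1 * xi w ^+ 2 * G2 (Y w))) =
   Ex (fun w => th w * (b w * G1 (Y w))) + 2^-1 * Ex (fun w => th w * (xi w * xi w * G2 (Y w))).
  rewrite -ExZ// -ExD//; last exact: L1Z.
  by congr (Ex _); apply/funext => w; ring.
set x := Ex (fun w => th w * (b w * G1 (Y w))) in EA0 *.
set y := Ex (fun w => th w * (xi w * xi w * G2 (Y w))) in EQ2 *.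
rewrite EQ2.
have hh : h ^+ 2 <= h by rewrite expr2 ler_piMl// ltW.
have h4 : h ^+ 4 <= h ^+ 2 by rewrite -[leRHS]mulr1 (exprD h 2 2) ler_wpM2l ?sqr_ge0// expr_le1// ltW.
have eB : 0 <= e * B ^+ 2 by rewrite mulr_ge0 ?sqr_ge0 ?ltW.
have ch := ler_wpM2l cc0 h4.
have eh := ler_wpM2l eB hh.
have kh : 0 <= Kg * B ^+ 2 * h ^+ 2 by rewrite mulr_ge0 ?sqr_ge0// mulr_ge0// sqr_ge0.
have E4' : Ex (fun w => c * D w ^+ 4) <= 64 * c * h ^+ 2 by exact: E4.
set q := Ex (fun w => c * D w ^+ 4) in E4' *.
have -> : h * (x + 2^-1 * y) + h * (4 * e * B ^+ 2 + h * (Kg * B ^+ 2 + 520 * C * B ^+ 4))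
  = h * x + 2^-1 * (h * y) + 4 * (e * B ^+ 2) * h + Kg * B ^+ 2 * h ^+ 2 + 65 * c * h ^+ 2.
  by rewrite /c; ring.
have -> : h * (2^-1 * y + 2 * e * B ^+ 2) = 2^-1 * (h * y) + 2 * (e * B ^+ 2) * h by ring.
have kk : 2^-1 * h ^+ 2 * (B * B * Kg) = 2^-1 * (Kg * B ^+ 2 * h ^+ 2) by ring.
rewrite kk in EA0.
lra.
Qed.

Section scheme.
Variables (s h : R) (Y0 : Omega -> R) (b xi : nat -> Omega -> R).
Variables (r lam : R).

Definition grid (j : nat) : R := s + j%:R * h.

Definition scheme (j : nat) (w : Omega) : R :=
  Y0 w + \sum_(i < j) (b i w * h + xi i w * increment W (grid i) (grid i.+1) w).

(** Discounting at rate [r] combined with killing at rate [lam * (xi^2 + b)]. The drift [b] is put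
    beside [xi ^+ 2] because the term [b * G1] needs the same uniform bound as [xi^2 * G2]. *)
Definition weight (j : nat) (w : Omega) : R :=
  expR (- \sum_(i < j) h * (r + lam * (xi i w ^+ 2 + b i w))).

Definition drift (j : nat) (w : Omega) : R :=
  b j w * G1 (scheme j w) + 2^-1 * xi j w ^+ 2 * G2 (scheme j w).

Variables (m : nat) (B : R).
Hypotheses (s0 : 0 <= s) (h0 : 0 < h) (h1 : h <= 1) (B0 : 0 <= B).
Hypotheses (r0 : 0 <= r) (lam0 : 0 <= lam).
Hypothesis FY0 : Fm s Y0.
Hypothesis Fb : forall j, (j < m)%N -> Fm (grid j) (b j).
Hypothesis Fxi : forall j, (j < m)%N -> Fm (grid j) (xi j).
Hypothesis bB : forall j w, (j < m)%N -> 0 <= b j w <= B.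
Hypothesis xiB : forall j w, (j < m)%N -> `|xi j w| <= B.

Lemma grid_ge j : s <= grid j.
Proof. by rewrite lerDl mulr_ge0// ltW. Qed.

Lemma grid_le i j : (i <= j)%N -> grid i <= grid j.
Proof. by move=> ij; rewrite lerD2l ler_pM2r// ler_nat. Qed.

Lemma gridS j : grid j.+1 = grid j + h.
Proof. by rewrite /grid -natr1 mulrDl mul1r addrA. Qed.

Lemma Fm_sum n (t : R) (U : nat -> Omega -> R) : (forall i, (i < n)%N -> Fm t (U i)) ->
  Fm t (fun w => \sum_(i < n) U i w).
Proof.
elim: n => [_|n ih hU].
  rewrite (_ : (fun w => _) = cst 0); first exact: measurable_cst.
  by apply/funext => w; rewrite big_ord0.
rewrite (_ : (fun w => _) = (fun w => \sum_(i < n) U i w + U n w)); last first.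
  by apply/funext => w; rewrite big_ord_recr.
by apply: measurable_funD; [apply: ih => i /ltnW; exact: hU|exact: hU].
Qed.

Lemma Fm_scheme j : (j <= m)%N -> Fm (grid j) (scheme j).
Proof.
move=> jm; apply: measurable_funD; first exact: (Fm_mono (grid_ge j) FY0).
apply: (@Fm_sum j (grid j) (fun i w => b i w * h + xi i w * increment W (grid i) (grid i.+1) w)) => i ij.
have im : (i < m)%N by rewrite (leq_trans ij).
have gij := grid_le (ltnW ij).
apply: measurable_funD; apply: measurable_funM => //.
- exact: (Fm_mono gij (Fb im)).
- exact: (Fm_mono gij (Fxi im)).
- apply: measurable_funB; apply: Fm_brownian.
  + exact: le_trans (grid_ge _).
  + exact: grid_le.
  + exact: le_trans (grid_ge _).
  + exact: gij.
Qed.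

(** The off-by-one matters: coefficients are frozen at the left end of a cell, so the weight after
    step [j] is already known at [grid j], before the increment of that step. It may therefore
    multiply the step as the factor [th] of [scheme_step]. *)
Lemma weight_Fm j : (j < m)%N -> Fm (grid j) (weight j.+1).
Proof.
move=> jm; apply: measurableT_comp => //; apply: measurableT_comp => //.
apply: (@Fm_sum j.+1 (grid j) (fun i w => h * (r + lam * (xi i w ^+ 2 + b i w)))) => i ij.
have im : (i < m)%N by rewrite (leq_trans ij).
have gij : grid i <= grid j by apply: grid_le; rewrite -ltnS.
apply: measurable_funM => //; apply: measurable_funD => //; apply: measurable_funM => //.
apply: measurable_funD; last exact: (Fm_mono gij (Fb im)).
by apply: measurable_funX; exact: (Fm_mono gij (Fxi im)).
Qed.

Lemma rate_ge0 i w : (i < m)%N -> 0 <= r + lam * (xi i w ^+ 2 + b i w).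
Proof.
move=> im; rewrite addr_ge0// mulr_ge0// addr_ge0 ?sqr_ge0//.
by have /andP[] := bB w im.
Qed.

Lemma weight_bounds j w : (j <= m)%N -> 0 < weight j w <= 1.
Proof.
move=> jm; rewrite expR_gt0/= expR_le1 oppr_le0 sumr_ge0// => i _.
by rewrite mulr_ge0 ?(ltW h0)// rate_ge0// (leq_trans (ltn_ord i)).
Qed.

Lemma weightS j w : (j < m)%N ->
  weight j.+1 w * (1 + h * (r + lam * (xi j w ^+ 2 + b j w))) <= weight j w.
Proof.
move=> jm; set a := h * _.
have -> : weight j w = weight j.+1 w * expR a.
  by rewrite /weight big_ord_recr/= -expRD opprD addrNK.
by rewrite ler_wpM2l ?expR_ge0// expR_ge1Dx.
Qed.

(** Telescope [weight j * G (scheme j)]. Since [G >= 0], [weightS] bounds the loss of weight over a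
    step from below by [h r] times the new weight, the killing part being discarded; this produces
    the term [- r G]. What remains is the increment of [G] times [weight j.+1], which [scheme_step]
    handles. *)
Lemma scheme_ineq A (e C : R) : Fil s A -> 0 < e -> 0 <= C ->
  (forall y z, G (y + z) <= G y + G1 y * z + 2^-1 * G2 y * z ^+ 2
                 + (e + C * z ^+ 2) * z ^+ 2) ->
  Ex (fun w => \1_A w * (weight m w * G (scheme m w) - G (Y0 w))) <=
  Ex (fun w => \1_A w * \sum_(j < m) h * (weight j.+1 w * (drift j w - r * G (scheme j w))))
  + m%:R * (h * (4 * e * B ^+ 2 + h * (Kg * B ^+ 2 + 520 * C * B ^+ 4))).
Proof.
move=> FA e0 C0 taylor.
have mS j : (j <= m)%N -> measurable_fun setT (scheme j).
  by move=> jm; exact: (Fm_measurable hW (Fm_scheme jm)).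
have mWt j : (j < m)%N -> measurable_fun setT (weight j.+1).
  by move=> jm; exact: (Fm_measurable hW (weight_Fm jm)).
have mA : measurable_fun setT (\1_A : Omega -> R).
  exact: (Fm_measurable hW (Fm_indic FA)).
have mb j : (j < m)%N -> measurable_fun setT (b j).
  by move=> jm; exact: (Fm_measurable hW (Fb jm)).
have mx j : (j < m)%N -> measurable_fun setT (xi j).
  by move=> jm; exact: (Fm_measurable hW (Fxi jm)).
have A1 w : 0 <= (\1_A w : R) <= 1 by rewrite indicE; case: (_ \in _); rewrite ler01 lexx.
have nA w : `|\1_A w : R| <= 1 by have /andP[? ?] := A1 w; rewrite ger0_norm.
pose inc j w := \1_A w * weight j.+1 w * (G (scheme j.+1 w) - G (scheme j w)).
pose dd j w := \1_A w * weight j.+1 w * drift j w.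
pose gg j w := \1_A w * weight j.+1 w * G (scheme j w).
have th01 j w : (j < m)%N -> 0 <= \1_A w * weight j.+1 w <= 1.
  move=> jm; have /andP[a0 a1] := A1 w; have /andP[b0 b1] := weight_bounds w jm.
  by rewrite mulr_ge0 ?(ltW b0)//= mulr_ile1// ltW.
have nth j w : (j < m)%N -> `|\1_A w * weight j.+1 w| <= 1.
  by move=> jm; have /andP[? ?] := th01 j w jm; rewrite ger0_norm.
have iinc j : (j < m)%N -> Pr.-integrable setT (EFin \o inc j).
  move=> jm; apply: (@L1_bounded _ _ _ _ _ (1 * Kg)).
    apply: measurable_funM; first by apply: measurable_funM => //; exact: mWt.
    apply: measurable_funB; apply: measurableT_comp => //; apply: mS => //.
    exact: ltnW.
  move=> w; rewrite normrM ler_pM ?nth//.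
  by apply: ler_norm_sub; [exact: (tf_ge0 hG)|exact: (tf_le hG)|exact: (tf_ge0 hG)|exact: (tf_le hG)].
have igg j : (j < m)%N -> Pr.-integrable setT (EFin \o gg j).
  move=> jm; apply: (@L1_bounded _ _ _ _ _ (1 * Kg)).
    apply: measurable_funM; first by apply: measurable_funM => //; exact: mWt.
    by apply: measurableT_comp => //; apply: mS; exact: ltnW.
  move=> w; rewrite normrM ler_pM ?nth// ger0_norm; first exact: (tf_le hG).
  exact: (tf_ge0 hG).
have idd j : (j < m)%N -> Pr.-integrable setT (EFin \o dd j).
  move=> jm; apply: (@L1_bounded _ _ _ _ _ (1 * (B * Kg + 2^-1 * B ^+ 2 * Kg))).
    apply: measurable_funM; first by apply: measurable_funM => //; exact: mWt.
    apply: measurable_funD; apply: measurable_funM.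
    - exact: mb.
    - by apply: measurableT_comp => //; apply: mS; exact: ltnW.
    - by apply: measurable_funM => //; apply: measurable_funX; exact: mx.
    - by apply: measurableT_comp => //; apply: mS; exact: ltnW.
  move=> w; rewrite normrM ler_pM ?nth//.
  rewrite (le_trans (ler_normD _ _))// lerD// normrM ler_pM//; try exact: (tf_le1 hG); try exact: (tf_le2 hG).
    by have /andP[? ?] := bB w jm; rewrite ger0_norm.
  rewrite normrM ger0_norm ?invr_ge0// ler_pM2l// normrX ler_sqr ?nnegrE//.
  exact: xiB.
have st j : (j < m)%N -> Ex (inc j) <= h * Ex (dd j) +
    h * (4 * e * B ^+ 2 + h * (Kg * B ^+ 2 + 520 * C * B ^+ 4)).
  move=> jm.
  have := @scheme_step (grid j) h B e C (fun w => \1_A w * weight j.+1 w)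
    (scheme j) (b j) (xi j) (le_trans s0 (grid_ge j)) h0 h1 B0 e0 C0 taylor.
  have -> : inc j = (fun w => \1_A w * weight j.+1 w *
      (G (scheme j w + (b j w * h + xi j w * increment W (grid j) (grid j + h) w)) - G (scheme j w))).
    by apply/funext => w; rewrite /inc {1}/scheme big_ord_recr/= addrA -gridS.
  apply.
  - apply: measurable_funM; last exact: weight_Fm.
    exact: (Fm_mono (grid_ge j) (Fm_indic FA)).
  - by apply: Fm_scheme; exact: ltnW.
  - exact: Fb.
  - exact: Fxi.
  - by move=> w; exact: th01.
  - by move=> w; have /andP[? ?] := bB w jm; rewrite ger0_norm.
  - by move=> w; exact: xiB.
pose inc' j w := inc j w - h * r * gg j w.
have iinc' j : (j < m)%N -> Pr.-integrable setT (EFin \o inc' j).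
  by move=> jm; apply: L1B; [exact: iinc|apply: L1Z; exact: igg].
pose dd' j w := h * dd j w - h * r * gg j w.
have idd' j : (j < m)%N -> Pr.-integrable setT (EFin \o dd' j).
  by move=> jm; apply: L1B; apply: L1Z; [exact: idd|exact: igg].
apply: (@le_trans _ _ (Ex (fun w => \sum_(j < m) inc' j w))).
  apply: Ex_le.
  - apply: (@L1_bounded _ _ _ _ _ (1 * Kg)).
      apply: measurable_funM => //; apply: measurable_funB.
        apply: measurable_funM; last by apply: measurableT_comp => //; exact: mS.
        (* [weight_Fm] only covers weights of successor index, so the empty scheme, of weight [1],
           is treated apart. *)
        case: (m) mWt => [_|n]; last by apply.
        rewrite (_ : weight 0 = cst 1); first exact: measurable_cst.
        by apply/funext => w; rewrite /weight big_ord0 oppr0 expR0.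
      by apply: measurableT_comp => //; exact: (Fm_measurable hW FY0).
    move=> w; rewrite normrM ler_pM//.
    have /andP[/ltW c0 c1] := weight_bounds w (leqnn m).
    apply: ler_norm_sub; [|rewrite -[leRHS]mul1r ler_pM//| |].
    - by rewrite mulr_ge0//; exact: (tf_ge0 hG).
    - exact: (tf_ge0 hG).
    - exact: (tf_le hG).
    - exact: (tf_ge0 hG).
    - exact: (tf_le hG).
  - exact: L1_sum.
  - move=> w; have -> : Y0 w = scheme 0 w by rewrite /scheme big_ord0 addr0.
    have -> : weight m w * G (scheme m w) - G (scheme 0 w) =
        \sum_(j < m) (weight j.+1 w * G (scheme j.+1 w) - weight j w * G (scheme j w)).
      rewrite -(big_mkord xpredT (fun j => weight j.+1 w * G (scheme j.+1 w) - weight j w * G (scheme j w))).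
      rewrite telescope_sumr//.
      by rewrite [weight 0 w]/weight big_ord0 oppr0 expR0 mul1r.
    rewrite mulr_sumr; apply: ler_sum => j _; have jm := ltn_ord j.
    have /andP[a0 _] := A1 w.
    have g0 := tf_ge0 hG (scheme j w).
    have wS := weightS w jm.
    have wr : weight j.+1 w * (1 + h * r) <= weight j w.
      apply: le_trans wS; rewrite ler_wpM2l ?expR_ge0// lerD2l ler_pM2l// lerDl.
      rewrite mulr_ge0// addr_ge0 ?sqr_ge0//; by have /andP[] := bB w jm.
    have := ler_wpM2r g0 wr => wrg.
    have -> : inc' j w = \1_A w * (weight j.+1 w * G (scheme j.+1 w)
       - weight j.+1 w * (1 + h * r) * G (scheme j w)).
      by rewrite /inc' /inc /gg; ring.
    by rewrite ler_wpM2l// lerD2l lerN2.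
apply: (@le_trans _ _ (Ex (fun w => \sum_(j < m) dd' j w) +
    m%:R * (h * (4 * e * B ^+ 2 + h * (Kg * B ^+ 2 + 520 * C * B ^+ 4))))); last first.
  rewrite lerD2r le_eqVlt; apply/orP; left; apply/eqP; congr (Ex _).
  apply/funext => w; rewrite mulr_sumr; apply: eq_bigr => j _.
  by rewrite /dd' /dd /gg; ring.
rewrite !Ex_sum//.
have -> : m%:R * (h * (4 * e * B ^+ 2 + h * (Kg * B ^+ 2 + 520 * C * B ^+ 4))) =
  \sum_(j < m) (h * (4 * e * B ^+ 2 + h * (Kg * B ^+ 2 + 520 * C * B ^+ 4))).
  by rewrite sumr_const card_ord mulr_natl.
rewrite -big_split/=; apply: ler_sum => j _; have jm := ltn_ord j.
rewrite /inc' /dd' ExB; [|exact: iinc|apply: L1Z; exact: igg].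
rewrite ExB; [|apply: L1Z; exact: idd|apply: L1Z; exact: igg].
rewrite (ExZ h (idd j jm)).
have := st j jm; lra.
Qed.

(* By [weightS] the weights absorb the quadratic variation of the scheme. *)
Lemma weighted_sum_le w : 0 < lam ->
  \sum_(j < m) h * (weight j.+1 w * (xi j w ^+ 2 + b j w)) <= lam^-1.
Proof.
move=> lamp; rewrite -[leRHS]mul1r ler_pdivlMr// mulr_suml.
apply: (@le_trans _ _ (\sum_(j < m) (weight j w - weight j.+1 w))).
  apply: ler_sum => j _; have jm := ltn_ord j.
  have := weightS w jm; have /andP[/ltW w0 _] := weight_bounds w jm.
  have : 0 <= weight j.+1 w * (h * r) by rewrite mulr_ge0// mulr_ge0// ltW.
  by lra.
rewrite -(big_mkord xpredT (fun j => weight j w - weight j.+1 w)).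
under eq_bigr do rewrite -opprB.
rewrite sumrN telescope_sumr// opprB [weight 0 w]/weight big_ord0 oppr0 expR0.
by have /andP[/ltW w0 _] := weight_bounds w (leqnn m); lra.
Qed.

End scheme.
End discrete.

(** * Step functions, time integrals and limits *)

Section steps.
Context {R : realType}.
Variables (s t : R) (m : nat).
Hypotheses (st : s < t) (m0 : (0 < m)%N).
Local Notation mu := (@lebesgue_measure R).

Definition mesh := (t - s) / m%:R.
Local Notation h := mesh.
Local Notation gr := (grid s h).

Lemma mesh_gt0 : 0 < h.
Proof. by rewrite divr_gt0 ?subr_gt0// ltr0n. Qed.

Lemma grid0 : gr 0 = s. Proof. by rewrite /grid mul0r addr0. Qed.

Lemma grid_last : gr m = t.
Proof.
rewrite /grid /mesh mulrC divfK; last by rewrite pnatr_eq0 -lt0n.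
by rewrite addrC subrK.
Qed.

Lemma grid_ltS j : gr j < gr j.+1.
Proof. by rewrite gridS ltrDl mesh_gt0. Qed.

(** Each cell carries the value of its left end, and everything outside [[s, t[] is [0]. Sums along
    the scheme thus become time integrals, for which pathwise limit theorems are available. *)
Definition stepf (f : nat -> R) (u : R) : R :=
  \sum_(j < m) f j * \1_(`[gr j, gr j.+1[%classic : set R) u.

Lemma stepfE f u j : (j < m)%N -> gr j <= u < gr j.+1 -> stepf f u = f j.
Proof.
move=> jm /andP[ju uj]; rewrite /stepf (bigD1 (Ordinal jm))//= indicE mem_set ?mulr1; last first.
  by rewrite /= in_itv/= ju uj.
rewrite big1 ?addr0// => i ij; rewrite indicE memNset ?mulr0//= in_itv/= => /andP[iu ui].
have hp := mesh_gt0.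
have [lij|lji|eij] := ltngtP i j.
- by have := le_trans (grid_le s hp lij) ju; rewrite leNgt ui.
- by have := le_trans (grid_le s hp lji) iu; rewrite leNgt uj.
- by move/eqP : ij; apply; exact: val_inj.
Qed.

Lemma grid_index u : s <= u -> u < t ->
  exists2 j, (j < m)%N & gr j <= u < gr j.+1.
Proof.
rewrite -grid_last; elim: (m) => [|n ih] su ut.
  by have := le_lt_trans su ut; rewrite grid0 ltxx.
have [un|nu] := ltP u (gr n); last by exists n => //; rewrite nu ut.
by have [j jn hj] := ih su un; exists j => //; rewrite ltnS ltnW.
Qed.

Lemma stepf_ind (P : R -> Prop) f u : s <= u -> u < t ->
  (forall j, (j < m)%N -> gr j <= u < gr j.+1 -> P (f j)) -> P (stepf f u).
Proof.
by move=> su ut hP; have [j jm hj] := grid_index su ut; rewrite (stepfE f jm hj); exact: hP.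
Qed.

Lemma measurable_stepf f (D : set R) : measurable_fun D (stepf f).
Proof.
by apply: measurable_sum => j; apply: measurable_funM => //; exact: measurable_indic.
Qed.

Lemma stepf_out f u : ~ (s <= u < t) -> stepf f u = 0.
Proof.
move=> nu; rewrite /stepf big1// => j _; rewrite indicE memNset ?mulr0//= in_itv/= => /andP[ju uj].
have hp := mesh_gt0; apply: nu; apply/andP; split; first exact: le_trans (grid_ge s hp j) ju.
by apply: lt_le_trans uj _; rewrite -grid_last; exact: grid_le.
Qed.

Lemma stepf_bound f (C : R) u : 0 <= C -> (forall j, (j < m)%N -> `|f j| <= C) -> `|stepf f u| <= C.
Proof.
move=> C0 fC; have [/andP[su ut]|/negP nu] := boolP (s <= u < t).
  by apply: (@stepf_ind (fun x => `|x| <= C)) => // j jm _; exact: fC.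
by rewrite stepf_out// normr0.
Qed.

Lemma itv_integrable_bounded (a b : R) (g : R -> R) (C : R) (D : set R) : D `<=` `[a, b] ->
  measurable D -> measurable_fun D g -> (forall u, D u -> `|g u| <= C) ->
  mu.-integrable D (EFin \o g).
Proof.
move=> Dab mD mg gC; apply: measurable_bounded_integrable => //.
  apply: (@le_lt_trans _ _ (mu `[a, b])); first by apply: le_measure => //; rewrite inE.
  by rewrite lebesgue_measure_itv/=; case: ifPn => // _; rewrite -EFinB ltry.
by exists C; split; rewrite ?num_real// => M CM w Dw; rewrite /= (le_trans (gC w Dw))// ltW.
Qed.

Lemma integral_stepf f n : (n <= m)%N ->
  (\int[mu]_(u in `[s, gr n[) stepf f u)%R = \sum_(j < n) h * f j.
Proof.
have hp := mesh_gt0.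
have ib (a b : R) D : D `<=` `[a, b] -> measurable D -> mu.-integrable D (EFin \o stepf f).
  move=> Dab mD; pose C := \sum_(j < m) `|f j|.
  apply: (itv_integrable_bounded Dab mD (C := C)); first exact: measurable_stepf.
  move=> u _; apply: stepf_bound; first by rewrite sumr_ge0.
  by move=> j jm; rewrite /C (bigD1 (Ordinal jm))//= lerDl sumr_ge0.
elim: n => [_|n ih nm].
  by rewrite grid0 set_itvco0 Rintegral_set0 big_ord0.
have gn : gr n <= gr n.+1 by exact: grid_le.
have -> : `[s, gr n.+1[%classic = `[s, gr n[ `|` `[gr n, gr n.+1[ :> set R.
  by rewrite (@itv_bndbnd_setU _ _ _ (BLeft (gr n)))// bnd_simp// grid_ge.
rewrite Rintegral_setU//=.
- rewrite ih ?(ltnW nm)// big_ord_recr/=; congr (_ + _).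
  transitivity (\int[mu]_(u in `[gr n, gr n.+1[) f n)%R.
    by apply: eq_Rintegral => u; rewrite inE/= in_itv/= => /(stepfE f nm).
  rewrite Rintegral_cst//= lebesgue_measure_itv/= lte_fin grid_ltS/=.
  by rewrite gridS addrAC subrr add0r mulrC.
- apply: (ib s (gr n.+1)); last exact: measurableU.
  move=> x [] /=; rewrite !in_itv/= => /andP[a c]; apply/andP; split.
  + by [].
  + by rewrite (le_trans (ltW c)).
  + by rewrite (le_trans _ a)// grid_ge.
  + exact: ltW.
- apply/disj_setPS => x [] /=; rewrite !in_itv/= => /andP[_ xs] /andP[sx _].
  by have := lt_le_trans xs sx; rewrite ltxx.
Qed.

End steps.

Lemma path_modulus {R : realType} (z : R -> R) u : {within `[0, +oo[, continuous z} ->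
  0 <= u -> forall e, 0 < e -> exists2 del, 0 < del &
    forall v, 0 <= v -> `|u - v| < del -> `|z u - z v| <= e.
Proof.
move=> /subspace_continuousP cz u0 e e0.
have u0' : `[0, +oo[%classic u by rewrite /= in_itv/= u0.
have /cvgrPdist_le/(_ e e0) := cz u u0'.
rewrite nearE/= /within/= => -[del /= del0 h]; exists del => // v v0 uv.
by apply: h => //=; rewrite in_itv/= v0.
Qed.

Section step_cvg.
Context {R : realType}.
Variables (s t : R).
Hypothesis (st : s < t).
Local Notation mu := (@lebesgue_measure R).
Local Notation D := (`[s, t[%classic : set R).
Local Notation gr m := (grid s (mesh s t m)).

Lemma mesh_lt e : 0 < e -> exists N, forall m, (N < m)%N -> mesh s t m < e.
Proof.
move=> e0; exists (Num.truncn ((t - s) / e)) => m Nm.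
have m0 : 0 < m%:R :> R by rewrite ltr0n (leq_ltn_trans _ Nm).
rewrite /mesh ltr_pdivrMr// mulrC -ltr_pdivrMr//.
have ts : 0 <= (t - s) / e by rewrite divr_ge0 ?(ltW e0)// subr_ge0 ltW.
by rewrite -truncn_lt_nat.
Qed.

(** The step function samples at a grid point to the left of [u], so only a modulus of continuity
    from the left is asked of [z]. Paths of simple processes have no more than that. *)
Lemma stepf_cvg (z : R -> R) u : s <= u -> u < t ->
  (forall e, 0 < e -> exists2 del, 0 < del &
     forall v, s <= v -> v <= u -> u - v < del -> `|z u - z v| <= e) ->
  stepf s t m.+1 (fun j => z (gr m.+1 j)) u @[m --> \oo] --> z u.
Proof.
move=> su ut hz; apply/cvgrPdist_le => e e0.
have [del del0 h] := hz e e0; have [N hN] := mesh_lt del0.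
exists N => // m /= Nm.
apply: (@stepf_ind _ _ _ _ st _ (fun x => `|z u - x| <= e)) => // j jm /andP[ju uj].
apply: h => //; first by apply: grid_ge; exact: mesh_gt0.
move: uj; rewrite gridS => uj; apply: lt_trans (hN m.+1 _); last by rewrite ltnS.
by rewrite ltrBlDl.
Qed.

End step_cvg.

Section joint.
Context {d : measure_display} {Omega : measurableType d} {R : realType}.
Variable Pr : probability Omega R.
Local Notation mu := (@lebesgue_measure R).
Local Notation TR := (measurableTypeR R).
Variables (s t : R).
Hypothesis (st : s < t).
Local Notation D := (`[s, t[%classic : set R).

Lemma measurable_indic_time (a b : R) :
  measurable_fun setT (fun p : TR * Omega => \1_(`[a, b[%classic : set R) p.1 : R).
Proof.
have mi : measurable_fun setT (\1_(`[a, b[%classic : set TR) : TR -> R).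
  exact: measurable_indic.
exact: (measurableT_comp mi measurable_fst).
Qed.

Lemma measurable_stepf_joint m (V : nat -> Omega -> R) :
  (forall j, (j < m)%N -> measurable_fun setT (V j)) ->
  measurable_fun setT (fun p : TR * Omega => stepf s t m (fun j => V j p.2) p.1).
Proof.
move=> mV; apply: measurable_sum => j; apply: measurable_funM.
  by apply: measurableT_comp => //; exact: mV.
exact: measurable_indic_time.
Qed.

(** Limit of step processes sampled on finer and finer grids, each of which is visibly measurable in
    the pair. *)
Lemma measurable_process_joint (Z : R -> Omega -> R) : 0 <= s ->
  (forall u, 0 <= u -> measurable_fun setT (Z u)) -> continuous_paths Z ->
  measurable_fun setT (fun p : TR * Omega => Z p.1 p.2 * \1_D p.1).
Proof.
move=> s0 mZ cZ; apply: (@measurable_fun_cvg _ _ _ setT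
  (fun m (p : TR * Omega) => stepf s t m.+1 (fun j => Z (grid s (mesh s t m.+1) j) p.2) p.1)).
  move=> m; apply: (@measurable_stepf_joint m.+1 (fun j => Z (grid s (mesh s t m.+1) j))) => j _; apply: mZ.
  by rewrite (le_trans s0)// grid_ge// mesh_gt0.
move=> [u w] _ /=; rewrite indicE; have [/andP[su ut]|nu] := boolP (s <= u < t).
  rewrite mem_set ?mulr1; last by rewrite /= in_itv/= su.
  apply: (stepf_cvg st (z := fun v => Z v w)) => // e e0.
  have [del del0 h] := path_modulus (cZ w) (le_trans s0 su) e0.
  exists del => // v sv vu uv; apply: h; first exact: le_trans sv.
  by rewrite ger0_norm// subr_ge0.
rewrite memNset ?mulr0; last by rewrite /= in_itv/=; exact/negP.
apply: cvg_near_cst; apply: nearW => m; apply: stepf_out => //; exact/negP.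
Qed.

Section tonelli.
Variable g : TR * Omega -> \bar R.
Hypotheses (mg : measurable_fun setT g) (g0 : forall p, (0 <= g p)%E).

Let gD (p : TR * Omega) : \bar R := (g p * (\1_D p.1)%:E)%E.

Let mgD : measurable_fun setT gD.
Proof.
apply: emeasurable_funM => //; apply/measurable_EFinP.
exact: measurable_indic_time.
Qed.

Let gD0 p : (0 <= gD p)%E. Proof. by rewrite mule_ge0// lee_fin. Qed.

Let intD w : (\int[mu]_(u in D) g (u, w) = \int[mu]_u gD (u, w))%E.
Proof.
rewrite integral_mkcond; apply: eq_integral => u _; rewrite patchE /gD/= indicE.
by case: ifPn => _; rewrite ?mule1 ?mule0.
Qed.

Lemma measurable_tonelliD : measurable_fun setT (fun w => \int[mu]_(u in D) g (u, w))%E.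
Proof.
under eq_fun do rewrite intD.
exact: (@measurable_fun_fubini_tonelli_G _ _ TR Omega R mu gD mgD gD0).
Qed.

Lemma tonelliD : (\int[Pr]_w \int[mu]_(u in D) g (u, w) =
  \int[mu]_(u in D) \int[Pr]_w g (u, w))%E.
Proof.
under eq_integral do rewrite intD.
rewrite -(@fubini_tonelli _ _ TR Omega R mu Pr gD mgD gD0).
rewrite [RHS]integral_mkcond; apply: eq_integral => u _; rewrite patchE.
rewrite /gD/= indicE; case: ifPn => _.
  by apply: eq_integral => w _; rewrite mule1.
by rewrite integral0_eq// => w _; rewrite mule0.
Qed.

Lemma measurable_tonelliD_time : measurable_fun D (fun u => \int[Pr]_w g (u, w))%E.
Proof.
apply: (@measurable_funTS _ _ TR).
exact: (@measurable_fun_fubini_tonelli_F _ _ TR Omega R Pr g mg g0).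
Qed.

End tonelli.

(** Tonelli covers nonnegative integrands; adding the bound [C] leads to that case, and its integral
    is subtracted again. *)
Lemma measurable_Rintegral (g : TR * Omega -> R) (C : R) :
  measurable_fun setT g -> (forall p, `|g p| <= C) ->
  measurable_fun setT (fun w => \int[mu]_(u in D) g (u, w))%R.
Proof.
move=> mg gC.
have iD (f : R -> R) K : measurable_fun setT f -> (forall u, `|f u| <= K) ->
    mu.-integrable D (EFin \o f).
  move=> mf fK; apply: (@itv_integrable_bounded _ s t _ K) => //.
    by move=> u /=; rewrite !in_itv/= => /andP[-> /ltW].
  exact: measurable_funTS.
have -> : (fun w => \int[mu]_(u in D) g (u, w))%R =
    (fun w => fine (\int[mu]_(u in D) (g (u, w) + C)%:E)%E - \int[mu]_(u in D) C)%R.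
  apply/funext => w.
  have mgw : measurable_fun setT (fun u : TR => g (u, w)).
    by apply: (measurableT_comp mg); exact: pair2_measurable.
  rewrite -[X in _ = (X - _)%R]/(\int[mu]_(u in D) (g (u, w) + C))%R.
  rewrite RintegralD//; first by rewrite addrK.
    exact: iD.
  by apply: (@iD (cst C) `|C|).
apply: measurable_funB => //; apply: measurableT_comp => //.
apply: (@measurable_tonelliD (fun p => (g p + C)%:E)).
  by apply/measurable_EFinP; exact: measurable_funD.
by move=> p; rewrite lee_fin; have := gC p; rewrite ler_norml => /andP[]; lra.
Qed.

End joint.

(** Borel-Cantelli in integrated form: the series has integral at most [1], so it is finite almost
    everywhere, and then its terms vanish in the limit by [nneseries_cvg0]. *)
Lemma summable_ae_cvg0 {d} {T : measurableType d} {R : realType}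
    (mu : {measure set T -> \bar R}) (D : set T) (f : nat -> T -> \bar R) :
  measurable D -> (forall k, measurable_fun D (f k)) ->
  (forall k x, D x -> (0 <= f k x)%E) ->
  (forall k, (\int[mu]_(x in D) f k x <= (1 / (2 ^ k.+1)%:R)%:E)%E) ->
  {ae mu, forall x, D x -> (\sum_(k <oo) f k x < +oo)%E}.
Proof.
move=> mD mf f0 hf.
have h : (\int[mu]_(x in D) (\sum_(k <oo) f k x) < +oo)%E.
  rewrite integral_nneseries//.
  apply: (@le_lt_trans _ _ (\sum_(k <oo) (1 / (2 ^ k.+1)%:R)%:E)%E).
    by apply: lee_nneseries => // k _ _; apply: integral_ge0 => x Dx; exact: f0.
  have := @cvg_geometric_eseries_half R 1 0; rewrite expr0 divr1 => /cvg_lim hl.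
  rewrite (_ : (\sum_(k <oo) (1 / (2 ^ k.+1)%:R)%:E)%E = 1%E) ?ltry// -hl//.
  by congr (limn _); apply/funext => n; apply: eq_bigr => k _; rewrite addn1.
have ig : mu.-integrable D (fun x => \sum_(k <oo) f k x)%E.
  apply/integrableP; split; first by apply: ge0_emeasurable_sum => // k x Dx _; exact: f0.
  under eq_integral => x xD.
    rewrite gee0_abs; last by apply: nneseries_ge0 => k _ _; apply: f0; rewrite inE in xD.
    over.
  exact: h.
apply: filterS (integrable_ae mD ig) => x hx Dx.
by have := hx Dx; rewrite ge0_fin_numE//; apply: nneseries_ge0 => k _ _; exact: f0.
Qed.

Lemma nneseries_cvg0 {R : realType} (a : nat -> \bar R) :
  (forall k, (0 <= a k)%E) -> (\sum_(k <oo) a k < +oo)%E -> a k @[k --> \oo] --> 0%E.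
Proof.
move=> a0 ha; have := nneseries_tail_cvg ha (fun k _ => a0 k).
apply: (@squeeze_cvge _ _ _ _ (cst 0%E)); last exact: cvg_cst.
apply: nearW => N; rewrite a0/=.
have := @nneseries_lim_ge R a xpredT N N.+1 (fun n _ _ => a0 n).
by rewrite big_nat1.
Qed.

Lemma ecvg0P {R : realType} (a : nat -> \bar R) : (forall k, (0 <= a k)%E) ->
  (forall e, 0 < e -> \forall k \near \oo, (a k <= e%:E)%E) <->
  a k @[k --> \oo] --> 0%E.
Proof.
move=> a0; split=> [h|/fine_cvgP[fa] /cvgrPdist_le h e e0].
  apply/fine_cvgP; split.
    near=> k; rewrite ge0_fin_numE//; apply: le_lt_trans (ltry 1).
    by near: k; exact: h.
  apply/cvgrPdist_le => e e0; near=> k.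
  have ak : (a k <= e%:E)%E by near: k; exact: h.
  rewrite sub0r normrN /= ger0_norm ?fine_ge0//.
  by rewrite -lee_fin fineK// ge0_fin_numE// (le_lt_trans ak)// ltry.
near=> k.
have fk : a k \is a fin_num by near: k.
have : `|0 - fine (a k)| <= e by near: k; exact: h.
by rewrite sub0r normrN ger0_norm ?fine_ge0// -lee_fin fineK.
Unshelve. all: by end_near. Qed.

(** * Convergence of the generator along one path *)

Section path.
Context {R : realType}.
Variables (G G1 G2 : R -> R) (K : R).
Hypothesis hG : test_fun G G1 G2 K.
Variables (r s t : R).
Hypotheses (r0 : 0 <= r) (st : s < t).
Local Notation mu := (@lebesgue_measure R).
Local Notation D := (`[s, t[%classic : set R).

(** Generator of the discounted value with [xi] and [b] as free arguments: along a scheme these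
    coefficients are not functions of the state [y]. *)
Definition ito_drift (xi b y : R) : R := b * G1 y + 2^-1 * xi ^+ 2 * G2 y - r * G y.

Let mG : measurable_fun setT G.
Proof. by apply: continuous_measurable_fun; exact: (tf_cG hG). Qed.
Let mG1 : measurable_fun setT G1.
Proof. by apply: continuous_measurable_fun; exact: (tf_cG1 hG). Qed.
Let mG2 : measurable_fun setT G2.
Proof. by apply: continuous_measurable_fun; exact: (tf_cG2 hG). Qed.
Let K0 : 0 <= K. Proof. exact: le_trans (tf_ge0 hG 0) (tf_le hG 0). Qed.

Variables (xi_ b_ y_ : nat -> R -> R) (H x : R -> R) (xM bM : R).
Hypotheses (mxi : forall k, measurable_fun D (xi_ k))
  (mb : forall k, measurable_fun D (b_ k))
  (my : forall k, measurable_fun D (y_ k))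
  (mH : measurable_fun D H) (mx : measurable_fun D x).
Hypothesis xM_ub : forall u, D u -> `|x u| <= xM.
Hypothesis bM_ub : forall k u, D u -> `|b_ k u| <= bM.
Hypothesis cb : forall u, D u -> b_ ^~ u @ \oo --> r * x u.
Hypothesis cy : {ae mu, forall u, D u -> y_ ^~ u @ \oo --> x u}.
Hypothesis cxi : (\int[mu]_(u in D) ((xi_ k u - H u) ^+ 2)%:E)%E @[k --> \oo] --> 0%E.
Hypothesis H2 : (\int[mu]_(u in D) (H u ^+ 2)%:E < +oo)%E.

(** The part of the error in which the noise coefficient is already [H]. It vanishes pointwise and
    is dominated by a constant plus [K * H^2], whereas [xi_] converges in quadratic mean over time
    only and is treated apart. *)
Let rho k u := `|b_ k u * G1 (y_ k u) - r * x u * G1 (x u)|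
  + 2^-1 * H u ^+ 2 * `|G2 (y_ k u) - G2 (x u)| + r * `|G (y_ k u) - G (x u)|.

Let rho0 k u : 0 <= rho k u.
Proof.
rewrite /rho; apply: addr_ge0; last exact: mulr_ge0.
apply: addr_ge0 => //; apply: mulr_ge0 => //.
by apply: mulr_ge0; [rewrite invr_ge0|exact: sqr_ge0].
Qed.

Let mrho k : measurable_fun D (rho k).
Proof.
have c (f g : R -> R) : measurable_fun setT f -> measurable_fun D g -> measurable_fun D (f \o g).
  by move=> mf mg; exact: measurableT_comp.
apply: measurable_funD; first apply: measurable_funD.
- apply: measurableT_comp => //; apply: measurable_funB.
    by apply: measurable_funM => //; exact: c.
  by apply: measurable_funM; [exact: measurable_funM|exact: c].
- apply: measurable_funM.
    by apply: measurable_funM => //; exact: measurable_funX.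
  by apply: measurableT_comp => //; apply: measurable_funB; exact: c.
- apply: measurable_funM => //.
  by apply: measurableT_comp => //; apply: measurable_funB; exact: c.
Qed.

Let mgen (a b y : R -> R) : measurable_fun D a -> measurable_fun D b ->
  measurable_fun D y -> measurable_fun D (fun u => ito_drift (a u) (b u) (y u)).
Proof.
move=> ma mb' my'; apply: measurable_funB; first apply: measurable_funD.
- by apply: measurable_funM => //; exact: (measurableT_comp mG1).
- apply: measurable_funM; last exact: (measurableT_comp mG2).
  by apply: measurable_funM => //; exact: measurable_funX.
- by apply: measurable_funM => //; exact: (measurableT_comp mG).
Qed.

Let mdiff k : measurable_fun D
  (fun u => `|ito_drift (xi_ k u) (b_ k u) (y_ k u) - ito_drift (H u) (r * x u) (x u)|).
Proof.
apply: measurableT_comp => //; apply: measurable_funB; apply: mgen => //.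
exact: measurable_funM.
Qed.

Let iH : mu.-integrable D (fun u => (H u ^+ 2)%:E).
Proof.
apply/integrableP; split; first by apply/measurable_EFinP; exact: measurable_funX.
by under eq_integral do rewrite gee0_abs ?lee_fin ?sqr_ge0//.
Qed.

Let rho_cvg : (\int[mu]_(u in D) (rho k u)%:E)%E @[k --> \oo] --> 0%E.
Proof.
pose g u := (bM * K + r * xM * K + r * (2 * K)) + K * H u ^+ 2.
have ig : mu.-integrable D (EFin \o g).
  have ic : mu.-integrable D (fun u => (bM * K + r * xM * K + r * (2 * K))%:E).
    apply: (@itv_integrable_bounded _ s t (cst (bM * K + r * xM * K + r * (2 * K)))
      `|bM * K + r * xM * K + r * (2 * K)|) => //.
    by move=> u /=; rewrite !in_itv/= => /andP[-> /ltW].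
  have := integrableD _ ic (integrableZl _ K iH).
  by apply => //; exact: measurable_itv.
have mD : measurable (D : set (measurableTypeR R)) by exact: measurable_itv.
have [| | | | |_ _] := @dominated_convergence _ (measurableTypeR R) R mu D mD
    (fun k => EFin \o rho k) (cst 0%E) (EFin \o g).
- by move=> k; apply/measurable_EFinP; exact: mrho.
- exact: measurable_cst.
- case: cy => N [mN N0 hN]; exists N; split => //.
  apply: subset_trans hN; apply: subsetC => u /= yu Du.
  have /(_ Du) cyu := yu.
  have cG := cvg_comp _ _ cyu (tf_cG hG (x := x u)).
  have cG1 := cvg_comp _ _ cyu (tf_cG1 hG (x := x u)).
  have cG2 := cvg_comp _ _ cyu (tf_cG2 hG (x := x u)).
  apply: cvg_EFin; first exact: nearW.
  rewrite (_ : 0 = `|r * x u * G1 (x u) - r * x u * G1 (x u)| +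
     2^-1 * H u ^+ 2 * `|G2 (x u) - G2 (x u)| + r * `|G (x u) - G (x u)|); last first.
    by rewrite !subrr !normr0 !mulr0 !addr0.
  apply: cvgD; first apply: cvgD.
  + by apply: cvg_norm; apply: cvgB; [apply: cvgM => //; exact: cb|exact: cvg_cst].
  + by apply: cvgM; [exact: cvg_cst|apply: cvg_norm; apply: cvgB => //; exact: cvg_cst].
  + by apply: cvgM; [exact: cvg_cst|apply: cvg_norm; apply: cvgB => //; exact: cvg_cst].
- exact: ig.
- apply: aeW => u k Du; rewrite lee_fin ger0_norm// /rho /g.
  have d2 (f : R -> R) (a b : R) : (forall y, `|f y| <= K) -> `|f a - f b| <= 2 * K.
    by move=> fK; rewrite (le_trans (ler_normB _ _))// mulr_natl mulr2n lerD.
  have nG y : `|G y| <= K by rewrite ger0_norm; [exact: (tf_le hG)|exact: (tf_ge0 hG)].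
  have a1 : `|b_ k u * G1 (y_ k u) - r * x u * G1 (x u)| <= bM * K + r * xM * K.
    rewrite (le_trans (ler_normB _ _))// !normrM (ger0_norm r0) lerD// ler_pM//; try exact: (tf_le1 hG).
    + exact: bM_ub.
    + by rewrite mulr_ge0.
    + by rewrite ler_wpM2l// xM_ub.
  have a2 : `|G2 (y_ k u) - G2 (x u)| <= 2 * K by apply: d2; exact: (tf_le2 hG).
  have a3 : `|G (y_ k u) - G (x u)| <= 2 * K by exact: d2.
  have b2 := ler_wpM2l (sqr_ge0 (H u)) a2.
  have b3 := ler_wpM2l r0 a3.
  lra.
- by rewrite integral0.
Qed.

(** Beside [rho] there remains half of [(xi^2 - H^2) * G2]. By [|xi^2 - H^2| <= (1 + 1/del) (xi -
    H)^2 + del H^2], one term vanishes as [k] grows and the other is small with [del]; pointwise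
    limits of [xi_] do not enter. *)
Lemma path_cvg : (\int[mu]_(u in D)
    (`|ito_drift (xi_ k u) (b_ k u) (y_ k u) - ito_drift (H u) (r * x u) (x u)|)%:E)%E
  @[k --> \oo] --> 0%E.
Proof.
have mD : measurable (D : set (measurableTypeR R)) by exact: measurable_itv.
apply/ecvg0P; first by move=> k; apply: integral_ge0 => u _; rewrite lee_fin.
move=> e e0.
pose I := fine (\int[mu]_(u in D) (H u ^+ 2)%:E)%E.
have IE : (\int[mu]_(u in D) (H u ^+ 2)%:E)%E = I%:E.
  by rewrite /I fineK//; exact: integrable_fin_num iH.
have I0 : 0 <= I by apply: fine_ge0; apply: integral_ge0 => u _; rewrite lee_fin sqr_ge0.
(* A third of [e] goes to [rho], a third to [c] times the quadratic error of [xi_ k], a third to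
   [K * del] times the integral [I] of [H^2]. The added [1] keeps the constants positive when [K] or
   [I] is zero. *)
pose del := e / (3 * (K * I + 1)).
have KI : 0 < 3 * (K * I + 1) by rewrite mulr_gt0// ltr_wpDl// mulr_ge0.
have del0 : 0 < del by rewrite divr_gt0.
pose c := K * (1 + del^-1) + 1.
have c0 : 0 < c by rewrite ltr_wpDl// mulr_ge0// addr_ge0// invr_ge0 ltW.
have rint0 k : (0 <= \int[mu]_(u in D) (rho k u)%:E)%E.
  by apply: integral_ge0 => u _; rewrite lee_fin.
have qint0 k : (0 <= \int[mu]_(u in D) ((xi_ k u - H u) ^+ 2)%:E)%E.
  by apply: integral_ge0 => u _; rewrite lee_fin sqr_ge0.
have h1 := (ecvg0P rint0).2 rho_cvg (e / 3) (divr_gt0 e0 (ltr0Sn _ 2)).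
have h2 := (ecvg0P qint0).2 cxi (e / 3 / c) (divr_gt0 (divr_gt0 e0 (ltr0Sn _ 2)) c0).
near=> k.
have k1 : (\int[mu]_(u in D) (rho k u)%:E <= (e / 3)%:E)%E by near: k; exact: h1.
have k2 : (\int[mu]_(u in D) ((xi_ k u - H u) ^+ 2)%:E <= (e / 3 / c)%:E)%E.
  by near: k; exact: h2.
have mq : measurable_fun D (fun u => ((xi_ k u - H u) ^+ 2)%:E).
  by apply/measurable_EFinP; apply: measurable_funX; exact: measurable_funB.
apply: (@le_trans _ _ (\int[mu]_(u in D) ((rho k u)%:E + (c%:E * ((xi_ k u - H u) ^+ 2)%:E
   + (K * del)%:E * (H u ^+ 2)%:E)))%E).
  apply: ge0_le_integral => //.
  - by apply/measurable_EFinP; exact: mdiff.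
  - apply: emeasurable_funD; first by apply/measurable_EFinP; exact: mrho.
    apply: emeasurable_funD; apply: emeasurable_funM => //.
    by apply/measurable_EFinP; exact: measurable_funX.
  - move=> u Du; rewrite -!EFinM -!EFinD lee_fin.
    set X := xi_ k u; set Y := y_ k u; set h := H u.
    have -> : ito_drift X (b_ k u) Y - ito_drift h (r * x u) (x u) =
      (b_ k u * G1 Y - r * x u * G1 (x u)) + 2^-1 * h ^+ 2 * (G2 Y - G2 (x u))
       - r * (G Y - G (x u)) + 2^-1 * (X ^+ 2 - h ^+ 2) * G2 Y.
      by rewrite /ito_drift; ring.
    apply: (@le_trans _ _ (rho k u + 2^-1 * `|X ^+ 2 - h ^+ 2| * K)).
      rewrite (le_trans (ler_normD _ _))//; apply: lerD.
        rewrite (le_trans (ler_normB _ _))//; apply: lerD.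
          rewrite (le_trans (ler_normD _ _))//; apply: lerD => //.
          by rewrite normrM ger0_norm// mulr_ge0 ?sqr_ge0// invr_ge0.
        by rewrite normrM ger0_norm.
      by rewrite !normrM ger0_norm ?invr_ge0// ler_wpM2l ?mulr_ge0 ?invr_ge0//; exact: (tf_le2 hG).
    rewrite lerD2l.
    have q : `|X ^+ 2 - h ^+ 2| <= (1 + del^-1) * (X - h) ^+ 2 + del * h ^+ 2.
      have d1 : del * del^-1 = 1 by rewrite divff// gt_eqF.
      have di : 0 <= del^-1 by rewrite invr_ge0 ltW.
      have p1 : 0 <= del^-1 * ((X - h) + del * h) ^+ 2 by rewrite mulr_ge0 ?sqr_ge0.
      have p2 : 0 <= del^-1 * ((X - h) - del * h) ^+ 2 by rewrite mulr_ge0 ?sqr_ge0.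
      have e1 : del^-1 * ((X - h) + del * h) ^+ 2 = del^-1 * (X - h) ^+ 2 + 2 * h * (X - h) + del * h ^+ 2.
        by field; rewrite gt_eqF.
      have e2 : del^-1 * ((X - h) - del * h) ^+ 2 = del^-1 * (X - h) ^+ 2 - 2 * h * (X - h) + del * h ^+ 2.
        by field; rewrite gt_eqF.
      rewrite e1 in p1; rewrite e2 in p2.
      have xh := sqr_ge0 (X - h).
      have -> : X ^+ 2 - h ^+ 2 = (X - h) ^+ 2 + 2 * h * (X - h) by ring.
      rewrite mulrDl mul1r ler_norml; apply/andP; split; lra.
    have := ler_wpM2r K0 q; have xh := sqr_ge0 (X - h).
    have : 0 <= `|X ^+ 2 - h ^+ 2| * K by rewrite mulr_ge0.
    rewrite /c; have -> : ((1 + del^-1) * (X - h) ^+ 2 + del * h ^+ 2) * K =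
      K * (1 + del^-1) * (X - h) ^+ 2 + K * del * h ^+ 2 by ring.
    by rewrite -mulrA mulrDl mul1r; lra.
have mH2 : measurable_fun D (fun u => (H u ^+ 2)%:E).
  by apply/measurable_EFinP; exact: measurable_funX.
rewrite ge0_integralD//; last 4 first.
- by move=> u _; rewrite lee_fin.
- by apply/measurable_EFinP; exact: mrho.
- move=> u _; rewrite -!EFinM -!EFinD lee_fin.
  by rewrite addr_ge0// mulr_ge0 ?sqr_ge0 ?(ltW c0)// mulr_ge0// ltW.
- by apply: emeasurable_funD; apply: emeasurable_funM.
rewrite ge0_integralD//; last 4 first.
- by move=> u _; rewrite -EFinM lee_fin mulr_ge0 ?sqr_ge0// ltW.
- exact: emeasurable_funM.
- by move=> u _; rewrite -EFinM lee_fin mulr_ge0 ?sqr_ge0// mulr_ge0// ltW.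
- exact: emeasurable_funM.
rewrite !ge0_integralZl//; last 4 first.
- by move=> u _; rewrite lee_fin sqr_ge0.
- by rewrite lee_fin mulr_ge0// ltW.
- by move=> u _; rewrite lee_fin sqr_ge0.
- by rewrite lee_fin ltW.
rewrite IE.
have -> : e%:E = ((e / 3)%:E + (c%:E * (e / 3 / c)%:E + (e / 3)%:E))%E.
  by rewrite -!EFinM -!EFinD; congr EFin; field; rewrite gt_eqF.
apply: leeD => //; apply: leeD; first by rewrite lee_pmul2l.
rewrite -EFinM lee_fin /del.
have -> : K * (e / (3 * (K * I + 1))) * I = (e / 3) * (K * I / (K * I + 1)).
  by field; rewrite gt_eqF// ltr_wpDl// mulr_ge0.
by rewrite ler_piMr ?divr_ge0 ?(ltW e0)// ler_pdivrMr ?mul1r ?lerDl// ltr_wpDl// mulr_ge0.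
Unshelve. all: by end_near. Qed.

End path.

(** * Simple processes and Riemann sums along a path *)

Section simple_processes.
Context {d : measure_display} {Omega : measurableType d} {R : realType}.
Variable Pr : probability Omega R.
Variable W : R -> Omega -> R.
Hypothesis hW : standard_brownian Pr W.
Local Notation Fm := (Fm Pr W).
Local Notation Fil := (brownian_filtration Pr W).
Local Notation TR := (measurableTypeR R).
Variable S : simple_process Fil.

Lemma sp_time_ge i : 0 <= sp_time S i.
Proof.
elim: i => [|i ih]; first exact: sp_time_ge0.
exact: le_trans ih (sp_time_nd S i).
Qed.

Lemma sp_eval_Fm u : Fm u (sp_eval S u).
Proof.
apply: (@Fm_sum _ _ _ _ _ (sp_size S) u (fun i w => sp_val S i w *
  ((sp_time S i < u) && (u <= sp_time S i.+1))%:R)) => i _.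
have [iu|ui] := ltP (sp_time S i) u; last first.
  rewrite (_ : (fun w => _) = cst 0); first exact: measurable_cst.
  by apply/funext => w; rewrite /= mulr0.
apply: measurable_funM; last exact: measurable_cst.
apply: (Fm_mono (ltW iu)); apply/FmP => B mB; exact: sp_val_measurable.
Qed.

Lemma sp_eval_bound : exists2 C, 0 <= C & forall u w, `|sp_eval S u w| <= C.
Proof.
have /choice[C hC] : forall i, exists C, forall w, `|sp_val S i w| <= C.
  by move=> i; exact: sp_val_bounded.
have C0 i : 0 <= C i by exact: le_trans (hC i point).
exists (\sum_(i < sp_size S) C i); first exact: sumr_ge0.
move=> u w; rewrite (le_trans (ler_norm_sum _ _ _))//; apply: ler_sum => i _.
by rewrite normrM; case: (_ && _); rewrite ?normr1 ?mulr1 ?normr0 ?mulr0.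
Qed.

(** Cells of the form []a, b]] make the paths locally constant to the left of every point, which is
    the regularity that [stepf_cvg] asks for. *)
Lemma sp_eval_left u w : exists2 del, 0 < del &
  forall v, v <= u -> u - v < del -> sp_eval S v w = sp_eval S u w.
Proof.
rewrite /sp_eval; elim: (sp_size S) => [|n [del del0 ih]].
  by exists 1 => // v _ _; rewrite !big_ord0.
pose dl (a : R) := if a < u then u - a else 1.
have dl0 a : 0 < dl a by rewrite /dl; case: ifPn => // au; rewrite subr_gt0.
exists (Num.min del (Num.min (dl (sp_time S n)) (dl (sp_time S n.+1)))).
  by rewrite !lt_min del0 !dl0.
move=> v vu; rewrite !lt_min => /and3P[uv u1 u2].
rewrite !big_ord_recr/= ih//; congr (_ + _ * _%:R).
have h1 : (sp_time S n < v) = (sp_time S n < u).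
  move: u1; rewrite /dl; case: ifPn => [au|]; first by lra.
  by rewrite -leNgt => ua _; apply/negbTE; rewrite -leNgt (le_trans vu).
have h2 : (v <= sp_time S n.+1) = (u <= sp_time S n.+1).
  move: u2; rewrite /dl; case: ifPn => [au|].
    by move=> h; rewrite [RHS]leNgt au/=; apply/negbTE; rewrite -ltNge; lra.
  by rewrite -leNgt => ua _; rewrite ua (le_trans vu).
by rewrite h1 h2.
Qed.

Lemma measurable_sp_val i : measurable_fun setT (sp_val S i).
Proof.
by apply: (Fm_measurable hW (t := sp_time S i)); apply/FmP => B mB; exact: sp_val_measurable.
Qed.

Lemma measurable_sp_eval_joint :
  measurable_fun setT (fun p : TR * Omega => sp_eval S p.1 p.2).
Proof.
apply: measurable_sum => i; apply: measurable_funM.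
  exact: (measurableT_comp (measurable_sp_val i)).
have mi : measurable_fun setT (\1_(`]sp_time S i, sp_time S i.+1]%classic : set TR) : TR -> R).
  exact: measurable_indic.
rewrite (_ : (fun p : TR * Omega => _) = (fun p : TR * Omega =>
    \1_(`]sp_time S i, sp_time S i.+1]%classic : set TR) p.1)).
  exact: (measurableT_comp mi measurable_fst).
apply/funext => p; rewrite indicE; congr (nat_of_bool _)%:R.
by apply/idP/idP; rewrite inE/= in_itv.
Qed.

Lemma measurable_sp_integral u : 0 <= u -> measurable_fun setT (sp_integral W S u).
Proof.
move=> u0; apply: measurable_sum => i; apply: measurable_funM; first exact: measurable_sp_val.
by apply: measurable_funB; apply: (measurable_brownian hW); rewrite le_min u0 sp_time_ge.
Qed.

End simple_processes.

Section path_sums.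
Context {R : realType}.
Variables (z : R -> R) (s h : R).
Hypotheses (s0 : 0 <= s) (h0 : 0 < h).
Local Notation gr := (grid s h).

(** The sum telescopes over the cells that start at or before [a]. Once the grid has passed [a], the
    last of them ends at some [v] at most one mesh beyond [a]. If [a < s] no cell is kept, and
    [Num.min s a = a] makes the right-hand side vanish with [v = a]. In the applications [a] is a
    jump time of a simple process. *)
Lemma truncated_sum a j :
  (gr j <= a -> \sum_(k < j) (gr k <= a)%R%:R * (z (gr k.+1) - z (gr k)) = z (gr j) - z s) /\
  (a < gr j -> exists v, [/\ a <= v, v <= a + h &
     \sum_(k < j) (gr k <= a)%R%:R * (z (gr k.+1) - z (gr k))
     = z v - z (Num.min s a)]).
Proof.
elim: j => [|j [ih1 ih2]].
  rewrite big_ord0 /grid mul0r addr0; split; first by rewrite subrr.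
  move=> aS; exists a; split => //; first by rewrite lerDl ltW.
  by rewrite (min_idPr _) ?subrr// ltW.
rewrite big_ord_recr/=; have gS : gr j.+1 = gr j + h by exact: gridS.
split=> [ja|aj].
  have jle : gr j <= a by rewrite (le_trans _ ja)// gS lerDl ltW.
  by rewrite ih1// jle mul1r addrC addrA subrK.
have [jle|jlt] := leP (gr j) a.
  exists (gr j.+1); split; first exact: ltW.
    by rewrite gS lerD2r.
  rewrite ih1// mul1r (min_idPl _); last by rewrite (le_trans _ jle)// grid_ge.
  by rewrite addrC addrA subrK.
have [v [av va hv]] := ih2 jlt.
by exists v; split => //; rewrite hv mul0r addr0.
Qed.

End path_sums.

Lemma bounded_cvg0 {d} {T : measurableType d} {R : realType}
    (mu : {measure set T -> \bar R}) (D : set T) (f : nat -> T -> R) (C : R) :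
  measurable D -> (mu D < +oo)%E -> (forall k, measurable_fun D (f k)) ->
  (forall k x, D x -> 0 <= f k x <= C) ->
  {ae mu, forall x, D x -> f ^~ x @ \oo --> 0} ->
  (\int[mu]_(x in D) (f k x)%:E)%E @[k --> \oo] --> 0%E.
Proof.
move=> mD Dfin mf fC cf.
have [| | | | |_ _] := @dominated_convergence _ T R mu D mD
    (fun k => EFin \o f k) (cst 0%E) (cst C%:E).
- by move=> k; exact/measurable_EFinP.
- exact: measurable_cst.
- case: cf => N [mN N0 hN]; exists N; split => //.
  apply: subset_trans hN; apply: subsetC => x /= h Dx.
  by apply: cvg_EFin; [exact: nearW|exact: h].
- apply: (@measurable_bounded_integrable _ _ _ _ (cst C)) => //.
  by exists `|C|; split; rewrite ?num_real// => M CM x _; exact: ltW.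
- by apply: aeW => x k Dx; rewrite lee_fin; have /andP[? ?] := fC k x Dx; rewrite ger0_norm.
- by rewrite integral0.
Qed.

Section path_limits.
Context {R : realType}.
Variables (z : R -> R) (s t : R).
Hypotheses (s0 : 0 <= s) (st : s < t).
Hypothesis cz : {within `[0, +oo[, continuous z}.
Local Notation gr m := (grid s (mesh s t m)).

Lemma truncated_sum_cvg a u : 0 <= a -> s <= u ->
  forall e, 0 < e -> exists N, forall m j, (N < m)%N ->
    gr m j <= u -> u - gr m j < mesh s t m ->
    `|\sum_(k < j) (gr m k <= a)%R%:R * (z (gr m k.+1) - z (gr m k))
      - (z (Num.min u a) - z (Num.min s a))| <= e.
Proof.
move=> a0 su e e0; have e2 : 0 < e / 2 by rewrite divr_gt0.
have u0 := le_trans s0 su.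
have [d1 d10 h1] := path_modulus cz a0 e2.
have ua0 : 0 <= Num.min u a by rewrite le_min u0.
have [d2 d20 h2] := path_modulus cz ua0 e2.
have [N1 hN1] := mesh_lt st d10; have [N2 hN2] := mesh_lt st d20.
exists (maxn N1 N2) => m j; rewrite gtn_max => /andP[N1m N2m] ju uj.
have m0 : (0 < m)%N by exact: leq_ltn_trans N1m.
have hp := mesh_gt0 st m0; have sg := grid_ge s hp j.
have [c1 c2] := truncated_sum z s hp a j.
have g0 : 0 <= gr m j by exact: le_trans sg.
have close : `|z (Num.min u a) - z (Num.min (gr m j) a)| <= e / 2.
  apply: h2; first by rewrite le_min g0.
  apply: le_lt_trans (hN2 _ N2m); apply: le_trans (ltW uj).
  case: (leP u a) => ua; case: (leP (gr m j) a) => ga; try lra.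
  - by rewrite ger0_norm ?subr_ge0.
  - by rewrite ger0_norm ?subr_ge0//; lra.
  - by rewrite subrr normr0 subr_ge0.
have [ja|aj] := leP (gr m j) a.
  rewrite c1//; move: close; rewrite (min_idPl ja) (_ : Num.min s a = s); last first.
    by apply/min_idPl; rewrite (le_trans sg).
  move=> c; rewrite distrC; apply: le_trans (_ : e / 2 <= e); last by lra.
  by rewrite (_ : z (Num.min u a) - z s - (z (gr m j) - z s) = z (Num.min u a) - z (gr m j)) //; ring.
have [v [av va hv]] := c2 aj; rewrite hv.
move: close; rewrite (min_idPr (ltW aj)) => close.
have c3 : `|z a - z v| <= e / 2.
  apply: h1; first exact: le_trans av.
  by rewrite ler0_norm ?subr_le0// opprB; apply: le_lt_trans (hN1 _ N1m); rewrite lerBlDl.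
rewrite (_ : z v - _ - _ = (z v - z a) - (z (Num.min u a) - z a)); last by ring.
rewrite (le_trans (ler_normB _ _))//; rewrite distrC in c3; lra.
Qed.

Local Notation mu := (@lebesgue_measure R).
Local Notation D := (`[s, t[%classic : set R).

Lemma lebesgue_itv_lty : (mu D < +oo)%E.
Proof. by rewrite lebesgue_measure_itv/=; case: ifPn => // _; rewrite -EFinB ltry. Qed.

Lemma measurable_path (a b : R) : 0 <= a -> measurable_fun (`[a, b[%classic : set R) z.
Proof.
move=> a0; have h : measurable_fun (`[0, +oo[%classic : set R) z.
  by apply: subspace_continuous_measurable_fun => //; exact: measurable_itv.
apply: (measurable_funS _ _ h); first exact: measurable_itv.
by move=> x /=; rewrite !in_itv/= andbT => /andP[ax _]; exact: le_trans ax.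
Qed.

Lemma stepf_path_cvg u : D u ->
  stepf s t m.+1 (fun j => z (gr m.+1 j)) u @[m --> \oo] --> z u.
Proof.
rewrite /= in_itv/= => /andP[su ut]; apply: (stepf_cvg st su ut) => e e0.
have [del del0 h] := path_modulus cz (le_trans s0 su) e0.
exists del => // v sv vu uv; apply: h; first exact: le_trans sv.
by rewrite ger0_norm// subr_ge0.
Qed.

(** Up to [gr m j] the Riemann sum is the integral of a step function, which converges boundedly on
    [[s, t[]; the rest of [[s, u[] is shorter than one mesh and costs at most [C] times the mesh. *)
Lemma bounded_drift_cvg u (C : R) : (forall v, 0 <= v -> `|z v| <= C) -> s <= u -> u <= t ->
  forall e, 0 < e -> exists N, forall m j, (N < m)%N -> (j <= m)%N ->
    gr m j <= u -> u - gr m j < mesh s t m ->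
    `|\sum_(k < j) mesh s t m * z (gr m k)
      - (\int[mu]_(v in `[s, u[) z v)%R| <= e.
Proof.
move=> zC su ut e e0; have e2 : 0 < e / 2 by rewrite divr_gt0.
have C0 : 0 <= C by exact: le_trans (zC 0 (lexx _)).
have mD : measurable (D : set (measurableTypeR R)) by exact: measurable_itv.
pose f m v := `|stepf s t m.+1 (fun j => z (gr m.+1 j)) v - z v|.
have mst m : measurable_fun D (stepf s t m.+1 (fun j => z (gr m.+1 j))).
  exact: measurable_stepf.
have mf m : measurable_fun D (f m).
  by apply: measurableT_comp => //; apply: measurable_funB => //; exact: measurable_path.
have stC m v : `|stepf s t m.+1 (fun j => z (gr m.+1 j)) v| <= C.
  apply: stepf_bound => // j _; apply: zC.
  by rewrite (le_trans s0)// grid_ge// mesh_gt0.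
have Dz v : D v -> `|z v| <= C.
  by rewrite /= in_itv/= => /andP[sv _]; apply: zC; exact: le_trans sv.
have fC m v : D v -> 0 <= f m v <= 2 * C.
  move=> Dv; rewrite normr_ge0/= (le_trans (ler_normB _ _))// mulr_natl mulr2n lerD//.
  exact: Dz.
have cf : {ae mu, forall v, D v -> f ^~ v @ \oo --> 0}.
  apply: aeW => v Dv; rewrite -(normr0 R) -(subrr (z v)); apply: cvg_norm.
  by apply: cvgB; [exact: stepf_path_cvg|exact: cvg_cst].
have I := @bounded_cvg0 _ (measurableTypeR R) R mu D f (2 * C) mD lebesgue_itv_lty mf fC cf.
have I0 m : (0 <= \int[mu]_(v in D) (f m v)%:E)%E.
  by apply: integral_ge0 => v _; rewrite lee_fin /f.
have /= [N1 _ hN1] := (ecvg0P I0).2 I _ e2.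
have C1 : 0 < C + 1 by rewrite ltr_wpDl.
have [N2 hN2] := mesh_lt st (divr_gt0 e2 C1).
exists (maxn N1 N2) => m j; rewrite gtn_max => /andP[N1m N2m] jm ju uj.
have m0 : (0 < m)%N by exact: leq_ltn_trans N1m.
have hp := mesh_gt0 st m0; have sg := grid_ge s hp j.
have hf : (\int[mu]_(v in D) (f m.-1 v)%:E <= (e / 2)%:E)%E.
  by apply: hN1; rewrite /= -ltnS prednK.
rewrite -(prednK m0) in jm ju uj hp sg *; set k := m.-1 in jm ju uj hp sg hf *.
rewrite -(integral_stepf st (ltn0Sn k) (fun i => z (gr k.+1 i)) jm).
have sub (x y : R) : s <= x -> y <= t -> (`[x, y[%classic : set R) `<=` `[s, t].
  move=> sx yt v /=; rewrite !in_itv/= => /andP[xv vy].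
  by rewrite (le_trans sx xv)/= ltW// (lt_le_trans vy).
have iz (x y : R) : s <= x -> y <= t -> mu.-integrable `[x, y[ (EFin \o z).
  move=> sx yt; apply: (@itv_integrable_bounded _ s t z C) => //.
  - exact: sub.
  - by apply: measurable_path; exact: le_trans sx.
  - move=> v /=; rewrite in_itv/= => /andP[xv _]; apply: zC.
    by rewrite (le_trans s0)// (le_trans sx).
have gt : gr k.+1 j <= t by exact: le_trans ut.
have ist (y : R) : y <= t -> mu.-integrable `[s, y[ (EFin \o stepf s t k.+1 (fun i => z (gr k.+1 i))).
  move=> yt; apply: (@itv_integrable_bounded _ s t _ C) => //.
  - exact: sub.
  - exact: measurable_stepf.
have -> : (\int[mu]_(v in `[s, u[) z v)%R =
   (\int[mu]_(v in `[s, (gr k.+1 j)[) z v + \int[mu]_(v in `[(gr k.+1 j), u[) z v)%R.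
  have E : `[s, u[%classic = `[s, (gr k.+1 j)[ `|` `[(gr k.+1 j), u[ :> set R.
    by rewrite (@itv_bndbnd_setU _ _ _ (BLeft (gr k.+1 j)))// bnd_simp.
  rewrite E Rintegral_setU//=.
  - by rewrite -E; exact: iz.
  - apply/disj_setPS => v [] /=; rewrite !in_itv/= => /andP[_ xs] /andP[sx _].
    by have := lt_le_trans xs sx; rewrite ltxx.
rewrite opprD addrA -RintegralB//; [|exact: ist|exact: iz].
rewrite (le_trans (ler_normB _ _))// (splitr e); apply: lerD.
  apply: le_trans (le_normr_Rintegral _ _) _ => //.
    have := integrableB _ (ist _ gt) (iz _ _ (lexx s) gt).
    by apply => //; exact: measurable_itv.
  rewrite -lee_fin; apply: le_trans hf.
  rewrite fineK.
    apply: ge0_subset_integral => //.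
    + by apply/measurable_EFinP; exact: (mf k).
    + by move=> v /=; rewrite !in_itv/= => /andP[-> vg]; exact: lt_le_trans gt.
  apply: (@integrable_fin_num _ _ _ mu) => //.
  apply: (@itv_integrable_bounded _ s t _ (2 * C)) => //.
  - exact: sub.
  - apply: measurable_funS (mf k) => //.
    by move=> v /=; rewrite !in_itv/= => /andP[-> vg]; exact: lt_le_trans gt.
  - move=> v hv; rewrite normr_id.
    have /andP[_] : 0 <= f k v <= 2 * C.
      by apply: fC; move: hv; rewrite /= !in_itv/= => /andP[-> vg]; exact: lt_le_trans gt.
    by [].
apply: le_trans (le_normr_Rintegral _ (iz _ _ sg ut)) _ => //.
apply: (@le_trans _ _ (\int[mu]_(v in `[gr k.+1 j, u[) C)%R).
  apply: le_Rintegral => //.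
  - have := integrable_abse (iz _ _ sg ut); exact.
  - apply: (@itv_integrable_bounded _ s t (cst C) `|C|) => //; exact: sub.
  - move=> v /=; rewrite in_itv/= => /andP[xv _]; apply: zC.
    by rewrite (le_trans s0)// (le_trans sg).
rewrite Rintegral_cst//= lebesgue_measure_itv/=; case: ifPn => _; last first.
  by rewrite /= mulr0 ltW.
rewrite -EFinB /=.
have m2 : mesh s t k.+1 < e / 2 / (C + 1) by apply: hN2; rewrite /k prednK.
apply: (@le_trans _ _ ((C + 1) * (e / 2 / (C + 1)))).
  apply: ler_pM => //; [by rewrite subr_ge0|by rewrite lerDl|].
  by rewrite ltW// (lt_trans uj).
by rewrite mulrC divfK// gt_eqF.
Qed.

End path_limits.

(** * Convergence in probability through truncated means *)

Section convergence.
Context {d : measure_display} {Omega : measurableType d} {R : realType}.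
Variable Pr : probability Omega R.
Local Notation mu := (@lebesgue_measure R).
Local Notation TR := (measurableTypeR R).
Variables (s t : R).
Hypothesis st : s < t.
Local Notation D := (`[s, t[%classic : set R).

Let mD : measurable (D : set TR). Proof. exact: measurable_itv. Qed.

(** Splitting at the level [e / 2] bounds the truncated mean by [e / 2] plus a probability. Means,
    unlike statements in probability, can be added, integrated over time and summed over a
    sequence. *)
Lemma cvg_prob_min (Q : nat -> Omega -> \bar R) :
  (forall n, measurable_fun setT (Q n)) -> (forall n w, (0 <= Q n w)%E) ->
  (forall eps, 0 < eps -> Pr [set w | (eps%:E < Q n w)%E] @[n --> \oo] --> 0%E) ->
  (\int[Pr]_w mine 1 (Q n w))%E @[n --> \oo] --> 0%E.
Proof.
move=> mQ Q0 hQ; apply/ecvg0P.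
  by move=> n; apply: integral_ge0 => w _; rewrite le_min lee01 Q0.
move=> e e0; have e2 : 0 < e / 2 by rewrite divr_gt0.
have P0 n : (0 <= Pr [set w | ((e / 2)%:E < Q n w)%E])%E by exact: measure_ge0.
have := (ecvg0P P0).2 (hQ _ e2) _ e2; apply: filterS => n hn.
have mE : measurable [set w | ((e / 2)%:E < Q n w)%E].
  by rewrite -[X in measurable X]setTI; exact: emeasurable_fun_o_infty.
apply: (@le_trans _ _ (\int[Pr]_w ((e / 2)%:E + (\1_[set w | ((e / 2)%:E < Q n w)%E] w)%:E))%E).
  apply: ge0_le_integral => //.
  - by move=> w _; rewrite le_min lee01 Q0.
  - by apply: measurable_mine.
  - by apply: emeasurable_funD => //; apply/measurable_EFinP; exact: measurable_indic.
  - move=> w _; rewrite indicE; case: (boolP (w \in _)) => [_|].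
      by rewrite ge_min lee_paddl// lee_fin ltW.
    by rewrite notin_setE/= => /negP; rewrite -leNgt adde0 ge_min => ->; rewrite orbT.
rewrite ge0_integralD//=; last 2 first.
- by move=> w _; rewrite lee_fin ltW.
- by apply/measurable_EFinP; exact: measurable_indic.
rewrite integral_cst//= probability_setT mule1 integral_indic// setIT.
by rewrite [e in leRHS](splitr e) EFinD leeD2l.
Qed.

(** Two orders of integration are needed. Here almost every path converges at all times, which is
    the situation when the grid is refined; [joint_cvg0_times] knows only means at each fixed time,
    as when the simple process varies, and exchanges the integrals first. *)
Lemma joint_cvg0_paths (f : nat -> TR * Omega -> R) (C : R) :
  (forall n, measurable_fun setT (f n)) -> (forall n p, 0 <= f n p <= C) ->
  {ae Pr, forall w u, D u -> f n (u, w) @[n --> \oo] --> 0} ->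
  (\int[Pr]_w \int[mu]_(u in D) (f n (u, w))%:E)%E @[n --> \oo] --> 0%E.
Proof.
move=> mf fC cf.
have mfw n w : measurable_fun D (fun u : TR => f n (u, w)).
  by apply: measurable_funTS; apply: (measurableT_comp (mf n)); exact: pair2_measurable.
have C0 : 0 <= C by have /andP[a b] := fC 0%N point; exact: le_trans b.
pose I n w := fine (\int[mu]_(u in D) (f n (u, w))%:E)%E.
have ub n w : (\int[mu]_(u in D) (f n (u, w))%:E <= (C * (t - s))%:E)%E.
  apply: (@le_trans _ _ (\int[mu]_(u in D) C%:E)%E).
    apply: ge0_le_integral => //.
    - by move=> u _; rewrite lee_fin; have /andP[] := fC n (u, w).
    - by apply/measurable_EFinP; exact: mfw.
    - by move=> u _; rewrite lee_fin; have /andP[] := fC n (u, w).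
  by rewrite integral_cst//= lebesgue_measure_itv/= lte_fin st -EFinB -EFinM.
have lb n w : (0 <= \int[mu]_(u in D) (f n (u, w))%:E)%E.
  by apply: integral_ge0 => u _; rewrite lee_fin; have /andP[] := fC n (u, w).
have IE n w : (\int[mu]_(u in D) (f n (u, w))%:E)%E = (I n w)%:E.
  by rewrite /I fineK// ge0_fin_numE//; apply: le_lt_trans (ub n w) _; rewrite ltry.
under eq_fun => n do under eq_integral do rewrite IE.
apply: (@bounded_cvg0 _ _ _ _ _ I (C * (t - s))) => //.
- by rewrite (le_lt_trans (probability_le1 _ _))// ltry.
- move=> n; apply: measurableT_comp => //.
  apply: (@measurable_tonelliD _ _ _ _ _ (fun p => (f n p)%:E)).
    exact/measurable_EFinP.
  by move=> p; rewrite lee_fin; have /andP[] := fC n p.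
- by move=> n w _; rewrite -2!lee_fin -IE lb ub.
- apply: filterS cf => w hw _.
  have : (\int[mu]_(u in D) (f n (u, w))%:E)%E @[n --> \oo] --> 0%E.
    apply: (@bounded_cvg0 _ TR _ _ _ (fun n u => f n (u, w)) C) => //.
    + exact: lebesgue_itv_lty.
    + by move=> n; exact: mfw.
    + by apply: aeW => u Du; exact: hw.
  by move/fine_cvg.
Qed.

Lemma joint_cvg0_times (f : nat -> TR * Omega -> R) (C : R) :
  (forall n, measurable_fun setT (f n)) -> (forall n p, 0 <= f n p <= C) ->
  (forall u, D u -> (\int[Pr]_w (f n (u, w))%:E)%E @[n --> \oo] --> 0%E) ->
  (\int[Pr]_w \int[mu]_(u in D) (f n (u, w))%:E)%E @[n --> \oo] --> 0%E.
Proof.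
move=> mf fC cf.
have f0 n p : (0 <= (f n p)%:E)%E by rewrite lee_fin; have /andP[] := fC n p.
have mfe n : measurable_fun setT (fun p => (f n p)%:E) by exact/measurable_EFinP.
under eq_fun => n do rewrite (@tonelliD _ _ _ Pr s t (fun p => (f n p)%:E) (mfe n) (f0 n)).
have mfu n u : measurable_fun setT (fun w => f n (u, w)).
  by apply: (measurableT_comp (mf n)); exact: pair1_measurable.
pose I n u := fine (\int[Pr]_w (f n (u, w))%:E)%E.
have ub n u : (\int[Pr]_w (f n (u, w))%:E <= C%:E)%E.
  apply: (@le_trans _ _ (\int[Pr]_w C%:E)%E).
    apply: ge0_le_integral => //; first exact/measurable_EFinP.
    by move=> w _; rewrite lee_fin; have /andP[] := fC n (u, w).
  by rewrite integral_cst//= probability_setT mule1.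
have lb n u : (0 <= \int[Pr]_w (f n (u, w))%:E)%E by exact: integral_ge0.
have IE n u : (\int[Pr]_w (f n (u, w))%:E)%E = (I n u)%:E.
  by rewrite /I fineK// ge0_fin_numE//; apply: le_lt_trans (ub n u) _; rewrite ltry.
under eq_fun => n do under eq_integral do rewrite IE.
apply: (@bounded_cvg0 _ TR _ _ _ I C) => //.
- exact: lebesgue_itv_lty.
- move=> n; apply: measurableT_comp => //.
  exact: (@measurable_tonelliD_time _ _ _ Pr s t (fun p => (f n p)%:E) (mfe n) (f0 n)).
- by move=> n u _; rewrite -2!lee_fin -IE lb ub.
- by apply: aeW => u Du; have := cf u Du => /fine_cvg.
Qed.

End convergence.

Lemma min1_itv {R : realType} (x : R) : 0 <= x -> 0 <= Num.min 1 x <= 1.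
Proof. by move=> x0; rewrite le_min ler01 x0 ge_min lexx. Qed.

Lemma min1_add {R : realType} (x y : R) : 0 <= x -> 0 <= y ->
  Num.min 1 (x + y) <= Num.min 1 x + Num.min 1 y.
Proof.
move=> x0 y0; case: (leP 1 x) => x1; case: (leP 1 y) => y1; rewrite ?ge_min; apply/orP.
- by left; lra.
- by left; rewrite lerDl.
- by left; rewrite lerDr.
- by right.
Qed.

(** Meant for an error with [y <= e + a + b + c] on fine grids, where [a], [b], [c] do not depend on
    the grid. The excess over their sum vanishes with the mesh on each path, and the truncated [a],
    [b], [c] are small in mean. *)
Lemma min1_excess {R : realType} (y a b c : R) : 0 <= a -> 0 <= b -> 0 <= c ->
  Num.min 1 y <= Num.min 1 (Num.max 0 (y - a - b - c)) +
   (Num.min 1 a + Num.min 1 b + Num.min 1 c).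
Proof.
move=> a0 b0 c0; set m := Num.max _ _.
have m0 : 0 <= m by rewrite le_max lexx.
have ym : y <= m + a + b + c.
  have : y - a - b - c <= m by rewrite le_max lexx orbT.
  lra.
have h1 : Num.min 1 y <= Num.min 1 (m + a + b + c).
  by rewrite le_min ge_min lexx/= ge_min ym orbT.
have h2 := min1_add (addr_ge0 (addr_ge0 m0 a0) b0) c0.
have h3 := min1_add (addr_ge0 m0 a0) b0.
have h4 := min1_add m0 a0.
lra.
Qed.

Lemma excess_le {R : realType} (y a b c e : R) : 0 <= e -> y <= e + a + b + c ->
  `|0 - Num.min 1 (Num.max 0 (y - a - b - c))| <= e.
Proof.
move=> e0 h; rewrite sub0r normrN ger0_norm ?le_min ?ler01 ?le_max ?lexx//.
rewrite ge_min; apply/orP; right; rewrite ge_max e0/=; lra.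
Qed.

Lemma within_comp {R : realType} (A : set R) (f g : R -> R) :
  {within A, continuous f} -> continuous g -> {within A, continuous (fun x => g (f x))}.
Proof. by move=> cf cg x; apply: (continuous_comp (cf x)); exact: cg. Qed.

(** * Approximation of the price process *)

Section approximation.
Context {d : measure_display} {Omega : measurableType d} {R : realType}.
Variable Pr : probability Omega R.
Variable W : R -> Omega -> R.
Hypothesis hW : standard_brownian Pr W.
Local Notation Fil := (brownian_filtration Pr W).
Local Notation Fm := (Fm Pr W).
Local Notation mu := (@lebesgue_measure R).
Local Notation TR := (measurableTypeR R).
Variables (r x0 : R) (hh : R -> R) (X M : R -> Omega -> R).
Variable S : nat -> simple_process Fil.
Hypotheses (r0 : 0 <= r) (mhh : measurable_fun setT hh).
Hypotheses (aX : adapted Fil X) (cX : continuous_paths X).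
Hypothesis X0 : forall t w, 0 <= t -> 0 <= X t w.
Hypotheses (aM : adapted Fil M) (cM : continuous_paths M).
Hypothesis hS : forall t eps : R, 0 <= t -> 0 < eps ->
  (Pr [set w | eps%:E < \int[mu]_(u in `[0%R, t])
         ((sp_eval (S n) u w - hh (X u w)) ^+ 2)%R%:E]%E @[n --> \oo] --> 0%E)
  /\ (Pr [set w | eps < `|sp_integral W (S n) t w - M t w|] @[n --> \oo] --> 0%E).
Hypothesis eqX : {ae Pr, forall w, forall t, 0 <= t ->
  X t w = x0 + \int[mu]_(u in `[0%R, t]) (r * X u w) + M t w}.

Variables (s t : R).
Hypotheses (s0 : 0 <= s) (st : s < t).
Local Notation D := (`[s, t[%classic : set R).
Local Notation gr m := (grid s (mesh s t m)).

Definition apx_xi n m j w := sp_eval (S n) (gr m j) w.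
(** The drift is sampled along the exact path and cut at level [n], since [scheme_step] wants
    bounded coefficients. Neither coefficient is read off the scheme, so its error does not feed
    back and no Gronwall argument arises. *)
Definition apx_b n m j w := r * Num.min (X (gr m j) w) n%:R.
Definition apx_Y n m := scheme W s (mesh s t m) (X s) (apx_b n m) (apx_xi n m).

Let noise n u w := sp_integral W (S n) u w - M u w.
Let overflow n w := fine (\int[mu]_(u in D) (r * (X u w - Num.min (X u w) n%:R))%:E)%E.

Lemma FmX u : 0 <= u -> Fm u (X u).
Proof. by move=> u0; apply/FmP => B mB; exact: aX. Qed.

Lemma measurable_X u : 0 <= u -> measurable_fun setT (X u).
Proof. by move=> u0; exact: (Fm_measurable hW (FmX u0)). Qed.

Lemma measurable_M u : 0 <= u -> measurable_fun setT (M u).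
Proof. by move=> u0; apply: (Fm_measurable hW (t := u)); apply/FmP => B mB; exact: aM. Qed.

(** Induction on the number of pieces of the simple process. On grid points the indicator of []a,
    b]] is that of [g <= b] minus that of [g <= a], so each piece contributes the difference of two
    truncated sums of the Brownian path, multiplied by the value [v]. *)
Lemma noise_sum_cvg n w u : s <= u ->
  forall e, 0 < e -> exists N, forall m j, (N < m)%N ->
    gr m j <= u -> u - gr m j < mesh s t m ->
    `|\sum_(k < j) apx_xi n m k w * increment W (gr m k) (gr m k.+1) w
      - (sp_integral W (S n) u w - sp_integral W (S n) s w)| <= e.
Proof.
move=> su; have cW : {within `[0, +oo[, continuous (fun v => W v w)}.
  by case: hW => _ _ h _ _; exact: h.
pose xi_ q v := \sum_(i < q) sp_val (S n) i w *
  ((sp_time (S n) i < v) && (v <= sp_time (S n) i.+1))%:R.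
pose SI_ q v := \sum_(i < q) sp_val (S n) i w *
  (W (Num.min v (sp_time (S n) i.+1)) w - W (Num.min v (sp_time (S n) i)) w).
suff : forall q e, 0 < e -> exists N, forall m j, (N < m)%N ->
    gr m j <= u -> u - gr m j < mesh s t m ->
    `|\sum_(k < j) xi_ q (gr m k) * increment W (gr m k) (gr m k.+1) w
      - (SI_ q u - SI_ q s)| <= e by apply.
elim=> [|q ih] e e0.
  exists 0%N => m j _ _ _; rewrite /xi_ /SI_ !big_ord0 subrr subr0.
  by rewrite big1 ?normr0 ?(ltW e0)// => k _; rewrite big_ord0 mul0r.
have e2 : 0 < e / 2 by rewrite divr_gt0.
pose v := sp_val (S n) q w; pose a := sp_time (S n) q; pose b := sp_time (S n) q.+1.
have v1 : 0 < 2 * (`|v| + 1) by rewrite mulr_gt0// ltr_wpDl.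
have e3 : 0 < e / 2 / (2 * (`|v| + 1)) by rewrite divr_gt0.
have [N1 h1] := ih _ e2.
have [N2 h2] := truncated_sum_cvg s0 st cW (sp_time_ge (S n) q) su e3.
have [N3 h3] := truncated_sum_cvg s0 st cW (sp_time_ge (S n) q.+1) su e3.
exists (maxn N1 (maxn N2 N3)) => m j; rewrite !gtn_max => /and3P[N1m N2m N3m] ju uj.
have := h1 m j N1m ju uj; have := h2 m j N2m ju uj; have := h3 m j N3m ju uj.
rewrite -/a -/b.
set T3 := \sum_(k < j) _; set T2 := \sum_(k < j) _; set T1 := \sum_(k < j) _.
move=> k3 k2 k1.
have -> : \sum_(k < j) xi_ q.+1 (gr m k) * increment W (gr m k) (gr m k.+1) w =
   T1 + v * (T3 - T2).
  rewrite /T1 /T2 /T3 -sumrB mulr_sumr -big_split/=; apply: eq_bigr => k _.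
  rewrite /xi_ big_ord_recr/= mulrDl; congr (_ + _); rewrite -/v -/a -/b -mulrA; congr (_ * _).
  have ab : a <= b by exact: sp_time_nd.
  rewrite -mulrBl -/(increment W (gr m k) (gr m k.+1) w); congr (_ * _).
  case: (ltP a (gr m k)) => ak; case: (leP (gr m k) b) => kb /=; rewrite ?subr0 ?subrr//.
  by have := le_lt_trans ak (le_lt_trans ab kb); rewrite ltxx.
have -> : SI_ q.+1 u - SI_ q.+1 s = SI_ q u - SI_ q s +
   v * ((W (Num.min u b) w - W (Num.min s b) w) - (W (Num.min u a) w - W (Num.min s a) w)).
  by rewrite /SI_ !big_ord_recr/= -/v -/a -/b; ring.
set B3 := _ - W (Num.min s b) w in k3 *; set B2 := _ - W (Num.min s a) w in k2 *.
have -> : T1 + v * (T3 - T2) - (SI_ q u - SI_ q s + v * (B3 - B2)) =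
  (T1 - (SI_ q u - SI_ q s)) + v * ((T3 - B3) - (T2 - B2)) by ring.
rewrite (le_trans (ler_normD _ _))// [leRHS]splitr lerD// normrM.
have : `|T3 - B3 - (T2 - B2)| <= 2 * (e / 2 / (2 * (`|v| + 1))).
  by rewrite (le_trans (ler_normB _ _))//; lra.
move=> hT; apply: (@le_trans _ _ ((`|v| + 1) * (2 * (e / 2 / (2 * (`|v| + 1)))))).
  by apply: ler_pM => //; rewrite lerDl.
by rewrite le_eqVlt; apply/orP; left; apply/eqP; field; rewrite gt_eqF//= ltr_wpDl.
Qed.

Lemma path_bound w : exists2 xM, 0 <= xM & forall u, s <= u <= t -> X u w <= xM.
Proof.
have cst' : {within `[s, t], continuous (fun v => X v w)}.
  have sub : `[s, t]%classic `<=` (`[0, +oo[%classic : set R).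
    by move=> v /=; rewrite !in_itv/= andbT => /andP[sv _]; exact: le_trans sv.
  exact: (continuous_subspaceW sub (@cX w)).
have [c cin hc] := EVT_max (ltW st) cst'.
exists (X c w); last by move=> u hu; apply: hc; rewrite in_itv.
by apply: X0; move: cin; rewrite in_itv/= => /andP[sc _]; exact: le_trans sc.
Qed.

Lemma sub_itv (x y : R) : s <= x -> y <= t -> (`[x, y[%classic : set R) `<=` `[s, t].
Proof.
move=> sx yt v /=; rewrite !in_itv/= => /andP[xv vy].
by rewrite (le_trans sx xv)/= ltW// (lt_le_trans vy).
Qed.

Lemma integrable_path (f : R -> R) (C : R) (x y : R) : s <= x -> y <= t ->
  {within `[0, +oo[, continuous f} -> (forall v, s <= v <= t -> `|f v| <= C) ->
  mu.-integrable `[x, y[ (EFin \o f).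
Proof.
move=> sx yt cf fC; apply: (@itv_integrable_bounded _ s t f C) => //.
- exact: sub_itv.
- by apply: measurable_path => //; exact: le_trans sx.
- move=> v /=; rewrite in_itv/= => /andP[xv vy]; apply: fC.
  by rewrite (le_trans sx)//= (le_trans (ltW vy)).
Qed.

Lemma continuous_rX w : {within `[0, +oo[, continuous (fun v => r * X v w)}.
Proof.
apply: (@within_comp _ _ (fun v => X v w) (fun y => r * y)); first exact: cX.
by move=> y; apply: cvgM; [exact: cvg_cst|exact: cvg_id].
Qed.

Lemma continuous_trunc n w : {within `[0, +oo[, continuous (fun v => r * Num.min (X v w) n%:R)}.
Proof.
apply: (@within_comp _ _ (fun v => X v w) (fun y => r * Num.min y n%:R)); first exact: cX.
pose q (y : R) := Num.min y n%:R.
have cm : continuous q.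
  have -> : q = (fun y => (y + n%:R - `|y - n%:R|) * 2^-1).
    by apply/funext => y; rewrite /q; case: (leP y n%:R) => yn;
      [rewrite ler0_norm ?subr_le0//|rewrite gtr0_norm ?subr_gt0//]; field.
  move=> y; apply: cvgM; last exact: cvg_cst.
  apply: cvgB; first by apply: cvgD; [exact: cvg_id|exact: cvg_cst].
  by apply: cvg_norm; apply: cvgB; [exact: cvg_id|exact: cvg_cst].
by move=> y; apply: cvgM; [exact: cvg_cst|exact: cm].
Qed.

Let rX_bound w : exists2 C, 0 <= C & forall v, s <= v <= t -> `|r * X v w| <= C.
Proof.
have [xM xM0 hx] := path_bound w; exists (r * xM); first exact: mulr_ge0.
move=> v hv; have v0 : 0 <= v by case/andP: hv => sv _; exact: le_trans sv.
by rewrite ger0_norm ?mulr_ge0 ?X0// ler_wpM2l// hx.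
Qed.

Let trunc_bound n v w : 0 <= v -> `|r * Num.min (X v w) n%:R| <= r * n%:R.
Proof.
move=> v0; have m0 : 0 <= Num.min (X v w) n%:R by rewrite le_min X0//= ler0n.
by rewrite ger0_norm ?mulr_ge0// ler_wpM2l// ge_min lexx orbT.
Qed.

Lemma drift_itv w u : s <= u -> u <= t ->
  (forall v, 0 <= v -> X v w = x0 + \int[mu]_(y in `[0%R, v]) (r * X y w) + M v w) ->
  X u w = X s w + (\int[mu]_(v in `[s, u[) (r * X v w))%R + (M u w - M s w).
Proof.
move=> su ut hw; have u0 := le_trans s0 su.
rewrite (hw u u0) (hw s s0).
have [b hb] : exists b, forall v, 0 <= v <= u -> X v w <= b.
  have cu : {within `[0, u], continuous (fun v => X v w)}.
    have sub : `[0, u]%classic `<=` (`[0, +oo[%classic : set R).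
      by move=> v /=; rewrite !in_itv/= andbT => /andP[].
    exact: (continuous_subspaceW sub (@cX w)).
  have [c _ hc] := EVT_max u0 cu.
  by exists (X c w) => v hv; apply: hc; rewrite in_itv.
have ir : mu.-integrable `[0, u] (EFin \o (fun v => r * X v w)).
  apply: (@itv_integrable_bounded _ 0 u _ (r * b)) => //.
    have h : measurable_fun (`[0, +oo[%classic : set R) (fun v => r * X v w).
      apply: subspace_continuous_measurable_fun; first exact: measurable_itv.
      exact: continuous_rX.
    apply: (measurable_funS _ _ h); first exact: measurable_itv.
    by move=> v /=; rewrite !in_itv/= andbT => /andP[].
  move=> v /=; rewrite in_itv/= => /andP[v0 vu].
  by rewrite ger0_norm ?mulr_ge0 ?X0// ler_wpM2l// hb// v0.
have -> : (\int[mu]_(v in `[s, u[) (r * X v w) = \int[mu]_(v in `]s, u]) (r * X v w))%R.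
  have isu (l r' : bool) : mu.-integrable [set` Interval (BSide l s) (BSide r' u)] (EFin \o (fun v => r * X v w)).
    apply: integrableS ir => //; move=> v /=; rewrite !in_itv/=.
    by case: l; case: r' => /= /andP[a c]; rewrite ?(le_trans s0 a) ?(le_trans s0 (ltW a)) ?c ?(ltW c).
  rewrite Rintegral_itv_bndo_bndc; last exact: (isu true true).
  by rewrite -Rintegral_itv_obnd_cbnd//; exact: (isu false false).
rewrite -(@Rintegral_itvB _ (fun v => r * X v w) (BLeft 0) (BRight u) s) //; first ring.
Qed.

(** Subtract the equation of [X] on [[s, u]] from the scheme. The Riemann sums of drift and noise
    cost [e], the cut of the drift costs [overflow], and replacing [M] by the integral of [S n]
    costs the two [noise] terms. Only [e] depends on the grid, so [n] must be chosen before [m]. *)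
Lemma scheme_error n w u : s <= u -> u <= t ->
  (forall v, 0 <= v -> X v w = x0 + \int[mu]_(y in `[0%R, v]) (r * X y w) + M v w) ->
  forall e, 0 < e -> exists N, forall m j, (N < m)%N -> (j <= m)%N ->
    gr m j <= u -> u - gr m j < mesh s t m ->
    `|apx_Y n m j w - X u w| <= e + overflow n w + `|noise n u w| + `|noise n s w|.
Proof.
move=> su ut hw e e0; have e2 : 0 < e / 2 by rewrite divr_gt0.
have [N1 h1] := noise_sum_cvg n w su e2.
have [N2 h2] := bounded_drift_cvg s0 st (@continuous_trunc n w)
  (fun v v0 => trunc_bound n w v0) su ut e2.
exists (maxn N1 N2) => m j; rewrite gtn_max => /andP[N1m N2m] jm ju uj.
have := h1 m j N1m ju uj; have := h2 m j N2m jm ju uj.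
set I2 := \int[mu]_(v in _) _; set S2 := \sum_(k < j) _; set S1 := \sum_(k < j) _.
move=> k2 k1; rewrite (drift_itv su ut hw).
set I1 := \int[mu]_(v in _) _.
have -> : apx_Y n m j w = X s w + (S2 + S1).
  rewrite /apx_Y /scheme; congr (_ + _); rewrite big_split/=; congr (_ + _).
  by apply: eq_bigr => k _; rewrite /apx_b mulrC.
have -> : X s w + (S2 + S1) - (X s w + I1 + (M u w - M s w)) =
  (S2 - I2) + (S1 - (sp_integral W (S n) u w - sp_integral W (S n) s w))
  - (I1 - I2) + noise n u w - noise n s w by rewrite /noise; ring.
have [C C0 hC] := rX_bound w.
have iX (y : R) : y <= t -> mu.-integrable `[s, y[ (EFin \o (fun v => r * X v w)).
  by move=> yt; apply: (integrable_path _ yt (@continuous_rX w) hC).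
have iT (y : R) : y <= t -> mu.-integrable `[s, y[ (EFin \o (fun v => r * Num.min (X v w) n%:R)).
  move=> yt; apply: (integrable_path (C := r * n%:R) _ yt (@continuous_trunc n w)) => // v /andP[sv _].
  by apply: trunc_bound; exact: le_trans sv.
have dv (v : R) : 0 <= v -> 0 <= r * X v w - r * Num.min (X v w) n%:R.
  by move=> v0; rewrite subr_ge0 ler_wpM2l// ge_min lexx.
have k3 : `|I1 - I2| <= overflow n w.
  rewrite /I1 /I2 -RintegralB//; [|exact: iX|exact: iT].
  rewrite ger0_norm; last first.
    apply: Rintegral_ge0 => v /=; rewrite in_itv/= => /andP[sv _].
    by apply: dv; exact: le_trans sv.
  rewrite /overflow -lee_fin fineK; last first.
    by apply: (integrable_fin_num (mu := mu)) => //; have := integrableB _ (iX u ut) (iT u ut); apply.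
  rewrite fineK; last first.
    apply: (integrable_fin_num (mu := mu)) => //.
    rewrite (_ : (fun x => _) = (fun v => (r * X v w - r * Num.min (X v w) n%:R)%:E)).
      by have := integrableB _ (iX t (lexx t)) (iT t (lexx t)); apply.
    by apply/funext => v; rewrite mulrBr.
  under [leRHS]eq_integral do rewrite mulrBr.
  apply: ge0_subset_integral => //.
  - have := integrableB _ (iX t (lexx t)) (iT t (lexx t)) => /(_ _)/measurable_int; apply.
    exact: measurable_itv.
  - move=> v /=; rewrite in_itv/= => /andP[sv _]; rewrite lee_fin.
    by apply: dv; exact: le_trans sv.
  - by move=> v /=; rewrite !in_itv/= => /andP[-> vu]; exact: lt_le_trans ut.
rewrite (le_trans (ler_normB _ _))// lerD2r (le_trans (ler_normD _ _))// lerD2r.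
rewrite (le_trans (ler_normB _ _))// lerD// (splitr e).
by rewrite (le_trans (ler_normD _ _))// lerD.
Qed.

Lemma within_min (z : R -> R) (a : R) : {within `[0, +oo[, continuous z} -> 0 <= a ->
  {within `[0, +oo[, continuous (fun u => z (Num.min u a))}.
Proof.
move=> cz a0; apply/subspace_continuousP => u /=; rewrite in_itv/= andbT => u0.
apply/cvgrPdist_le => e e0.
have m0 : 0 <= Num.min u a by rewrite le_min u0.
have [del del0 h] := path_modulus cz m0 e0.
rewrite nearE /within/=; exists del => // v /= uv; rewrite in_itv/= andbT => v0.
apply: h; first by rewrite le_min v0.
apply: le_lt_trans uv; case: (leP u a) => ua; case: (leP v a) => va //.
- rewrite ler0_norm ?subr_le0// ler0_norm ?subr_le0; last exact: le_trans (ltW va).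
  by rewrite lerN2 lerD2l lerN2 ltW.
- rewrite ger0_norm ?subr_ge0// ger0_norm ?subr_ge0; last exact: le_trans (ltW ua).
  by rewrite lerD2r ltW.
- by rewrite subrr normr0.
Qed.

Lemma continuous_noise n : continuous_paths (noise n).
Proof.
move=> w; apply/subspace_continuousP => u u0.
have cW : {within `[0, +oo[, continuous (fun v => W v w)} by case: hW => _ _ h _ _; exact: h.
apply: cvgB; last by have /subspace_continuousP := @cM w; apply.
rewrite /sp_integral; elim: (sp_size (S n)) => [|q ih].
  by rewrite big_ord0; under eq_fun do rewrite big_ord0; exact: cvg_cst.
rewrite big_ord_recr/=; under eq_fun do rewrite big_ord_recr/=.
apply: cvgD => //; apply: cvgM; first exact: cvg_cst.
apply: cvgB.
  by have /subspace_continuousP := within_min cW (sp_time_ge (S n) q.+1); apply.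
by have /subspace_continuousP := within_min cW (sp_time_ge (S n) q); apply.
Qed.

Lemma measurable_noise n u : 0 <= u -> measurable_fun setT (noise n u).
Proof.
move=> u0; apply: measurable_funB; last exact: measurable_M.
exact: (measurable_sp_integral hW).
Qed.

Let XI (a b : R) (p : TR * Omega) : R := X p.1 p.2 * \1_(`[a, b[%classic : set R) p.1.

Let mXI a b : a < b -> 0 <= a -> measurable_fun setT (XI a b).
Proof.
by move=> ab a0; apply: measurable_process_joint => // u u0; exact: measurable_X.
Qed.

Let XIE a b u w : (`[a, b[%classic : set R) u -> XI a b (u, w) = X u w.
Proof. by move=> h; rewrite /XI/= indicE mem_set ?mulr1. Qed.

Let ND n (p : TR * Omega) : R := noise n p.1 p.2 * \1_D p.1.

Let mND n : measurable_fun setT (ND n).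
Proof.
apply: measurable_process_joint => //; last exact: continuous_noise.
by move=> u u0; exact: measurable_noise.
Qed.

Let NDE n u w : D u -> ND n (u, w) = noise n u w.
Proof. by move=> h; rewrite /ND/= indicE mem_set ?mulr1. Qed.

Let gr_ge0 m j : 0 <= gr m.+1 j.
Proof. by rewrite (le_trans s0)// grid_ge// mesh_gt0. Qed.

Lemma apx_xi_Fm n m j : Fm (gr m j) (apx_xi n m j).
Proof. exact: sp_eval_Fm. Qed.

Lemma measurable_apx_xi n m j : (0 < m)%N -> measurable_fun setT (apx_xi n m j).
Proof. by move=> _; apply: (Fm_measurable hW (t := gr m j)); exact: apx_xi_Fm. Qed.

Lemma apx_b_Fm n m j : (0 < m)%N -> Fm (gr m j) (apx_b n m j).
Proof.
case: m => // m _; apply: measurable_funM => //.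
by apply: measurable_minr => //; exact: FmX.
Qed.

Lemma apx_Y_Fm n m j : (0 < m)%N -> Fm (gr m j) (apx_Y n m j).
Proof.
move=> m0; apply: (@Fm_scheme _ _ _ _ _ s (mesh s t m) _ _ _ j.+1) => //.
- exact: mesh_gt0.
- exact: FmX.
- by move=> i _; exact: apx_b_Fm.
- by move=> i _; exact: apx_xi_Fm.
Qed.

Lemma measurable_apx_Y n m j : (0 < m)%N -> measurable_fun setT (apx_Y n m j).
Proof. by move=> m0; apply: (Fm_measurable hW (t := gr m j)); exact: apx_Y_Fm. Qed.

(** The three things that have to converge: the noise coefficient in mean square over time, the path
    over time, and the terminal value. Truncation by [1] gives all of them finite means. *)
Definition diffusion_error n m w : \bar R := (mine 1 (\int[mu]_(u in D)
  ((stepf s t m (fun j => apx_xi n m j w) u - hh (X u w)) ^+ 2)%:E))%E.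
Definition path_error n m w : \bar R := (\int[mu]_(u in D)
  (Num.min 1 `|stepf s t m (fun j => apx_Y n m j w) u - X u w|)%:E)%E.
Definition endpoint_error n m w : \bar R := (Num.min 1 `|apx_Y n m m w - X t w|)%:E.

Let jxi n m (p : TR * Omega) := stepf s t m (fun j => apx_xi n m j p.2) p.1.
Let jY n m (p : TR * Omega) := stepf s t m (fun j => apx_Y n m j p.2) p.1.

Let mjxi n m : (0 < m)%N -> measurable_fun setT (jxi n m).
Proof.
move=> m0; apply: (@measurable_stepf_joint _ _ _ s t m (apx_xi n m)) => j _.
exact: measurable_apx_xi.
Qed.

Let mjY n m : (0 < m)%N -> measurable_fun setT (jY n m).
Proof.
move=> m0; apply: (@measurable_stepf_joint _ _ _ s t m (apx_Y n m)) => j _.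
exact: measurable_apx_Y.
Qed.

Let mhX a b : a < b -> 0 <= a -> measurable_fun setT (hh \o XI a b).
Proof. by move=> ab a0; apply: measurableT_comp => //; exact: mXI. Qed.

Let sqE n m w : (\int[mu]_(u in D)
  ((stepf s t m (fun j => apx_xi n m j w) u - hh (X u w)) ^+ 2)%:E =
  \int[mu]_(u in D) (((jxi n m (u, w)) - (hh \o XI s t) (u, w)) ^+ 2)%:E)%E.
Proof. by apply: eq_integral => u; rewrite inE => Du; rewrite /= XIE. Qed.

Let path_errorE n m w : path_error n m w =
  (\int[mu]_(u in D) (Num.min 1 `|jY n m (u, w) - XI s t (u, w)|)%:E)%E.
Proof. by apply: eq_integral => u; rewrite inE => Du; rewrite XIE. Qed.

Lemma measurable_diffusion_error n m : (0 < m)%N -> measurable_fun setT (diffusion_error n m).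
Proof.
move=> m0; apply: measurable_mine => //; under eq_fun do rewrite sqE.
apply: (@measurable_tonelliD _ _ _ s t (fun p => (((jxi n m p) - (hh \o XI s t) p) ^+ 2)%:E)).
  apply/measurable_EFinP; apply: measurable_funX; apply: measurable_funB; first exact: mjxi.
  exact: mhX.
by move=> p; rewrite lee_fin sqr_ge0.
Qed.

Lemma measurable_path_error n m : (0 < m)%N -> measurable_fun setT (path_error n m).
Proof.
move=> m0; rewrite (funext (path_errorE n m)).
apply: (@measurable_tonelliD _ _ _ s t (fun p => (Num.min 1 `|jY n m p - XI s t p|)%:E)).
  apply/measurable_EFinP; apply: measurable_minr => //; apply: measurableT_comp => //.
  by apply: measurable_funB; [exact: mjY|exact: mXI].
by move=> p; rewrite lee_fin le_min ler01/=.
Qed.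

Lemma measurable_endpoint_error n m : (0 < m)%N -> measurable_fun setT (endpoint_error n m).
Proof.
move=> m0; apply/measurable_EFinP; apply: measurable_minr => //; apply: measurableT_comp => //.
apply: measurable_funB; first exact: measurable_apx_Y.
by apply: measurable_X; exact: le_trans (ltW st).
Qed.

Lemma errors_ge0 n m w : [/\ (0 <= diffusion_error n m w)%E, (0 <= path_error n m w)%E & (0 <= endpoint_error n m w)%E].
Proof.
split.
- by rewrite /diffusion_error le_min lee_fin ler01/=; apply: integral_ge0 => u _; rewrite lee_fin sqr_ge0.
- by apply: integral_ge0 => u _; rewrite lee_fin le_min ler01/=.
- by rewrite /endpoint_error lee_fin le_min ler01/=.
Qed.

Let t0 : 0 < t. Proof. exact: le_lt_trans st. Qed.

(** The factor [2] is that of [(x + y)^2 <= 2 x^2 + 2 y^2], which separates the distance from [S n]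
    to the integrand from the error of sampling [S n] on the grid. The time integral starts at [0]
    to match [hS]. *)
Let Q0 n w := (2%:E * \int[mu]_(u in `[0%R, t[)
  ((sp_eval (S n) u w - hh (XI 0 t (u, w))) ^+ 2)%:E)%E.

Let mSh n a b : a < b -> 0 <= a ->
  measurable_fun setT (fun p : TR * Omega => ((sp_eval (S n) p.1 p.2 - hh (XI a b p)) ^+ 2)%:E).
Proof.
move=> ab a0; apply/measurable_EFinP; apply: measurable_funX; apply: measurable_funB.
  exact: (measurable_sp_eval_joint hW).
exact: mhX.
Qed.

Let mQ0 n : measurable_fun setT (Q0 n).
Proof.
have sq0 p : (0 <= ((sp_eval (S n) p.1 p.2 - hh (XI 0 t p)) ^+ 2)%:E)%E.
  by rewrite lee_fin sqr_ge0.
by apply: measurable_funeM; exact: (@measurable_tonelliD _ _ _ 0 t _ (mSh n t0 (lexx 0)) sq0).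
Qed.

Let Q0_cvg : (\int[Pr]_w mine 1 (Q0 n w))%E @[n --> \oo] --> 0%E.
Proof.
have sq0 n p : (0 <= ((sp_eval (S n) p.1 p.2 - hh (XI 0 t p)) ^+ 2)%:E)%E.
  by rewrite lee_fin sqr_ge0.
apply: cvg_prob_min.
- exact: mQ0.
- by move=> n w; rewrite mule_ge0//; apply: integral_ge0 => u _; rewrite lee_fin sqr_ge0.
- move=> eps eps0; have e2 : 0 < eps / 2 by rewrite divr_gt0.
  have [h _] := hS (ltW t0) e2; move: h; apply: cvg_trans; apply: near_eq_cvg.
  apply: nearW => n; congr (Pr _); apply/seteqP.
  suff E w : (\int[mu]_(u in `[0%R, t]) ((sp_eval (S n) u w - hh (X u w)) ^+ 2)%R%:E =
     \int[mu]_(u in `[0%R, t[) ((sp_eval (S n) u w - hh (XI 0 t (u, w))) ^+ 2)%:E)%E.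
    split=> w /=; rewrite /Q0 E => hlt.
      by rewrite -lte_pdivrMl// -EFinM mulrC.
    by move: hlt; rewrite -lte_pdivrMl// -EFinM mulrC.
  rewrite -integral_itv_bndo_bndc; last first.
    have /measurable_EFinP m1 : measurable_fun setT (fun u : TR =>
        ((sp_eval (S n) u w - hh (XI 0 (t + 1) (u, w))) ^+ 2)%:E).
      have t1 : 0 < t + 1 by rewrite ltr_wpDl// ltW.
      exact: (measurableT_comp (mSh n t1 (lexx 0)) (pair2_measurable w)).
    apply/measurable_EFinP.
    apply: (eq_measurable_fun (fun u : TR => (sp_eval (S n) u w - hh (XI 0 (t + 1) (u, w))) ^+ 2)).
      move=> u; rewrite inE/= in_itv/= => /andP[u0 ut]; rewrite XIE//= in_itv/= u0/=.
      by rewrite (lt_trans ut)// ltrDl.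
    exact: measurable_funTS.
  by apply: eq_integral => u; rewrite inE => Du; rewrite XIE.
Qed.

Let cvg_apx_xi n : (\int[Pr]_w \int[mu]_(u in D)
  ((jxi n m.+1 (u, w) - sp_eval (S n) u w) ^+ 2)%:E)%E @[m --> \oo] --> 0%E.
Proof.
have [C C0 hC] := sp_eval_bound (S n).
apply: (@joint_cvg0_paths _ _ _ Pr s t st
  (fun m p => (jxi n m.+1 p - sp_eval (S n) p.1 p.2) ^+ 2) ((2 * C) ^+ 2)).
- move=> m; apply: measurable_funX; apply: measurable_funB; first exact: mjxi.
  exact: (measurable_sp_eval_joint hW).
- move=> m p; rewrite sqr_ge0/= -real_normK ?num_real// ler_sqr ?nnegrE ?mulr_ge0//.
  rewrite (le_trans (ler_normB _ _))// mulr_natl mulr2n lerD//.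
  by apply: stepf_bound => // j _; exact: hC.
- apply: aeW => w u; rewrite /= in_itv/= => /andP[su ut].
  have -> : (0 : R) = (sp_eval (S n) u w - sp_eval (S n) u w) ^+ 2 by rewrite subrr expr0n.
  have : jxi n m.+1 (u, w) @[m --> \oo] --> sp_eval (S n) u w.
    apply: (stepf_cvg st (z := fun v => sp_eval (S n) v w) su ut) => e e0.
    have [del del0 h] := sp_eval_left (S n) u w.
    by exists del => // v _ vu uv; rewrite h// subrr normr0 ltW.
  move=> h; rewrite expr2; under eq_fun do rewrite expr2.
  by apply: cvgM; apply: cvgB => //; exact: cvg_cst.
Qed.

Lemma diffusion_error_small e : 0 < e -> \forall n \near \oo, exists N, forall m, (N < m)%N ->
  (\int[Pr]_w diffusion_error n m w <= e%:E)%E.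
Proof.
move=> e0; have e2 : 0 < e / 2 by rewrite divr_gt0.
have Q00 n w : (0 <= Q0 n w)%E.
  by rewrite mule_ge0//; apply: integral_ge0 => u _; rewrite lee_fin sqr_ge0.
have I0 n : (0 <= \int[Pr]_w mine 1 (Q0 n w))%E.
  by apply: integral_ge0 => w _; rewrite le_min lee01 Q00.
have := (ecvg0P I0).2 Q0_cvg _ e2; apply: filterS => n hn.
have e4 : 0 < e / 2 / 2 by rewrite divr_gt0.
have J0 m : (0 <= \int[Pr]_w \int[mu]_(u in D)
    ((jxi n m.+1 (u, w) - sp_eval (S n) u w) ^+ 2)%:E)%E.
  by apply: integral_ge0 => w _; apply: integral_ge0 => u _; rewrite lee_fin sqr_ge0.
have /= [N _ hN] := (ecvg0P J0).2 (@cvg_apx_xi n) _ e4.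
exists N => m Nm; have m0 : (0 < m)%N by exact: leq_ltn_trans Nm.
have := hN m.-1; rewrite prednK//= => /(_ _) hm.
have {}hm := hm (ltac:(by rewrite -ltnS prednK)).
pose q1 p := ((jxi n m p - sp_eval (S n) p.1 p.2) ^+ 2)%:E.
have mq1 : measurable_fun setT q1.
  apply/measurable_EFinP; apply: measurable_funX; apply: measurable_funB; first exact: mjxi.
  exact: (measurable_sp_eval_joint hW).
have q10 p : (0 <= q1 p)%E by rewrite lee_fin sqr_ge0.
pose q2 p := ((sp_eval (S n) p.1 p.2 - hh (XI s t p)) ^+ 2)%:E.
have mq2 : measurable_fun setT q2 by exact: mSh.
have q20 p : (0 <= q2 p)%E by rewrite lee_fin sqr_ge0.
have mw (q : TR * Omega -> \bar R) w : measurable_fun setT q -> measurable_fun D (fun u : TR => q (u, w)).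
  by move=> mq; apply: measurable_funTS; apply: (measurableT_comp mq); exact: pair2_measurable.
have bd w : (diffusion_error n m w <= mine 1 (Q0 n w) + 2%:E * \int[mu]_(u in D) q1 (u, w))%E.
  have i1 : (0 <= \int[mu]_(u in D) q1 (u, w))%E by exact: integral_ge0.
  have : (\int[mu]_(u in D) ((stepf s t m (fun j => apx_xi n m j w) u - hh (X u w)) ^+ 2)%:E
    <= Q0 n w + 2%:E * \int[mu]_(u in D) q1 (u, w))%E.
    rewrite sqE.
    apply: (@le_trans _ _ (\int[mu]_(u in D) (2%:E * q2 (u, w) + 2%:E * q1 (u, w)))%E).
      apply: ge0_le_integral => //.
      - by move=> u _; rewrite lee_fin sqr_ge0.
      - apply: (mw (fun p => ((jxi n m p - (hh \o XI s t) p) ^+ 2)%:E)).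
        apply/measurable_EFinP; apply: measurable_funX; apply: measurable_funB; first exact: mjxi.
        exact: mhX.
      - by apply: emeasurable_funD; apply: measurable_funeM; exact: mw.
      - move=> u _; rewrite /q1 /q2 -!EFinM -EFinD lee_fin /=.
        set a := jxi n m (u, w); set b := sp_eval _ _ _; set c := hh _.
        have := sqr_ge0 ((b - c) - (a - b)); lra.
    rewrite ge0_integralD//; last 4 first.
    - by move=> u _; rewrite mule_ge0.
    - by apply: measurable_funeM; exact: mw.
    - by move=> u _; rewrite mule_ge0.
    - by apply: measurable_funeM; exact: mw.
    rewrite !ge0_integralZl//; [|exact: mw|exact: mw].
    apply: leeD => //; apply: lee_wpmul2l => //.
    have -> : (\int[mu]_(u in D) q2 (u, w) = \int[mu]_(u in D)
        ((sp_eval (S n) u w - hh (XI 0 t (u, w))) ^+ 2)%:E)%E.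
      apply: eq_integral => u; rewrite inE => Du; rewrite /q2/= !XIE//.
      by move: Du; rewrite /= !in_itv/= => /andP[su ->]; rewrite andbT; exact: le_trans su.
    apply: ge0_subset_integral => //.
    - apply: measurable_funTS.
      exact: (measurableT_comp (mSh n t0 (lexx 0)) (pair2_measurable w)).
    - by move=> u _; rewrite lee_fin sqr_ge0.
    - by move=> u /=; rewrite !in_itv/= => /andP[su ->]; rewrite andbT; exact: le_trans su.
  move=> h; rewrite /diffusion_error; have [Q1|Q1] := leP 1%E (Q0 n w).
    by rewrite ge_min leeDl// mule_ge0.
  by rewrite ge_min h orbT.
apply: (@le_trans _ _ (\int[Pr]_w (mine 1 (Q0 n w) + 2%:E * \int[mu]_(u in D) q1 (u, w)))%E).
  apply: ge0_le_integral => //.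
  - by move=> w _; have [] := errors_ge0 n m w.
  - exact: measurable_diffusion_error.
  - apply: emeasurable_funD; first by apply: measurable_mine => //; exact: mQ0.
    apply: measurable_funeM; exact: (@measurable_tonelliD _ _ _ s t q1 mq1 q10).
rewrite ge0_integralD//; last 4 first.
- by move=> w _; rewrite le_min lee01 Q00.
- by apply: measurable_mine => //; exact: mQ0.
- by move=> w _; rewrite mule_ge0//; exact: integral_ge0.
- apply: measurable_funeM; exact: (@measurable_tonelliD _ _ _ s t q1 mq1 q10).
rewrite ge0_integralZl//; last 2 first.
- exact: (@measurable_tonelliD _ _ _ s t q1 mq1 q10).
- by move=> w _; exact: integral_ge0.
have -> : e = e / 2 + 2 * (e / 2 / 2) by field.
apply: (@le_trans _ _ ((e / 2)%:E + 2%:E * (e / 2 / 2)%:E)%E); last by rewrite -EFinM -EFinD.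
by apply: leeD; [exact: hn|exact: lee_wpmul2l].
Qed.

Let mNDw n u : 0 <= u -> measurable_fun setT (fun w => Num.min 1 `|noise n u w|).
Proof.
by move=> u0; apply: measurable_minr => //; apply: measurableT_comp => //; exact: measurable_noise.
Qed.

Let noise_cvg0 u : 0 <= u ->
  (\int[Pr]_w (Num.min 1 `|noise n u w|)%:E)%E @[n --> \oo] --> 0%E.
Proof.
move=> u0; under eq_fun do under eq_integral do rewrite EFin_min.
apply: cvg_prob_min.
- by move=> n; apply/measurable_EFinP; apply: measurableT_comp => //; exact: measurable_noise.
- by move=> n w; rewrite lee_fin.
- by move=> eps eps0; have [_] := hS u0 eps0.
Qed.

Let overflow_fin n w : (\int[mu]_(u in D) (r * (X u w - Num.min (X u w) n%:R))%:E)%E =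
  (overflow n w)%:E.
Proof.
rewrite /overflow fineK//.
have [C C0 hC] := rX_bound w.
apply: (integrable_fin_num (mu := mu)) => //.
rewrite (_ : (fun x => _) = (fun v => (r * X v w - r * Num.min (X v w) n%:R)%:E)); last first.
  by apply/funext => v; rewrite mulrBr.
have i1 := integrable_path (lexx s) (lexx t) (@continuous_rX w) hC.
suff i2 : mu.-integrable D (EFin \o (fun v => r * Num.min (X v w) n%:R)).
  by have := integrableB _ i1 i2; apply.
apply: (integrable_path (C := r * n%:R) (lexx s) (lexx t) (@continuous_trunc n w)) => v /andP[sv _].
by apply: trunc_bound; exact: le_trans sv.
Qed.

Let overflow_ge0 n w : 0 <= overflow n w.
Proof.
rewrite -lee_fin -overflow_fin; apply: integral_ge0 => v; rewrite /= in_itv/= => /andP[sv _].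
by rewrite lee_fin mulr_ge0// subr_ge0 ge_min lexx.
Qed.

Let measurable_overflow n : measurable_fun setT (overflow n).
Proof.
apply: measurableT_comp => //.
pose q (p : TR * Omega) := (r * (XI s t p - Num.min (XI s t p) n%:R))%:E.
have q0 p : (0 <= q p)%E by rewrite lee_fin mulr_ge0// subr_ge0 ge_min lexx.
have mq : measurable_fun setT q.
  apply/measurable_EFinP; apply: measurable_funM => //; apply: measurable_funB; first exact: mXI.
  by apply: measurable_minr => //; exact: mXI.
rewrite (_ : (fun w => _) = (fun w => \int[mu]_(u in D) q (u, w))%E).
  exact: (@measurable_tonelliD _ _ _ s t q mq q0).
by apply/funext => w; apply: eq_integral => u; rewrite inE => Du; rewrite /q XIE.
Qed.

(** Each path is bounded on [[s, t]], so its overflow is exactly [0] as soon as [n] exceeds that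
    bound. *)
Let overflow_cvg0 : (\int[Pr]_w (Num.min 1 (overflow n w))%:E)%E @[n --> \oo] --> 0%E.
Proof.
apply: (@bounded_cvg0 _ _ _ Pr setT (fun n w => Num.min 1 (overflow n w)) 1) => //.
- by rewrite (le_lt_trans (probability_le1 _ _))// ltry.
- by move=> n; apply: measurable_minr => //; exact: measurable_overflow.
- by move=> n w _; exact: min1_itv.
apply: aeW => w _; have [xM xM0 hx] := path_bound w.
apply: cvg_near_cst; exists (Num.truncn xM).+1 => // n /= hn.
have xn : xM <= n%:R.
  by apply: le_trans (ltW (truncnS_gt xM)) _; rewrite ler_nat.
suff -> : overflow n w = 0 by rewrite (min_idPr _).
apply: EFin_inj; rewrite -overflow_fin; apply: integral0_eq => v; rewrite /= in_itv/= => /andP[sv vt].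
by rewrite (min_idPl _) ?subrr ?mulr0// (le_trans _ xn)// hx// sv ltW.
Qed.

Let tri n u w := Num.min 1 (overflow n w) + Num.min 1 `|noise n u w| + Num.min 1 `|noise n s w|.

Let measurable_tri n u : 0 <= u -> measurable_fun setT (tri n u).
Proof.
move=> u0; apply: measurable_funD; last exact: mNDw.
apply: measurable_funD; last exact: mNDw.
by apply: measurable_minr => //; exact: measurable_overflow.
Qed.

Let tri_cvg0 u : 0 <= u -> (\int[Pr]_w (tri n u w)%:E)%E @[n --> \oo] --> 0%E.
Proof.
move=> u0.
have -> : (fun n => \int[Pr]_w (tri n u w)%:E)%E =
  (fun n => \int[Pr]_w (Num.min 1 (overflow n w))%:E + \int[Pr]_w (Num.min 1 `|noise n u w|)%:E
            + \int[Pr]_w (Num.min 1 `|noise n s w|)%:E)%E.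
  have m0 (x : R) : 0 <= x -> (0 <= (Num.min 1 x)%:E)%E by move=> ?; rewrite lee_fin le_min ler01.
  have mo n : measurable_fun setT (fun w => (Num.min 1 (overflow n w))%:E).
    by apply/measurable_EFinP; apply: measurable_minr => //; exact: measurable_overflow.
  have mn n v : 0 <= v -> measurable_fun setT (fun w => (Num.min 1 `|noise n v w|)%:E).
    by move=> v0; apply/measurable_EFinP; exact: mNDw.
  apply/funext => n.
  rewrite -(@ge0_integralD _ _ _ Pr setT measurableT (fun w => (Num.min 1 (overflow n w))%:E)
    (fun w => (Num.min 1 `|noise n u w|)%:E))//; last 2 first.
  - by move=> w _; exact: m0.
  - exact: mn.
  rewrite -(@ge0_integralD _ _ _ Pr setT measurableT
    (fun w => ((Num.min 1 (overflow n w))%:E + (Num.min 1 `|noise n u w|)%:E)%E)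
    (fun w => (Num.min 1 `|noise n s w|)%:E))//; last 3 first.
  - by move=> w _; rewrite adde_ge0// m0.
  - by apply: emeasurable_funD => //; exact: mn.
  - exact: mn.
have -> : (0 = 0 + 0 + 0 :> \bar R)%E by rewrite !adde0.
apply: cvgeD => //; last exact: noise_cvg0.
apply: cvgeD => //; exact: noise_cvg0.
Qed.

Lemma endpoint_error_small e : 0 < e -> \forall n \near \oo, exists N, forall m, (N < m)%N ->
  (\int[Pr]_w endpoint_error n m w <= e%:E)%E.
Proof.
move=> e0; have e2 : 0 < e / 2 by rewrite divr_gt0.
have tri0 n w : 0 <= tri n t w by rewrite !addr_ge0// le_min ler01/=.
have I0 n : (0 <= \int[Pr]_w (tri n t w)%:E)%E by apply: integral_ge0 => w _; rewrite lee_fin.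
have := (ecvg0P I0).2 (tri_cvg0 (ltW t0)) _ e2; apply: filterS => n hn.
pose exc m w := Num.min 1 (Num.max 0 (`|apx_Y n m.+1 m.+1 w - X t w| - overflow n w
   - `|noise n t w| - `|noise n s w|)).
have exc01 m w : 0 <= exc m w <= 1 by rewrite min1_itv// le_max lexx.
have mexc m : measurable_fun setT (exc m).
  apply: measurable_minr => //; apply: measurable_maxr => //.
  apply: measurable_funB; last by apply: measurableT_comp => //; exact: measurable_noise.
  apply: measurable_funB; last by apply: measurableT_comp => //; apply: measurable_noise; exact: ltW.
  apply: measurable_funB => //; apply: measurableT_comp => //; apply: measurable_funB.
    exact: measurable_apx_Y.
  by apply: measurable_X; exact: ltW.
have cexc : (\int[Pr]_w (exc m w)%:E)%E @[m --> \oo] --> 0%E.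
  apply: (@bounded_cvg0 _ _ _ Pr setT exc 1) => //.
    by rewrite (le_lt_trans (probability_le1 _ _))// ltry.
  apply: filterS eqX => w hw _; apply/cvgrPdist_le => eps eps0.
  have [N hN] := scheme_error n (ltW st) (lexx t) hw eps0.
  exists N => // m /= Nm; have := hN m.+1 m.+1 Nm (leqnn _).
  rewrite grid_last// lexx subrr mesh_gt0// => /(_ isT isT) h.
  exact: (excess_le (ltW eps0) h).
have J0 m : (0 <= \int[Pr]_w (exc m w)%:E)%E.
  by apply: integral_ge0 => w _; rewrite lee_fin; have /andP[] := exc01 m w.
have /= [N _ hN] := (ecvg0P J0).2 cexc _ e2.
exists N.+1 => -[//|m]; rewrite ltnS => Nm; have {}hm := hN m (ltnW Nm).
apply: (@le_trans _ _ (\int[Pr]_w ((exc m w)%:E + (tri n t w)%:E))%E).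
  apply: ge0_le_integral => //.
  - by move=> w _; have [] := errors_ge0 n m.+1 w.
  - exact: measurable_endpoint_error.
  - apply: emeasurable_funD; first exact/measurable_EFinP.
    by apply/measurable_EFinP; apply: measurable_tri; exact: ltW.
  - by move=> w _; rewrite -EFinD lee_fin; exact: min1_excess.
rewrite ge0_integralD//; last 4 first.
- by move=> w _; rewrite lee_fin; have /andP[] := exc01 m w.
- exact/measurable_EFinP.
- by move=> w _; rewrite lee_fin.
- by apply/measurable_EFinP; apply: measurable_tri; exact: ltW.
by rewrite [e in leRHS]splitr EFinD leeD.
Qed.

Lemma path_error_small e : 0 < e -> \forall n \near \oo, exists N, forall m, (N < m)%N ->
  (\int[Pr]_w path_error n m w <= e%:E)%E.
Proof.
move=> e0; have e2 : 0 < e / 2 by rewrite divr_gt0.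
pose T n (p : TR * Omega) := Num.min 1 (overflow n p.2) + Num.min 1 `|ND n p|
   + Num.min 1 `|noise n s p.2|.
have T0 n p : 0 <= T n p by rewrite !addr_ge0// le_min ler01/=.
have mT n : measurable_fun setT (T n).
  apply: measurable_funD.
    apply: measurable_funD.
      apply: (measurableT_comp (f := fun w => Num.min 1 (overflow n w))) => //.
      by apply: measurable_minr => //; exact: measurable_overflow.
    by apply: measurable_minr => //; apply: measurableT_comp => //; exact: mND.
  by apply: (measurableT_comp (f := fun w => Num.min 1 `|noise n s w|)) => //; exact: mNDw.
have cT : (\int[Pr]_w \int[mu]_(u in D) (T n (u, w))%:E)%E @[n --> \oo] --> 0%E.
  apply: (@joint_cvg0_times _ _ _ Pr s t T 3) => //.
    move=> n p; rewrite T0/=.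
    have -> : (3 : R) = 1 + 1 + 1 by lra.
    by rewrite !lerD// ge_min lexx.
  move=> u Du; have u0 : 0 <= u by move: Du; rewrite /= in_itv/= => /andP[su _]; exact: le_trans su.
  under eq_fun do under eq_integral do rewrite /T /= NDE//.
  exact: tri_cvg0.
have I0 n : (0 <= \int[Pr]_w \int[mu]_(u in D) (T n (u, w))%:E)%E.
  by apply: integral_ge0 => w _; apply: integral_ge0 => u _; rewrite lee_fin.
have := (ecvg0P I0).2 cT _ e2; apply: filterS => n hn.
pose exc m (p : TR * Omega) := Num.min 1 (Num.max 0 (`|jY n m.+1 p - XI s t p| - overflow n p.2
   - `|ND n p| - `|noise n s p.2|)).
have exc01 m p : 0 <= exc m p <= 1 by rewrite min1_itv// le_max lexx.
have mexc m : measurable_fun setT (exc m).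
  apply: measurable_minr => //; apply: measurable_maxr => //.
  apply: measurable_funB; last first.
    apply: (measurableT_comp (f := fun w => `|noise n s w|)) => //.
    by apply: measurableT_comp => //; exact: measurable_noise.
  apply: measurable_funB; last by apply: measurableT_comp => //; exact: mND.
  apply: measurable_funB; last exact: (measurableT_comp (@measurable_overflow n)).
  by apply: measurableT_comp => //; apply: measurable_funB; [exact: mjY|exact: mXI].
have cexc : (\int[Pr]_w \int[mu]_(u in D) (exc m (u, w))%:E)%E @[m --> \oo] --> 0%E.
  apply: (@joint_cvg0_paths _ _ _ Pr s t st exc 1) => //.
  apply: filterS eqX => w hw u Du; apply/cvgrPdist_le => eps eps0.
  have /andP[su ut] : s <= u < t by move: Du; rewrite /= in_itv.
  have [N hN] := scheme_error n su (ltW ut) hw eps0.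
  exists N => // m /= Nm.
  have h : `|jY n m.+1 (u, w) - X u w| <= eps + overflow n w + `|noise n u w| + `|noise n s w|.
    rewrite /jY/=; have [j jm /andP[ju uj]] := grid_index (ltn0Sn m) su ut.
    rewrite (stepfE st (ltn0Sn m) _ jm); last by rewrite ju.
    apply: (hN m.+1 j Nm (ltnW jm) ju); move: uj; rewrite gridS; lra.
  rewrite /exc XIE// NDE//; exact: (excess_le (ltW eps0) h).
have J0 m : (0 <= \int[Pr]_w \int[mu]_(u in D) (exc m (u, w))%:E)%E.
  by apply: integral_ge0 => w _; apply: integral_ge0 => u _; rewrite lee_fin; have /andP[] := exc01 m (u, w).
have /= [N _ hN] := (ecvg0P J0).2 cexc _ e2.
exists N.+1 => -[//|m]; rewrite ltnS => Nm; have {}hm := hN m (ltnW Nm).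
have e0' p : (0 <= (exc m p)%:E)%E by rewrite lee_fin; have /andP[] := exc01 m p.
have T0' p : (0 <= (T n p)%:E)%E by rewrite lee_fin.
have me : measurable_fun setT (fun p => (exc m p)%:E) by exact/measurable_EFinP.
have mT' : measurable_fun setT (fun p => (T n p)%:E) by exact/measurable_EFinP.
have mw (q : TR * Omega -> \bar R) w : measurable_fun setT q -> measurable_fun D (fun u : TR => q (u, w)).
  by move=> mq; apply: measurable_funTS; apply: (measurableT_comp mq); exact: pair2_measurable.
apply: (@le_trans _ _ (\int[Pr]_w (\int[mu]_(u in D) (exc m (u, w))%:E
    + \int[mu]_(u in D) (T n (u, w))%:E))%E).
  apply: ge0_le_integral => //.
  - by move=> w _; have [] := errors_ge0 n m.+1 w.
  - exact: measurable_path_error.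
  - apply: emeasurable_funD; first exact: (@measurable_tonelliD _ _ _ s t _ me e0').
    exact: (@measurable_tonelliD _ _ _ s t _ mT' T0').
  - move=> w _; rewrite -ge0_integralD//; [|exact: (mw _ w me)|exact: (mw _ w mT')].
    rewrite path_errorE; apply: ge0_le_integral => //.
    + apply: (mw (fun p => (Num.min 1 `|jY n m.+1 p - XI s t p|)%:E)).
      apply/measurable_EFinP; apply: measurable_minr => //; apply: measurableT_comp => //.
      by apply: measurable_funB; [exact: mjY|exact: mXI].
    + by apply: emeasurable_funD; [exact: (mw _ w me)|exact: (mw _ w mT')].
    + by move=> u _; rewrite -EFinD lee_fin; exact: min1_excess.
rewrite ge0_integralD//; last 4 first.
- by move=> w _; exact: integral_ge0.
- exact: (@measurable_tonelliD _ _ _ s t _ me e0').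
- by move=> w _; exact: integral_ge0.
- exact: (@measurable_tonelliD _ _ _ s t _ mT' T0').
by rewrite [e in leRHS]splitr EFinD leeD.
Qed.

Lemma errors_small k e : 0 < e -> exists2 n, (k <= n)%N & exists N, forall m, (N < m)%N ->
  [/\ (\int[Pr]_w diffusion_error n m w <= e%:E)%E, (\int[Pr]_w path_error n m w <= e%:E)%E
    & (\int[Pr]_w endpoint_error n m w <= e%:E)%E].
Proof.
move=> e0; have [NA _ hA] := diffusion_error_small e0; have [NB _ hB] := path_error_small e0; have [NC _ hC] := endpoint_error_small e0.
pose n := maxn k (maxn NA (maxn NB NC)).
exists n; first exact: leq_maxl.
have [N1 h1] := hA n (leq_trans (leq_maxl _ _) (leq_maxr _ _)).
have [N2 h2] := hB n (leq_trans (leq_trans (leq_maxl _ _) (leq_maxr _ _)) (leq_maxr _ _)).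
have [N3 h3] := hC n (leq_trans (leq_trans (leq_maxr _ _) (leq_maxr _ _)) (leq_maxr _ _)).
exists (maxn N1 (maxn N2 N3)) => m; rewrite !gtn_max => /and3P[m1 m2 m3].
by split; [exact: h1|exact: h2|exact: h3].
Qed.

End approximation.

Lemma summable_integrals_ae {d} {T : measurableType d} {R : realType}
    (mu : {measure set T -> \bar R}) (D : set T) (f : nat -> T -> \bar R) :
  measurable D -> (forall k, measurable_fun D (f k)) ->
  (forall k x, D x -> (0 <= f k x)%E) ->
  (\sum_(k <oo) \int[mu]_(x in D) f k x < +oo)%E ->
  {ae mu, forall x, D x -> (\sum_(k <oo) f k x < +oo)%E}.
Proof.
move=> mD mf f0 hf.
have h : (\int[mu]_(x in D) (\sum_(k <oo) f k x) < +oo)%E by rewrite integral_nneseries.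
have ig : mu.-integrable D (fun x => \sum_(k <oo) f k x)%E.
  apply/integrableP; split; first by apply: ge0_emeasurable_sum => // k x Dx _; exact: f0.
  under eq_integral => x xD.
    rewrite gee0_abs; last by apply: nneseries_ge0 => k _ _; apply: f0; rewrite inE in xD.
    over.
  exact: h.
case: (integrable_ae mD ig) => N [mN N0 hN]; exists N; split => //.
apply: subset_trans hN; apply: subsetC => x /= hx Dx.
by have := hx Dx; rewrite ge0_fin_numE//; apply: nneseries_ge0 => k _ _; exact: f0.
Qed.

Lemma min1_cvg0 {R : realType} (a : nat -> \bar R) : (forall k, (0 <= a k)%E) ->
  mine 1%E (a k) @[k --> \oo] --> 0%E -> a k @[k --> \oo] --> 0%E.
Proof.
move=> a0 h; have m0 k : (0 <= mine 1%E (a k))%E by rewrite le_min lee01 a0.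
apply/(ecvg0P a0) => e e0; have e2 : 0 < Num.min e 2^-1 by rewrite lt_min e0/=.
have := (ecvg0P m0).2 h _ e2; apply: filterS => k; rewrite ge_min => /orP[|hk].
  by rewrite lee_fin le_min => /andP[_] h1; exfalso; lra.
by apply: le_trans hk _; rewrite lee_fin ge_min lexx.
Qed.

Lemma min1_norm_cvg {R : realType} (a : nat -> R) (l : R) :
  (Num.min 1 `|a k - l|)%:E @[k --> \oo] --> 0%E -> a k @[k --> \oo] --> l.
Proof.
move=> h.
have n0 k : (0 <= (`|a k - l|)%:E)%E by rewrite lee_fin.
have := @min1_cvg0 _ _ n0; under eq_fun do rewrite -EFin_min.
move/(_ h)/(ecvg0P n0) => h'; apply/cvgrPdist_le => e e0.
by apply: filterS (h' e e0) => k; rewrite lee_fin distrC.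
Qed.

Lemma ler_expRN {R : realType} (a b : R) : 0 <= a -> 0 <= b ->
  `|expR (- a) - expR (- b)| <= `|a - b|.
Proof.
suff h (x y : R) : 0 <= x -> x <= y -> expR (- x) - expR (- y) <= y - x.
  move=> a0 b0; have [ab|ba] := leP a b.
    rewrite (distrC a) !ger0_norm ?subr_ge0 ?ler_expR ?lerN2//; exact: h.
  by rewrite (distrC (expR _)) !ger0_norm ?subr_ge0 ?ler_expR ?lerN2 ?(ltW ba)//; apply: h => //; exact: ltW.
move=> x0 xy.
have -> : expR (- x) - expR (- y) = expR (- x) * (1 - expR (- (y - x))).
  by rewrite mulrBr mulr1 -expRD; congr (_ - expR _); ring.
have h1 : 1 - expR (- (y - x)) <= y - x.
  by have := expR_ge1Dx (- (y - x)); lra.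
have h0 : 0 <= 1 - expR (- (y - x)) by rewrite subr_ge0 expR_le1 oppr_le0 subr_ge0.
apply: le_trans h1; rewrite ler_piMl// expR_le1; lra.
Qed.

(** * Dynkin inequality for the price process *)

Section weights.
Context {d : measure_display} {Omega : measurableType d} {R : realType}.
Variables (s t r lam : R) (m : nat) (b xi : nat -> Omega -> R).
Hypotheses (st : s < t) (m0 : (0 < m)%N) (r0 : 0 <= r) (lam0 : 0 <= lam).
Local Notation mu := (@lebesgue_measure R).
Local Notation D := (`[s, t[%classic : set R).
Local Notation h := (mesh s t m).
Local Notation gr := (grid s h).
Hypothesis b0 : forall j w, (j < m)%N -> 0 <= b j w.
Local Notation v := (weight h b xi r lam).

Let hp : 0 < h. Proof. exact: mesh_gt0. Qed.

Let q0 j w : (j < m)%N -> 0 <= h * (xi j w ^+ 2 + b j w).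
Proof. by move=> jm; rewrite mulr_ge0 ?(ltW hp)// addr_ge0 ?sqr_ge0 ?b0. Qed.

Lemma weight_itv j w : (j <= m)%N -> 0 <= v j w <= 1.
Proof.
move=> jm; rewrite expR_ge0/= expR_le1 oppr_le0 sumr_ge0// => i _.
have im : (i < m)%N by exact: leq_trans jm.
rewrite mulr_ge0 ?(ltW hp)// addr_ge0// mulr_ge0// addr_ge0 ?sqr_ge0//; exact: b0.
Qed.

(** The weight is [exp (- r j h)] times [exp (- lam Lj)] with the partial clock [Lj] between [0] and
    [L]. The second factor is within [1 - exp (- lam L)] of [1], and [exp (- x)] is 1-Lipschitz on
    nonnegative reals. *)
Lemma weight_close j w c L : (j <= m)%N -> 0 <= c ->
  \sum_(i < m) h * (xi i w ^+ 2 + b i w) <= L ->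
  `|v j w - expR (- c)| <= 1 - expR (- (lam * L)) + `|r * (j%:R * h) - c|.
Proof.
move=> jm c0 hL; pose Lj := \sum_(i < j) h * (xi i w ^+ 2 + b i w).
have L0 : 0 <= Lj by apply: sumr_ge0 => i _; apply: q0; exact: leq_trans jm.
have LL : Lj <= L.
  apply: le_trans hL; rewrite /Lj -(big_mkord xpredT (fun i => h * (xi i w ^+ 2 + b i w))).
  rewrite -(big_mkord xpredT (fun i => h * (xi i w ^+ 2 + b i w))).
  rewrite [leRHS](big_cat_nat (leq0n j) jm)/= lerDl big_nat_cond sumr_ge0// => i.
  by rewrite andbT => /andP[_ im]; exact: q0.
have -> : v j w = expR (- (r * (j%:R * h))) * expR (- (lam * Lj)).
  rewrite -expRD /weight; congr expR; rewrite -opprD; congr (- _).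
  under eq_bigr do rewrite mulrDr.
  rewrite big_split/= sumr_const card_ord -mulr_natl; congr (_ + _); first ring.
  by rewrite /Lj mulr_sumr; apply: eq_bigr => i _; ring.
set x := expR (- (r * (j%:R * h))); set y := expR (- (lam * Lj)).
have rj0 : 0 <= r * (j%:R * h) by rewrite mulr_ge0// mulr_ge0// ltW.
have x1 : 0 <= x <= 1 by rewrite expR_ge0 expR_le1; lra.
have lL : 0 <= lam * Lj by exact: mulr_ge0.
have y1 : y <= 1 by rewrite expR_le1; lra.
have y2 : expR (- (lam * L)) <= y by rewrite ler_expR lerN2 ler_wpM2l.
have -> : x * y - expR (- c) = (x - expR (- c)) - x * (1 - y) by ring.
rewrite (le_trans (ler_normB _ _))// addrC lerD//; last exact: ler_expRN.
case/andP: x1 => x0 x1; rewrite ger0_norm ?mulr_ge0 ?subr_ge0//.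
apply: (@le_trans _ _ (1 - y)); last by rewrite lerD2l lerN2.
by rewrite ler_piMl// subr_ge0.
Qed.

Variables (f kx : R -> R) (K Kf : R) (w : Omega) (f_ : nat -> R).
Hypotheses (mk : measurable_fun D kx) (kK : forall u, D u -> `|kx u| <= K).

(** Cell by cell, the error of the drift carries a weight at most [1], and the error of the weight
    multiplies [kx], bounded by [K]. The term [r * h] arises because [v j.+1] discounts up to the
    right end of the cell containing [u]. *)
Lemma weighted_sum_close L :
  \sum_(i < m) h * (xi i w ^+ 2 + b i w) <= L ->
  `|\sum_(j < m) h * (v j.+1 w * f_ j) - (\int[mu]_(u in D) (expR (- (r * (u - s))) * kx u))%R| <=
  (\int[mu]_(u in D) `|stepf s t m f_ u - kx u|)%R +
  K * (1 - expR (- (lam * L)) + r * h) * (t - s).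
Proof.
move=> hL; have mD : measurable (D : set (measurableTypeR R)) by exact: measurable_itv.
have sub : D `<=` `[s, t] by move=> u /=; rewrite !in_itv/= => /andP[-> /ltW].
have K0 : 0 <= K by apply: le_trans (kK (u := s) _) => //=; rewrite in_itv/= lexx.
pose C := \sum_(j < m) `|f_ j|.
have C0 : 0 <= C by exact: sumr_ge0.
have fC j : (j < m)%N -> `|f_ j| <= C.
  by move=> jm; rewrite /C (bigD1 (Ordinal jm))//= lerDl sumr_ge0.
have <- : (\int[mu]_(u in D) stepf s t m (fun j => v j.+1 w * f_ j) u)%R =
  \sum_(j < m) h * (v j.+1 w * f_ j).
  have := @integral_stepf _ s t m st m0 (fun j => v j.+1 w * f_ j) m (leqnn m).
  by rewrite grid_last.
have me : measurable_fun setT (fun u : R => expR (- (r * (u - s)))).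
  apply: measurableT_comp => //; apply: measurableT_comp => //.
  by apply: measurable_funM => //; exact: measurable_funB.
have mek : measurable_fun D (fun u : R => expR (- (r * (u - s))) * kx u).
  by apply: measurable_funM => //; exact: measurable_funTS.
have e1 (u : R) : s <= u -> 0 <= expR (- (r * (u - s))) <= 1.
  by move=> su; rewrite expR_ge0 expR_le1 oppr_le0 mulr_ge0// subr_ge0.
have i1 : mu.-integrable D (EFin \o stepf s t m (fun j => v j.+1 w * f_ j)).
  apply: (itv_integrable_bounded sub mD (C := C)); first exact: measurable_stepf.
  move=> u _; apply: stepf_bound => // j jm; rewrite normrM -[leRHS]mul1r ler_pM//; last exact: fC.
  by have /andP[a c] := weight_itv w jm; rewrite ger0_norm.
have i2 : mu.-integrable D (EFin \o (fun u : R => expR (- (r * (u - s))) * kx u)).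
  apply: (itv_integrable_bounded sub mD (C := K)) => // u Du.
  have /andP[su _] : s <= u < t by move: Du; rewrite /= in_itv.
  have /andP[a c] := e1 u su.
  rewrite normrM (ger0_norm a) -[leRHS]mul1r; apply: ler_pM => //; exact: kK.
have i3 : mu.-integrable D (EFin \o (fun u : R => `|stepf s t m f_ u - kx u|)).
  apply: (itv_integrable_bounded sub mD (C := C + K)).
    by apply: measurableT_comp => //; apply: measurable_funB => //; exact: measurable_stepf.
  move=> u Du; rewrite normr_id (le_trans (ler_normB _ _))// lerD//; last exact: kK.
  exact: stepf_bound.
set de := 1 - _ + _.
have de0 : 0 <= de.
  rewrite /de; apply: addr_ge0; last by rewrite mulr_ge0// ltW.
  rewrite subr_ge0 expR_le1 oppr_le0 mulr_ge0//.
  by apply: le_trans hL; apply: sumr_ge0 => i _; exact: q0.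
have i4 : mu.-integrable D (EFin \o (fun=> K * de : R)).
  by apply: (itv_integrable_bounded sub mD (C := `|K * de|)).
rewrite -RintegralB//.
have -> : K * de * (t - s) = (\int[mu]_(u in D) (K * de))%R.
  rewrite Rintegral_cst//= lebesgue_measure_itv/= lte_fin st -EFinB/=; ring.
rewrite -RintegralD//.
have i5 : mu.-integrable D (EFin \o (fun u => stepf s t m (fun j => v j.+1 w * f_ j) u -
  expR (- (r * (u - s))) * kx u)) by have := integrableB mD i1 i2; apply.
have i6 : mu.-integrable D (EFin \o (fun u => `|stepf s t m f_ u - kx u| + K * de)).
  by have := integrableD mD i3 i4; apply.
apply: le_trans (le_normr_Rintegral _ i5) _ => //.
apply: le_Rintegral => //; first by have := integrable_abse i5; apply.
move=> u Du; have /andP[su ut] : s <= u < t by move: Du; rewrite /= in_itv.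
have [j jm hj] := grid_index m0 su ut.
rewrite !(stepfE st m0 _ jm hj).
have -> : v j.+1 w * f_ j - expR (- (r * (u - s))) * kx u =
  v j.+1 w * (f_ j - kx u) + (v j.+1 w - expR (- (r * (u - s)))) * kx u by ring.
rewrite (le_trans (ler_normD _ _))// !normrM lerD//.
  have /andP[a c] := weight_itv w jm.
  by rewrite ger0_norm// ler_piMl.
rewrite mulrC ler_pM//; first exact: kK.
apply: le_trans (weight_close jm _ hL) _; first by rewrite mulr_ge0// subr_ge0.
rewrite /de lerD2l -mulrBr normrM (ger0_norm r0) ler_wpM2l//.
case/andP: hj; rewrite gridS /grid -natr1 => h1 h2.
rewrite ger0_norm; first by move: h1; lra.
by move: h2; rewrite subr_ge0; lra.
Qed.

End weights.

Lemma budget_combine {R : realFieldType} (a b c e f g h : R) :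
  a <= b + f -> - e <= g + h -> a - (b - c) - e - c <= f + g + h.
Proof. lra. Qed.

Lemma cvg_seq_ge {R : realType} (u : nat -> R) (a l : R) :
  u k @[k --> \oo] --> l -> (forall k, a <= u k) -> a <= l.
Proof.
move=> ul au; have <- := cvg_lim (@Rhausdorff R) ul.
by apply: limr_ge; [apply/cvg_ex; exists l|exact: nearW].
Qed.

Section dynkin_inequality.
Context {d : measure_display} {Omega : measurableType d} {R : realType}.
Variable Pr : probability Omega R.
Variable W : R -> Omega -> R.
Hypothesis hW : standard_brownian Pr W.
Local Notation Fil := (brownian_filtration Pr W).
Local Notation Fm := (Fm Pr W).
Local Notation Ex := (Ex Pr).
Local Notation mu := (@lebesgue_measure R).
Local Notation TR := (measurableTypeR R).
Variables (r x0 : R) (hh : R -> R) (X M : R -> Omega -> R).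
Variable S : nat -> simple_process Fil.
Hypotheses (r0 : 0 <= r) (mhh : measurable_fun setT hh).
Hypotheses (aX : adapted Fil X) (cX : continuous_paths X).
Hypothesis X0 : forall t w, 0 <= t -> 0 <= X t w.
Hypotheses (aM : adapted Fil M) (cM : continuous_paths M).
Hypothesis hS : forall t eps : R, 0 <= t -> 0 < eps ->
  (Pr [set w | eps%:E < \int[mu]_(u in `[0%R, t])
         ((sp_eval (S n) u w - hh (X u w)) ^+ 2)%R%:E]%E @[n --> \oo] --> 0%E)
  /\ (Pr [set w | eps < `|sp_integral W (S n) t w - M t w|] @[n --> \oo] --> 0%E).
Hypothesis eqX : {ae Pr, forall w, forall t, 0 <= t ->
  X t w = x0 + \int[mu]_(u in `[0%R, t]) (r * X u w) + M t w}.
Hypothesis H2 : {ae Pr, forall w, forall t : R, 0 <= t ->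
  (\int[mu]_(u in `[0%R, t]) ((hh (X u w)) ^+ 2)%:E < +oo)%E}.

Variables (G G1 G2 : R -> R) (Kg Kk : R).
Hypothesis hG : test_fun G G1 G2 Kg.
(** [L G] for the coefficients of the price process, [hh x] standing for [x sigma(x)]. Its
    boundedness in [hk] is what imposes flat test functions. *)
Definition price_drift (x : R) : R := ito_drift G G1 G2 r (hh x) (r * x) x.
Hypothesis hk : forall x, 0 <= x -> `|price_drift x| <= Kk.

Variables (s t : R).
Hypotheses (s0 : 0 <= s) (st : s < t).
Local Notation D := (`[s, t[%classic : set R).
Local Notation gr m := (grid s (mesh s t m)).
Local Notation xi_ := (apx_xi S s t).
Local Notation b_ := (apx_b r X s t).
Local Notation Y_ := (apx_Y r X S s t).
Local Notation v_ n m lam := (weight (mesh s t m) (b_ n m) (xi_ n m) r lam).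

Let mD : measurable (D : set TR). Proof. exact: measurable_itv. Qed.
Let t0 : 0 <= t. Proof. exact: ltW (le_lt_trans s0 st). Qed.
Let ts0 : 0 < t - s. Proof. by rewrite subr_gt0. Qed.
Let Kg0 : 0 <= Kg. Proof. exact: le_trans (tf_ge0 hG 0) (tf_le hG 0). Qed.
Let Kk0 : 0 <= Kk. Proof. exact: le_trans (hk (lexx 0)). Qed.

Let mG : measurable_fun setT G.
Proof. by apply: continuous_measurable_fun; exact: (tf_cG hG). Qed.
Let mG1 : measurable_fun setT G1.
Proof. by apply: continuous_measurable_fun; exact: (tf_cG1 hG). Qed.
Let mG2 : measurable_fun setT G2.
Proof. by apply: continuous_measurable_fun; exact: (tf_cG2 hG). Qed.

Let mgen {d'} {T : measurableType d'} (B : set T) (a b y : T -> R) : measurable_fun B a -> measurable_fun B b ->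
  measurable_fun B y -> measurable_fun B (fun u => ito_drift G G1 G2 r (a u) (b u) (y u)).
Proof.
move=> ma mb' my'; apply: measurable_funB; first apply: measurable_funD.
- by apply: measurable_funM => //; exact: (measurableT_comp mG1).
- apply: measurable_funM; last exact: (measurableT_comp mG2).
  by apply: measurable_funM => //; exact: measurable_funX.
- by apply: measurable_funM => //; exact: (measurableT_comp mG).
Qed.

Let measurable_price_drift : measurable_fun setT price_drift.
Proof. by apply: mgen => //; exact: measurable_funM. Qed.

Lemma apx_b_itv n m j w : (0 < m)%N -> 0 <= b_ n m j w <= r * n%:R.
Proof.
move=> m0; have g0 : 0 <= gr m j by rewrite (le_trans s0)// grid_ge// mesh_gt0.
by rewrite /apx_b ler_wpM2l ?ge_min ?lexx ?orbT// andbT mulr_ge0// le_min X0//=.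
Qed.

Lemma mesh_sum m : (0 < m)%N -> m%:R * mesh s t m = t - s.
Proof. by move=> m0; rewrite /mesh mulrC divfK// pnatr_eq0 -lt0n. Qed.

(** For fixed [n] the coefficients are bounded by [B]. Half of [de] pays for the Taylor tolerance
    [e]; the other half pays for the terms of order [h], whose constant [Q] depends on [C] and so on
    [e]. The grid is fine enough for every [lam] at once, as [lam] goes to [0] only after the grid
    has been refined. *)
Lemma scheme_budget n de A : Fil s A -> 0 < de -> exists N, forall m, (N < m)%N ->
  mesh s t m <= de /\ forall lam, 0 <= lam ->
  Ex (fun w => \1_A w * (v_ n m lam m w * G (Y_ n m m w) - G (X s w))) <=
  Ex (fun w => \1_A w * \sum_(j < m) mesh s t m * (v_ n m lam j.+1 w *
     ito_drift G G1 G2 r (xi_ n m j w) (b_ n m j w) (Y_ n m j w))) + de.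
Proof.
move=> FA de0; have [CS CS0 hCS] := sp_eval_bound (S n).
pose B := CS + r * n%:R.
have rn0 : 0 <= r * n%:R by rewrite mulr_ge0.
have B0 : 0 <= B by rewrite addr_ge0.
have q0 : 0 < 4 * (B ^+ 2 + 1) * (t - s) by rewrite mulr_gt0// mulr_gt0// ltr_wpDl// sqr_ge0.
have e0 : 0 < de / 2 / (4 * (B ^+ 2 + 1) * (t - s)) by rewrite divr_gt0// divr_gt0.
have [C C0 taylor] := tf_taylor hG e0.
set e := de / 2 / _ in e0 taylor.
pose Q := Kg * B ^+ 2 + 520 * C * B ^+ 4.
have Q0 : 0 <= Q.
  apply: addr_ge0; first by rewrite mulr_ge0 ?sqr_ge0.
  by apply: mulr_ge0; [apply: mulr_ge0; [exact: ler0n|exact: C0]|exact: exprn_ge0].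
have f0 : 0 < de / 2 / ((t - s) * (Q + 1)).
  by rewrite divr_gt0 ?divr_gt0// mulr_gt0// ltr_wpDl.
have i0 : 0 < Num.min 1 (Num.min de (de / 2 / ((t - s) * (Q + 1)))) by rewrite !lt_min ltr01 de0.
have [N hN] := mesh_lt st i0.
exists N => m Nm; have m0 : (0 < m)%N by exact: leq_ltn_trans Nm.
have := hN m Nm; rewrite !lt_min => /and3P[h1 h2 h3]; split; first exact: ltW.
move=> lam lam0.
have hp : 0 < mesh s t m by exact: mesh_gt0.
have := @scheme_ineq _ _ _ Pr W hW G G1 G2 Kg hG s (mesh s t m) (X s) (b_ n m) (xi_ n m) r lam m B
  s0 hp (ltW h1) B0 r0 lam0 (FmX aX s0).
move=> /(_ _ _ _ _ A e C FA e0 C0 taylor).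
move=> h.
have {h} := h (fun j _ => apx_b_Fm r aX s0 st n m0) (fun j _ => @apx_xi_Fm _ _ _ _ _ S s t n m j).
have bB j w : (j < m)%N -> 0 <= b_ n m j w <= B.
  move=> _; have /andP[-> h /=] := apx_b_itv n j w m0.
  by rewrite (le_trans h)// lerDr.
have xB j w : (j < m)%N -> `|xi_ n m j w| <= B.
  by move=> _; rewrite (le_trans (hCS _ _))// lerDl.
move=> /(_ bB xB) h.
have {}h : Ex (fun w => \1_A w * (v_ n m lam m w * G (Y_ n m m w) - G (X s w))) <=
  Ex (fun w => \1_A w * \sum_(j < m) mesh s t m * (v_ n m lam j.+1 w *
     ito_drift G G1 G2 r (xi_ n m j w) (b_ n m j w) (Y_ n m j w))) +
  m%:R * (mesh s t m * (4 * e * B ^+ 2 + mesh s t m * Q)) by exact: h.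
apply: le_trans h _; rewrite lerD2l mulrA mesh_sum// mulrDr [leRHS]splitr lerD//.
  have -> : (t - s) * (4 * e * B ^+ 2) = de / 2 * (B ^+ 2 / (B ^+ 2 + 1)).
    by rewrite /e; field; rewrite !gt_eqF// ltr_wpDl// sqr_ge0.
  rewrite ler_piMr ?divr_ge0 ?(ltW de0)// ler_pdivrMr ?mul1r ?lerDl//.
  by rewrite ltr_wpDl// sqr_ge0.
have tq : 0 < (t - s) * (Q + 1) by rewrite mulr_gt0// ltr_wpDl.
move: h3; rewrite ltr_pdivlMr// => h3; apply: le_trans (ltW h3).
have -> : (t - s) * (mesh s t m * Q) = mesh s t m * ((t - s) * Q) by ring.
by rewrite ler_pM2l// ler_pM2l// lerDl.
Qed.

Local Notation errA_ := (diffusion_error hh X S s t).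
Local Notation errB_ := (path_error r X S s t).
Local Notation errC_ := (endpoint_error r X S s t).

(** For each [k] the index of the simple process is chosen first, then a grid fine enough for the
    errors and for the budget. The bounds [2^-(k+1)] are summable, which yields almost sure
    convergence along the sequence. *)
Lemma good_sequence A : Fil s A -> exists nk mk : nat -> nat, forall k,
  [/\ (k <= nk k)%N, (k < mk k)%N, mesh s t (mk k) <= k.+1%:R^-1,
    (forall lam, 0 <= lam ->
     Ex (fun w => \1_A w * (v_ (nk k) (mk k) lam (mk k) w * G (Y_ (nk k) (mk k) (mk k) w) - G (X s w))) <=
     Ex (fun w => \1_A w * \sum_(j < mk k) mesh s t (mk k) * (v_ (nk k) (mk k) lam j.+1 w *
       ito_drift G G1 G2 r (xi_ (nk k) (mk k) j w) (b_ (nk k) (mk k) j w) (Y_ (nk k) (mk k) j w)))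
     + k.+1%:R^-1)
    & [/\ (\int[Pr]_w errA_ (nk k) (mk k) w <= (1 / (2 ^ k.+1)%:R)%:E)%E,
          (\int[Pr]_w errB_ (nk k) (mk k) w <= (1 / (2 ^ k.+1)%:R)%:E)%E
        & (\int[Pr]_w errC_ (nk k) (mk k) w <= (1 / (2 ^ k.+1)%:R)%:E)%E] ].
Proof.
move=> FA.
have : forall k, exists nm : nat * nat, [/\ (k <= nm.1)%N, (k < nm.2)%N, mesh s t nm.2 <= k.+1%:R^-1,
    (forall lam, 0 <= lam ->
     Ex (fun w => \1_A w * (v_ nm.1 nm.2 lam nm.2 w * G (Y_ nm.1 nm.2 nm.2 w) - G (X s w))) <=
     Ex (fun w => \1_A w * \sum_(j < nm.2) mesh s t nm.2 * (v_ nm.1 nm.2 lam j.+1 w *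
       ito_drift G G1 G2 r (xi_ nm.1 nm.2 j w) (b_ nm.1 nm.2 j w) (Y_ nm.1 nm.2 j w)))
     + k.+1%:R^-1)
    & [/\ (\int[Pr]_w errA_ nm.1 nm.2 w <= (1 / (2 ^ k.+1)%:R)%:E)%E,
          (\int[Pr]_w errB_ nm.1 nm.2 w <= (1 / (2 ^ k.+1)%:R)%:E)%E
        & (\int[Pr]_w errC_ nm.1 nm.2 w <= (1 / (2 ^ k.+1)%:R)%:E)%E] ].
  move=> k; have e0 : 0 < 1 / (2 ^ k.+1)%:R :> R by rewrite divr_gt0// ltr0n expn_gt0.
  have [n kn [N1 h1]] := errors_small hW r0 mhh aX cX X0 aM cM hS eqX s0 st k e0.
  have k0 : 0 < k.+1%:R^-1 :> R by rewrite invr_gt0.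
  have [N2 h2] := scheme_budget n FA k0.
  pose m := (maxn k (maxn N1 N2)).+1.
  have mk : (k < m)%N by rewrite ltnS leq_maxl.
  have m1 : (N1 < m)%N by rewrite ltnS (leq_trans (leq_maxl _ _) (leq_maxr _ _)).
  have m2 : (N2 < m)%N by rewrite ltnS (leq_trans (leq_maxr _ _) (leq_maxr _ _)).
  have [g1 g2] := h2 m m2.
  exists (n, m); split => //=; exact: h1.
move=> /choice[f hf]; exists (fun k => (f k).1), (fun k => (f k).2); exact: hf.
Qed.

Section limit.
Variables nk mk : nat -> nat.
Hypotheses (hnk : forall k, (k <= nk k)%N) (hmk : forall k, (k < mk k)%N).
Hypothesis hA : forall k, (\int[Pr]_w errA_ (nk k) (mk k) w <= (1 / (2 ^ k.+1)%:R)%:E)%E.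
Hypothesis hB : forall k, (\int[Pr]_w errB_ (nk k) (mk k) w <= (1 / (2 ^ k.+1)%:R)%:E)%E.
Hypothesis hC : forall k, (\int[Pr]_w errC_ (nk k) (mk k) w <= (1 / (2 ^ k.+1)%:R)%:E)%E.

Let mk0 k : (0 < mk k)%N. Proof. exact: leq_ltn_trans (hmk k). Qed.

Let sxi k w := stepf s t (mk k) (fun j => xi_ (nk k) (mk k) j w).
Let sb k w := stepf s t (mk k) (fun j => b_ (nk k) (mk k) j w).
Let sY k w := stepf s t (mk k) (fun j => Y_ (nk k) (mk k) j w).

Lemma selected_paths : {ae Pr, forall w,
  [/\ (\int[mu]_(u in D) ((sxi k w u - hh (X u w)) ^+ 2)%:E)%E @[k --> \oo] --> 0%E,
      {ae mu, forall u, D u -> sY k w u @[k --> \oo] --> X u w},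
      Y_ (nk k) (mk k) (mk k) w @[k --> \oo] --> X t w
    & (\int[mu]_(u in D) ((hh (X u w)) ^+ 2)%:E < +oo)%E]}.
Proof.
have g k w := errors_ge0 r hh X S s t (nk k) (mk k) w.
have sA := @summable_ae_cvg0 _ _ _ Pr setT (fun k => errA_ (nk k) (mk k)) measurableT
  (fun k => measurable_diffusion_error hW S mhh aX cX s0 st (nk k) (mk0 k))
  (fun k w _ => let: And3 a _ _ := g k w in a) hA.
have sB := @summable_ae_cvg0 _ _ _ Pr setT (fun k => errB_ (nk k) (mk k)) measurableT
  (fun k => measurable_path_error hW r S aX cX s0 st (nk k) (mk0 k))
  (fun k w _ => let: And3 _ a _ := g k w in a) hB.
have sC := @summable_ae_cvg0 _ _ _ Pr setT (fun k => errC_ (nk k) (mk k)) measurableT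
  (fun k => measurable_endpoint_error hW r S aX s0 st (nk k) (mk0 k))
  (fun k w _ => let: And3 _ _ a := g k w in a) hC.
apply: filterS3 sA sB (filterI sC H2) => w /(_ I) wA /(_ I) wB [/(_ I) wC wH]; split.
- apply: min1_cvg0; first by move=> k; apply: integral_ge0 => u _; rewrite lee_fin sqr_ge0.
  by apply: nneseries_cvg0 wA => k; have [] := g k w.
- have mX : measurable_fun D (fun u => X u w) by exact: (measurable_path (@cX w)).
  have := @summable_integrals_ae _ TR _ mu D (fun k u => (Num.min 1 `|sY k w u - X u w|)%:E) mD _ _ wB.
  case.
  + move=> k; apply/measurable_EFinP; apply: measurable_minr => //; apply: measurableT_comp => //.
    by apply: measurable_funB => //; exact: measurable_stepf.
  + by move=> k u _; rewrite lee_fin le_min ler01/=.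
  + move=> N [mN N0 hN]; exists N; split => //.
    apply: subset_trans hN; apply: subsetC => u /= hu Du.
    apply: min1_norm_cvg; apply: nneseries_cvg0 (hu Du) => k.
    by rewrite lee_fin le_min ler01/=.
- apply: min1_norm_cvg; apply: nneseries_cvg0 wC => k; by have [] := g k w.
- apply: le_lt_trans (wH t t0); apply: ge0_subset_integral => //.
  + apply/measurable_EFinP; apply: measurable_funX; apply: measurableT_comp => //.
    have h : measurable_fun (`[0, +oo[%classic : set R) (fun u => X u w).
      by apply: subspace_continuous_measurable_fun; [exact: measurable_itv|exact: cX].
    apply: (measurable_funS _ _ h); first exact: measurable_itv.
    by move=> u /=; rewrite !in_itv/= andbT => /andP[].
  + by move=> u _; rewrite lee_fin sqr_ge0.
  + by move=> u /=; rewrite !in_itv/= => /andP[su /ltW ->]; rewrite andbT; exact: le_trans su.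
Qed.

Lemma selected_drift w u : D u -> sb k w u @[k --> \oo] --> r * X u w.
Proof.
move=> Du; have [xM xM0 hx] := path_bound cX X0 s0 st w.
have := stepf_path_cvg s0 st (@cX w) Du => h.
have pk : (mk k).-1 @[k --> \oo] --> \oo.
  apply/cvgnyPge => q; exists q => // k /= qk.
  by rewrite -ltnS prednK// (leq_ltn_trans qk).
have {}h := cvg_comp _ _ pk h.
have {}h : stepf s t (mk k) (fun j => X (gr (mk k) j) w) u @[k --> \oo] --> X u w.
  move: h; apply: cvg_trans; apply: near_eq_cvg; apply: nearW => k /=.
  by rewrite prednK.
 apply: (cvg_trans _ (cvgM (cvg_cst r) h)); apply: near_eq_cvg.
exists (Num.truncn xM).+1 => // k /= hn.
have xn : xM <= (nk k)%:R.
  by apply: le_trans (ltW (truncnS_gt xM)) _; rewrite ler_nat (leq_trans hn).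
have /andP[su ut] : s <= u < t by move: Du; rewrite /= in_itv.
have [j jm hj] := grid_index (mk0 k) su ut.
rewrite /sb !(stepfE st (mk0 k) _ jm hj) /apx_b (min_idPl _)//.
rewrite (le_trans _ xn)// hx// grid_ge ?mesh_gt0//=.
by case/andP: hj => ju _; rewrite (le_trans ju)// ltW.
Qed.

Let XI (p : TR * Omega) : R := X p.1 p.2 * \1_D p.1.

Let mXI : measurable_fun setT XI.
Proof.
apply: measurable_process_joint => // u u0; exact: (measurable_X hW aX).
Qed.

Let XIE u w : D u -> XI (u, w) = X u w.
Proof. by move=> h; rewrite /XI/= indicE mem_set ?mulr1. Qed.

Let XI0 p : 0 <= XI p.
Proof.
rewrite /XI indicE; case: (boolP (p.1 \in _)) => [|_]; last by rewrite mulr0.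
by rewrite inE /= in_itv/= => /andP[su _]; rewrite mulr1 X0// (le_trans s0).
Qed.

Let IH w := (\int[mu]_(u in D) ((hh (XI (u, w))) ^+ 2)%:E)%E.
Let IX w := (\int[mu]_(u in D) (r * XI (u, w))%:E)%E.
(** Eventual bound for the clock [\sum h (xi^2 + b)]. By [xi^2 <= 2 hh^2 + 2 (xi - hh)^2] it is at
    most [2 IH + 2 * (1/2) + IX + 1] once the errors of [xi] and [b] are below [1/2] and [1]. It is
    meaningful on the paths with [IH] finite, hence almost surely, but it has no uniform bound;
    hence the weights. *)
Let L w : R := 2 * fine (IH w) + fine (IX w) + 2.

Let IHge0 w : (0 <= IH w)%E. Proof. by apply: integral_ge0 => u _; rewrite lee_fin sqr_ge0. Qed.
Let IXge0 w : (0 <= IX w)%E. Proof. by apply: integral_ge0 => u _; rewrite lee_fin mulr_ge0. Qed.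

Let L0 w : 0 <= L w.
Proof. by rewrite /L addr_ge0// addr_ge0 ?fine_ge0// mulr_ge0// fine_ge0. Qed.

Let mL : measurable_fun setT L.
Proof.
apply: measurable_funD => //; apply: measurable_funD.
  apply: measurable_funM => //; apply: measurableT_comp => //.
  apply: (@measurable_tonelliD _ _ _ s t (fun p => ((hh (XI p)) ^+ 2)%:E)).
    by apply/measurable_EFinP; apply: measurable_funX; exact: measurableT_comp.
  by move=> p; rewrite lee_fin sqr_ge0.
apply: measurableT_comp => //; apply: (@measurable_tonelliD _ _ _ s t (fun p => (r * XI p)%:E)).
  by apply/measurable_EFinP; exact: measurable_funM.
by move=> p; rewrite lee_fin mulr_ge0.
Qed.

Lemma selected_clock w :
  (\int[mu]_(u in D) ((sxi k w u - hh (X u w)) ^+ 2)%:E)%E @[k --> \oo] --> 0%E ->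
  (\int[mu]_(u in D) ((hh (X u w)) ^+ 2)%:E < +oo)%E ->
  \forall k \near \oo, \sum_(i < mk k) mesh s t (mk k) *
     (xi_ (nk k) (mk k) i w ^+ 2 + b_ (nk k) (mk k) i w) <= L w.
Proof.
move=> cxi hfin; have [xM xM0 hx] := path_bound cX X0 s0 st w.
have mX : measurable_fun D (fun u => X u w) by exact: (measurable_path (@cX w)).
have msb k : measurable_fun D (sb k w) by exact: measurable_stepf.
have msx k : measurable_fun D (sxi k w) by exact: measurable_stepf.
have mrX : measurable_fun D (fun u => r * X u w) by exact: measurable_funM.
have mhX : measurable_fun D (fun u => hh (X u w)) by exact: measurableT_comp.
have Xx u : D u -> 0 <= X u w <= xM.
  rewrite /= in_itv/= => /andP[su ut]; rewrite X0 ?(le_trans s0)//=.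
  by apply: hx; rewrite su ltW.
have sbx k u : D u -> 0 <= sb k w u <= r * xM.
  move=> Du; have /andP[su ut] : s <= u < t by move: Du; rewrite /= in_itv.
  apply: (@stepf_ind _ s t (mk k) st (mk0 k) (fun y => 0 <= y <= r * xM)) => // j jm /andP[ju _].
  have /andP[-> _] /= := apx_b_itv (nk k) j w (mk0 k).
  rewrite /apx_b ler_wpM2l// ge_min hx// grid_ge ?mesh_gt0//=.
  by rewrite (le_trans ju)// ltW.
have mdb k : measurable_fun D (fun u => `|sb k w u - r * X u w|).
  by apply: measurableT_comp => //; exact: measurable_funB.
have cb : (\int[mu]_(u in D) (`|sb k w u - r * X u w|)%:E)%E @[k --> \oo] --> 0%E.
  apply: (@bounded_cvg0 _ TR _ _ _ (fun k u => `|sb k w u - r * X u w|) (r * xM)) => //.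
  - exact: lebesgue_itv_lty.
  - move=> k u Du; rewrite normr_ge0/=; have /andP[a1 a2] := sbx k u Du; have /andP[b1 b2] := Xx u Du.
    by apply: ler_norm_sub => //; [rewrite mulr_ge0|rewrite ler_wpM2l].
  - apply: aeW => u Du; rewrite -(normr0 R); apply: cvg_norm.
    rewrite -(subrr (r * X u w)); apply: cvgB; last exact: cvg_cst.
    exact: selected_drift.
have n1 k : (0 <= \int[mu]_(u in D) ((sxi k w u - hh (X u w)) ^+ 2)%:E)%E.
  by apply: integral_ge0 => u _; rewrite lee_fin sqr_ge0.
have n2 k : (0 <= \int[mu]_(u in D) (`|sb k w u - r * X u w|)%:E)%E.
  by apply: integral_ge0 => u _; rewrite lee_fin.
have half : 0 < 2^-1 :> R by rewrite invr_gt0.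
have h1 := (ecvg0P n1).2 cxi _ half.
have h2 := (ecvg0P n2).2 cb _ ltr01.
near=> k.
have k1 : (\int[mu]_(u in D) ((sxi k w u - hh (X u w)) ^+ 2)%:E <= (2^-1)%:E)%E by near: k; exact: h1.
have k2 : (\int[mu]_(u in D) (`|sb k w u - r * X u w|)%:E <= 1%:E)%E by near: k; exact: h2.
have := @integral_stepf _ s t (mk k) st (mk0 k)
  (fun j => xi_ (nk k) (mk k) j w ^+ 2 + b_ (nk k) (mk k) j w) (mk k) (leqnn _).
rewrite grid_last// => <-; set q := stepf s t _ _.
have qE u : D u -> q u = sxi k w u ^+ 2 + sb k w u.
  rewrite /= in_itv/= => /andP[su ut]; have [j jm hj] := grid_index (mk0 k) su ut.
  by rewrite /q /sxi /sb !(stepfE st (mk0 k) _ jm hj).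
have IHE : IH w = (\int[mu]_(u in D) ((hh (X u w)) ^+ 2)%:E)%E.
  by apply: eq_integral => u; rewrite inE => Du; rewrite XIE.
have IXE : IX w = (\int[mu]_(u in D) (r * X u w)%:E)%E.
  by apply: eq_integral => u; rewrite inE => Du; rewrite XIE.
have IHf : (fine (IH w))%:E = IH w by rewrite fineK// ge0_fin_numE// IHE.
have IXf : (fine (IX w))%:E = IX w.
  rewrite fineK// ge0_fin_numE// IXE; apply: (@le_lt_trans _ _ (\int[mu]_(u in D) (r * xM)%:E)%E).
    apply: ge0_le_integral => //.
    - by move=> u Du; rewrite lee_fin mulr_ge0//; have /andP[] := Xx u Du.
    - exact/measurable_EFinP.
    - by move=> u Du; rewrite lee_fin ler_wpM2l//; have /andP[] := Xx u Du.
  by rewrite integral_cst//= lebesgue_measure_itv/= lte_fin st -EFinB -EFinM ltry.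
have mq : measurable_fun D (fun u => (2 * (hh (X u w)) ^+ 2)%:E).
  by apply/measurable_EFinP; apply: measurable_funM => //; exact: measurable_funX.
have mq2 : measurable_fun D (fun u => (2 * (sxi k w u - hh (X u w)) ^+ 2)%:E).
  apply/measurable_EFinP; apply: measurable_funM => //; apply: measurable_funX.
  exact: measurable_funB.
have mq3 : measurable_fun D (fun u => (r * X u w)%:E) by exact/measurable_EFinP.
have mq4 : measurable_fun D (fun u => (`|sb k w u - r * X u w|)%:E).
  by apply/measurable_EFinP; apply: measurableT_comp => //; exact: measurable_funB.
have g1 u : D u -> (0 <= (2 * (hh (X u w)) ^+ 2)%:E)%E by move=> _; rewrite lee_fin mulr_ge0// sqr_ge0.
have g2 u : D u -> (0 <= (2 * (sxi k w u - hh (X u w)) ^+ 2)%:E)%E.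
  by move=> _; rewrite lee_fin mulr_ge0// sqr_ge0.
have g3 u : D u -> (0 <= (r * X u w)%:E)%E.
  by move=> Du; rewrite lee_fin mulr_ge0//; have /andP[] := Xx u Du.
have g4 u : D u -> (0 <= (`|sb k w u - r * X u w|)%:E)%E by move=> _; rewrite lee_fin.
have hle : (\int[mu]_(u in D) (q u)%:E <= (L w)%:E)%E.
  apply: (@le_trans _ _ (\int[mu]_(u in D) ((2 * (hh (X u w)) ^+ 2)%:E +
    (2 * (sxi k w u - hh (X u w)) ^+ 2)%:E + (r * X u w)%:E + (`|sb k w u - r * X u w|)%:E))%E).
    apply: ge0_le_integral => //.
    - move=> u Du; rewrite lee_fin qE//; have /andP[a _] := sbx k u Du.
      by rewrite addr_ge0 ?sqr_ge0.
    - by apply/measurable_EFinP; exact: measurable_stepf.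
    - by apply: emeasurable_funD => //; apply: emeasurable_funD => //; exact: emeasurable_funD.
    - move=> u Du; rewrite qE// -!EFinD lee_fin.
      have := ler_norm (sb k w u - r * X u w).
      have := sqr_ge0 (sxi k w u - 2 * hh (X u w)).
      set a := sxi k w u; set b := hh _; set n := `|_|; lra.
  rewrite ge0_integralD//; last 2 first.
  - by move=> u Du; rewrite !adde_ge0 ?g1 ?g2 ?g3.
  - by apply: emeasurable_funD => //; exact: emeasurable_funD.
  rewrite ge0_integralD//; last 2 first.
  - by move=> u Du; rewrite !adde_ge0 ?g1 ?g2.
  - exact: emeasurable_funD.
  rewrite ge0_integralD//.
  have Z (f : R -> R) : measurable_fun D f -> (\int[mu]_(u in D) (2 * (f u) ^+ 2)%:E =
      2%:E * \int[mu]_(u in D) ((f u) ^+ 2)%:E)%E.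
    move=> mf; under eq_integral do rewrite EFinM.
    rewrite ge0_integralZl//; first by apply/measurable_EFinP; exact: measurable_funX.
    by move=> u _; rewrite lee_fin sqr_ge0.
  rewrite (Z _ mhX) (Z (fun u => sxi k w u - hh (X u w))); last exact: measurable_funB.
  rewrite -IHE -IXE -IHf -IXf.
  apply: (@le_trans _ _ (2%:E * (fine (IH w))%:E + 2%:E * (2^-1)%:E + (fine (IX w))%:E + 1%:E)%E).
    by apply: leeD => //; apply: leeD => //; apply: leeD => //; exact: lee_wpmul2l.
  by rewrite -!EFinM -!EFinD lee_fin /L; lra.
rewrite -lee_fin; apply: le_trans (hle).
rewrite /Rintegral fineK// ge0_fin_numE//; last first.
  apply: integral_ge0 => u Du; rewrite lee_fin qE//; have /andP[a _] := sbx k u Du.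
  by rewrite addr_ge0 ?sqr_ge0.
by apply: le_lt_trans hle _; rewrite ltry.
Unshelve. all: by end_near. Qed.

Let J w : R := (\int[mu]_(u in D) (expR (- (r * (u - s))) * price_drift (X u w)))%R.
Let ed : R := expR (- (r * (t - s))).

Let mJ : measurable_fun setT J.
Proof.
pose q (p : TR * Omega) := expR (- (r * `|p.1 - s|)) * (price_drift (XI p)).
have mq : measurable_fun setT q.
  apply: measurable_funM; last exact: (measurableT_comp measurable_price_drift).
  apply: measurableT_comp => //; apply: measurableT_comp => //; apply: measurable_funM => //.
  apply: measurableT_comp => //; apply: measurable_funB => //; exact: measurable_fst.
rewrite (_ : J = fun w => \int[mu]_(u in D) q (u, w))%R; last first.
  apply/funext => w; apply: eq_Rintegral => u; rewrite inE => Du; rewrite /q XIE//=.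
  by move: Du; rewrite /= in_itv/= => /andP[su _]; rewrite ger0_norm// subr_ge0.
apply: (@measurable_Rintegral _ _ _ s t q Kk) => // p.
rewrite /q normrM -[leRHS]mul1r ler_pM//; last exact: hk.
by rewrite ger0_norm ?expR_ge0// expR_le1 oppr_le0 mulr_ge0.
Qed.

Let J_bound w : `|J w| <= Kk * (t - s).
Proof.
have sub : D `<=` `[s, t] by move=> u /=; rewrite !in_itv/= => /andP[-> /ltW].
have mX : measurable_fun D (fun u => X u w) by exact: (measurable_path (@cX w)).
have bd u : D u -> `|expR (- (r * (u - s))) * price_drift (X u w)| <= Kk.
  rewrite /= in_itv/= => /andP[su _]; rewrite normrM -[leRHS]mul1r ler_pM//.
    by rewrite ger0_norm ?expR_ge0// expR_le1 oppr_le0 mulr_ge0// subr_ge0.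
  by apply: hk; apply: X0; exact: le_trans su.
have i1 : mu.-integrable D (EFin \o (fun u => expR (- (r * (u - s))) * price_drift (X u w))).
  apply: (itv_integrable_bounded sub mD (C := Kk)) => //.
  apply: measurable_funM; last exact: (measurableT_comp measurable_price_drift).
  apply: measurable_funTS; apply: measurableT_comp => //; apply: measurableT_comp => //.
  by apply: measurable_funM => //; exact: measurable_funB.
have i2 : mu.-integrable D (EFin \o (fun=> Kk : R)).
  by apply: (itv_integrable_bounded sub mD (C := `|Kk|)).
have -> : Kk * (t - s) = (\int[mu]_(u in D) Kk)%R.
  by rewrite Rintegral_cst//= lebesgue_measure_itv/= lte_fin st -EFinB.
apply: le_trans (le_normr_Rintegral _ i1) _ => //.
by apply: le_Rintegral => //; have := integrable_abse i1; apply.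
Qed.

Let Psi lam k w := \sum_(j < mk k) mesh s t (mk k) * (v_ (nk k) (mk k) lam j.+1 w *
   ito_drift G G1 G2 r (xi_ (nk k) (mk k) j w) (b_ (nk k) (mk k) j w) (Y_ (nk k) (mk k) j w)).
Let Val lam k w := v_ (nk k) (mk k) lam (mk k) w * G (Y_ (nk k) (mk k) (mk k) w).
(** Gap between the weighted discrete quantities and the discounted continuous ones. It does not
    vanish as [k] grows, since the weights keep the factor [exp (- lam * clock)]. That bias is at
    most [cc * (1 - exp (- lam L))]; [Exc] is the part of the gap beyond it, and does vanish. *)
Let Del lam k w := (Val lam k w - Psi lam k w) - (ed * G (X t w) - J w).
Let cc := Kg + Kk * (t - s).
Let Exc lam k w := Num.max 0 (`|Del lam k w| - cc * (1 - expR (- (lam * L w)))).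

Let nG y : `|G y| <= Kg.
Proof. by rewrite ger0_norm; [exact: (tf_le hG)|exact: (tf_ge0 hG)]. Qed.

Let mxi k j : measurable_fun setT (xi_ (nk k) (mk k) j).
Proof. by apply: (Fm_measurable hW (t := gr (mk k) j)); exact: apx_xi_Fm. Qed.
Let mb k j : measurable_fun setT (b_ (nk k) (mk k) j).
Proof.
apply: (Fm_measurable hW (t := gr (mk k) j)); exact: (apx_b_Fm r aX s0 st (nk k) (mk0 k)).
Qed.
Let mY k j : measurable_fun setT (Y_ (nk k) (mk k) j).
Proof. exact: (measurable_apx_Y hW r S aX s0 st (nk k) j (mk0 k)). Qed.

Let mv lam k j : measurable_fun setT (v_ (nk k) (mk k) lam j).
Proof.
apply: measurableT_comp => //; apply: measurableT_comp => //.
apply: measurable_sum => i; apply: measurable_funM => //; apply: measurable_funD => //.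
apply: measurable_funM => //; apply: measurable_funD => //; exact: measurable_funX.
Qed.

Let mPsi lam k : measurable_fun setT (Psi lam k).
Proof.
apply: measurable_sum => i; apply: measurable_funM => //; apply: measurable_funM => //.
exact: mgen.
Qed.

Let mVal lam k : measurable_fun setT (Val lam k).
Proof. by apply: measurable_funM => //; exact: (measurableT_comp mG). Qed.

Let mXt u : 0 <= u -> measurable_fun setT (fun w => G (X u w)).
Proof. by move=> u0; apply: (measurableT_comp mG); exact: (measurable_X hW aX). Qed.

Let mDel lam k : measurable_fun setT (Del lam k).
Proof.
apply: measurable_funB; first exact: measurable_funB.
by apply: measurable_funB => //; apply: measurable_funM => //; exact: mXt.
Qed.

Let mexpL lam : measurable_fun setT (fun w => 1 - expR (- (lam * L w))).
Proof.
apply: measurable_funB => //; apply: measurableT_comp => //; apply: measurableT_comp => //.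
exact: measurable_funM.
Qed.

Let expL_itv lam w : 0 <= lam -> 0 <= 1 - expR (- (lam * L w)) <= 1.
Proof.
move=> l0; rewrite subr_ge0 expR_le1 oppr_le0 mulr_ge0//= lerBlDr lerDl; exact: expR_ge0.
Qed.

Let ed_itv : 0 <= ed <= 1.
Proof. by rewrite /ed expR_ge0 expR_le1 oppr_le0 mulr_ge0// ltW. Qed.

Let bk0 k j w : (j < mk k)%N -> 0 <= b_ (nk k) (mk k) j w.
Proof. by move=> _; have /andP[] := apx_b_itv (nk k) j w (mk0 k). Qed.

Let cc0 : 0 <= cc. Proof. by rewrite addr_ge0// mulr_ge0// ltW. Qed.

Let Val_bound lam k w : 0 <= lam -> `|Val lam k w| <= Kg.
Proof.
move=> l0; rewrite /Val normrM -[leRHS]mul1r ler_pM//.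
have /andP[a c] := @weight_itv _ _ _ s t r lam (mk k) (b_ (nk k) (mk k)) (xi_ (nk k) (mk k))
  st (mk0 k) r0 l0 (@bk0 k) (mk k) w (leqnn _).
by rewrite ger0_norm.
Qed.

Let gen_bound x b y : 0 <= b -> `|ito_drift G G1 G2 r x b y| <= Kg * (x ^+ 2 + b) + r * Kg.
Proof.
move=> b0; rewrite /ito_drift (le_trans (ler_normB _ _))// lerD//.
  have e1 : `|b * G1 y| = b * `|G1 y| by rewrite normrM (ger0_norm b0).
  have e2 : `|2^-1 * x ^+ 2 * G2 y| = 2^-1 * x ^+ 2 * `|G2 y|.
    by rewrite normrM ger0_norm// mulr_ge0 ?invr_ge0// sqr_ge0.
  rewrite (le_trans (ler_normD _ _))// e1 e2.
  have := ler_wpM2l b0 (tf_le1 hG y); have := ler_wpM2l (sqr_ge0 x) (tf_le2 hG y).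
  have := mulr_ge0 Kg0 (sqr_ge0 x); lra.
by rewrite normrM (ger0_norm r0) ler_wpM2l.
Qed.

(** The purpose of the weights: a bound independent of [k] and of the path, of order [1 / lam] by
    [weighted_sum_le], for a sum that otherwise is only bounded by the clock of the path. *)
Let Psi_bound lam k w : 0 < lam -> `|Psi lam k w| <= Kg * lam^-1 + r * Kg * (t - s).
Proof.
move=> l0; have hp : 0 < mesh s t (mk k) by exact: mesh_gt0.
have wv j : (j <= mk k)%N -> 0 <= v_ (nk k) (mk k) lam j w <= 1.
  by move=> jm; exact: (@weight_itv _ _ _ s t r lam (mk k) (b_ (nk k) (mk k)) (xi_ (nk k) (mk k))
  st (mk0 k) r0 (ltW l0) (@bk0 k) j w jm).
apply: (le_trans (ler_norm_sum _ _ _)).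
apply: (@le_trans _ _ (\sum_(j < mk k) (Kg * (mesh s t (mk k) * (v_ (nk k) (mk k) lam j.+1 w *
   (xi_ (nk k) (mk k) j w ^+ 2 + b_ (nk k) (mk k) j w))) + mesh s t (mk k) * (r * Kg)))).
  apply: ler_sum => j _; have /andP[v0 v1] := wv j.+1 (ltn_ord j).
  have bj := bk0 w (ltn_ord j).
  rewrite normrM (gtr0_norm hp) normrM (ger0_norm v0).
  set v := weight _ _ _ _ _ _ _ in v0 v1 *; set x := xi_ _ _ _ _; set b := b_ _ _ _ _ in bj *.
  set y := Y_ _ _ _ _.
  have hg : `|ito_drift G G1 G2 r x b y| <= Kg * (x ^+ 2 + b) + r * Kg.
    exact: gen_bound.
  have := ler_wpM2l v0 hg => h.
  have : v * (r * Kg) <= r * Kg by rewrite ler_piMl// mulr_ge0.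
  move=> h2; have : v * `|ito_drift G G1 G2 r x b y| <= Kg * (v * (x ^+ 2 + b)) + r * Kg by lra.
  by move=> h3; have := ler_wpM2l (ltW hp) h3; lra.
rewrite big_split/= -mulr_sumr lerD//.
  rewrite ler_wpM2l//.
  have bB j w' : (j < mk k)%N -> 0 <= b_ (nk k) (mk k) j w' <= r * (nk k)%:R.
    by move=> _; exact: apx_b_itv.
  exact: (weighted_sum_le (xi_ (nk k) (mk k)) hp r0 (ltW l0) bB w l0).
by rewrite sumr_const card_ord -mulr_natl mulrA mesh_sum// mulrC.
Qed.

Let Cl lam := (Kg + (Kg * lam^-1 + r * Kg * (t - s))) + (Kg + Kk * (t - s)).

Let Del_bound lam k w : 0 < lam -> `|Del lam k w| <= Cl lam.
Proof.
move=> l0; rewrite /Del (le_trans (ler_normB _ _))// lerD// (le_trans (ler_normB _ _))// lerD//.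
- by apply: Val_bound; exact: ltW.
- exact: Psi_bound.
- rewrite normrM -[leRHS]mul1r ler_pM//; case/andP: ed_itv => a c; by rewrite ger0_norm.
Qed.

Let Exc_itv lam k w : 0 < lam -> 0 <= Exc lam k w <= Cl lam.
Proof.
move=> l0; have Db := Del_bound k w l0.
rewrite /Exc le_max lexx/= ge_max (le_trans _ Db)//=.
have /andP[a _] := expL_itv w (ltW l0); have := mulr_ge0 cc0 a; lra.
Qed.

(** Pathwise along the selected sequence: [path_cvg] deals with the drift without weights, and both
    weight comparisons apply as soon as the clock is below [L w]. *)
Let Exc_cvg lam : 0 < lam -> {ae Pr, forall w, Exc lam k w @[k --> \oo] --> 0}.
Proof.
move=> l0; apply: filterS selected_paths => w [cxi cY cend hfin].
have [xM xM0 hx] := path_bound cX X0 s0 st w.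
have mX : measurable_fun D (fun u => X u w) by exact: (measurable_path (@cX w)).
have Xx u : D u -> 0 <= X u w <= xM.
  rewrite /= in_itv/= => /andP[su ut]; rewrite X0 ?(le_trans s0)//=.
  by apply: hx; rewrite su ltW.
have nX u : D u -> `|X u w| <= xM by move=> /Xx /andP[a c]; rewrite ger0_norm.
have mst f k : measurable_fun D (stepf s t (mk k) f) by exact: measurable_stepf.
have sbx k u : D u -> `|sb k w u| <= r * xM.
  move=> Du; have /andP[su ut] : s <= u < t by move: Du; rewrite /= in_itv.
  apply: (@stepf_ind _ s t (mk k) st (mk0 k) (fun y => `|y| <= r * xM)) => // j jm /andP[ju _].
  have /andP[a _] /= := apx_b_itv (nk k) j w (mk0 k); rewrite ger0_norm//.
  rewrite /apx_b ler_wpM2l// ge_min hx// grid_ge ?mesh_gt0//=.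
  by rewrite (le_trans ju)// ltW.
have mhX : measurable_fun D (fun u => hh (X u w)) by exact: measurableT_comp.
have := @path_cvg _ G G1 G2 Kg hG r s t r0 (fun k => sxi k w) (fun k => sb k w) (fun k => sY k w)
  (fun u => hh (X u w)) (fun u => X u w) xM (r * xM) (fun k => mst _ k) (fun k => mst _ k)
  (fun k => mst _ k) mhX mX nX sbx (fun u Du => @selected_drift w u Du) cY cxi hfin.
set E := fun k => (\int[mu]_(u in D) _)%E => cE.
have clk := selected_clock cxi hfin.
have cI : fine (E k) @[k --> \oo] --> 0 by move/fine_cvg : cE.
have cG : `|G (Y_ (nk k) (mk k) (mk k) w) - G (X t w)| @[k --> \oo] --> 0.
  rewrite -(normr0 R); apply: cvg_norm; rewrite -(subrr (G (X t w))); apply: cvgB; last exact: cvg_cst.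
  exact: (cvg_comp _ _ cend (tf_cG hG (x := X t w))).
have cm : Kk * (t - s) * r * mesh s t (mk k) @[k --> \oo] --> 0.
  rewrite -(mulr0 (Kk * (t - s) * r)); apply: cvgM; first exact: cvg_cst.
  apply/cvgrPdist_le => e e0; have [N hN] := mesh_lt st e0; exists N => // k /= Nk.
  rewrite sub0r normrN ger0_norm ?ltW ?mesh_gt0//; apply: hN; exact: leq_ltn_trans (hmk k).
apply: (@squeeze_cvgr _ _ _ _ (cst 0) (fun k => fine (E k) + `|G (Y_ (nk k) (mk k) (mk k) w) - G (X t w)|
   + Kk * (t - s) * r * mesh s t (mk k))); last 2 first.
- exact: cvg_cst.
- rewrite -[0 in X in _ --> X](addr0 0) -[0 in X in _ --> X + _](addr0 0).
  by apply: cvgD => //; exact: cvgD.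
apply: filterS clk => k hL; rewrite /Exc le_max lexx/= ge_max; apply/andP; split.
  rewrite addr_ge0// ?mulr_ge0// ?(ltW ts0) ?(ltW (mesh_gt0 _ _))// addr_ge0// fine_ge0//.
  by apply: integral_ge0 => u _; rewrite lee_fin.
have hbk := @bk0 k.
have i1 := @weighted_sum_close _ _ _ s t r lam (mk k) (b_ (nk k) (mk k)) (xi_ (nk k) (mk k))
  st (mk0 k) r0 (ltW l0) hbk (fun u => price_drift (X u w)) Kk w
  (fun j => ito_drift G G1 G2 r (xi_ (nk k) (mk k) j w) (b_ (nk k) (mk k) j w) (Y_ (nk k) (mk k) j w))
  (measurableT_comp measurable_price_drift mX) (fun u Du => hk (let: conj a _ := andP (Xx u Du) in a)) (L w) hL.
have i2 := @weight_close _ _ _ s t r lam (mk k) (b_ (nk k) (mk k)) (xi_ (nk k) (mk k))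
  st (mk0 k) r0 (ltW l0) hbk (mk k) w (r * (t - s)) (L w) (leqnn _) (mulr_ge0 r0 (ltW ts0)) hL.
rewrite mesh_sum// subrr normr0 addr0 in i2.
have EE : (\int[mu]_(u in D) `|stepf s t (mk k) (fun j => ito_drift G G1 G2 r (xi_ (nk k) (mk k) j w)
   (b_ (nk k) (mk k) j w) (Y_ (nk k) (mk k) j w)) u - price_drift (X u w)|)%R = fine (E k).
  rewrite /Rintegral /E; congr fine; apply: eq_integral => u; rewrite inE => Du.
  have /andP[su ut] : s <= u < t by move: Du; rewrite /= in_itv.
  have [j jm hj] := grid_index (mk0 k) su ut.
  by rewrite /sxi /sb /sY !(stepfE st (mk0 k) _ jm hj).
rewrite EE -/(Psi lam k w) -/(J w) in i1; rewrite -/ed in i2.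
set g := 1 - expR (- (lam * L w)) in i1 i2 *.
have /andP[v0 v1] := @weight_itv _ _ _ s t r lam (mk k) (b_ (nk k) (mk k)) (xi_ (nk k) (mk k))
  st (mk0 k) r0 (ltW l0) hbk (mk k) w (leqnn _).
have i3 : `|Val lam k w - ed * G (X t w)| <=
    `|G (Y_ (nk k) (mk k) (mk k) w) - G (X t w)| + g * Kg.
  rewrite /Val; set v := weight _ _ _ _ _ _ _ in v0 v1 i2 *; set y := G (Y_ _ _ _ _).
  have -> : v * y - ed * G (X t w) = v * (y - G (X t w)) + (v - ed) * G (X t w) by ring.
  rewrite (le_trans (ler_normD _ _))// !normrM (ger0_norm v0) lerD//; first by rewrite ler_piMl.
  by rewrite ler_pM.
have -> : Del lam k w = (Val lam k w - ed * G (X t w)) - (Psi lam k w - J w).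
  by rewrite /Del; ring.
have i4 := ler_normB (Val lam k w - ed * G (X t w)) (Psi lam k w - J w).
by rewrite lerBlDr (le_trans i4)//; rewrite /cc; lra.
Qed.

(** The order of limits matters. For fixed [lam], the [Exc] are bounded by [Cl lam], so they
    disappear in mean as [k] grows and leave the mean bias. Then [lam = 1 / (i + 1)] tends to [0],
    and the bias, dominated by [1] and vanishing because [L w] is a real number, disappears as
    well. *)
Lemma dynkin_limit A : measurable A ->
  (forall k lam, 0 <= lam -> Ex (fun w => \1_A w * (Val lam k w - G (X s w))) <=
     Ex (fun w => \1_A w * Psi lam k w) + k.+1%:R^-1) ->
  Ex (fun w => \1_A w * (ed * G (X t w) - G (X s w))) <= Ex (fun w => \1_A w * J w).
Proof.
move=> mA hbudget.
have mi : measurable_fun setT (\1_A : Omega -> R) by exact: measurable_indic.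
have i1 w : `|\1_A w : R| <= 1 by rewrite indicE; case: (_ \in _); rewrite ?normr1 ?normr0.
have b1 (U : Omega -> R) C : measurable_fun setT U -> (forall w, `|U w| <= C) ->
    Pr.-integrable setT (EFin \o (fun w => \1_A w * U w)).
  move=> mU UC; apply: (@L1_bounded _ _ _ _ _ C); first exact: measurable_funM.
  by move=> w; rewrite normrM -[leRHS]mul1r ler_pM.
have edG w : `|ed * G (X t w)| <= Kg.
  by rewrite normrM -[leRHS]mul1r ler_pM//; case/andP: ed_itv => a c; rewrite ger0_norm.
have iT : Pr.-integrable setT (EFin \o (fun w => \1_A w * (ed * G (X t w) - G (X s w)))).
  apply: (b1 _ (Kg + Kg)); last by move=> w; rewrite (le_trans (ler_normB _ _))// lerD.
  by apply: measurable_funB; [apply: measurable_funM => //; exact: mXt|exact: mXt].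
have iJ := b1 J _ mJ J_bound.
have step lam k : 0 < lam ->
    Ex (fun w => \1_A w * (ed * G (X t w) - G (X s w))) - Ex (fun w => \1_A w * J w) <=
    k.+1%:R^-1 + Ex (Exc lam k) + cc * Ex (fun w => 1 - expR (- (lam * L w))).
  move=> l0.
  have iV : Pr.-integrable setT (EFin \o (fun w => \1_A w * (Val lam k w - G (X s w)))).
    apply: (b1 _ (Kg + Kg)); first by apply: measurable_funB => //; exact: mXt.
    by move=> w; rewrite (le_trans (ler_normB _ _))// lerD// Val_bound// ltW.
  have iP := b1 (Psi lam k) _ (mPsi lam k) (fun w => Psi_bound k w l0).
  have iD := b1 (Del lam k) _ (mDel lam k) (fun w => Del_bound k w l0).
  have iE : Pr.-integrable setT (EFin \o Exc lam k).
    apply: (@L1_bounded _ _ _ _ _ (Cl lam)).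
      apply: measurable_maxr => //; apply: measurable_funB; first exact: measurableT_comp.
      exact: measurable_funM.
    by move=> w; have /andP[a c] := Exc_itv k w l0; rewrite ger0_norm.
  have iL : Pr.-integrable setT (EFin \o (fun w => 1 - expR (- (lam * L w)))).
    apply: (@L1_bounded _ _ _ _ _ 1) => // w.
    by have /andP[a c] := expL_itv w (ltW l0); rewrite ger0_norm.
  have -> : (fun w => \1_A w * (ed * G (X t w) - G (X s w))) = (fun w =>
     (\1_A w * (Val lam k w - G (X s w)) - (\1_A w * Psi lam k w - \1_A w * J w)) - \1_A w * Del lam k w).
    by apply/funext => w; rewrite /Del; ring.
  have iPJ := L1B iP iJ.
  have iVPJ := L1B iV iPJ.
  rewrite (ExB iVPJ iD) (ExB iV iPJ) (ExB iP iJ).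
  have h1 : - Ex (fun w => \1_A w * Del lam k w) <=
      Ex (fun w => Exc lam k w + cc * (1 - expR (- (lam * L w)))).
    have -> : - Ex (fun w => \1_A w * Del lam k w) = Ex (fun w => -1 * (\1_A w * Del lam k w)).
      by rewrite (ExZ _ iD) mulN1r.
    apply: Ex_le; [exact: L1Z|by apply: L1D => //; exact: L1Z|].
    move=> w; have h2 : `|Del lam k w| - cc * (1 - expR (- (lam * L w))) <= Exc lam k w.
      by rewrite /Exc le_max lexx orbT.
    have : -1 * (\1_A w * Del lam k w) <= `|Del lam k w|.
      rewrite mulN1r -mulrN (le_trans (ler_norm _))// normrM normrN ler_piMl//.
    by move: h2; lra.
  rewrite (ExD iE (L1Z cc iL)) (ExZ cc iL) in h1.
  have hb := hbudget k lam (ltW l0).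
  exact: (budget_combine _ hb h1).
have step2 lam : 0 < lam ->
    Ex (fun w => \1_A w * (ed * G (X t w) - G (X s w))) - Ex (fun w => \1_A w * J w) <=
    cc * Ex (fun w => 1 - expR (- (lam * L w))).
  move=> l0.
  have cE : Ex (Exc lam k) @[k --> \oo] --> Ex (fun=> 0).
    apply: (@Ex_dct _ _ _ _ _ _ (Cl lam)) => //.
    - move=> k; apply: measurable_maxr => //; apply: measurable_funB; first exact: measurableT_comp.
      exact: measurable_funM.
    - by move=> k w; have /andP[a c] := Exc_itv k w l0; rewrite ger0_norm.
    - exact: Exc_cvg.
  rewrite Ex_cst in cE.
  have c1 : k.+1%:R^-1 + Ex (Exc lam k) + cc * Ex (fun w => 1 - expR (- (lam * L w)))
     @[k --> \oo] --> 0 + 0 + cc * Ex (fun w => 1 - expR (- (lam * L w))).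
    apply: cvgD; last exact: cvg_cst.
    apply: cvgD => //; exact: cvg_harmonic.
  rewrite !add0r in c1.
  by apply: (cvg_seq_ge c1) => k; exact: step.
have cL : Ex (fun w => 1 - expR (- (i.+1%:R^-1 * L w))) @[i --> \oo] --> Ex (fun=> 0).
  apply: (@Ex_dct _ _ _ _ _ _ 1) => //.
  - move=> i w; have i0 : 0 <= i.+1%:R^-1 :> R by rewrite invr_ge0.
    by have /andP[a c] := expL_itv w i0; rewrite ger0_norm.
  - apply: aeW => w; rewrite -(subrr (1 : R)); apply: cvgB; first exact: cvg_cst.
    have e0 : expR (- (0 * L w)) = 1 by rewrite mul0r oppr0 expR0.
    rewrite -[X in _ --> X]e0.
    apply: continuous_cvg; first exact: continuous_expR.
    apply: cvgN; apply: cvgM; last exact: cvg_cst.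
    exact: cvg_harmonic.
rewrite Ex_cst in cL.
rewrite -subr_le0.
have c2 : cc * Ex (fun w => 1 - expR (- (i.+1%:R^-1 * L w))) @[i --> \oo] --> cc * 0.
  by apply: cvgM => //; exact: cvg_cst.
rewrite mulr0 in c2.
apply: (cvg_seq_ge c2) => i; apply: step2.
by rewrite invr_gt0.
Qed.

End limit.

Lemma dynkin_le A : Fil s A ->
  Ex (fun w => \1_A w * (expR (- (r * (t - s))) * G (X t w) - G (X s w))) <=
  Ex (fun w => \1_A w * (\int[mu]_(u in D) (expR (- (r * (u - s))) * price_drift (X u w)))%R).
Proof.
move=> FA; have [nk [mk h]] := good_sequence FA.
apply: (@dynkin_limit nk mk); try by move=> k; have [? ? ? ? []] := h k.
- by apply: (filt_measurable hW FA).
Qed.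

End dynkin_inequality.

(** * Smooth test functions *)

Section positive_powers.
Context {R : realType}.

Definition ppow (n : nat) (u : R) : R := Num.max u 0 ^+ n.

Lemma continuous_ppow n : continuous (ppow n).
Proof.
have cm : continuous (fun u : R => Num.max u 0).
  have -> : (fun u : R => Num.max u 0) = (fun u => (u + `|u|) * 2^-1).
    apply/funext => u; case: (leP u 0) => u0.
      by rewrite ler0_norm// subrr mul0r.
    by rewrite gtr0_norm//; field.
  move=> u; apply: cvgM; last exact: cvg_cst.
  by apply: cvgD; [exact: cvg_id|apply: cvg_norm; exact: cvg_id].
elim: n => [|n ih].
  by rewrite (_ : ppow 0 = cst 1)//; exact: cst_continuous.
rewrite (_ : ppow n.+1 = fun u => Num.max u 0 * ppow n u); last first.
  by apply/funext => u; rewrite /ppow exprS.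
by move=> u; apply: cvgM; [exact: cm|exact: ih].
Qed.

(** Away from [0] the function is locally zero or a power. At [0] its difference quotient is
    [ppow n.+1], which is continuous, so Caratheodory's criterion applies. *)
Lemma is_derive_ppow n (u : R) : is_derive u 1 (ppow n.+2) (n.+2%:R * ppow n.+1 u).
Proof.
have [u0|u0|->] := ltgtP u 0.
- apply: (@near_eq_is_derive _ _ _ (cst 0)).
    near=> v; rewrite /ppow (max_idPr _) ?expr0n//.
    by near: v; apply: filterS (lt_nbhsl u0) => v /ltW.
  by rewrite /ppow (max_idPr (ltW u0)) expr0n mulr0; exact: is_derive_cst.
- apply: (@near_eq_is_derive _ _ _ ((id : R -> R) ^+ n.+2)).
    near=> v; rewrite /ppow (max_idPl _) ?exprfctE//.
    by near: v; apply: filterS (lt_nbhsr u0) => v /ltW.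
  rewrite /ppow (max_idPl (ltW u0)).
  have := @is_deriveX _ _ (id : R -> R) n.+2 u 1 1 (is_derive_id _ _).
  by rewrite /= [X in is_derive _ _ _ X]mulr1.
- apply/is_derive1_caratheodory; exists (ppow n.+1); split.
  + move=> z; rewrite /ppow maxxx expr0n subr0 subr0 exprSr.
    by case: (leP z 0) => // _; rewrite expr0n !mul0r.
  + exact: continuous_ppow.
  + by rewrite /ppow maxxx !expr0n mulr0.
Unshelve. all: by end_near. Qed.

End positive_powers.

Section spline.
Context {R : realType}.
Variable w : R.
Hypothesis w0 : 0 < w.

(* A convex C^2 regularisation of u |-> u^+: its second derivative is the hat
   function of mass 1 supported in [0, 2w]. *)
Definition spl (u : R) : R :=
  (6 * w ^+ 2)^-1 * (ppow 3 u - 2 * ppow 3 (u - w) + ppow 3 (u - 2 * w)).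
Definition spl1 (u : R) : R :=
  (2 * w ^+ 2)^-1 * (ppow 2 u - 2 * ppow 2 (u - w) + ppow 2 (u - 2 * w)).
Definition spl2 (u : R) : R :=
  (w ^+ 2)^-1 * (ppow 1 u - 2 * ppow 1 (u - w) + ppow 1 (u - 2 * w)).

Let is_derive_comb n (c k : R) (u : R) :
  k = n.+2%:R * c ->
  is_derive u 1 (fun u => c * (ppow n.+2 u - 2 * ppow n.+2 (u - w) + ppow n.+2 (u - 2 * w)))
    (k * (ppow n.+1 u - 2 * ppow n.+1 (u - w) + ppow n.+1 (u - 2 * w))).
Proof.
move=> ->.
have sh (a : R) : is_derive u 1 (fun u => ppow n.+2 (u - a)) (n.+2%:R * ppow n.+1 (u - a)).
  have h1 : is_derive u 1 (fun u : R => u - a) 1.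
    have := is_deriveB (is_derive_id u (1 : R)) (is_derive_cst a u (1 : R)); rewrite subr0; apply.
  have h2 := is_derive_ppow n (u - a).
  have := @is_derive1_comp _ (ppow n.+2) (fun u : R => u - a) u _ _ h2 h1.
  by rewrite mulr1; apply.
have h := is_deriveZ c (is_deriveD (is_deriveB (is_derive_ppow n u) (is_deriveZ 2 (sh w))) (sh (2 * w))).
apply: (is_derive_eq h); rewrite /GRing.scale/=; ring.
Qed.

Lemma is_derive_spl (u : R) : is_derive u 1 spl (spl1 u).
Proof. by apply: is_derive_comb; field; rewrite gt_eqF. Qed.

Lemma is_derive_spl1 (u : R) : is_derive u 1 spl1 (spl2 u).
Proof. by apply: is_derive_comb; field; rewrite gt_eqF. Qed.

Let sh_cont (a : R) n : continuous (fun u : R => ppow n (u - a)).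
Proof.
move=> u; apply: (@continuous_comp _ _ _ (fun u : R => u - a) (ppow n)); last exact: continuous_ppow.
by apply: cvgB; [exact: cvg_id|exact: cvg_cst].
Qed.

Lemma continuous_spl2 : continuous spl2.
Proof.
move=> u; apply: cvgM; first exact: cvg_cst.
apply: cvgD; last exact: sh_cont.
apply: cvgB; first exact: continuous_ppow.
by apply: cvgM; [exact: cvg_cst|exact: sh_cont].
Qed.

Lemma spl2_ge0 u : 0 <= spl2 u.
Proof.
rewrite /spl2 mulr_ge0 ?invr_ge0 ?sqr_ge0// /ppow !expr1.
by case: (leP u 0); case: (leP (u - w) 0); case: (leP (u - 2 * w) 0) => *; lra.
Qed.

Lemma spl_neg u : u <= 0 -> [/\ spl u = 0, spl1 u = 0 & spl2 u = 0].
Proof.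
have p := w0; move=> u0; rewrite /spl /spl1 /spl2 /ppow (max_idPr u0) !(max_idPr _); last 2 first.
- lra.
- lra.
by split; rewrite !expr0n/=; ring.
Qed.

Lemma spl_large u : 2 * w <= u -> [/\ spl u = u - w, spl1 u = 1 & spl2 u = 0].
Proof.
move=> wu; have p := w0; rewrite /spl /spl1 /spl2 /ppow !(max_idPl _); last 3 first.
- lra.
- lra.
- lra.
by split; field; rewrite gt_eqF.
Qed.

Lemma spl1_itv u : 0 <= spl1 u <= 1.
Proof.
have p := w0; have w2 : 0 < 2 * w ^+ 2 by rewrite mulr_gt0// exprn_gt0.
have [u0|u0] := leP u 0; first by have [_ -> _] := spl_neg u0; rewrite lexx ler01.
have [uw|uw] := leP (2 * w) u; first by have [_ -> _] := spl_large uw; rewrite lexx ler01.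
have z0 : Num.max (u - 2 * w) 0 = 0 by rewrite (max_idPr _)//; lra.
rewrite /spl1 mulrC divr_ge0 ?ler_pdivrMr ?(ltW w2) ?mul1r// /ppow (max_idPl (ltW u0)) z0 expr0n/= addr0.
  by case: (leP (u - w) 0) => h; rewrite ?expr0n/=; nra.
by case: (leP (u - w) 0) => h; rewrite ?expr0n/=; nra.
Qed.

End spline.

Section mean_value.
Context {R : realType}.

Lemma mvt_pos (f df : R -> R) (a b : R) : (forall u : R, a <= u <= b -> is_derive u 1 f (df u)) ->
  a <= b -> exists2 c, a <= c <= b & f b - f a = df c * (b - a).
Proof.
move=> hf; rewrite le_eqVlt => /orP[/eqP <-|ab].
  by exists a; rewrite ?lexx// !subrr mulr0.
have [|| c cab e] := @MVT R f df a b ab.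
- by move=> u; rewrite in_itv/= => /andP[/ltW au /ltW ub]; apply: hf; rewrite au.
- apply: derivable_within_continuous => u; rewrite in_itv/= => hu.
  by have [] := hf u hu.
by exists c => //; move: cab; rewrite in_itv/= => /andP[/ltW -> /ltW ->].
Qed.

Lemma mvt0 (f df : R -> R) (z : R) : (forall u : R, is_derive u 1 f (df u)) ->
  exists c, [/\ f z - f 0 = df c * z, `|c| <= `|z| & 0 <= c * z].
Proof.
move=> hf; have [z0|z0] := leP 0 z.
  have [c /andP[c0 cz] e] := mvt_pos (fun u _ => hf u) z0.
  by exists c; rewrite e subr0 !ger0_norm// mulr_ge0.
have [c /andP[c0 cz] e] := mvt_pos (fun u _ => hf u) (ltW z0).
exists c; rewrite !ler0_norm ?(ltW z0)// lerN2 mulr_le0 ?(ltW z0)//; split => //.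
by apply: oppr_inj; rewrite opprB e; ring.
Qed.

(** Let [k] be [f] minus the quadratic majorant, so that [k] and [k1] vanish at [0]. Two mean values
    give [k z = k2 b * (a * z)] with [k2 b <= 0], and [mvt0] records [0 <= a * z], which settles
    both signs of [z] at once. *)
Lemma taylor2 (f f1 f2 : R -> R) (y z c : R) :
  (forall u : R, is_derive u 1 f (f1 u)) -> (forall u : R, is_derive u 1 f1 (f2 u)) ->
  (forall v, `|v| <= `|z| -> f2 (y + v) - f2 y <= 2 * c) ->
  f (y + z) <= f y + f1 y * z + 2^-1 * f2 y * z ^+ 2 + c * z ^+ 2.
Proof.
move=> d1 d2 hc.
pose k v := f (y + v) - (f y + f1 y * v + (2^-1 * f2 y + c) * v ^+ 2).
pose k1 v := f1 (y + v) - (f1 y + (f2 y + 2 * c) * v).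
pose k2 v := f2 (y + v) - (f2 y + 2 * c).
have sh (g g1 : R -> R) (v : R) : (forall u : R, is_derive u 1 g (g1 u)) ->
    is_derive v 1 (fun v => g (y + v)) (g1 (y + v)).
  move=> hg; have h1 : is_derive v 1 (fun v : R => y + v) 1.
    have := is_deriveD (is_derive_cst y v (1 : R)) (is_derive_id v (1 : R)); rewrite add0r; apply.
  have := @is_derive1_comp _ g (fun v : R => y + v) v _ _ (hg (y + v)) h1.
  by rewrite mulr1; apply.
have dk (v : R) : is_derive v 1 k (k1 v).
  have h := is_deriveB (sh f f1 v d1) (is_deriveD (is_deriveD (is_derive_cst (f y) v (1 : R))
    (is_deriveZ (f1 y) (is_derive_id v (1 : R))))
    (is_deriveZ (2^-1 * f2 y + c) (@is_deriveX _ _ (id : R -> R) 2 v 1 1 (is_derive_id _ _)))).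
  by apply: (is_derive_eq h); rewrite /k1 /GRing.scale/= expr1; field.
have dk1 (v : R) : is_derive v 1 k1 (k2 v).
  have h := is_deriveB (sh f1 f2 v d2) (is_deriveD (is_derive_cst (f1 y) v (1 : R))
    (is_deriveZ (f2 y + 2 * c) (is_derive_id v (1 : R)))).
  by apply: (is_derive_eq h); rewrite /k2 /GRing.scale/=; ring.
have [a [ea az a0]] := mvt0 z dk.
have [b [eb ba b0]] := mvt0 a dk1.
have k00 : k 0 = 0 by rewrite /k addr0 expr0n/=; ring.
have k10 : k1 0 = 0 by rewrite /k1 addr0; ring.
rewrite k00 subr0 in ea; rewrite k10 subr0 in eb.
have kb : k2 b <= 0 by have := hc b (le_trans ba az); rewrite /k2; lra.
have : k z <= 0 by rewrite ea eb -mulrA mulr_le0_ge0.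
by rewrite /k; lra.
Qed.

End mean_value.

Section smooth_test_functions.
Context {R : realType}.

Lemma uniform_continuity (f : R -> R) (a b e : R) : continuous f -> 0 < e ->
  exists2 del, 0 < del & forall x y, a <= x <= b -> `|x - y| < del -> `|f x - f y| <= e.
Proof.
move=> cf e0; have e2 : 0 < e / 2 by rewrite divr_gt0.
have /compact_near_coveringP cpt := @segment_compact R a b.
pose P (del x : R) := forall y, `|x - y| < del -> `|f x - f y| <= e.
have near_P : forall x, [set` `[a, b]] x -> \forall x' \near x & del \near (0^'+ : set_system R), P del x'.
  move=> x _; have /cvgrPdist_le/(_ _ e2) := cf x.
  move=> /nbhs_ballP[/= eta eta0 h].
  have eta2 : 0 < eta / 2 by rewrite divr_gt0.
  exists (ball x (eta / 2), [set del | 0 < del /\ del < eta / 2]) => /=.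
    split; first exact: nbhsx_ballx.
    near=> del; split => //; near: del; exact: nbhs_right_lt.
  move=> [x' del] [/= bx [del0 del2]] y yd.
  have hx' : `|f x - f x'| <= e / 2.
    by apply: h; apply: lt_trans bx _; rewrite ltr_pdivrMr// ltr_pMr// ltr1n.
  have hy : `|f x - f y| <= e / 2.
    apply: h; rewrite /ball/= (_ : x - y = (x - x') + (x' - y)); last ring.
    by rewrite (le_lt_trans (ler_normD _ _))// [ltRHS]splitr ltrD// (lt_trans yd).
  rewrite (_ : f x' - f y = (f x - f y) - (f x - f x')); last ring.
  by rewrite (le_trans (ler_normB _ _))// [leRHS]splitr lerD.
have [del /= del0 hdel] := cpt _ _ P _ near_P.
have h2 : 0 < del / 2 by exact: divr_gt0.
exists (del / 2) => // x y xab xy; apply: (hdel (del / 2) _ _ x) => //=.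
  by rewrite sub0r normrN gtr0_norm// ltr_pdivrMr// ltr_pMr// ltr1n.
Unshelve. all: by end_near. Qed.

Lemma continuous_bounded_itv (f : R -> R) (a b : R) : continuous f -> a <= b ->
  exists2 K, 0 <= K & forall x, a <= x <= b -> `|f x| <= K.
Proof.
move=> cf ab.
have cn : {within `[a, b], continuous (fun x => `|f x|)}.
  apply: continuous_subspaceT => x; apply: cvg_norm; exact: cf.
have [c _ hc] := EVT_max ab cn.
by exists `|f c| => // x hx; apply: hc; rewrite in_itv.
Qed.

Variables (F F1 F2 : R -> R) (a b : R).
Hypotheses (ab : a < b) (d1 : forall x : R, is_derive x 1 F (F1 x))
  (d2 : forall x : R, is_derive x 1 F1 (F2 x)) (cF2 : continuous F2).
Hypotheses (Fa : forall x, x <= a -> F x = F a) (Fb : forall x, b <= x -> F x = F b).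
Hypotheses (F10 : forall x, x <= a \/ b <= x -> F1 x = 0)
  (F20 : forall x, x <= a \/ b <= x -> F2 x = 0).
Hypothesis F0 : forall x, 0 <= F x.

Let is_derive_continuous (f f' : R -> R) : (forall x : R, is_derive x 1 f (f' x)) -> continuous f.
Proof. by move=> h x; apply: differentiable_continuous; apply/derivable1_diffP; have [] := h x. Qed.

(** [F2] is uniformly continuous on the whole line: a step shorter than [1] from outside
    [[a - 1, b + 1]] stays where [F2] is zero. Steps shorter than [dl] thus have error [e]; for
    longer ones the crude constant [K] is at most [C * z^2] with [C = K / (dl / 2)^2]. *)
Lemma test_fun_of_C2 : exists K, test_fun F F1 F2 K.
Proof.
have cF := is_derive_continuous d1; have cF1 := is_derive_continuous d2.
have [K0 K00 h0] := continuous_bounded_itv cF (ltW ab).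
have [K1 K10 h1] := continuous_bounded_itv cF1 (ltW ab).
have [K2 K20 h2] := continuous_bounded_itv cF2 (ltW ab).
pose K := K0 + K1 + K2.
have aa : a <= a <= b by rewrite lexx ltW.
have bb : a <= b <= b by rewrite lexx ltW.
have out x : [\/ x <= a, b <= x | a <= x <= b].
  have [xa|ax] := leP x a; first by constructor 1.
  have [bx|xb] := leP b x; first by constructor 2.
  by constructor 3; rewrite !ltW.
have g0 x : F x <= K.
  have : F x <= K0.
    apply: le_trans (ler_norm _) _; have [/Fa ->|/Fb ->|] := out x; exact: h0.
  by rewrite /K; lra.
have g1 x : `|F1 x| <= K.
  have : `|F1 x| <= K1.
    by have [xa|bx|] := out x; [rewrite F10 ?normr0//; left|rewrite F10 ?normr0//; right|exact: h1].
  by rewrite /K; lra.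
have g2 x : `|F2 x| <= K.
  have : `|F2 x| <= K2.
    by have [xa|bx|] := out x; [rewrite F20 ?normr0//; left|rewrite F20 ?normr0//; right|exact: h2].
  by rewrite /K; lra.
exists K; split => // e e0.
have e2 : 0 < 2 * e by rewrite mulr_gt0.
have [del del0 hd] := uniform_continuity (a - 1) (b + 1) cF2 e2.
pose dl := Num.min del 1.
have dl0 : 0 < dl by rewrite lt_min del0 ltr01.
have K0' : 0 <= K by rewrite /K !addr_ge0.
exists (K / (dl / 2) ^+ 2); first by rewrite divr_ge0 ?sqr_ge0.
move=> y z; have dl2 : 0 < dl / 2 by rewrite divr_gt0.
have [zd|zd] := ltP `|z| dl.
  apply: le_trans (taylor2 (c := e) d1 d2 _) _.
    move=> v vz; have vd : `|v| < dl by exact: le_lt_trans zd.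
    apply: le_trans (ler_norm _) _; rewrite distrC.
    have yv : `|y - (y + v)| < dl by rewrite opprD addrA subrr sub0r normrN.
    have [yin|/negP yout] := boolP (a - 1 <= y <= b + 1).
      by apply: hd => //; apply: lt_le_trans yv _; rewrite ge_min lexx.
    have v1 : `|v| < 1 by apply: lt_le_trans vd _; rewrite ge_min lexx orbT.
    move: v1; rewrite ltr_norml => /andP[v1 v2].
    have [ya|ay] := leP y (a - 1).
      by rewrite !F20 ?subrr ?normr0 ?(ltW e2)//; left; lra.
    have yb : b + 1 < y by rewrite ltNge; apply/negP => h; apply: yout; rewrite (ltW ay).
    by rewrite !F20 ?subrr ?normr0 ?(ltW e2)//; right; lra.
  by rewrite lerD2l ler_wpM2r ?sqr_ge0// lerDl mulr_ge0 ?sqr_ge0// divr_ge0 ?sqr_ge0.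
apply: le_trans (taylor2 (c := K) d1 d2 _) _.
  move=> v _; have := g2 y; have := g2 (y + v); rewrite !ler_norml => /andP[_ p1] /andP[p2 _].
  lra.
rewrite lerD2l ler_wpM2r ?sqr_ge0//.
have : K <= K / (dl / 2) ^+ 2 * z ^+ 2.
  rewrite mulrAC ler_pdivlMr ?exprn_gt0// ler_wpM2l// -(real_normK (num_real z)).
  by rewrite ler_sqr ?nnegrE ?(ltW dl2)//; lra.
lra.
Qed.

End smooth_test_functions.

(** * Convex duality between prices and [phi] *)

Section convexity.
Context {R : realType}.

Lemma C1_is_derive (A : set R) (f : R -> R) (x : R) : C1_on A f -> A x ->
  is_derive x 1 f ((f^`())%classic x).
Proof. by move=> h /h[df _]; rewrite derive1E; exact: derivableP. Qed.

Lemma nondecreasing_of_derive (g g1 : R -> R) (x y : R) :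
  (forall u : R, x <= u <= y -> is_derive u 1 g (g1 u)) ->
  (forall u, x <= u <= y -> 0 <= g1 u) -> x <= y -> g x <= g y.
Proof.
move=> dg g0 xy; have [c cxy e] := mvt_pos dg xy.
by rewrite -subr_ge0 e mulr_ge0 ?g0// subr_ge0.
Qed.

Lemma tangent_le (f f1 : R -> R) (x y : R) :
  (forall u : R, 0 < u -> is_derive u 1 f (f1 u)) ->
  (forall u v, 0 < u -> u <= v -> f1 u <= f1 v) -> 0 < x -> 0 < y ->
  f x + f1 x * (y - x) <= f y.
Proof.
move=> df mf x0 y0; have [xy|yx] := leP x y.
  have [|c /andP[xc cy] e] := @mvt_pos _ f f1 x y _ xy.
    by move=> u /andP[xu _]; apply: df; exact: lt_le_trans xu.
  by rewrite -lerBrDl e ler_wpM2r ?subr_ge0// mf.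
have [|c /andP[yc cx] e] := @mvt_pos _ f f1 y x _ (ltW yx).
  by move=> u /andP[yu _]; apply: df; exact: lt_le_trans yu.
have h := mf c x (lt_le_trans y0 yc) cx.
have : f1 c * (x - y) <= f1 x * (x - y) by rewrite ler_wpM2r ?subr_ge0// ltW.
by rewrite -e; lra.
Qed.

End convexity.

Section prices.
Context {R : realType}.
Variables (x0 : R) (P phi : R -> R).
Hypotheses (hx0 : 0 < x0) (hP : regular_put_prices x0 P) (hphi : admissible_phi x0 P phi).
Local Notation phi1 := (phi^`())%classic.
Local Notation phi2 := (phi1^`())%classic.
Local Notation P1 := (P^`())%classic.

Let oitv (a x : R) : x != a -> \forall u \near x, u != a.
Proof.
by rewrite neq_lt => /orP[h|h]; [apply: filterS (lt_nbhsl h)|apply: filterS (lt_nbhsr h)] => u;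
  rewrite neq_lt => ->; rewrite ?orbT.
Qed.

Lemma phi_derive (x : R) : 0 < x -> is_derive x 1 phi (phi1 x).
Proof. by case: hphi => _ _ [h _] _ _ x0'; exact: (C1_is_derive h). Qed.

Lemma phi1_derive (x : R) : 0 < x -> is_derive x 1 phi1 (phi2 x).
Proof. by case: hphi => _ _ [_ h] _ _ x0'; exact: (C1_is_derive h). Qed.

Lemma phi2_continuous (x : R) : 0 < x -> {for x, continuous phi2}.
Proof. by case: hphi => _ _ [_ h] _ _ /h[]. Qed.

Lemma phi2_gt0 (x : R) : 0 < x -> 0 < phi2 x.
Proof. by case: hphi => _ _ _ h _ /h. Qed.

Lemma phi_gt0 (x : R) : 0 < x -> 0 < phi x.
Proof. by case: hphi => _ [_ h] _ _ _ /h. Qed.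

Lemma phi1_nd (x y : R) : 0 < x -> x <= y -> phi1 x <= phi1 y.
Proof.
move=> x0'; apply: nondecreasing_of_derive => u /andP[xu _].
  by apply: phi1_derive; exact: lt_le_trans xu.
by apply: ltW; apply: phi2_gt0; exact: lt_le_trans xu.
Qed.

Lemma phi_tangent (x y : R) : 0 < x -> 0 < y -> phi x + phi1 x * (y - x) <= phi y.
Proof. by apply: tangent_le => *; [exact: phi_derive|exact: phi1_nd]. Qed.

(** A nonnegative slope at [x] would keep the convex function above [phi x > 0] on the right of [x],
    against its limit [0]. *)
Lemma phi1_lt0 (x : R) : 0 < x -> phi1 x < 0.
Proof.
move=> xp; rewrite ltNge; apply/negP => h.
have hl : phi y @[y --> +oo] --> (0 : R) by case: hphi.
have h2 : 0 < phi x / 2 by rewrite divr_gt0// phi_gt0.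
have /cvgrPdist_lt/(_ _ h2)[M [Mr hM]] := hl.
pose y := Num.max (M + 1) x.
have : `|0 - phi y| < phi x / 2.
  by apply: hM; rewrite /y lt_max ltrDl ltr01.
have xy : x <= y by rewrite /y le_max lexx orbT.
have yp : 0 < y by exact: lt_le_trans xy.
have := phi_tangent xp yp; have : 0 <= phi1 x * (y - x) by rewrite mulr_ge0// subr_ge0.
rewrite sub0r normrN gtr0_norm ?phi_gt0//; have := phi_gt0 xp; lra.
Qed.

Lemma phi_decreasing (x y : R) : 0 < x -> x < y -> phi y < phi x.
Proof.
move=> xp xy; have yp := lt_trans xp xy.
have := phi_tangent yp xp; have h : 0 < phi1 y * (x - y).
  by rewrite nmulr_rgt0 ?phi1_lt0// subr_lt0.
by move: h; lra.
Qed.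

Lemma phi_nonincreasing (x y : R) : 0 < x -> x <= y -> phi y <= phi x.
Proof. by move=> xp; rewrite le_eqVlt => /orP[/eqP->//|/(phi_decreasing xp)/ltW]. Qed.

Lemma price_bounds K : 0 <= K -> K - x0 <= P K /\ 0 <= P K <= K.
Proof. by case: hP => h _ /h; rewrite ge_max => /andP[/andP[-> ->] ->]. Qed.

Lemma price_gt0 K : 0 < K -> 0 < P K.
Proof.
move=> K0; have [_ [Ks [_ _ inc _ _]]] := hP.
have K2 : 0 < K / 2 by rewrite divr_gt0.
have [_ /andP[h _]] := price_bounds (ltW K2); apply: le_lt_trans h _.
by apply: inc; rewrite ?inE// ltr_pdivrMr// ltr_pMr// ltr1n.
Qed.

Lemma phi_ge (z K : R) : 0 < z -> z <= x0 -> z <= K -> K - z <= P K * phi z.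
Proof.
move=> z0 zx zK; have PK : 0 < P K by apply: price_gt0; exact: lt_le_trans zK.
rewrite mulrC -ler_pdivrMr// -lee_fin; case: hphi => /(_ z z0 zx) -> _ _ _ _.
by apply: ereal_sup_ubound; exists K.
Qed.

Lemma phi_le (z c : R) : 0 < z -> z <= x0 -> (forall K, z <= K -> K - z <= P K * c) -> phi z <= c.
Proof.
move=> z0 zx h; rewrite -lee_fin; case: hphi => /(_ z z0 zx) -> _ _ _ _.
apply: ge_ereal_sup => _ /= [K zK <-].
by rewrite lee_fin ler_pdivrMr ?price_gt0 ?(lt_le_trans z0)// mulrC; exact: h.
Qed.

(** For large [K] the price is [K - x0], and [(K - z) / (K - x0) >= 1]. This lower bound near [0] is
    what allows capped test functions to be flat there. *)
Lemma phi_ge1 (z : R) : 0 < z -> z <= x0 -> 1 <= phi z.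
Proof.
move=> z0 zx; have [_ [Ks [[_ lin] _ _ _ _]]] := hP.
pose K := Num.max Ks 0 + x0 + 1.
have m0 : 0 <= Num.max Ks 0 by rewrite le_max lexx orbT.
have mK : Ks <= Num.max Ks 0 by rewrite le_max lexx.
have K0 : 0 <= K by rewrite /K; have := hx0; lra.
have KK : Ks <= K by rewrite /K; have := hx0; lra.
have zK : z <= K by rewrite /K; lra.
have := phi_ge z0 zx zK; rewrite (lin K K0 KK) => h.
have d0 : 0 < K - x0 by rewrite /K; lra.
by rewrite -(ler_pM2l d0) mulr1; apply: le_trans h; lra.
Qed.

Lemma phi_x0 : phi x0 = 1.
Proof.
apply/eqP; rewrite eq_le phi_ge1// andbT; apply: phi_le => // K xK.
by rewrite mulr1; have [] := price_bounds (le_trans (ltW hx0) xK).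
Qed.

Section below.
Variable Ks : R.
Hypotheses (h1 : forall K, 0 < K -> K < Ks -> Num.max (K - x0) 0 < P K)
  (h2 : forall K, 0 <= K -> Ks <= K -> P K = K - x0)
  (h3 : C1_on [set K | 0 < K] P) (h4 : C2_on [set K | 0 < K /\ K != Ks] P)
  (h5 : {in [pred K | 0 < K] &, {homo P : K L / K < L}})
  (h6 : forall K : R, 0 < K -> K < Ks -> 0 < (P^`(2))%classic K).

Lemma Kstar_gt0 : 0 < Ks.
Proof.
rewrite ltNge; apply/negP => Ks0; have := h2 (lexx 0) Ks0.
by have [_ /andP[]] := price_bounds (lexx 0); have := hx0; lra.
Qed.

Let dP (x : R) : 0 < x -> is_derive x 1 P (P1 x).
Proof. by move=> xp; exact: (C1_is_derive h3). Qed.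

Let dP1 (x : R) : 0 < x -> x != Ks -> is_derive x 1 P1 ((P^`(2))%classic x).
Proof. by move=> xp xK; case: h4 => _ h; exact: (C1_is_derive h). Qed.

Let P1_cont (x : R) : 0 < x -> {for x, continuous P1}.
Proof. by move=> /h3[]. Qed.

Let P1_above (x : R) : Ks < x -> P1 x = 1.
Proof.
move=> Kx; have xp := lt_trans Kstar_gt0 Kx.
have h : is_derive x 1 P 1.
  apply: (@near_eq_is_derive _ _ _ (fun u : R => u - x0)).
    near=> u; have Ku : Ks < u by near: u; exact: lt_nbhsr.
    by rewrite h2// ltW// (lt_trans Kstar_gt0).
  have := is_deriveB (is_derive_id x (1 : R)) (is_derive_cst x0 x (1 : R)); rewrite subr0; apply.
by have [_ <-] := h; rewrite derive1E.
Unshelve. all: by end_near. Qed.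

(** Smooth fit: the slope is [1] above [Ks] and [P1] is continuous at [Ks]. *)
Let P1_star : P1 Ks = 1.
Proof.
have /cvgrPdist_le hc := P1_cont Kstar_gt0.
apply/eqP; rewrite -subr_eq0 -normr_le0; apply/ler_addgt0Pl => e e0; rewrite addr0.
have /nbhs_ballP[/= del del0 hd] := hc e e0.
have d2 : 0 < del / 2 by rewrite divr_gt0.
have a1 : P1 (Ks + del / 2) = 1 by apply: P1_above; rewrite ltrDl.
rewrite -a1; apply: hd; rewrite /ball/= opprD addrA subrr sub0r normrN gtr0_norm//.
by rewrite ltr_pdivrMr// ltr_pMr// ltr1n.
Qed.

Let P1_below_nd (x y : R) : 0 < x -> x <= y -> y < Ks -> P1 x <= P1 y.
Proof.
move=> xp xy yK; apply: (@nondecreasing_of_derive _ P1 (P^`(2))%classic x y _ _ xy) => u /andP[xu uy].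
  by apply: dP1; [exact: lt_le_trans xu|rewrite lt_eqF// (le_lt_trans uy)].
by apply: ltW; apply: h6; [exact: lt_le_trans xu|exact: le_lt_trans yK].
Qed.

Let P1_le1 (x : R) : 0 < x -> P1 x <= 1.
Proof.
move=> xp; have [xK|Kx|->] := ltgtP x Ks; [|by rewrite P1_above|by rewrite P1_star].
have /cvgrPdist_le hc := P1_cont Kstar_gt0.
apply/ler_addgt0Pr => e e0; have /nbhs_ballP[/= del del0 hd] := hc e e0.
pose y := Num.max x (Ks - del / 2).
have d2 : 0 < del / 2 by rewrite divr_gt0.
have xy : x <= y by rewrite le_max lexx.
have yK : y < Ks by rewrite gt_max xK/=; lra.
have yd : Ks - del / 2 <= y by rewrite le_max lexx orbT.
apply: le_trans (P1_below_nd xp xy yK) _.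
have : `|P1 Ks - P1 y| <= e.
  by apply: hd; rewrite /ball/= gtr0_norm ?subr_gt0//; lra.
rewrite P1_star ler_norml => /andP[]; lra.
Qed.

Let P1_nd (x y : R) : 0 < x -> x <= y -> P1 x <= P1 y.
Proof.
move=> xp xy; have [yK|Ky|->] := ltgtP y Ks; first exact: P1_below_nd.
  by rewrite (P1_above Ky); exact: P1_le1.
by rewrite P1_star; exact: P1_le1.
Qed.

Let P1_gt0 (x : R) : 0 < x -> 0 < P1 x.
Proof.
move=> xp; have x2 : 0 < x / 2 by rewrite divr_gt0.
have xx : x / 2 < x by rewrite ltr_pdivrMr// ltr_pMr// ltr1n.
have [|c /andP[c1 c2] e] := @mvt_pos _ P P1 (x / 2) x _ (ltW xx).
  by move=> u /andP[hu _]; apply: dP; exact: lt_le_trans hu.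
have : 0 < P1 c * (x - x / 2) by rewrite -e subr_gt0 h5 ?inE.
rewrite pmulr_lgt0 ?subr_gt0// => c0; apply: lt_le_trans c0 _.
by apply: P1_nd => //; exact: lt_le_trans c1.
Qed.

Let P_tangent (x y : R) : 0 < x -> 0 < y -> P x + P1 x * (y - x) <= P y.
Proof. by apply: tangent_le. Qed.

(* The line through [(K, P K)] with slope [P' K] meets the axis at the [z]
   for which the supremum defining [phi z] is attained at [K]. *)
Lemma touching_point K : 0 < K -> K < Ks -> exists z, [/\ 0 < z, z < x0 & P K * phi z = K - z].
Proof.
move=> K0 KK; have K2 : 0 < K / 2 by rewrite divr_gt0.
have KhK : K / 2 < K by rewrite ltr_pdivrMr// ltr_pMr// ltr1n.
have P0 := price_gt0 K0.
have p1 := P1_gt0 K0.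
have p2 : P1 (K / 2) < P1 K.
  have [|c /andP[c1 c2] e] := @mvt_pos _ P1 (P^`(2))%classic (K / 2) K _ (ltW KhK).
    move=> u /andP[hu uK]; apply: dP1; first exact: lt_le_trans hu.
    by rewrite lt_eqF// (le_lt_trans uK).
  rewrite -subr_gt0 e mulr_gt0 ?subr_gt0//; apply: h6; first exact: lt_le_trans c1.
  exact: le_lt_trans KK.
(* This makes the intersection with the axis positive. The bound [P k <= k] stands in for [P 0 = 0]:
   strict convexity between [K / 2] and [K] gains [K / 2 * (P1 K - P1 (K / 2))], and [k] spends half
   of that gain. *)
have zp : P K < K * P1 K.
  pose k := K / 4 * (P1 K - P1 (K / 2)).
  have k0 : 0 < k by rewrite mulr_gt0 ?subr_gt0// divr_gt0.
  have t1 := P_tangent K0 K2; have t2 := P_tangent K2 k0.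
  have [_ /andP[_ Pk]] := price_bounds (ltW k0).
  have q : 0 <= P1 (K / 2) * k by rewrite mulr_ge0 ?(ltW k0)// ltW// P1_gt0.
  have kE : k = K / 4 * P1 K - K / 4 * P1 (K / 2) by rewrite /k; ring.
  have : 0 < K * (P1 K - P1 (K / 2)) by rewrite mulr_gt0// subr_gt0.
  rewrite !mulrBr in t1 t2 *; lra.
pose z := K - P K / P1 K.
have z0 : 0 < z by rewrite subr_gt0 ltr_pdivrMr.
have Kz : (K - z) * P1 K = P K by rewrite /z; field; rewrite gt_eqF.
(* Amounts to [(K - x0) * P1 K < P K]: the price exceeds the payoff, and its slope is at most
   [1]. *)
have zx : z < x0.
  rewrite /z ltrBlDr -ltrBlDl ltr_pdivlMr//.
  have := h1 K0 KK; rewrite gt_max => /andP[a1 a2].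
  have [Kx|xK] := leP K x0.
    by apply: le_lt_trans P0; rewrite mulr_le0_ge0 ?(ltW p1)// subr_le0.
  by apply: le_lt_trans a1; rewrite ler_piMr ?P1_le1// subr_ge0 ltW.
have zK : z <= K by rewrite /z lerBlDr lerDl divr_ge0// ltW.
exists z; split => //; apply/eqP; rewrite eq_le phi_ge ?(ltW zx)// andbT.
rewrite mulrC -ler_pdivlMr//; apply: phi_le (ltW zx) _ => // L zL.
have Lp : 0 < L by exact: lt_le_trans zL.
have -> : (K - z) / P K = (P1 K)^-1 by rewrite -Kz; field; rewrite !gt_eqF// subr_gt0 /z ltrBlDr ltrDl divr_gt0.
rewrite ler_pdivlMr//; have := P_tangent K0 Lp; rewrite -{1}Kz; lra.
Qed.

(** Up to [x0] this is the definition of [phi] as a supremum. Beyond [x0] the extension is only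
    known to be convex: [P K * phi] meets the line [K - x] at some [z < x0] and is above it at [x0],
    so its slope at [x0] is at least [- 1] and it stays above. *)
Lemma phi_dominates_below K x : 0 < K -> K < Ks -> 0 < x -> K - x <= P K * phi x.
Proof.
move=> K0 KK xp; have PK := price_gt0 K0; have px := phi_gt0 xp.
have [xx|xx] := leP x x0.
  have [Kx|xK] := leP K x; last by apply: phi_ge => //; exact: ltW.
  by apply: (@le_trans _ _ 0); rewrite ?subr_le0// mulr_ge0// ltW.
have [z [z0 zx ze]] := touching_point K0 KK.
have t1 := phi_tangent hx0 z0; have t2 := phi_tangent hx0 xp.
have [Kx|xK] := leP K x0.
  by apply: (@le_trans _ _ 0); rewrite ?mulr_ge0 ?ltW// subr_lt0 (le_lt_trans Kx).
have t3 := phi_ge hx0 (lexx x0) (ltW xK).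
have m1 : - 1 <= P K * phi1 x0.
  have zz : 0 < x0 - z by rewrite subr_gt0.
  rewrite -(ler_pM2r zz); have := ler_wpM2l (ltW PK) t1; rewrite mulrDr ze; lra.
have := ler_wpM2l (ltW PK) t2; rewrite mulrDr => t4.
have xz : 0 <= x - x0 by rewrite subr_ge0 ltW.
have := ler_wpM2r xz m1; lra.
Qed.

(** Strikes below [Ks] and within [e] of it lose at most [e] on the left, and monotonicity of [P]
    takes care of the right-hand side. *)
Lemma phi_dominates_star x : 0 < x -> Ks - x <= P Ks * phi x.
Proof.
move=> xp; have px := phi_gt0 xp.
have [Kx|xK] := leP Ks x.
  apply: (@le_trans _ _ 0); rewrite ?subr_le0// mulr_ge0 ?(ltW px)//.
  by apply: ltW; apply: price_gt0; exact: Kstar_gt0.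
apply/ler_addgt0Pr => e e0.
have k0 : 0 < Num.min (Ks / 2) e by rewrite lt_min e0 divr_gt0// Kstar_gt0.
pose K := Ks - Num.min (Ks / 2) e.
have m1 : Num.min (Ks / 2) e <= Ks / 2 by rewrite ge_min lexx.
have m2 : Num.min (Ks / 2) e <= e by rewrite ge_min lexx orbT.
have Kp : 0 < K by rewrite /K; have := Kstar_gt0; lra.
have KK : K < Ks by rewrite /K; lra.
have := phi_dominates_below Kp KK xp.
have : P K * phi x <= P Ks * phi x.
  by rewrite ler_wpM2r ?(ltW px)// ltW// h5 ?inE// Kstar_gt0.
by rewrite /K; lra.
Qed.

End below.

(** The linear part is there for [K > Ks], where no touching point exists. Since [K - x = K / Ks *
    (Ks - x) + (K / Ks - 1) * x], scaling the inequality at [Ks] gives domination, and at [x0] the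
    majorant equals [K - x0] because [P Ks = Ks - x0]. *)
Lemma supersolution K : 0 < K -> exists a b, [/\ 0 <= a, 0 <= b, a + b * x0 = P K
  & forall x, 0 < x -> K - x <= a * phi x + b * x].
Proof.
move=> K0; have [_ [Ks [[h1 h2] [h3 h4] h5 h6 _]]] := hP.
have Ks0 := Kstar_gt0 h2.
have [KK|KK|KE] := ltgtP K Ks.
- exists (P K), 0; split; rewrite ?mul0r ?addr0//; first by apply: ltW; exact: price_gt0.
  by move=> x xp; rewrite mul0r addr0; exact: (phi_dominates_below h1 h2 h3 h4 h5 h6).
- have rK : 0 <= K / Ks - 1 by rewrite subr_ge0 ler_pdivlMr// mul1r ltW.
  exists (K / Ks * P Ks), (K / Ks - 1); split => //.
  + by rewrite mulr_ge0 ?divr_ge0 ?(ltW K0) ?(ltW Ks0)// ltW// price_gt0.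
  + rewrite (h2 _ (ltW K0) (ltW KK)) (h2 _ (ltW Ks0) (lexx _)).
    by field; rewrite gt_eqF.
  + move=> x xp; have := phi_dominates_star h1 h2 h3 h4 h5 h6 xp.
    have k0 : 0 <= K / Ks by rewrite divr_ge0 ?ltW.
    move=> /(ler_wpM2l k0); rewrite mulrBr divfK ?gt_eqF// mulrA mulrBl mul1r; lra.
- exists (P K), 0; split; rewrite ?mul0r ?addr0//; first by apply: ltW; exact: price_gt0.
  by move=> x xp; rewrite mul0r addr0 KE; exact: (phi_dominates_star h1 h2 h3 h4 h5 h6).
Qed.

Lemma exercise_boundary K : 0 < K ->
  P K = K - x0 \/ exists z, [/\ 0 < z, z < x0 & P K * phi z = K - z].
Proof.
move=> K0; have [_ [Ks [[h1 h2] [h3 h4] h5 h6 _]]] := hP.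
have [KK|KK] := leP Ks K; first by left; exact: h2 (ltW K0) KK.
by right; exact: (touching_point h1 h2 h3 h4 h5 h6).
Qed.

End prices.

(** * Compositions that are flat near zero and at infinity *)

Section composition.
Context {R : realType}.
Variables (f f1 f2 h h1 h2 : R -> R) (al be c0 c1 : R).
Hypotheses (df : forall x : R, 0 < x -> is_derive x 1 f (f1 x))
  (df1 : forall x : R, 0 < x -> is_derive x 1 f1 (f2 x))
  (cf2 : forall x : R, 0 < x -> {for x, continuous f2}).
Hypotheses (dh : forall u : R, is_derive u 1 h (h1 u))
  (dh1 : forall u : R, is_derive u 1 h1 (h2 u)) (ch2 : continuous h2).
Hypotheses (al0 : 0 < al) (albe : al < be).
Hypothesis flat0 : forall x, 0 < x -> x <= al -> [/\ h (f x) = c0, h1 (f x) = 0 & h2 (f x) = 0].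
Hypothesis flat1 : forall x, be <= x -> [/\ h (f x) = c1, h1 (f x) = 0 & h2 (f x) = 0].
Hypothesis hf0 : forall x, 0 < x -> 0 <= h (f x).

(** [f] is controlled on []0, +oo[] only, whereas test functions live on the whole line. As
    [h (f x)] is already constant on []0, al]], that constant continues it to the left; the two
    descriptions overlap on []0, al[], so the result is C^2. *)
Definition flat_comp (x : R) : R := if x < al then c0 else h (f x).
Definition flat_comp1 (x : R) : R := if x < al then 0 else h1 (f x) * f1 x.
Definition flat_comp2 (x : R) : R :=
  if x < al then 0 else h2 (f x) * f1 x ^+ 2 + h1 (f x) * f2 x.

Lemma flat_compE x : 0 < x -> [/\ flat_comp x = h (f x), flat_comp1 x = h1 (f x) * f1 x
  & flat_comp2 x = h2 (f x) * f1 x ^+ 2 + h1 (f x) * f2 x].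
Proof.
move=> xp; rewrite /flat_comp /flat_comp1 /flat_comp2; case: ifPn => // xa.
by have [-> -> ->] := flat0 xp (ltW xa); rewrite !mul0r addr0.
Qed.

Lemma flat_comp_low x : x < al -> [/\ flat_comp x = c0, flat_comp1 x = 0 & flat_comp2 x = 0].
Proof. by move=> xa; rewrite /flat_comp /flat_comp1 /flat_comp2 xa. Qed.

Lemma flat_comp_flat x : x <= al \/ be <= x -> flat_comp1 x = 0 /\ flat_comp2 x = 0.
Proof.
move=> [|bx].
  rewrite le_eqVlt => /orP[/eqP->|/flat_comp_low[] //].
  have [_ -> ->] := flat_compE al0; have [_ -> ->] := flat0 al0 (lexx al).
  by rewrite !mul0r addr0.
have xp : 0 < x by rewrite (lt_le_trans al0)// (le_trans (ltW albe)).
by have [_ -> ->] := flat_compE xp; have [_ -> ->] := flat1 bx; rewrite !mul0r addr0.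
Qed.

Let near_pos (x : R) : 0 < x -> \forall u \near x, 0 < u.
Proof. by move=> xp; exact: lt_nbhsr. Qed.

Let near_low (x : R) : x < al -> \forall u \near x, u < al.
Proof. by move=> xa; exact: lt_nbhsl. Qed.

Let dhf (g g1 : R -> R) (x : R) : (forall u : R, is_derive u 1 g (g1 u)) -> 0 < x ->
  is_derive x 1 (g \o f) (g1 (f x) * f1 x).
Proof.
by move=> dg xp; have := @is_derive1_comp _ g f x _ _ (dg (f x)) (df xp).
Qed.

Lemma is_derive_flat_comp (x : R) : is_derive x 1 flat_comp (flat_comp1 x).
Proof.
have [xa|ax] := ltP x al.
  apply: (@near_eq_is_derive _ _ _ (cst c0)).
    by apply: filterS (near_low xa) => u ua; have [-> _ _] := flat_comp_low ua.
  by have [_ -> _] := flat_comp_low xa; exact: is_derive_cst.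
have xp := lt_le_trans al0 ax.
apply: (@near_eq_is_derive _ _ _ (h \o f)).
  by apply: filterS (near_pos xp) => u up; have [-> _ _] := flat_compE up.
by have [_ -> _] := flat_compE xp; exact: dhf.
Qed.

Lemma is_derive_flat_comp1 (x : R) : is_derive x 1 flat_comp1 (flat_comp2 x).
Proof.
have [xa|ax] := ltP x al.
  apply: (@near_eq_is_derive _ _ _ (cst 0)).
    by apply: filterS (near_low xa) => u ua; have [_ -> _] := flat_comp_low ua.
  by have [_ _ ->] := flat_comp_low xa; exact: is_derive_cst.
have xp := lt_le_trans al0 ax.
apply: (@near_eq_is_derive _ _ _ ((h1 \o f) * f1)).
  by apply: filterS (near_pos xp) => u up; have [_ -> _] := flat_compE up.
have [_ _ ->] := flat_compE xp.
have hM := is_deriveM (dhf dh1 xp) (df1 xp).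
by apply: (is_derive_eq hM); rewrite /GRing.scale/=; ring.
Qed.

Let derive_cont (g : R -> R) (g' x : R) : is_derive x 1 g g' -> {for x, continuous g}.
Proof. by move=> [dg _]; apply: differentiable_continuous; exact/derivable1_diffP. Qed.

Lemma continuous_flat_comp2 : continuous flat_comp2.
Proof.
move=> x; have [xa|ax] := ltP x al.
  have [_ _ e] := flat_comp_low xa; rewrite /continuous_at e.
  apply: cvg_near_cst; apply: filterS (near_low xa) => u ua.
  by have [_ _ ->] := flat_comp_low ua.
have xp := lt_le_trans al0 ax.
have cfx : {for x, continuous f} := derive_cont (df xp).
have c1x : {for x, continuous f1} := derive_cont (df1 xp).
have ch : {for x, continuous (h1 \o f)}.
  by apply: continuous_comp => //; exact: derive_cont (dh1 _).
have ch2' : {for x, continuous (h2 \o f)}.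
  by apply: continuous_comp => //; exact: ch2.
have [_ _ e] := flat_compE xp; rewrite /continuous_at e.
have cc : (h2 \o f) u * (f1 u * f1 u) + (h1 \o f) u * f2 u @[u --> x] -->
    (h2 \o f) x * (f1 x * f1 x) + (h1 \o f) x * f2 x.
  apply: cvgD; apply: cvgM => //; first by apply: cvgM.
  exact: cf2.
rewrite -expr2 in cc; apply: cvg_trans cc; apply: near_eq_cvg.
by apply: filterS (near_pos xp) => u up; have [_ _ ->] := flat_compE up.
Qed.

Lemma flat_comp_test_fun : exists K, test_fun flat_comp flat_comp1 flat_comp2 K.
Proof.
have c0E : c0 = flat_comp al by have [-> _ _] := flat_compE al0; have [-> _ _] := flat0 al0 (lexx al).
apply: (@test_fun_of_C2 _ flat_comp flat_comp1 flat_comp2 al be albe is_derive_flat_comp is_derive_flat_comp1 continuous_flat_comp2).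
- by move=> x; rewrite le_eqVlt => /orP[/eqP->//|/flat_comp_low[-> _ _]].
- move=> x bx; have bp : 0 < be by exact: lt_trans albe.
  have [-> _ _] := flat_compE (lt_le_trans bp bx); have [-> _ _] := flat_compE bp.
  by have [-> _ _] := flat1 bx; have [-> _ _] := flat1 (lexx be).
- by move=> x /flat_comp_flat[].
- by move=> x /flat_comp_flat[].
- move=> x; have [/flat_comp_low[-> _ _]|ax] := ltP x al.
    by have [<- _ _] := flat0 al0 (lexx al); exact: hf0.
  have xp := lt_le_trans al0 ax; have [-> _ _] := flat_compE xp; exact: hf0.
Qed.

End composition.

(** [hh] is under control on [[al, be]] only, and elsewhere the derivatives of [G] vanish. *)
Lemma price_drift_bounded {R : realType} (r : R) (hh G G1 G2 : R -> R) (Kg al be B : R) :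
  0 <= r -> test_fun G G1 G2 Kg -> 0 <= be ->
  (forall x, x <= al \/ be <= x -> G1 x = 0 /\ G2 x = 0) ->
  (forall x, al <= x <= be -> hh x ^+ 2 <= B) ->
  exists Kk, forall x, 0 <= x -> `|price_drift r hh G G1 G2 x| <= Kk.
Proof.
move=> r0 hG b0 flat hB.
have Kg0 : 0 <= Kg by exact: le_trans (tf_ge0 hG 0) (tf_le hG 0).
exists (r * be * Kg + `|B| * Kg + r * Kg) => x x0.
have nG : `|r * G x| <= r * Kg.
  by rewrite normrM !ger0_norm ?ler_wpM2l ?(tf_le hG)// (tf_ge0 hG).
have rbK : 0 <= r * be * Kg by rewrite !mulr_ge0.
have BK : 0 <= `|B| * Kg by rewrite mulr_ge0.
rewrite /price_drift /ito_drift (le_trans (ler_normB _ _))// lerD// (le_trans (ler_normD _ _))//.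
have [xa|ax] := leP x al.
  by have [-> ->] := flat x (or_introl xa); rewrite !mulr0 !normr0 addr0 addr_ge0.
have [bx|xb] := leP be x.
  by have [-> ->] := flat x (or_intror bx); rewrite !mulr0 !normr0 addr0 addr_ge0.
apply: lerD.
  rewrite normrM ler_pM//; last exact: (tf_le1 hG).
  by rewrite ger0_norm ?mulr_ge0// ler_wpM2l// ltW.
rewrite normrM ler_pM//; last exact: (tf_le2 hG).
have hx : hh x ^+ 2 <= `|B|.
  by apply: le_trans (ler_norm _); apply: hB; rewrite !ltW.
have h0 := sqr_ge0 (hh x).
by rewrite ger0_norm; lra.
Qed.

(** * Stopping on grids and the put payoff *)

Section stopped_sums.
Context {R : realType}.
Variables (c : nat -> bool) (a : nat -> R).

Lemma stopped_sum n j : (forall i, (i < j)%N -> c i) -> (forall i, (j <= i)%N -> ~~ c i) ->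
  (j <= n)%N -> a 0 + \sum_(i < n) (c i)%:R * (a i.+1 - a i) - (c n)%:R * a n = a j.
Proof.
move=> cj nc jn; rewrite (negbTE (nc n jn)) mul0r subr0.
rewrite -(big_mkord xpredT (fun i => (c i)%:R * (a i.+1 - a i))).
have tail : \sum_(j <= i < n) (c i)%:R * (a i.+1 - a i) = 0.
  rewrite big_nat_cond big1// => i; rewrite andbT => /andP[ji _].
  by rewrite (negbTE (nc i ji)) mul0r.
rewrite (big_cat_nat (leq0n j) jn)/= tail addr0.
rewrite (_ : \sum_(0 <= i < j) _ = \sum_(0 <= i < j) (a i.+1 - a i)).
  by rewrite telescope_sumr// addrC subrK.
by apply: eq_big_nat => i /andP[_ ij]; rewrite cj// mul1r.
Qed.

Lemma never_stopped n : (forall i, (i <= n)%N -> c i) ->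
  a 0 + \sum_(i < n) (c i)%:R * (a i.+1 - a i) - (c n)%:R * a n = 0.
Proof.
move=> cn; rewrite cn// mul1r.
rewrite -(big_mkord xpredT (fun i => (c i)%:R * (a i.+1 - a i))).
rewrite (_ : \sum_(0 <= i < n) _ = \sum_(0 <= i < n) (a i.+1 - a i)).
  by rewrite telescope_sumr//; ring.
by apply: eq_big_nat => i /andP[_ ij]; rewrite cn ?mul1r// ltnW.
Qed.

End stopped_sums.

Lemma cvg_seq_le {R : realType} (u : nat -> R) (a l : R) :
  u k @[k --> \oo] --> l -> (forall k, u k <= a) -> l <= a.
Proof.
move=> ul au; have <- := cvg_lim (@Rhausdorff R) ul.
by apply: limr_le; [apply/cvg_ex; exists l|exact: nearW].
Qed.

Lemma first_index (c : nat -> bool) n : (exists2 i, (i <= n)%N & ~~ c i) ->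
  exists j, [/\ (j <= n)%N, ~~ c j & forall i, (i < j)%N -> c i].
Proof.
move=> [i0 i0n hi0]; have ex : exists i, ~~ c i by exists i0.
exists (ex_minn ex); case: ex_minnP => j nj hj; split => //.
  by apply: leq_trans i0n; exact: hj.
by move=> i ij; apply/negPn/negP => /hj; rewrite leqNgt ij.
Qed.

Section cells.
Context {R : realType}.
Variables (s t : R) (m : nat) (f : R -> R) (C : R).
Hypotheses (st : s < t) (m0 : (0 < m)%N).
Local Notation mu := (@lebesgue_measure R).
Local Notation gr := (grid s (mesh s t m)).
Hypotheses (mf : measurable_fun (`[s, t] : set R) f) (fC : forall u, s <= u <= t -> `|f u| <= C).

Lemma integral_cells (c : nat -> R) n : (n <= m)%N ->
  (\int[mu]_(u in `[s, gr n[) (stepf s t m c u * f u))%R =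
  \sum_(j < n) c j * (\int[mu]_(u in `[gr j, gr j.+1[) f u)%R.
Proof.
have hp := mesh_gt0 st m0.
have grt k : (k <= m)%N -> gr k <= t.
  by move=> km; have := grid_le s hp km; rewrite grid_last.
have C0 : 0 <= C by apply: le_trans (fC (u := s) _) => //; rewrite lexx ltW.
have iv (a b : R) D (g : R -> R) K : 0 <= K -> D `<=` `[s, t] -> measurable (D : set (measurableTypeR R)) ->
    measurable_fun (`[s, t] : set R) g -> (forall u, `|g u| <= K) ->
    mu.-integrable D (EFin \o (fun u => g u * f u)).
  move=> K0 Dst mD mg gK; apply: (itv_integrable_bounded Dst mD (C := K * C)).
    have mst : measurable (`[s, t]%classic : set (measurableTypeR R)) by exact: measurable_itv.
    by apply: (measurable_funS mst Dst); exact: measurable_funM.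
  by move=> u Du; rewrite normrM ler_pM//; apply: fC; have := Dst u Du; rewrite /= in_itv.
pose Cc := \sum_(j < m) `|c j|.
have Cc0 : 0 <= Cc by rewrite sumr_ge0.
have sC u : `|stepf s t m c u| <= Cc.
  by apply: stepf_bound => // j jm; rewrite /Cc (bigD1 (Ordinal jm))//= lerDl sumr_ge0.
elim: n => [_|n ih nm].
  by rewrite grid0 set_itvco0 Rintegral_set0 big_ord0.
have gn : gr n <= gr n.+1 by exact: grid_le.
have -> : `[s, gr n.+1[%classic = `[s, gr n[ `|` `[gr n, gr n.+1[ :> set R.
  by rewrite (@itv_bndbnd_setU _ _ _ (BLeft (gr n)))// bnd_simp// grid_ge.
have sg := grid_ge s hp n.
rewrite Rintegral_setU//=.
- rewrite ih ?(ltnW nm)// big_ord_recr/=; congr (_ + _).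
  transitivity (\int[mu]_(u in `[gr n, gr n.+1[) (c n * f u))%R.
    by apply: eq_Rintegral => u; rewrite inE/= in_itv/= => /(stepfE st m0 c nm) ->.
  rewrite RintegralZl//.
  have sub : `[gr n, gr n.+1[ `<=` (`[s, t] : set R).
    move=> u /=; rewrite !in_itv/= => /andP[a b]; rewrite (le_trans sg a)/=.
    by rewrite (le_trans (ltW b))// grt.
  apply: (itv_integrable_bounded sub (C := C)) => //.
    have mst : measurable (`[s, t]%classic : set (measurableTypeR R)) by exact: measurable_itv.
    exact: (measurable_funS mst sub).
  by move=> u Du; apply: fC; have := sub u Du; rewrite /= in_itv.
- apply: (iv s t _ (stepf s t m c) Cc) => //; [|exact: measurableU|exact: measurable_stepf].
  move=> x [] /=; rewrite !in_itv/= => /andP[a b]; apply/andP; split.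
  + by [].
  + by rewrite (le_trans (ltW b))// grt// ltnW.
  + by rewrite (le_trans _ a).
  + by rewrite (le_trans (ltW b))// grt.
- apply/disj_setPS => x [] /=; rewrite !in_itv/= => /andP[_ xs] /andP[sx _].
  by have := lt_le_trans xs sx; rewrite ltxx.
Qed.

End cells.

Lemma discount_integral {R : realType} (r s t : R) : s < t ->
  (\int[@lebesgue_measure R]_(u in `[s, t[) (expR (- (r * (u - s))) * r))%R = 1 - expR (- (r * (t - s))).
Proof.
move=> st; pose F (u : R) := - expR (- (r * (u - s))).
have dF (u : R) : is_derive u 1 F (expR (- (r * (u - s))) * r).
  have h1 : is_derive u 1 (fun u : R => - (r * (u - s))) (- r).
    have h := is_deriveN (is_deriveZ r (is_deriveB (is_derive_id u (1 : R)) (is_derive_cst s u (1 : R)))).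
    by apply: (is_derive_eq h); rewrite /GRing.scale/= subr0 mulr1.
  have h2 := is_deriveN (@is_derive1_comp _ expR (fun u : R => - (r * (u - s))) u _ _ (is_derive_expR _) h1).
  by apply: (is_derive_eq h2); rewrite mulrN opprK.
have dcont (g : R -> R) (g' x : R) : is_derive x 1 g g' -> {for x, continuous g}.
  by move=> [dg _]; apply: differentiable_continuous; exact/derivable1_diffP.
have cF : continuous F by move=> u; exact: dcont (dF u).
have cf : continuous (fun u : R => expR (- (r * (u - s))) * r).
  move=> u; apply: cvgM; last exact: cvg_cst.
  apply: (@continuous_comp _ _ _ (fun u : R => - (r * (u - s))) expR); last exact: continuous_expR.
  apply: cvgN; apply: cvgM; first exact: cvg_cst.
  by apply: cvgB; [exact: cvg_id|exact: cvg_cst].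
rewrite /Rintegral integral_itv_bndo_bndc; last first.
  apply/measurable_EFinP; apply: measurable_funTS; exact: continuous_measurable_fun.
rewrite (@continuous_FTC2 _ _ F)//=.
- by rewrite /F subrr mulr0 oppr0 expR0 opprK addrC.
- exact: continuous_subspaceT.
- split.
  + by move=> u _; have [] := dF u.
  + by apply: cvg_at_right_filter; exact: cF.
  + by apply: cvg_at_left_filter; exact: cF.
- by move=> u _; have [_] := dF u; rewrite derive1E.
Qed.

Section optimal_stopping.
Context {d : measure_display} {Omega : measurableType d} {R : realType}.
Variable Pr : probability Omega R.
Variable W : R -> Omega -> R.
Hypothesis hW : standard_brownian Pr W.
Local Notation Fil := (brownian_filtration Pr W).
Local Notation Fm := (Fm Pr W).
Local Notation Ex := (Ex Pr).
Local Notation L1 U := (Pr.-integrable setT (EFin \o U)).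
Local Notation mu := (@lebesgue_measure R).
Local Notation TR := (measurableTypeR R).
Variables (r x0 : R) (hh : R -> R) (X : R -> Omega -> R).
Hypotheses (r0 : 0 < r).
Hypotheses (aX : adapted Fil X) (cX : continuous_paths X).
Hypothesis X0 : forall t w, 0 <= t -> 0 <= X t w.
Hypothesis Xx0 : {ae Pr, forall w, X 0 w = x0}.

(** Conditional expectations are tested on events of [Fil s], and the factor [exp (- r s)] is
    divided out, so that this is the form in which the Dynkin inequality comes. *)
Definition discounted_supermartingale (g : R -> R) : Prop :=
  forall s t A, 0 <= s -> s < t -> Fil s A ->
  Ex (fun w => \1_A w * (expR (- (r * (t - s))) * g (X t w) - g (X s w))) <= 0.

Variable T : R.
Hypothesis T0 : 0 < T.
Local Notation ti n := (grid 0 (mesh 0 T n)).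

Let ti_ge0 n i : (0 < n)%N -> 0 <= ti n i.
Proof. by move=> n0; apply: grid_ge; exact: mesh_gt0. Qed.

Let ti_lt n i : (0 < n)%N -> ti n i < ti n i.+1.
Proof. by move=> n0; exact: grid_ltS. Qed.

Definition discounted_value (n : nat) (g : R -> R) (w : Omega) (i : nat) : R :=
  expR (- (r * ti n i)) * g (X (ti n i) w).

(* The discounted value of [g] at the first grid time [i <= n] at which the
   event [A i] of not having stopped fails, and [0] if there is none. *)
Definition stopped (n : nat) (A : nat -> set Omega) (g : R -> R) (w : Omega) : R :=
  discounted_value n g w 0 + \sum_(i < n) \1_(A i) w * (discounted_value n g w i.+1 - discounted_value n g w i)
  - \1_(A n) w * discounted_value n g w n.

Lemma stopped_at n (A : nat -> set Omega) g w j : (forall i, (i < j)%N -> A i w) -> (forall i, (j <= i)%N -> ~ A i w) ->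
  (j <= n)%N -> stopped n A g w = discounted_value n g w j.
Proof.
move=> h1 h2 jn; rewrite -(@stopped_sum R (fun i => w \in A i) (discounted_value n g w) n j)//.
- by move=> i /h1 h; rewrite inE.
- by move=> i /h2 h; apply/negP; rewrite inE.
Qed.

Lemma stopped_never n (A : nat -> set Omega) g w : (forall i, (i <= n)%N -> A i w) -> stopped n A g w = 0.
Proof.
move=> h1; rewrite -(@never_stopped R (fun i => w \in A i) (discounted_value n g w) n)//.
- by move=> i /h1 h; rewrite inE.
Qed.

Variable g : R -> R.
Hypothesis mg : measurable_fun setT g.

Let mgX u : 0 <= u -> measurable_fun setT (fun w => g (X u w)).
Proof. by move=> u0; apply: (measurableT_comp mg); exact: (measurable_X hW aX). Qed.

Let mdval n i : (0 < n)%N -> measurable_fun setT (fun w => discounted_value n g w i).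
Proof. by move=> n0; apply: measurable_funM => //; apply: mgX; exact: ti_ge0. Qed.

Lemma measurable_stopped n A : (0 < n)%N -> (forall i, measurable (A i)) ->
  measurable_fun setT (stopped n A g).
Proof.
move=> n0 mA; apply: measurable_funB; last first.
  by apply: measurable_funM; [exact: measurable_indic|exact: mdval].
apply: measurable_funD; first exact: mdval.
apply: measurable_sum => i; apply: measurable_funM; first exact: measurable_indic.
by apply: measurable_funB; exact: mdval.
Qed.

Variable Cg : R.
Hypothesis gC : forall x, `|g x| <= Cg.

Let i1 (A : set Omega) w : `|\1_A w : R| <= 1.
Proof. by rewrite indicE; case: (_ \in _); rewrite ?normr1 ?normr0. Qed.

Let Cg0 : 0 <= Cg. Proof. exact: le_trans (gC 0). Qed.

Lemma discounted_value_bound n w i : (0 < n)%N -> `|discounted_value n g w i| <= Cg.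
Proof.
move=> n0; rewrite normrM -[leRHS]mul1r ler_pM//.
by rewrite ger0_norm ?expR_ge0// expR_le1 oppr_le0 mulr_ge0 ?ti_ge0// ltW.
Qed.

Let stepE n i w : (0 < n)%N -> discounted_value n g w i.+1 - discounted_value n g w i =
  expR (- (r * ti n i)) * (expR (- (r * (ti n i.+1 - ti n i))) * g (X (ti n i.+1) w) - g (X (ti n i) w)).
Proof.
move=> n0; rewrite /discounted_value mulrBr mulrA -expRD; congr (expR _ * _ - _); ring.
Qed.

(** Optional stopping as finite bookkeeping: each summand is a one-step inequality tested on the
    event of not having stopped yet, and the last term removes the paths that never stop on the
    grid. *)
Lemma Ex_stopped n (A : nat -> set Omega) : (0 < n)%N -> (forall i, measurable (A i)) ->
  Ex (stopped n A g) = Ex (fun w => g (X 0 w)) +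
   \sum_(i < n) expR (- (r * ti n i)) * Ex (fun w => \1_(A i) w *
     (expR (- (r * (ti n i.+1 - ti n i))) * g (X (ti n i.+1) w) - g (X (ti n i) w)))
   - Ex (fun w => \1_(A n) w * discounted_value n g w n).
Proof.
move=> n0 mA.
have l0 : L1 (fun w => discounted_value n g w 0).
  by apply: (@L1_bounded _ _ _ _ _ Cg) => [|w]; [exact: mdval|exact: discounted_value_bound].
have l1 : L1 (fun w => \1_(A n) w * discounted_value n g w n).
  apply: (@L1_bounded _ _ _ _ _ Cg) => [|w].
    by apply: measurable_funM; [exact: measurable_indic|exact: mdval].
  by rewrite normrM -[leRHS]mul1r ler_pM// discounted_value_bound.
pose U i w := \1_(A i) w *
     (expR (- (r * (ti n i.+1 - ti n i))) * g (X (ti n i.+1) w) - g (X (ti n i) w)).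
have lU i : L1 (U i).
  apply: (@L1_bounded _ _ _ _ _ (Cg + Cg)) => [|w].
    apply: measurable_funM; first exact: measurable_indic.
    by apply: measurable_funB; [apply: measurable_funM => //|]; apply: mgX; exact: ti_ge0.
  rewrite normrM -[leRHS]mul1r ler_pM// (le_trans (ler_normB _ _))// lerD//.
  rewrite normrM -[leRHS]mul1r ler_pM//.
  by rewrite ger0_norm ?expR_ge0// expR_le1 oppr_le0 mulr_ge0 ?(ltW r0)// subr_ge0 ltW// ti_lt.
have lV (i : nat) : (i < n)%N -> L1 (fun w => expR (- (r * ti n i)) * U i w) by move=> _; exact: L1Z.
have -> : stopped n A g = (fun w => discounted_value n g w 0 + \sum_(i < n) expR (- (r * ti n i)) * U i w
    - \1_(A n) w * discounted_value n g w n).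
  apply/funext => w; rewrite /stopped; congr (_ + _ - _); apply: eq_bigr => i _.
  by rewrite stepE// /U; ring.
rewrite ExB; [|apply: L1D => //; exact: (@L1_sum _ _ _ _ n (fun i w => expR (- (r * ti n i)) * U i w))|exact: l1].
rewrite ExD; [|exact: l0|exact: (@L1_sum _ _ _ _ n (fun i w => expR (- (r * ti n i)) * U i w))].
rewrite (@Ex_sum _ _ _ _ n (fun i w => expR (- (r * ti n i)) * U i w))//.
congr (_ + _ - _).
  by congr Ex; apply/funext => w; rewrite /discounted_value grid0 mulr0 oppr0 expR0 mul1r.
by apply: eq_bigr => i _; rewrite (ExZ _ (lU i)).
Qed.

Lemma Ex_start : Ex (fun w => g (X 0 w)) = g x0.
Proof.
rewrite -[RHS](Ex_cst Pr (g x0)); apply: eq_Ex_ae => //; first exact: mgX.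
by apply: filterS Xx0 => w ->.
Qed.

Section upper.
Variable tau : Omega -> \bar R.
Hypothesis htau : is_stopping_time Fil tau.

Let A n i : set Omega := ~` [set w | (tau w <= (ti n i)%:E)%E].

Let FA n i : (0 < n)%N -> Fil (ti n i) (A n i).
Proof.
move=> n0; have h : @measurable _ (g_sigma_algebraType (filt_gen Pr W (ti n i))) [set w | (tau w <= (ti n i)%:E)%E].
  by case: htau => _; apply; exact: ti_ge0.
exact: (measurableC h).
Qed.

(** Exercise after [T] pays nothing, so grids of [[0, T]] suffice. For the put the neglected part is
    at most [K * exp (- r T)]. *)
Definition stopped_before (w : Omega) : R :=
  match tau w with
  | u%:E => if u <= T then expR (- (r * u)) * g (X u w) else 0
  | _ => 0
  end.

Hypothesis cg : continuous g.

(** The grid stops at the first grid time not before [tau w], at most one mesh later. Approximation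
    from the right keeps the stopping decision in the filtration, and continuity of paths gives the
    limit. *)
Lemma stopped_cvg w : stopped n.+1 (A n.+1) g w @[n --> \oo] --> stopped_before w.
Proof.
rewrite /stopped_before; case: htau => /(_ w) + _; case e : (tau w) => [u| |//] => [u0|_].
- have u0' : 0 <= u by rewrite -lee_fin.
  have [uT|Tu] := leP u T; last first.
    apply: cvg_near_cst; apply: nearW => n; apply: stopped_never => i ni.
    rewrite /A /= e lee_fin; apply/negP; rewrite -ltNge; apply: le_lt_trans Tu.
    by rewrite -[leRHS](grid_last 0 T (ltn0Sn n)); apply: grid_le => //; exact: mesh_gt0.
  apply/cvgrPdist_le => eps eps0.
  have cp : {within `[0, +oo[, continuous (fun v => expR (- (r * v)) * g (X v w))}.
    apply/subspace_continuousP => v v0; apply: cvgM.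
      apply: cvg_within_filter; apply: continuous_comp; last exact: continuous_expR.
      by apply: cvgN; apply: cvgM; [exact: cvg_cst|exact: cvg_id].
    have /subspace_continuousP/(_ v v0) h := @cX w.
    exact: (cvg_comp _ _ h (@cg _)).
  have [del del0 hd] := path_modulus cp u0' eps0.
  have [N hN] := mesh_lt T0 del0; exists N => // n /= Nn.
  have n0 := ltn0Sn n; have mp : 0 < mesh 0 T n.+1 by exact: mesh_gt0.
  have hA i : A n.+1 i w <-> ti n.+1 i < u.
    by rewrite /A /= e lee_fin; split => [/negP|h]; [rewrite -ltNge|apply/negP; rewrite -ltNge].
  have [|j [jn nj hj]] := @first_index (fun i => ti n.+1 i < u) n.+1.
    by exists n.+1 => //; rewrite -leNgt [leRHS](grid_last 0 T n0).
  rewrite -leNgt in nj.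
  rewrite (@stopped_at n.+1 (A n.+1) g w j)//; last 2 first.
  + by move=> i ij; apply/hA; exact: hj.
  + move=> i ji /hA; apply/negP; rewrite -leNgt (le_trans nj)//; exact: grid_le.
  apply: hd; first exact: ti_ge0.
  rewrite ler0_norm ?subr_le0// opprB; apply: le_lt_trans (hN n.+1 Nn).
  case: j jn nj hj => [|j] jn nj hj; first by rewrite grid0 lerBlDr (le_trans (ltW mp))// lerDl.
  by rewrite gridS lerBlDr addrC lerD2l ltW// hj.
- apply: cvg_near_cst; apply: nearW => n; apply: stopped_never => i ni.
  by rewrite /A /= e.
Qed.

Lemma measurable_stopped_before : measurable_fun setT stopped_before.
Proof.
apply: (@measurable_fun_cvg _ _ _ setT (fun n => stopped n.+1 (A n.+1) g)).
  move=> n; apply: measurable_stopped => // i.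
  by apply: (filt_measurable hW); exact: FA.
by move=> w _; exact: stopped_cvg.
Qed.

Lemma stopped_bound n (B : nat -> set Omega) w : (0 < n)%N -> (forall i, B i.+1 `<=` B i) -> `|stopped n B g w| <= Cg.
Proof.
move=> n0 dB.
have mono i j : (i <= j)%N -> B j `<=` B i.
  elim: j => [|j ih]; first by rewrite leqn0 => /eqP->.
  by rewrite leq_eqVlt => /orP[/eqP->//|/ih h]; exact: (subset_trans (dB j)).
have [all|nall] := pselect (forall i, (i <= n)%N -> B i w).
  by rewrite stopped_never// normr0.
have [|j [jn /negP nj hj]] := @first_index (fun i => w \in B i) n.
  apply: contrapT => h; apply: nall => i ni; apply: contrapT => Bi; apply: h.
  by exists i => //; apply/negP; rewrite inE.
rewrite (@stopped_at n B g w j)//; first exact: discounted_value_bound.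
  by move=> i /hj; rewrite inE.
by move=> i ji Bi; apply: nj; rewrite inE; exact: (mono _ _ ji).
Qed.

Lemma stopped_before_le : discounted_supermartingale g -> (forall x, 0 <= g x) ->
  Ex stopped_before <= g x0.
Proof.
move=> sup g0.
have mA n i : (0 < n)%N -> measurable (A n i).
  by move=> n0; apply: (filt_measurable hW); exact: FA.
have dA n i : (0 < n)%N -> A n i.+1 `<=` A n i.
  move=> n0 w /= h h'; apply: h; apply: le_trans h' _.
  by rewrite lee_fin ltW// ti_lt.
have cE : Ex (stopped n.+1 (A n.+1) g) @[n --> \oo] --> Ex stopped_before.
  apply: (@Ex_dct _ _ _ _ _ _ Cg).
  - by move=> n; apply: measurable_stopped => // i; exact: mA.
  - exact: measurable_stopped_before.
  - by move=> n w; apply: stopped_bound => // i; exact: dA.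
  - by apply: aeW => w; exact: stopped_cvg.
apply: (cvg_seq_le cE) => n.
rewrite Ex_stopped//; last by move=> i; exact: mA.
rewrite Ex_start.
have h1 : \sum_(i < n.+1) expR (- (r * ti n.+1 i)) * Ex (fun w => \1_(A n.+1 i) w *
     (expR (- (r * (ti n.+1 i.+1 - ti n.+1 i))) * g (X (ti n.+1 i.+1) w) - g (X (ti n.+1 i) w))) <= 0.
  rewrite sumr_le0// => i _; rewrite mulr_ge0_le0 ?expR_ge0//.
  by apply: sup; [exact: ti_ge0|exact: ti_lt|exact: FA].
have h2 : 0 <= Ex (fun w => \1_(A n.+1 n.+1) w * discounted_value n.+1 g w n.+1).
  by apply: Ex_ge0 => w; rewrite mulr_ge0// mulr_ge0// expR_ge0.
move: h1 h2; lra.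
Qed.

End upper.

End optimal_stopping.

Section payoffs.
Context {d : measure_display} {Omega : measurableType d} {R : realType}.
Variable Pr : probability Omega R.
Variable W : R -> Omega -> R.
Hypothesis hW : standard_brownian Pr W.
Local Notation Fil := (brownian_filtration Pr W).
Local Notation Ex := (Ex Pr).
Local Notation L1 U := (Pr.-integrable setT (EFin \o U)).
Local Notation mu := (@lebesgue_measure R).
Local Notation TR := (measurableTypeR R).
Variables (r x0 : R) (X : R -> Omega -> R) (K : R).
Hypotheses (r0 : 0 < r) (K0 : 0 < K).
Hypotheses (aX : adapted Fil X) (cX : continuous_paths X).
Hypothesis X0 : forall t w, 0 <= t -> 0 <= X t w.
Hypothesis Xx0 : {ae Pr, forall w, X 0 w = x0}.

(** The cut at [K] makes the payoff bounded on the whole line, as the stopping lemmas require; it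
    has no effect for [x >= 0]. *)
Definition put (x : R) : R := Num.min (Num.max (K - x) 0) K.

Lemma putE x : 0 <= x -> put x = Num.max (K - x) 0.
Proof. by move=> x0'; rewrite /put (min_idPl _)// ge_max (ltW K0) andbT; lra. Qed.

Let continuous_max0 : continuous (fun u : R => Num.max u 0).
Proof.
have -> : (fun u : R => Num.max u 0) = ppow 1 by apply/funext => u; rewrite /ppow expr1.
exact: continuous_ppow.
Qed.

Lemma continuous_put : continuous put.
Proof.
have -> : put = fun x => K - Num.max (K - Num.max (K - x) 0) 0.
  apply/funext => x; rewrite /put; case: (leP (K - x) 0) => h1.
    by rewrite (min_idPl (ltW K0)) subr0 (max_idPl (ltW K0)) subrr.
  have -> : K - (K - x) = x by ring.
  by case: (leP x 0) => h2; [rewrite (min_idPr _) ?subr0|rewrite (min_idPl _)]; lra.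
move=> x; apply: cvgB; first exact: cvg_cst.
apply: (@continuous_comp _ _ _ (fun x : R => K - Num.max (K - x) 0) (fun u : R => Num.max u 0)).
  apply: cvgB; first exact: cvg_cst.
  apply: (@continuous_comp _ _ _ (fun x : R => K - x) (fun u : R => Num.max u 0)).
    by apply: cvgB; [exact: cvg_cst|exact: cvg_id].
  exact: continuous_max0.
exact: continuous_max0.
Qed.

Lemma measurable_put : measurable_fun setT put.
Proof. exact: continuous_measurable_fun continuous_put. Qed.

Section one_time.
Variable tau : Omega -> \bar R.
Hypothesis htau : is_stopping_time Fil tau.
Local Notation payoff := (discounted_payoff r K X tau).

Lemma payoff_itv w : 0 <= payoff w <= K.
Proof.
rewrite /discounted_payoff; case: htau => /(_ w) + _; case: (tau w) => [u| |] h; rewrite ?lexx ?(ltW K0)//.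
have u0 : 0 <= u by rewrite -lee_fin.
have m0 : 0 <= Num.max (K - X u w) 0 by rewrite le_max lexx orbT.
rewrite mulr_ge0 ?expR_ge0//= -[leRHS]mul1r ler_pM ?expR_ge0//.
  by rewrite expR_le1 oppr_le0 mulr_ge0// ltW.
by rewrite ge_max (ltW K0) andbT; have := X0 w u0; lra.
Qed.

Let Tk (k : nat) : R := k.+1%:R.
Let Tk0 k : 0 < Tk k. Proof. by rewrite ltr0n. Qed.

(** The value of [X] at a general stopping time is reached as a limit of grid sums for a fixed
    horizon, and then as a limit of horizons. *)
Lemma measurable_payoff : measurable_fun setT payoff.
Proof.
apply: (@measurable_fun_cvg _ _ _ setT (fun k => stopped_before r X (Tk k) put tau)).
  by move=> k; exact: (measurable_stopped_before hW r aX cX (Tk0 k) measurable_put htau continuous_put).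
move=> w _; rewrite /discounted_payoff /stopped_before.
case: htau => /(_ w) + _; case: (tau w) => [u| |] h; [|exact: cvg_cst|exact: cvg_cst].
have u0 : 0 <= u by rewrite -lee_fin.
apply: cvg_near_cst; exists (Num.truncn u) => // k /= uk.
rewrite putE ?X0// ifT//; apply: le_trans (ltW (truncnS_gt u)) _.
by rewrite ler_nat.
Qed.

Lemma expectation_payoff : 'E_Pr[payoff]%E = (Ex payoff)%:E.
Proof.
rewrite unlock Ex_EFin//; apply: (@L1_bounded _ _ _ _ _ K); first exact: measurable_payoff.
by move=> w; have /andP[a c] := payoff_itv w; rewrite ger0_norm.
Qed.

Lemma payoff_upper (F : R -> R) (C : R) : continuous F -> (forall x, 0 <= F x <= C) ->
  discounted_supermartingale Pr W r X F -> (forall x, 0 <= x -> Num.max (K - x) 0 <= F x) ->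
  Ex payoff <= F x0.
Proof.
move=> cF F0 sup dom.
have mF : measurable_fun setT F by exact: continuous_measurable_fun.
have FC x : `|F x| <= C by have /andP[a c] := F0 x; rewrite ger0_norm.
have Fge x : 0 <= F x by have /andP[] := F0 x.
have step T : 0 < T -> Ex payoff <= F x0 + K * expR (- (r * T)).
  move=> T0.
  have mS := measurable_stopped_before hW r aX cX T0 mF htau cF.
  have h := stopped_before_le hW r0 aX cX Xx0 T0 mF FC htau cF sup Fge.
  have S0 w : `|stopped_before r X T F tau w| <= C.
    have C0 : 0 <= C by exact: le_trans (FC 0).
    rewrite /stopped_before; case: htau => /(_ w) + _; case: (tau w) => [u| |] hu; rewrite ?normr0//.
    have u0 : 0 <= u by rewrite -lee_fin.
    case: ifP => _; rewrite ?normr0// normrM -[leRHS]mul1r ler_pM//.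
    by rewrite ger0_norm ?expR_ge0// expR_le1 oppr_le0 mulr_ge0// ltW.
  have iS : L1 (stopped_before r X T F tau) by exact: L1_bounded mS S0.
  have ic : L1 (fun=> K * expR (- (r * T))).
    by apply: (@L1_bounded _ _ _ _ _ `|K * expR (- (r * T))|).
  apply: (@le_trans _ _ (Ex (fun w => stopped_before r X T F tau w + K * expR (- (r * T))))).
    apply: Ex_le.
    - apply: (@L1_bounded _ _ _ _ _ K); first exact: measurable_payoff.
      by move=> w; have /andP[a c] := payoff_itv w; rewrite ger0_norm.
    - exact: L1D.
    - move=> w; have e0 : 0 <= K * expR (- (r * T)) by rewrite mulr_ge0 ?expR_ge0// ltW.
      rewrite /discounted_payoff /stopped_before; case: htau => /(_ w) + _; case: (tau w) => [u| |] hu; rewrite ?add0r//.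
      have u0 : 0 <= u by rewrite -lee_fin.
      have [uT|uT] := leP u T.
        by apply: (@le_trans _ _ (expR (- (r * u)) * F (X u w))); [rewrite ler_wpM2l ?expR_ge0// dom// X0|rewrite lerDl].
      rewrite add0r mulrC ler_pM ?expR_ge0//; first by rewrite le_max lexx orbT.
        by rewrite ge_max (ltW K0) andbT; have := X0 w u0; lra.
      by rewrite ler_expR lerN2 ler_pM2l// ltW.
  by rewrite (ExD iS ic) Ex_cst lerD2r.
(* With this horizon [exp (r T) >= 1 + r T] yields [K * exp (- r T) <= e]. *)
apply/ler_addgt0Pr => e e0; pose T := K / (r * e).
have re : 0 < r * e by rewrite mulr_gt0.
have T0 : 0 < T by rewrite divr_gt0.
apply: le_trans (step T T0) _; rewrite lerD2l expRN ler_pdivrMr ?expR_gt0//.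
apply: (@le_trans _ _ (e * (1 + r * T))); last by rewrite ler_wpM2l ?(ltW e0)// expR_ge1Dx.
by rewrite /T; have -> : e * (1 + r * (K / (r * e))) = e + K by [field; rewrite !gt_eqF|]; lra.
Qed.

End one_time.

Section lower.
Variables (T z : R) (n : nat).
Hypotheses (T0 : 0 < T) (n0 : (0 < n)%N).
Local Notation ti := (grid 0 (mesh 0 T n)).

Let mp : 0 < mesh 0 T n. Proof. exact: mesh_gt0. Qed.
Let ti_ge0 i : 0 <= ti i. Proof. exact: grid_ge. Qed.

(** All grid points up to [i] are tested, so that the events decrease with [i] and encode a first
    passage. *)
Definition above (i : nat) : set Omega := [set w | forall j, (j <= i)%N -> z < X (ti j) w].

Lemma Fil_bigcup (t : R) (D : set nat) (B : nat -> set Omega) :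
  (forall j, D j -> Fil t (B j)) -> Fil t (\bigcup_(j in D) B j).
Proof.
move=> h; have := @bigcup_measurable _ (g_sigma_algebraType (filt_gen Pr W t)) B D.
by apply => j Dj; exact: h.
Qed.

Lemma Fil_setC (t : R) (B : set Omega) : Fil t B -> Fil t (~` B).
Proof. by move=> h; have := @measurableC _ (g_sigma_algebraType (filt_gen Pr W t)) B h. Qed.

Let low_Fil (t : R) j : ti j <= t -> Fil t (X (ti j) @^-1` `]-oo, z]).
Proof.
move=> jt; apply: (filt_mono jt); apply: aX; [exact: ti_ge0|exact: measurable_itv].
Qed.

Lemma above_Fil i : Fil (ti i) (above i).
Proof.
have -> : above i = ~` \bigcup_(j in [set j | (j <= i)%N]) (X (ti j) @^-1` `]-oo, z]).
  apply/seteqP; split=> [w h [j /= ji]|w h j ji].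
    by rewrite in_itv/= leNgt h.
  rewrite ltNge; apply/negP => hj; apply: h.
  by exists j; [exact: ji|rewrite /= in_itv/=; exact: hj].
apply: Fil_setC; apply: Fil_bigcup => j /= ji.
by apply: low_Fil; exact: (grid_le 0 mp ji).
Qed.

(** [find] returns the length [n.+1] when nothing is found, so [hit w <= n] says that the passage
    occurs on the grid. *)
Let hit (w : Omega) : nat := find (fun j => X (ti j) w <= z) (iota 0 n.+1).

Definition first_below (w : Omega) : \bar R :=
  if (hit w <= n)%N then (ti (hit w))%:E else +oo%E.

Let hitP w : (hit w <= n)%N -> X (ti (hit w)) w <= z.
Proof.
move=> h; have hs : has (fun j => X (ti j) w <= z) (iota 0 n.+1).
  by rewrite has_find size_iota ltnS.
by have := nth_find 0%N hs; rewrite nth_iota// size_iota in hs *.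
Qed.

Let before_hit w j : (j < hit w)%N -> (j <= n)%N -> z < X (ti j) w.
Proof.
move=> jh jn; have := before_find 0%N jh; rewrite nth_iota// add0n => /negbT.
by rewrite -ltNge.
Qed.

Let hit_le w j : (j <= n)%N -> X (ti j) w <= z -> (hit w <= j)%N.
Proof.
move=> jn hj; rewrite leqNgt; apply/negP => /before_hit/(_ jn).
by rewrite ltNge hj.
Qed.

Lemma first_below_stopping : is_stopping_time Fil first_below.
Proof.
split=> [w|t t0].
  by rewrite /first_below; case: ifP => _; rewrite ?lee_fin ?leey.
have -> : [set w | (first_below w <= t%:E)%E] =
    \bigcup_(j in [set j | (j <= n)%N /\ ti j <= t]) (X (ti j) @^-1` `]-oo, z]).
  apply/seteqP; split=> [w /=|w [j [jn jt]]].
    rewrite /first_below; case: ifP => [hn|_]; last by rewrite leye_eq.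
    by rewrite lee_fin => ht; exists (hit w) => //=; rewrite in_itv/=; exact: hitP.
  rewrite /= in_itv/= => hj; have hl := hit_le jn hj.
  rewrite /first_below (leq_trans hl jn) lee_fin (le_trans _ jt)//.
  exact: (grid_le 0 mp hl).
by apply: Fil_bigcup => j [_ jt]; exact: low_Fil.
Qed.

Lemma stopped_first_below (g : R -> R) w : stopped r X T n above g w =
  if (hit w <= n)%N then discounted_value r X T n g w (hit w) else 0.
Proof.
case: ifP => hn.
  apply: stopped_at => //.
  - move=> i ih j ji; apply: before_hit; first exact: leq_ltn_trans ih.
    by rewrite (leq_trans ji)// (leq_trans (ltnW ih)).
  - by move=> i hi /(_ _ hi); rewrite ltNge hitP.
apply: stopped_never => i ni j ji; rewrite ltNge; apply/negP => hj.
have jn : (j <= n)%N by exact: leq_trans ni.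
by have := leq_trans (hit_le jn hj) jn; rewrite hn.
Qed.

Hypothesis zK : z <= K.

Lemma payoff_first_below (g : R -> R) (C : R) w : 0 < C -> (forall x, 0 <= g x <= C) ->
  (K - z) / C * stopped r X T n above g w <= discounted_payoff r K X first_below w.
Proof.
move=> C0 gC; rewrite stopped_first_below /discounted_payoff /first_below.
case: ifP => hn; last by rewrite mulr0.
have /andP[ga gb] := gC (X (ti (hit w)) w).
rewrite /discounted_value mulrCA ler_wpM2l ?expR_ge0//.
apply: (@le_trans _ _ (K - z)).
  have Kz : 0 <= K - z by rewrite subr_ge0.
  by rewrite mulrAC ler_pdivrMr// ler_wpM2l.
by rewrite le_max; apply/orP; left; rewrite lerD2l lerN2; exact: hitP.
Qed.

End lower.

End payoffs.

Lemma Rintegral_le0 {d} {T : measurableType d} {R : realType}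
    (mu : {measure set T -> \bar R}) (D : set T) (f : T -> R) :
  (forall x, D x -> f x <= 0) -> (\int[mu]_(x in D) f x)%R <= 0.
Proof.
move=> f0; rewrite /Rintegral; apply: fine_le0.
under eq_integral do rewrite -(oppeK (f _)%:E).
rewrite integral_ge0N; first by rewrite oppe_le0; apply: integral_ge0 => x /f0; rewrite -EFinN lee_fin oppr_ge0.
by move=> x /f0; rewrite -EFinN lee_fin oppr_ge0.
Qed.

(** * Supermartingales and first passage of the price process *)

Section price_process.
Context {d : measure_display} {Omega : measurableType d} {R : realType}.
Variable Pr : probability Omega R.
Variable W : R -> Omega -> R.
Hypothesis hW : standard_brownian Pr W.
Local Notation Fil := (brownian_filtration Pr W).
Local Notation Ex := (Ex Pr).
Local Notation L1 U := (Pr.-integrable setT (EFin \o U)).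
Local Notation mu := (@lebesgue_measure R).
Local Notation TR := (measurableTypeR R).
Variables (r x0 : R) (hh : R -> R) (X M : R -> Omega -> R).
Variable S : nat -> simple_process Fil.
Hypotheses (r0 : 0 < r) (mhh : measurable_fun setT hh).
Hypotheses (aX : adapted Fil X) (cX : continuous_paths X).
Hypothesis X0 : forall t w, 0 <= t -> 0 <= X t w.
Hypotheses (aM : adapted Fil M) (cM : continuous_paths M).
Hypothesis hS : forall t eps : R, 0 <= t -> 0 < eps ->
  (Pr [set w | eps%:E < \int[mu]_(u in `[0%R, t])
         ((sp_eval (S n) u w - hh (X u w)) ^+ 2)%R%:E]%E @[n --> \oo] --> 0%E)
  /\ (Pr [set w | eps < `|sp_integral W (S n) t w - M t w|] @[n --> \oo] --> 0%E).
Hypothesis eqX : {ae Pr, forall w, forall t, 0 <= t ->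
  X t w = x0 + \int[mu]_(u in `[0%R, t]) (r * X u w) + M t w}.
Hypothesis H2 : {ae Pr, forall w, forall t : R, 0 <= t ->
  (\int[mu]_(u in `[0%R, t]) ((hh (X u w)) ^+ 2)%:E < +oo)%E}.
Hypothesis Xx0 : {ae Pr, forall w, X 0 w = x0}.

Variables (G G1 G2 : R -> R) (Kg Kk : R).
Hypothesis hG : test_fun G G1 G2 Kg.
Hypothesis hk : forall x, 0 <= x -> `|price_drift r hh G G1 G2 x| <= Kk.
Local Notation kp := (price_drift r hh G G1 G2).

Let mG : measurable_fun setT G.
Proof. by apply: continuous_measurable_fun; exact: (tf_cG hG). Qed.
Let mG1 : measurable_fun setT G1.
Proof. by apply: continuous_measurable_fun; exact: (tf_cG1 hG). Qed.
Let mG2 : measurable_fun setT G2.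
Proof. by apply: continuous_measurable_fun; exact: (tf_cG2 hG). Qed.

Let mkp : measurable_fun setT kp.
Proof.
apply: measurable_funB; first apply: measurable_funD.
- by apply: measurable_funM => //; exact: measurable_funM.
- by apply: measurable_funM => //; apply: measurable_funM => //; exact: measurable_funX.
- by apply: measurable_funM.
Qed.

Let dynkin s t A : 0 <= s -> s < t -> Fil s A ->
  Ex (fun w => \1_A w * (expR (- (r * (t - s))) * G (X t w) - G (X s w))) <=
  Ex (fun w => \1_A w * (\int[mu]_(u in `[s, t[) (expR (- (r * (u - s))) * kp (X u w)))%R).
Proof.
move=> s0 st FA.
exact: (dynkin_le hW (ltW r0) mhh aX cX X0 aM cM hS eqX H2 hG hk s0 st FA).
Qed.

Lemma price_drift_le0_supermartingale : (forall x, 0 <= x -> kp x <= 0) ->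
  discounted_supermartingale Pr W r X G.
Proof.
move=> k0 s t A s0 st FA; apply: le_trans (dynkin s0 st FA) _.
apply: Rintegral_le0 => w _; rewrite mulr_ge0_le0//.
apply: Rintegral_le0 => u; rewrite /= in_itv/= => /andP[su _].
by rewrite mulr_ge0_le0 ?expR_ge0// k0// X0// (le_trans s0).
Qed.

(** Strict inequality: a path counted as below [z] is so by a positive margin, which continuity
    carries to the preceding grid point. *)
Definition below (z x : R) : R := \1_(`]-oo, z[%classic : set R) x.

Lemma below_itv z x : 0 <= below z x <= 1.
Proof. by rewrite /below indicE; case: (_ \in _); rewrite ?lexx ?ler01. Qed.

Lemma belowE z x : below z x = (x < z)%R%:R.
Proof.
rewrite /below indicE; congr (nat_of_bool _)%:R.
by apply/idP/idP; rewrite inE /= in_itv.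
Qed.

Lemma measurable_below z : measurable_fun setT (below z).
Proof. by apply: measurable_indic; exact: measurable_itv. Qed.

Section occupation.
Variables (s t : R).
Hypotheses (s0 : 0 <= s) (st : s < t).
Local Notation D := (`[s, t[%classic : set R).
Let mD : measurable (D : set TR). Proof. exact: measurable_itv. Qed.
Let sub : D `<=` `[s, t]. Proof. by move=> u /=; rewrite !in_itv/= => /andP[-> /ltW]. Qed.

Definition occupation (z : R) (w : Omega) : R := (\int[mu]_(u in D) below z (X u w))%R.

Let mX w : measurable_fun D (fun u => X u w).
Proof. exact: (measurable_path (@cX w)). Qed.

Let ibelow z w : mu.-integrable D (EFin \o (fun u => below z (X u w))).
Proof.
apply: (itv_integrable_bounded sub mD (C := 1)).
  by apply: (measurableT_comp (@measurable_below z)); exact: mX.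
by move=> u _; have /andP[a c] := below_itv z (X u w); rewrite ger0_norm.
Qed.

Lemma occupation_itv z w : 0 <= occupation z w <= t - s.
Proof.
apply/andP; split.
  by apply: Rintegral_ge0 => u _; have /andP[] := below_itv z (X u w).
have -> : t - s = (\int[mu]_(u in D) 1)%R.
  by rewrite Rintegral_cst//= lebesgue_measure_itv/= lte_fin st -EFinB mul1r.
apply: le_Rintegral => //.
  by apply: (itv_integrable_bounded sub mD (C := 1)) => // u _; rewrite normr1.
by move=> u _; have /andP[] := below_itv z (X u w).
Qed.

Lemma measurable_occupation z : measurable_fun setT (occupation z).
Proof.
pose q (p : TR * Omega) := below z (X p.1 p.2 * \1_D p.1).
have mq : measurable_fun setT q.
  apply: (measurableT_comp (@measurable_below z)).
  by apply: measurable_process_joint => // u u0; exact: (measurable_X hW aX).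
rewrite (_ : occupation z = fun w => \int[mu]_(u in D) q (u, w))%R; last first.
  by apply/funext => w; apply: eq_Rintegral => u; rewrite inE => Du; rewrite /q/= indicE mem_set// mulr1.
apply: (@measurable_Rintegral _ _ _ s t q 1) => // p.
by have /andP[a c] := below_itv z (X p.1 p.2 * \1_D p.1); rewrite /q ger0_norm.
Qed.

(** Passing from [G] to [C - G] turns the upper estimate into a lower one. The drift [- r C]
    integrates against the discount to [- C * (1 - exp (- r (t - s)))], exactly what the constant
    [C] loses, and the remainder is charged to the time spent below [z]. *)
Lemma dynkin_occupation (C Cp z : R) A : 0 <= C -> 0 <= Cp ->
  (forall x, 0 <= x -> kp x <= - (r * C) + Cp * below z x) -> Fil s A ->
  - (Cp * Ex (fun w => \1_A w * occupation z w)) <=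
  Ex (fun w => \1_A w * (expR (- (r * (t - s))) * (C - G (X t w)) - (C - G (X s w)))).
Proof.
move=> C0 Cp0 kC FA.
have mA : measurable A by exact: (filt_measurable hW FA).
have mi : measurable_fun setT (\1_A : Omega -> R) by exact: measurable_indic.
have i1 w : `|\1_A w : R| <= 1 by rewrite indicE; case: (_ \in _); rewrite ?normr1 ?normr0.
have i0 w : 0 <= \1_A w :> R by rewrite indicE.
set e := expR (- (r * (t - s))).
have e1 : 0 <= e <= 1 by rewrite expR_ge0 expR_le1 oppr_le0 mulr_ge0 ?(ltW r0)// subr_ge0 ltW.
have t0 : 0 <= t by exact: ltW (le_lt_trans s0 st).
have Kg0 : 0 <= Kg by exact: le_trans (tf_ge0 hG 0) (tf_le hG 0).
have nG y : `|G y| <= Kg by rewrite ger0_norm; [exact: (tf_le hG)|exact: (tf_ge0 hG)].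
have mGX u : 0 <= u -> measurable_fun setT (fun w => G (X u w)).
  by move=> u0; apply: (measurableT_comp mG); exact: (measurable_X hW aX).
pose U w := e * G (X t w) - G (X s w).
have iU : L1 (fun w => \1_A w * U w).
  apply: (@L1_bounded _ _ _ _ _ (Kg + Kg)).
    apply: measurable_funM => //; apply: measurable_funB; last exact: mGX.
    by apply: measurable_funM => //; exact: mGX.
  move=> w; rewrite normrM -[leRHS]mul1r ler_pM// (le_trans (ler_normB _ _))// lerD//.
  rewrite normrM -[leRHS]mul1r ler_pM//; case/andP: e1 => a b; by rewrite ger0_norm.
have iO : L1 (fun w => \1_A w * occupation z w).
  apply: (@L1_bounded _ _ _ _ _ (t - s)).
    by apply: measurable_funM => //; exact: measurable_occupation.
  move=> w; have /andP[a b] := occupation_itv z w.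
  by rewrite normrM -[leRHS]mul1r ler_pM// ger0_norm.
have iA : L1 (fun w => C * (1 - e) * \1_A w).
  by apply: L1Z; apply: (@L1_bounded _ _ _ _ _ 1).
have key : Ex (fun w => \1_A w * U w) <=
    Ex (fun w => Cp * (\1_A w * occupation z w) - C * (1 - e) * \1_A w).
  apply: le_trans (dynkin s0 st FA) _.
  have me : measurable_fun D (fun u : R => expR (- (r * (u - s)))).
    apply: measurable_funTS; apply: measurableT_comp => //; apply: measurableT_comp => //.
    by apply: measurable_funM => //; exact: measurable_funB.
  have eb u : D u -> 0 <= expR (- (r * (u - s))) <= 1.
    rewrite /= in_itv/= => /andP[su _].
    by rewrite expR_ge0 expR_le1 oppr_le0 mulr_ge0 ?(ltW r0)// subr_ge0.
  have ik w : mu.-integrable D (EFin \o (fun u => expR (- (r * (u - s))) * kp (X u w))).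
    apply: (itv_integrable_bounded sub mD (C := Kk)).
      by apply: measurable_funM => //; apply: (measurableT_comp mkp); exact: mX.
    move=> u Du; have /andP[a b] := eb u Du; rewrite normrM (ger0_norm a) -[leRHS]mul1r ler_pM//.
    apply: hk; apply: X0; move: Du; rewrite /= in_itv/= => /andP[su _]; exact: le_trans su.
  have ie : mu.-integrable D (EFin \o (fun u => expR (- (r * (u - s))) * r)).
    apply: (itv_integrable_bounded sub mD (C := r)); first exact: measurable_funM.
    move=> u Du; have /andP[a b] := eb u Du; rewrite normrM (ger0_norm a) (gtr0_norm r0).
    by rewrite ler_piMl// ltW.
  have pathw w : (\int[mu]_(u in D) (expR (- (r * (u - s))) * kp (X u w)))%R <=
      Cp * occupation z w - C * (1 - e).
    have -> : Cp * occupation z w - C * (1 - e) =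
       (\int[mu]_(u in D) (Cp * below z (X u w) - C * (expR (- (r * (u - s))) * r)))%R.
      rewrite RintegralB//=; [|exact: (integrableZl mD Cp (ibelow z w))|exact: (integrableZl mD C ie)].
      have -> : (\int[mu]_(u in D) (Cp * below z (X u w)))%R = Cp * occupation z w.
        by rewrite RintegralZl//; exact: ibelow.
      by rewrite RintegralZl// discount_integral.
    apply: le_Rintegral => //.
      by have := integrableB mD (integrableZl mD Cp (ibelow z w)) (integrableZl mD C ie); apply.
    move=> u Du; have /andP[a b] := eb u Du.
    have xu : 0 <= X u w by apply: X0; move: Du; rewrite /= in_itv/= => /andP[su _]; exact: le_trans su.
    have /andP[bz _] := below_itv z (X u w).
    apply: le_trans (ler_wpM2l a (kC _ xu)) _.
    have : expR (- (r * (u - s))) * (Cp * below z (X u w)) <= Cp * below z (X u w).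
      by rewrite ler_piMl// mulr_ge0.
    lra.
  apply: Ex_le.
  - have iC : L1 (fun w => \1_A w * (\int[mu]_(u in D) (expR (- (r * (u - s))) * kp (X u w)))%R).
      apply: (@L1_bounded _ _ _ _ _ (Kk * (t - s))).
        apply: measurable_funM => //.
        pose q (p : TR * Omega) := expR (- (r * `|p.1 - s|)) * kp (`|X p.1 p.2 * \1_D p.1|).
        have mq : measurable_fun setT q.
          apply: measurable_funM.
            apply: measurableT_comp => //; apply: measurableT_comp => //; apply: measurable_funM => //.
            apply: measurableT_comp => //; apply: measurable_funB => //; exact: measurable_fst.
          apply: (measurableT_comp mkp); apply: measurableT_comp => //.
          by apply: measurable_process_joint => // u u0; exact: (measurable_X hW aX).
        rewrite (_ : (fun w => _) = fun w => \int[mu]_(u in D) q (u, w))%R.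
          apply: (@measurable_Rintegral _ _ _ s t q Kk) => // p.
          rewrite /q normrM -[leRHS]mul1r ler_pM//; last exact: hk.
          by rewrite ger0_norm ?expR_ge0// expR_le1 oppr_le0 mulr_ge0// ltW.
        apply/funext => w; apply: eq_Rintegral => u; rewrite inE => Du.
        rewrite /q/= indicE mem_set// mulr1.
        move: Du; rewrite /= in_itv/= => /andP[su _].
        by rewrite !ger0_norm ?subr_ge0// X0// (le_trans s0).
      move=> w; rewrite normrM -[leRHS]mul1r ler_pM//.
      have iK : mu.-integrable D (EFin \o (fun=> Kk : R)).
        by apply: (itv_integrable_bounded sub mD (C := `|Kk|)).
      have -> : Kk * (t - s) = (\int[mu]_(u in D) Kk)%R.
        by rewrite Rintegral_cst//= lebesgue_measure_itv/= lte_fin st -EFinB.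
      apply: le_trans (le_normr_Rintegral _ (ik w)) _ => //.
      apply: le_Rintegral => //; first by have := integrable_abse (ik w); apply.
      move=> u Du; have /andP[a b] := eb u Du; rewrite normrM (ger0_norm a) -[leRHS]mul1r ler_pM//.
      apply: hk; apply: X0; move: Du; rewrite /= in_itv/= => /andP[su _]; exact: le_trans su.
    exact: iC.
  - exact: (L1B (L1Z Cp iO) iA).
  - by move=> w; have := ler_wpM2l (i0 w) (pathw w); lra.
rewrite (ExB (L1Z Cp iO) iA) (ExZ Cp iO) in key.
have -> : (fun w => \1_A w * (e * (C - G (X t w)) - (C - G (X s w)))) =
   (fun w => -1 * (\1_A w * U w) - C * (1 - e) * \1_A w).
  by apply/funext => w; rewrite /U; ring.
rewrite (ExB (L1Z (-1) iU) iA) (ExZ (-1) iU); move: key; lra.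
Qed.

End occupation.

Section first_passage.
Variables (T z C Cp : R).
Hypotheses (T0 : 0 < T) (C0 : 0 <= C) (Cp0 : 0 <= Cp).
Hypothesis kC : forall x, 0 <= x -> kp x <= - (r * C) + Cp * below z x.
Hypothesis GC : forall x, G x <= C.
Local Notation ti n := (grid 0 (mesh 0 T n)).
Local Notation Ab n := (above X T z n).
Local Notation H := (fun x => C - G x).
Local Notation D := (`[0, T[%classic : set R).

Definition passage_error (n : nat) : R :=
  Ex (fun w => \int[mu]_(u in D) (stepf 0 T n (fun i => \1_(Ab n i) w) u * below z (X u w)))%R.

(** Sum [dynkin_occupation] over the cells, on the events that no passage has been seen. Paths
    without passage by [T] account for [C * exp (- r T)]. *)
Lemma stopped_passage_ge n : (0 < n)%N ->
  H x0 - C * expR (- (r * T)) - Cp * passage_error n <= Ex (stopped r X T n (Ab n) H).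
Proof.
move=> n0; have mp : 0 < mesh 0 T n by exact: mesh_gt0.
have FA i := above_Fil aX z T0 n0 i.
have mA i : measurable (Ab n i) by exact: (filt_measurable hW (FA i)).
have mH : measurable_fun setT H by exact: measurable_funB.
have H0 x : 0 <= H x by rewrite subr_ge0.
have HC x : H x <= C by rewrite lerBlDr lerDl; exact: (tf_ge0 hG).
have nH x : `|H x| <= C by rewrite ger0_norm.
have i1 (A : set Omega) w : 0 <= (\1_A w : R) <= 1 by rewrite indicE; case: (_ \in _); rewrite ?lexx ?ler01.
have tg i : 0 <= ti n i by exact: grid_ge.
have tl i : ti n i < ti n i.+1 by exact: grid_ltS.
rewrite (Ex_stopped hW r0 aX T0 mH nH n0 mA) (Ex_start hW aX Xx0 mH).
have iO i : L1 (fun w => \1_(Ab n i) w * occupation (ti n i) (ti n i.+1) z w).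
  apply: (@L1_bounded _ _ _ _ _ (ti n i.+1 - ti n i)).
    by apply: measurable_funM; [exact: measurable_indic|exact: measurable_occupation].
  move=> w; have /andP[a b] := occupation_itv (tg i) (tl i) z w; have /andP[c e] := i1 (Ab n i) w.
  by rewrite normrM -[leRHS]mul1r ler_pM// ger0_norm.
have hsum : - (Cp * passage_error n) <= \sum_(i < n) expR (- (r * ti n i)) * Ex (fun w => \1_(Ab n i) w *
     (expR (- (r * (ti n i.+1 - ti n i))) * H (X (ti n i.+1) w) - H (X (ti n i) w))).
  have -> : passage_error n = \sum_(i < n) Ex (fun w => \1_(Ab n i) w * occupation (ti n i) (ti n i.+1) z w).
    rewrite -(@Ex_sum _ _ _ Pr n (fun i w => \1_(Ab n i) w * occupation (ti n i) (ti n i.+1) z w))//.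
    congr Ex; apply/funext => w.
    have mb : measurable_fun (`[0, T] : set R) (fun u => below z (X u w)).
      apply: (measurableT_comp (@measurable_below z)).
      have h : measurable_fun (`[0, +oo[%classic : set R) (fun u => X u w).
        by apply: subspace_continuous_measurable_fun; [exact: measurable_itv|exact: cX].
      apply: (measurable_funS _ _ h); first exact: measurable_itv.
      by move=> u /=; rewrite !in_itv/= andbT => /andP[].
    have bC u : 0 <= u <= T -> `|below z (X u w)| <= 1.
      by move=> _; have /andP[a b] := below_itv z (X u w); rewrite ger0_norm.
    have := integral_cells T0 n0 mb bC (fun i => \1_(Ab n i) w) (leqnn n).
    by rewrite grid_last.
  rewrite mulr_sumr -sumrN; apply: ler_sum => i _.
  have h := dynkin_occupation (tg i) (tl i) C0 Cp0 kC (FA i).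
  have e1 : 0 <= expR (- (r * ti n i)) <= 1.
    by rewrite expR_ge0 expR_le1 oppr_le0 mulr_ge0// ltW.
  case/andP: e1 => e0 e1; apply: le_trans (ler_wpM2l e0 h).
  rewrite mulrN lerN2 ler_piMl// mulr_ge0// Ex_ge0// => w.
  have /andP[a _] := occupation_itv (tg i) (tl i) z w; have /andP[c _] := i1 (Ab n i) w.
  exact: mulr_ge0.
have hend : Ex (fun w => \1_(Ab n n) w * discounted_value r X T n H w n) <= C * expR (- (r * T)).
  rewrite -[leRHS](Ex_cst Pr); apply: Ex_le.
  - apply: (@L1_bounded _ _ _ _ _ C).
      apply: measurable_funM; first exact: measurable_indic.
      by apply: measurable_funM => //; apply: (measurableT_comp mH); exact: (measurable_X hW aX).
    move=> w; have /andP[c e] := i1 (Ab n n) w.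
    rewrite normrM -[leRHS]mul1r ler_pM//; first by rewrite ger0_norm.
    exact: (discounted_value_bound X r0 T0 nH w n n0).
  - by apply: (@L1_bounded _ _ _ _ _ `|C * expR (- (r * T))|).
  - move=> w; have /andP[c e] := i1 (Ab n n) w; rewrite /discounted_value grid_last// [leRHS]mulrC.
    have hb : expR (- (r * T)) * H (X T w) <= expR (- (r * T)) * C by rewrite ler_wpM2l ?expR_ge0.
    by apply: le_trans hb; rewrite ler_piMl// mulr_ge0 ?expR_ge0.
move: hsum hend; set q := \sum_(i < n) _; set q2 := Ex (fun w => \1_(Ab n n) w * _); lra.
Qed.

(** If [X u < z], continuity puts the grid point just before [u] below [z] as well on fine grids, so
    the passage has already been seen and the integrand is [0]. It is bounded by [1], and dominated
    convergence applies. *)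
Lemma passage_error_cvg : passage_error n.+1 @[n --> \oo] --> 0.
Proof.
pose XI (p : TR * Omega) := X p.1 p.2 * \1_D p.1.
have mXI : measurable_fun setT XI.
  by apply: measurable_process_joint => // u u0; exact: (measurable_X hW aX).
pose f n (p : TR * Omega) := stepf 0 T n.+1 (fun i => \1_(Ab n.+1 i) p.2) p.1 * below z (XI p).
have mA n i : measurable (Ab n.+1 i).
  apply: (filt_measurable hW (t := ti n.+1 i)); exact: above_Fil.
have mf n : measurable_fun setT (f n).
  apply: measurable_funM; last exact: (measurableT_comp (@measurable_below z)).
  by apply: (@measurable_stepf_joint _ _ _ 0 T n.+1 (fun i w => \1_(Ab n.+1 i) w)) => i _; exact: measurable_indic.
have i1 (A : set Omega) w : 0 <= (\1_A w : R) <= 1 by rewrite indicE; case: (_ \in _); rewrite ?lexx ?ler01.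
have s1 n w u : 0 <= stepf 0 T n.+1 (fun i => \1_(Ab n.+1 i) w) u <= 1.
  have [/andP[u0 uT]|/negP nu] := boolP (0 <= u < T).
    by apply: (@stepf_ind _ 0 T n.+1 T0 (ltn0Sn n) (fun y => 0 <= y <= 1)) => // j _ _; exact: i1.
  by rewrite stepf_out// lexx ler01.
have f1 n p : 0 <= f n p <= 1.
  have /andP[a b] := s1 n p.2 p.1; have /andP[c e] := below_itv z (XI p).
  by rewrite mulr_ge0//= -[leRHS]mul1r ler_pM.
have cf : (\int[Pr]_w \int[mu]_(u in D) (f n (u, w))%:E)%E @[n --> \oo] --> 0%E.
  apply: (@joint_cvg0_paths _ _ _ Pr 0 T T0 f 1) => //.
  apply: aeW => w u Du; have /andP[u0 uT] : 0 <= u < T by move: Du; rewrite /= in_itv.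
  have XE : XI (u, w) = X u w by rewrite /XI/= indicE mem_set// mulr1.
  have [zX|Xz] := leP z (X u w).
    apply: cvg_near_cst; apply: nearW => n.
    by rewrite /f XE belowE ltNge zX mulr0.
  have e0 : 0 < (z - X u w) / 2 by rewrite divr_gt0// subr_gt0.
  have [del del0 hd] := path_modulus (@cX w) u0 e0.
  have [N hN] := mesh_lt T0 del0.
  apply: cvg_near_cst; exists N => // n /= Nn.
  rewrite /f /=; have [j jm hj] := grid_index (ltn0Sn n) u0 uT.
  rewrite (stepfE T0 (ltn0Sn n) _ jm hj) indicE memNset ?mul0r// => /(_ j (leqnn j)) zj.
  have mp : 0 < mesh 0 T n.+1 by exact: mesh_gt0.
  have := hd (ti n.+1 j) (grid_ge 0 mp j).
  case/andP: hj; rewrite gridS => j1 j2; rewrite ger0_norm ?subr_ge0// => h.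
  have /h : u - ti n.+1 j < del by apply: lt_trans (hN n.+1 Nn); rewrite ltrBlDl.
  rewrite ler_norml => /andP[]; move: zj e0; lra.
have EE n : (\int[Pr]_w \int[mu]_(u in D) (f n (u, w))%:E)%E = (passage_error n.+1)%:E.
  pose I w := (\int[mu]_(u in D) f n (u, w))%R.
  have mI : measurable_fun setT I.
    by apply: (@measurable_Rintegral _ _ _ 0 T (f n) 1) => // p; have /andP[a b] := f1 n p; rewrite ger0_norm.
  have mD : measurable (D : set TR) by exact: measurable_itv.
  have sub : D `<=` `[0, T] by move=> u /=; rewrite !in_itv/= => /andP[-> /ltW].
  have ifn w : mu.-integrable D (EFin \o (fun u => f n (u, w))).
    apply: (itv_integrable_bounded sub mD (C := 1)).
      by apply: (@measurable_funTS _ _ TR); apply: (measurableT_comp (mf n)); exact: pair2_measurable.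
    by move=> u _; have /andP[a b] := f1 n (u, w); rewrite ger0_norm.
  have IE w : (\int[mu]_(u in D) (f n (u, w))%:E)%E = (I w)%:E.
    by rewrite /I /Rintegral fineK//; exact: integrable_fin_num (ifn w).
  have i11 : mu.-integrable D (EFin \o (fun=> 1 : R)).
    by apply: (itv_integrable_bounded sub mD (C := 1)) => // u _; rewrite normr1.
  have IT w : 0 <= I w <= T.
    apply/andP; split; first by apply: Rintegral_ge0 => u _; have /andP[] := f1 n (u, w).
    have -> : T = (\int[mu]_(u in D) 1)%R.
      by rewrite Rintegral_cst//= lebesgue_measure_itv/= lte_fin T0 -EFinB mul1r subr0.
    by apply: le_Rintegral => // u _; have /andP[] := f1 n (u, w).
  under eq_integral do rewrite IE.
  rewrite -Ex_EFin; last first.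
    by apply: (@L1_bounded _ _ _ _ _ T) => // w; have /andP[a b] := IT w; rewrite ger0_norm.
  congr EFin; rewrite /passage_error; congr Ex; apply/funext => w.
  apply: eq_Rintegral => u; rewrite inE => Du.
  by rewrite /f /XI /= indicE mem_set// mulr1.
rewrite (funext EE) in cf.
by move/fine_cvg : cf.
Qed.

End first_passage.

(** Exercise at the monitored passage is a stopping time whose payoff is at least [(K - z) / C]
    times the stopped value of [C - G]. The grid is refined first, then the horizon goes to
    infinity. *)
Lemma passage_lower_bound (K z C Cp y : R) : 0 < K -> z <= K -> 0 < C -> 0 <= Cp ->
  (forall x, 0 <= x -> kp x <= - (r * C) + Cp * below z x) -> (forall x, G x <= C) ->
  (forall tau, is_stopping_time Fil tau -> ('E_Pr[discounted_payoff r K X tau] <= y%:E)%E) ->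
  (K - z) / C * (C - G x0) <= y.
Proof.
move=> K0 zK C0 Cp0 kC GC hy; have C0' := ltW C0.
have kz0 : 0 <= (K - z) / C by rewrite divr_ge0// subr_ge0.
have H0 x : 0 <= C - G x <= C.
  by rewrite subr_ge0 GC lerBlDr lerDl (tf_ge0 hG).
have mH : measurable_fun setT (fun x => C - G x) by exact: measurable_funB.
have step T n : 0 < T -> (0 < n)%N ->
    (K - z) / C * (C - G x0 - C * expR (- (r * T)) - Cp * passage_error T z n) <= y.
  move=> T0 n0.
  have ht := first_below_stopping aX z T0 n0.
  have := hy _ ht; rewrite (expectation_payoff hW r0 K0 aX cX X0 ht) lee_fin; apply: le_trans.
  apply: le_trans (ler_wpM2l kz0 (stopped_passage_ge T0 C0' Cp0 kC GC n0)) _.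
  have mA i : measurable (above X T z n i).
    by apply: (filt_measurable hW (t := grid 0 (mesh 0 T n) i)); exact: above_Fil.
  have iS : L1 (stopped r X T n (above X T z n) (fun x => C - G x)).
    apply: (@L1_bounded _ _ _ _ _ C).
      by apply: (measurable_stopped hW r aX T0 mH n0 mA).
    move=> w; apply: stopped_bound => //.
      by move=> x; have /andP[a b] := H0 x; rewrite ger0_norm.
    by move=> i v /= h j ji; apply: h; exact: leq_trans ji (leqnSn i).
  rewrite -(ExZ ((K - z) / C) iS); apply: Ex_le.
  - exact: L1Z.
  - apply: (@L1_bounded _ _ _ _ _ K); first exact: (measurable_payoff hW r K0 aX cX X0 ht).
    by move=> w; have /andP[a b] := payoff_itv r0 K0 X0 ht w; rewrite ger0_norm.
  - by move=> w; apply: payoff_first_below.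
have step2 T : 0 < T -> (K - z) / C * (C - G x0 - C * expR (- (r * T))) <= y.
  move=> T0.
  have c1 : (K - z) / C * (C - G x0 - C * expR (- (r * T)) - Cp * passage_error T z n.+1)
      @[n --> \oo] --> (K - z) / C * (C - G x0 - C * expR (- (r * T)) - Cp * 0).
    apply: cvgM; first exact: cvg_cst.
    apply: cvgB; first exact: cvg_cst.
    by apply: cvgM; [exact: cvg_cst|exact: passage_error_cvg].
  rewrite mulr0 subr0 in c1.
  by apply: (cvg_seq_le c1) => n; exact: step.
(* [K + |z|] is positive and bounds [K - z] without a sign condition on [z]; with this [T] the
   discounted remainder is at most [e]. *)
apply/ler_addgt0Pr => e e0; pose T := (K + `|z|) / (r * e).
have re : 0 < r * e by rewrite mulr_gt0.
have Kz : 0 < K + `|z| by rewrite ltr_wpDr.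
have T0 : 0 < T by rewrite divr_gt0.
have := step2 T T0; rewrite mulrBr mulrA divfK ?gt_eqF// => h.
suff : (K - z) * expR (- (r * T)) <= e by move: h; lra.
rewrite expRN ler_pdivrMr ?expR_gt0//.
apply: (@le_trans _ _ (e * (1 + r * T))); last by rewrite ler_wpM2l ?(ltW e0)// expR_ge1Dx.
rewrite /T; have -> : e * (1 + r * ((K + `|z|) / (r * e))) = e + (K + `|z|) by field; rewrite !gt_eqF.
by have := ler_norm (- z); rewrite normrN; move: e0; lra.
Qed.

End price_process.

(** * Capped solutions of the pricing equation *)

Section spline_monotone.
Context {R : realType}.
Variable w : R.
Hypothesis w0 : 0 < w.

Lemma spl_mvt (u v : R) : u <= v -> exists2 c, 0 <= c <= 1 & spl w v - spl w u = c * (v - u).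
Proof.
move=> uv; have [c _ e] := mvt_pos (fun x _ => is_derive_spl w0 x) uv.
by exists (spl1 w c) => //; exact: spl1_itv.
Qed.

Lemma spl_ge0 u : 0 <= spl w u.
Proof.
have [u0|u0] := leP u 0; first by have [-> _ _] := spl_neg w0 u0.
have [c /andP[c0 _] e] := spl_mvt (ltW u0); have [z0 _ _] := spl_neg w0 (lexx 0).
by move: e; rewrite z0 !subr0 => ->; rewrite mulr_ge0// ltW.
Qed.

Lemma spl_convex u : 0 <= u -> spl w u <= u * spl1 w u.
Proof.
move=> u0; pose q v := v * spl1 w v - spl w v.
have dq (v : R) : is_derive v 1 q (v * spl2 w v).
  have h := is_deriveB (is_deriveM (is_derive_id v (1 : R)) (is_derive_spl1 w0 v)) (is_derive_spl w0 v).
  by apply: (is_derive_eq h); rewrite /GRing.scale/=; ring.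
have : q 0 <= q u.
  apply: (nondecreasing_of_derive (fun v _ => dq v)) => // v /andP[v0 _].
  by rewrite mulr_ge0// spl2_ge0.
have [z0 _ _] := spl_neg w0 (lexx 0).
by rewrite /q z0 mul0r subrr subr_ge0.
Qed.

Variable K : R.
Hypothesis K0 : 0 <= K.

(** A concave C^2 version of [min u K]: the identity up to [K], and the constant [K + w] from
    [K + 2 w] on. *)
Definition cap (u : R) : R := u - spl w (u - K).
Definition cap1 (u : R) : R := 1 - spl1 w (u - K).
Definition cap2 (u : R) : R := - spl2 w (u - K).

Lemma is_derive_shift (g g1 : R -> R) (a u : R) : (forall v : R, is_derive v 1 g (g1 v)) ->
  is_derive u 1 (fun u => g (u - a)) (g1 (u - a)).
Proof.
move=> dg; have h1 : is_derive u 1 (fun u : R => u - a) 1.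
  have := is_deriveB (is_derive_id u (1 : R)) (is_derive_cst a u (1 : R)); rewrite subr0; apply.
have := @is_derive1_comp _ g (fun u : R => u - a) u _ _ (dg (u - a)) h1.
by rewrite mulr1; apply.
Qed.

Lemma continuous_shift (g : R -> R) (a : R) : continuous g -> continuous (fun u => g (u - a)).
Proof.
move=> cg u; apply: (@continuous_comp _ _ _ (fun u : R => u - a) g); last exact: cg.
by apply: cvgB; [exact: cvg_id|exact: cvg_cst].
Qed.

Lemma is_derive_cap (u : R) : is_derive u 1 cap (cap1 u).
Proof.
exact: (is_deriveB (is_derive_id u (1 : R)) (is_derive_shift K u (is_derive_spl w0))).
Qed.

Lemma is_derive_cap1 (u : R) : is_derive u 1 cap1 (cap2 u).
Proof.
have h := is_deriveB (is_derive_cst (1 : R) u (1 : R)) (is_derive_shift K u (is_derive_spl1 w0)).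
by apply: (is_derive_eq h); rewrite sub0r.
Qed.

Lemma continuous_cap2 : continuous cap2.
Proof.
by move=> u; apply: cvgN; apply: continuous_shift; exact: continuous_spl2.
Qed.

Lemma cap_large u : K + 2 * w <= u -> [/\ cap u = K + w, cap1 u = 0 & cap2 u = 0].
Proof.
move=> h; have hu : 2 * w <= u - K by rewrite lerBrDl.
by rewrite /cap /cap1 /cap2; have [-> -> ->] := spl_large w0 hu; split; ring.
Qed.

Lemma cap_le u : cap u <= u.
Proof. by rewrite /cap lerBlDr lerDl spl_ge0. Qed.

Lemma cap_ge u v : 0 <= v -> v <= u -> v <= K -> v <= cap u.
Proof.
move=> v0 vu vK; rewrite /cap; have [uK|Ku] := leP u K.
  by have [|-> _ _] := @spl_neg _ w w0 (u - K); rewrite ?subr_le0 ?subr0.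
have [|c /andP[_ c1] e] := @spl_mvt 0 (u - K); first by rewrite subr_ge0 ltW.
have [z0 _ _] := spl_neg w0 (lexx 0); rewrite z0 !subr0 in e.
rewrite e; have : c * (u - K) <= u - K by rewrite ler_piMl// subr_ge0 ltW.
lra.
Qed.

Lemma cap_ge0 u : 0 <= u -> 0 <= cap u.
Proof. by move=> u0; apply: cap_ge. Qed.

(** A concave function that is nonnegative at [0]. When [L f = 0], the generator of [cap (f x)]
    contains [r * (cap1 * f - cap)], so this inequality, with [cap2 <= 0], keeps it a
    supersolution. *)
Lemma cap_concave u : 0 <= u -> cap1 u * u <= cap u.
Proof.
move=> u0; rewrite /cap /cap1; have /andP[s0 s1] := spl1_itv w0 (u - K).
have [uK|Ku] := leP u K.
  by have [|-> -> _] := @spl_neg _ w w0 (u - K); rewrite ?subr_le0// subr0 mul1r subr0.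
have h : spl w (u - K) <= (u - K) * spl1 w (u - K) by apply: spl_convex; rewrite subr_ge0 ltW.
have := mulr_ge0 K0 s0; move: h; lra.
Qed.

End spline_monotone.

Section diffusion.
Context {R : realType}.
Variables (r x0 : R) (P phi : R -> R).
Hypotheses (r0 : 0 < r) (hx0 : 0 < x0) (hP : regular_put_prices x0 P)
  (hphi : admissible_phi x0 P phi).
Local Notation phi1 := (phi^`())%classic.
Local Notation phi2 := (phi1^`())%classic.

Definition variance (x : R) : R := 2 * r * ((phi x - x * phi1 x) / phi2 x).

(** [is_volatility] leaves [sigma] free outside []0, +oo[], where [sigma x * x] need not be
    measurable. This version is [0] there and agrees with the coefficient on [[0, +oo[], where [X]
    lives. *)
Definition diffusion : R -> R := (fun x => Num.sqrt (variance x)) \_ `]0, +oo[%classic.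

Lemma variance_ge0 x : 0 < x -> 0 <= variance x.
Proof.
move=> xp; rewrite /variance; apply: mulr_ge0; first by rewrite mulr_ge0 ?ler0n ?(ltW r0).
apply: divr_ge0; last exact: ltW (phi2_gt0 hphi xp).
rewrite subr_ge0; apply: le_trans (ltW (phi_gt0 hphi xp)).
by apply: mulr_ge0_le0; [exact: ltW|exact: ltW (phi1_lt0 hphi xp)].
Qed.

Lemma diffusionE x : 0 < x -> diffusion x ^+ 2 = variance x.
Proof.
move=> xp; rewrite /diffusion patchE mem_set; last by rewrite /= in_itv/= xp.
by rewrite sqr_sqrtr// variance_ge0.
Qed.

Lemma diffusion0 : diffusion 0 = 0.
Proof. by rewrite /diffusion patchE memNset//= in_itv/= ltxx. Qed.

Lemma diffusion_volatility sigma x : is_volatility r phi sigma -> 0 <= x ->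
  sigma x * x = diffusion x.
Proof.
move=> hs; rewrite le_eqVlt => /orP[/eqP<-|xp]; first by rewrite mulr0 diffusion0.
have [s0 e] := hs x xp.
rewrite /diffusion patchE mem_set; last by rewrite /= in_itv/= xp.
have e' : sigma x ^+ 2 = 2 * r * ((phi x - x * phi1 x) / (x ^+ 2 * phi2 x)) := e.
have -> : variance x = (sigma x * x) ^+ 2.
  rewrite exprMn e' /variance; field.
  by rewrite (gt_eqF (phi2_gt0 hphi xp)) gt_eqF.
by rewrite sqrtr_sqr; apply/esym/ger0_norm; rewrite mulr_ge0// ltW.
Qed.

Let derive_cont (g : R -> R) (g' x : R) : is_derive x 1 g g' -> {for x, continuous g}.
Proof. by move=> [dg _]; apply: differentiable_continuous; exact/derivable1_diffP. Qed.

Lemma continuous_variance x : 0 < x -> {for x, continuous variance}.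
Proof.
move=> xp; apply: cvgM; first exact: cvg_cst.
apply: cvgM.
  apply: cvgB; first exact: derive_cont (phi_derive hphi xp).
  apply: cvgM; first exact: cvg_id.
  exact: derive_cont (phi1_derive hphi xp).
apply: cvgV; first by rewrite gt_eqF// (phi2_gt0 hphi).
exact: (phi2_continuous hphi xp).
Qed.

Lemma measurable_diffusion : measurable_fun setT diffusion.
Proof.
have mI : measurable (`]0, +oo[%classic : set R) by exact: measurable_itv.
apply/(measurable_restrictT _ mI).
apply: subspace_continuous_measurable_fun => //.
apply: continuous_in_subspaceT => x; rewrite inE /= in_itv/= andbT => xp.
apply: continuous_comp; first exact: continuous_variance.
exact: sqrt_continuous.
Qed.

Lemma diffusion_bounded al be : 0 < al -> al <= be ->
  exists B, forall x, al <= x <= be -> diffusion x ^+ 2 <= B.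
Proof.
move=> al0 albe; have cv : {within `[al, be], continuous variance}.
  apply: continuous_in_subspaceT => x; rewrite inE /= in_itv/= => /andP[ax _].
  by apply: continuous_variance; exact: lt_le_trans ax.
have [c _ hc] := EVT_max albe cv; exists (variance c) => x hx.
rewrite diffusionE; first by apply: hc; rewrite in_itv.
by case/andP: hx => ax _; exact: lt_le_trans ax.
Qed.

Lemma generator_phi x : 0 < x ->
  2^-1 * diffusion x ^+ 2 * phi2 x = r * (phi x - x * phi1 x).
Proof.
move=> xp; rewrite diffusionE// /variance; field.
by rewrite gt_eqF// (phi2_gt0 hphi).
Qed.

Section capped_supersolution.
Variables (a b K de : R).
Hypotheses (a0 : 0 <= a) (b0 : 0 <= b) (K0 : 0 < K) (de0 : 0 < de).
Hypothesis dom : forall x, 0 < x -> K - x <= a * phi x + b * x.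

(** Both coefficients are raised by [de]. On []0, al]], where [phi >= 1] and [x <= de / 2], the
    first gives [f >= K + de / 2]; beyond [be] the second gives [f >= K + de]. Both exceed
    [K + 2 w = K + de / 4], from where the cap is constant. The cost at [x0] is [de * (1 + x0)]. *)
Let f (x : R) := (a + de) * phi x + (b + de) * x.
Let f1 (x : R) := (a + de) * phi1 x + (b + de).
Let f2 (x : R) := (a + de) * phi2 x.
Let w := de / 8.
Let w0 : 0 < w. Proof. by rewrite divr_gt0. Qed.
Let al := Num.min (de / 2) x0.
Let be := al + (K + de) / de.

Let al0 : 0 < al. Proof. by rewrite lt_min hx0 divr_gt0. Qed.
Let albe : al < be. Proof. by rewrite ltrDl divr_gt0// addr_gt0. Qed.

Let f_ge x : 0 < x -> Num.max (K - x) 0 <= f x.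
Proof.
move=> xp; have pp := ltW (phi_gt0 hphi xp); rewrite ge_max; apply/andP; split.
  apply: le_trans (dom xp) _; rewrite /f !mulrDl.
  have := mulr_ge0 (ltW de0) pp; have := mulr_ge0 (ltW de0) (ltW xp); lra.
by rewrite /f addr_ge0// mulr_ge0 ?addr_ge0 ?(ltW de0) ?(ltW xp).
Qed.

Let df (x : R) : 0 < x -> is_derive x 1 f (f1 x).
Proof.
move=> xp; have h := is_deriveD (is_deriveZ (a + de) (phi_derive hphi xp))
  (is_deriveZ (b + de) (is_derive_id x (1 : R))).
by apply: (is_derive_eq h); rewrite /GRing.scale/= mulr1.
Qed.

Let df1 (x : R) : 0 < x -> is_derive x 1 f1 (f2 x).
Proof.
move=> xp; have h := is_deriveD (is_deriveZ (a + de) (phi1_derive hphi xp))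
  (is_derive_cst (b + de) x (1 : R)).
by apply: (is_derive_eq h); rewrite /GRing.scale/= addr0.
Qed.

Let cf2 (x : R) : 0 < x -> {for x, continuous f2}.
Proof. by move=> xp; apply: cvgM; [exact: cvg_cst|exact: (phi2_continuous hphi xp)]. Qed.

Let flat0 x : 0 < x -> x <= al ->
  [/\ cap w K (f x) = K + w, cap1 w K (f x) = 0 & cap2 w K (f x) = 0].
Proof.
rewrite le_min => xp /andP[xd xx]; apply: cap_large => //.
have := dom xp; have h1 := phi_ge1 hx0 hP hphi xp xx.
have := ler_wpM2l (ltW de0) h1; have := mulr_ge0 (ltW de0) (ltW xp).
rewrite /f /w !mulrDl; move: de0; lra.
Qed.

Let flat1 x : be <= x ->
  [/\ cap w K (f x) = K + w, cap1 w K (f x) = 0 & cap2 w K (f x) = 0].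
Proof.
move=> bx; apply: cap_large => //.
have xp : 0 < x by rewrite (lt_le_trans al0)// (le_trans (ltW albe)).
have h : K + de <= de * x.
  rewrite mulrC -ler_pdivrMr//; apply: le_trans bx; rewrite /be lerDr ltW//.
have := mulr_ge0 b0 (ltW xp); have := mulr_ge0 (addr_ge0 a0 (ltW de0)) (ltW (phi_gt0 hphi xp)).
rewrite /f /w [(b + de) * x]mulrDl; move: de0 h; lra.
Qed.

Let F := flat_comp f (cap w K) al (K + w).
Let F1 := flat_comp1 f f1 (cap1 w K) al.
Let F2 := flat_comp2 f f1 f2 (cap1 w K) (cap2 w K) al.

Let hE (x : R) : 0 < x -> [/\ F x = cap w K (f x), F1 x = cap1 w K (f x) * f1 x
  & F2 x = cap2 w K (f x) * f1 x ^+ 2 + cap1 w K (f x) * f2 x].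
Proof. by move=> xp; exact: (flat_compE f1 f2 flat0 xp). Qed.

Let F0 : [/\ F 0 = K + w, F1 0 = 0 & F2 0 = 0].
Proof. exact: flat_comp_low. Qed.

Let f0 x : 0 < x -> 0 <= f x.
Proof. by move=> xp; apply: le_trans (f_ge xp); rewrite le_max lexx orbT. Qed.

Lemma capped_supersolution : exists G G1 G2 Kg Kk, [/\ test_fun G G1 G2 Kg,
  forall x, 0 <= x -> `|price_drift r diffusion G G1 G2 x| <= Kk,
  forall x, 0 <= x -> price_drift r diffusion G G1 G2 x <= 0,
  forall x, 0 <= x -> Num.max (K - x) 0 <= G x
  & G x0 <= (a + de) * phi x0 + (b + de) * x0].
Proof.
have hf0 x : 0 < x -> 0 <= cap w K (f x).
  by move=> xp; apply: (cap_ge0 w0 (ltW K0)); exact: f0.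
have [Kg hG] := flat_comp_test_fun df df1 cf2 (is_derive_cap w0 K) (is_derive_cap1 w0 K)
  (@continuous_cap2 _ w K) al0 albe flat0 flat1 hf0.
have flat x : x <= al \/ be <= x -> F1 x = 0 /\ F2 x = 0.
  exact: (flat_comp_flat f1 f2 al0 albe flat0 flat1).
have [B hB] := diffusion_bounded al0 (ltW albe).
have [Kk hKk] := price_drift_bounded (ltW r0) hG (ltW (lt_trans al0 albe)) flat hB.
exists F, F1, F2, Kg, Kk; split => //.
- move=> x; rewrite le_eqVlt => /orP[/eqP<-|xp].
    have [e0 e1 e2] := F0; rewrite /price_drift /ito_drift e0 e1 e2 !mulr0 addr0 sub0r oppr_le0.
    by rewrite mulr_ge0 ?(ltW r0)// addr_ge0 ?(ltW K0) ?(ltW w0).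
  have [e0 e1 e2] := hE xp; rewrite /price_drift /ito_drift e0 e1 e2.
  have eq1 := generator_phi xp.
  set c := cap w K (f x); set c1 := cap1 w K (f x); set c2 := cap2 w K (f x).
  (* Chain rule for the generator, sorted so that the last bracket is [L phi = 0]; the linear part
     of [f] drops out, and the other two terms are nonpositive by concavity of the cap. *)
  have -> : r * x * (c1 * f1 x) + 2^-1 * diffusion x ^+ 2 * (c2 * f1 x ^+ 2 + c1 * f2 x) - r * c =
    r * (c1 * f x - c) + 2^-1 * diffusion x ^+ 2 * f1 x ^+ 2 * c2 +
    c1 * (a + de) * (2^-1 * diffusion x ^+ 2 * phi2 x - r * (phi x - x * phi1 x)).
    by rewrite /f /f1 /f2; ring.
  rewrite eq1 subrr mulr0 addr0.
  have h1 : r * (c1 * f x - c) <= 0.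
    by rewrite mulr_ge0_le0 ?(ltW r0)// subr_le0 (cap_concave w0 (ltW K0))// f0.
  have h2 : 2^-1 * diffusion x ^+ 2 * f1 x ^+ 2 * c2 <= 0.
    apply: mulr_ge0_le0; last by rewrite /c2 /cap2 oppr_le0 spl2_ge0.
    by apply: mulr_ge0; rewrite ?sqr_ge0// mulr_ge0 ?sqr_ge0// invr_ge0.
  by move: h1 h2; lra.
- move=> x; rewrite le_eqVlt => /orP[/eqP<-|xp].
    by have [-> _ _] := F0; rewrite subr0 ge_max addr_ge0 ?(ltW K0) ?(ltW w0)// andbT lerDl ltW.
  have [-> _ _] := hE xp; apply: (cap_ge w0) => //; first by rewrite le_max lexx orbT.
    exact: f_ge.
  by rewrite ge_max (ltW K0) andbT; move: xp; lra.
- by have [-> _ _] := hE hx0; exact: cap_le.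
Qed.

End capped_supersolution.

Section spread.
Variables (z w : R).
Hypotheses (z0 : 0 < z) (zx : z < x0) (w0 : 0 < w) (w1 : 3 * w <= 1).
Hypothesis wz : phi z + 2 * w <= phi (z / 2).

Let q := phi z.
Let C := q - w.
(** [C - g] is the difference of two smoothed calls with strikes [w] and [q]: [0] up to [w],
    [u - 2 w] from [3 w] to [q], and [C] from [q + 2 w] on. So [C - g (phi x)] follows [phi] above
    [z], is flat at infinity where [phi <= w], and flat on []0, z / 2]], where [wz] puts [phi] above
    [q + 2 w]. *)
Let g (u : R) := C - (spl w (u - w) - spl w (u - q)).
Let g1 (u : R) := - (spl1 w (u - w) - spl1 w (u - q)).
Let g2 (u : R) := - (spl2 w (u - w) - spl2 w (u - q)).

Let q1 : 1 < q.
Proof. by rewrite -(phi_x0 hx0 hP hphi); exact: (phi_decreasing hphi z0 zx). Qed.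

Let C0 : 0 < C. Proof. by rewrite /C; move: q1 w1 w0; lra. Qed.

Let dg (u : R) : is_derive u 1 g (g1 u).
Proof.
have h := is_deriveB (is_derive_cst C u (1 : R)) (is_deriveB (is_derive_shift w u (is_derive_spl w0))
  (is_derive_shift q u (is_derive_spl w0))).
by apply: (is_derive_eq h); rewrite sub0r.
Qed.

Let dg1 (u : R) : is_derive u 1 g1 (g2 u).
Proof.
exact: (is_deriveN (is_deriveB (is_derive_shift w u (is_derive_spl1 w0))
  (is_derive_shift q u (is_derive_spl1 w0)))).
Qed.

Let cg2 : continuous g2.
Proof.
move=> u; apply: cvgN; apply: cvgB; apply: continuous_shift; exact: continuous_spl2.
Qed.

Let wq : w <= q. Proof. by move: q1 w1 w0; lra. Qed.

Let g_itv u : 0 <= g u <= C.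
Proof.
have [|c /andP[c0 c1] e] := @spl_mvt _ w w0 (u - q) (u - w).
  by rewrite lerD2l lerN2.
rewrite /g e; have -> : u - w - (u - q) = C by rewrite /C; ring.
have := ler_wpM2r (ltW C0) c1; have := mulr_ge0 c0 (ltW C0); rewrite mul1r; lra.
Qed.

Let al := z / 2.
Let al0 : 0 < al. Proof. by rewrite divr_gt0. Qed.

Let flat0 x : 0 < x -> x <= al -> [/\ g (phi x) = 0, g1 (phi x) = 0 & g2 (phi x) = 0].
Proof.
move=> xp xa; have h := phi_nonincreasing hphi xp xa.
have h1 : 2 * w <= phi x - q by move: wz; rewrite -/q -/al; lra.
have h2 : 2 * w <= phi x - w by move: wq h1; lra.
rewrite /g /g1 /g2; have [-> -> ->] := spl_large w0 h1; have [-> -> ->] := spl_large w0 h2.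
by rewrite /C; split; ring.
Qed.

Let low x : phi x <= w -> [/\ g (phi x) = C, g1 (phi x) = 0 & g2 (phi x) = 0].
Proof.
move=> h; have h1 : phi x - w <= 0 by rewrite subr_le0.
have h2 : phi x - q <= 0 by rewrite subr_le0 (le_trans h).
rewrite /g /g1 /g2; have [-> -> ->] := spl_neg w0 h1; have [-> -> ->] := spl_neg w0 h2.
by rewrite !subrr subr0 oppr0.
Qed.

Lemma capped_spread : exists G G1 G2 Kg Kk Cp, [/\ test_fun G G1 G2 Kg,
  forall x, 0 <= x -> `|price_drift r diffusion G G1 G2 x| <= Kk,
  0 <= Cp /\ forall x, 0 <= x ->
    price_drift r diffusion G G1 G2 x <= - (r * (phi z - w)) + Cp * below z x,
  forall x, G x <= phi z - w
  & phi z - w - G x0 = 1 - 2 * w].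
Proof.
have [M hM] : exists M, forall x, M < x -> phi x <= w.
  have hl : phi y @[y --> +oo] --> (0 : R) by case: hphi.
  have /cvgrPdist_le/(_ _ w0)[M [Mr hM]] := hl; exists M => x /hM.
  by rewrite sub0r normrN => h; exact: le_trans (ler_norm _) h.
pose be := Num.max (M + 1) (al + 1).
have albe : al < be by rewrite lt_max ltrDl ltr01 orbT.
have flat1 x : be <= x -> [/\ g (phi x) = C, g1 (phi x) = 0 & g2 (phi x) = 0].
  rewrite ge_max => /andP[Mx _]; apply: low; apply: hM; apply: lt_le_trans Mx.
  by rewrite ltrDl.
have gf0 x : 0 < x -> 0 <= g (phi x) by move=> _; have /andP[] := g_itv (phi x).
pose F := flat_comp phi g al 0; pose F1 := flat_comp1 phi phi1 g1 al; pose F2 := flat_comp2 phi phi1 phi2 g1 g2 al.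
have [Kg hG] := flat_comp_test_fun (fun x => phi_derive hphi (x := x)) (fun x => phi1_derive hphi (x := x))
  (fun x => phi2_continuous hphi (x := x)) dg dg1 cg2 al0 albe flat0 flat1 gf0.
have flat x : x <= al \/ be <= x -> F1 x = 0 /\ F2 x = 0.
  exact: (flat_comp_flat phi1 phi2 al0 albe flat0 flat1).
have [B hB] := diffusion_bounded al0 (ltW albe).
have [Kk hKk] := price_drift_bounded (ltW r0) hG (ltW (lt_trans al0 albe)) flat hB.
have Kk0 : 0 <= Kk by exact: le_trans (hKk 0 (lexx _)).
have rC : 0 <= r * C by rewrite mulr_ge0 ?ltW.
have hE (x : R) : 0 < x -> [/\ F x = g (phi x), F1 x = g1 (phi x) * phi1 x
    & F2 x = g2 (phi x) * phi1 x ^+ 2 + g1 (phi x) * phi2 x].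
  by move=> xp; exact: (flat_compE phi1 phi2 flat0 xp).
(* Below [z] no sign of the drift is known; this constant merely lifts [- r C] up to the bound
   [Kk]. *)
exists F, F1, F2, Kg, Kk, (Kk + r * C); split => //.
- split; first exact: addr_ge0.
  move=> x xge; rewrite belowE -/q -/C; have [xz|zx'] := ltP x z.
    by rewrite mulr1; have := le_trans (ler_norm _) (hKk x xge); lra.
  rewrite mulr0 addr0; have xp : 0 < x by exact: lt_le_trans zx'.
  have pq : phi x <= q by exact: (phi_nonincreasing hphi z0 zx').
  have pq0 : phi x - q <= 0 by rewrite subr_le0.
  have [e0 e1 e2] := hE x xp; rewrite /price_drift /ito_drift e0 e1 e2.
  rewrite /g /g1 /g2; have [-> -> ->] := spl_neg w0 pq0; rewrite !subr0.
  set s := spl w _; set s1 := spl1 w _; set s2 := spl2 w _.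
  (* Above [z] only the spline of strike [w] is active. Its convexity gives [s <= s1 * phi], so
     everything beside [- r C] is nonpositive, the last bracket being [L phi = 0]. *)
  have -> : r * x * (- s1 * phi1 x) + 2^-1 * diffusion x ^+ 2 * (- s2 * phi1 x ^+ 2 + - s1 * phi2 x)
     - r * (C - s) = - (r * C) - r * (s1 * phi x - s) - 2^-1 * diffusion x ^+ 2 * phi1 x ^+ 2 * s2
     - s1 * (2^-1 * diffusion x ^+ 2 * phi2 x - r * (phi x - x * phi1 x)) by ring.
  rewrite (generator_phi xp) subrr mulr0 subr0.
  have h2 : 0 <= 2^-1 * diffusion x ^+ 2 * phi1 x ^+ 2 * s2.
    apply: mulr_ge0; last exact: spl2_ge0.
    by apply: mulr_ge0; rewrite ?sqr_ge0// mulr_ge0 ?sqr_ge0// invr_ge0.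
  have h1 : 0 <= r * (s1 * phi x - s).
    rewrite mulr_ge0 ?(ltW r0)// subr_ge0; have /andP[s10 _] := spl1_itv w0 (phi x - w).
    have [pw|wp] := leP (phi x) w.
      have pw0 : phi x - w <= 0 by rewrite subr_le0.
      by rewrite /s /s1; have [-> -> _] := spl_neg w0 pw0; rewrite mul0r.
    have h : s <= (phi x - w) * s1 by apply: (spl_convex w0); rewrite subr_ge0 ltW.
    apply: le_trans h _; rewrite mulrC ler_wpM2l//.
    by rewrite lerBlDr lerDl ltW.
  by move: h1 h2; lra.
- move=> x; rewrite -/q -/C; have [xa|ax] := ltP x al.
    by rewrite /F; have [-> _ _] := flat_comp_low phi phi1 phi2 g g1 g2 0 xa; exact: ltW.
  by have [-> _ _] := hE x (lt_le_trans al0 ax); have /andP[] := g_itv (phi x).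
- have [-> _ _] := hE x0 hx0; rewrite /g -/q -/C (phi_x0 hx0 hP hphi).
  have h1 : 1 - q <= 0 by rewrite subr_le0 ltW.
  have h2 : 2 * w <= 1 - w by move: w1; lra.
  have [-> _ _] := spl_neg w0 h1; have [-> _ _] := spl_large w0 h2.
  by ring.
Qed.

End spread.

End diffusion.

(** * Put prices under the calibrated volatility *)

Section price_process_of_volatility.
Context {d : measure_display} {Omega : measurableType d} {R : realType}.
Variable Pr : probability Omega R.
Variable W : R -> Omega -> R.
Hypothesis hW : standard_brownian Pr W.
Local Notation Fil := (brownian_filtration Pr W).
Variables (r x0 : R) (P phi sigma : R -> R) (X : R -> Omega -> R).
Hypotheses (r0 : 0 < r) (hx0 : 0 < x0) (hP : regular_put_prices x0 P)
  (hphi : admissible_phi x0 P phi) (hsigma : is_volatility r phi sigma).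
Hypothesis hX : is_price_process Pr Fil W r x0 sigma X.

Let X0 t w : 0 <= t -> 0 <= X t w. Proof. by case: hX => _ _ h _ _; exact: h. Qed.
Let aX : adapted Fil X. Proof. by case: hX. Qed.
Let cX : continuous_paths X. Proof. by case: hX. Qed.
Let Xx0 : {ae Pr, forall w, X 0 w = x0}.
Proof. by case: hX => _ _ _ h _; apply: filterS h => w []. Qed.

Let volX u w : 0 <= u -> sigma (X u w) * X u w = diffusion r phi (X u w).
Proof. by move=> u0; exact: (diffusion_volatility hphi hsigma (X0 w u0)). Qed.

(** The data of [is_price_process] with the measurable [diffusion] in place of [sigma x * x]; both
    agree along the nonnegative path [X]. *)
Let ito : exists M (S : nat -> simple_process Fil),
  [/\ adapted Fil M, continuous_paths M,
    forall t eps : R, 0 <= t -> 0 < eps ->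
      (Pr [set w | eps%:E < \int[lebesgue_measure]_(u in `[0%R, t])
         ((sp_eval (S n) u w - diffusion r phi (X u w)) ^+ 2)%R%:E]%E @[n --> \oo] --> 0%E)
      /\ (Pr [set w | eps < `|sp_integral W (S n) t w - M t w|] @[n --> \oo] --> 0%E),
    {ae Pr, forall w, forall t, 0 <= t ->
      X t w = x0 + \int[lebesgue_measure]_(u in `[0%R, t]) (r * X u w) + M t w}
  & {ae Pr, forall w, forall t : R, 0 <= t ->
     (\int[lebesgue_measure]_(u in `[0%R, t]) ((diffusion r phi (X u w)) ^+ 2)%:E < +oo)%E}].
Proof.
case: hX => _ _ _ _ [M [_ sq aM cM [S hS]] eqX]; exists M, S; split => //.
- move=> t eps t0 e0; have [h1 h2] := hS t eps t0 e0; split => //.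
  rewrite (_ : (fun n => _) = fun n => Pr [set w | eps%:E < \int[lebesgue_measure]_(u in `[0%R, t])
      ((sp_eval (S n) u w - sigma (X u w) * X u w) ^+ 2)%R%:E]%E) //.
  apply/funext => n; congr (Pr _).
  apply/seteqP; split => w /=; congr (_ < _)%E; apply: eq_integral => u;
    by rewrite inE /= in_itv/= => /andP[u0 _]; rewrite volX.
- apply: filterS sq => w h t t0; have := h t t0; congr (_ < _)%E; apply: eq_integral => u.
  by rewrite inE /= in_itv/= => /andP[u0 _]; rewrite volX.
Qed.

Variable K : R.
Hypothesis K0 : 0 < K.

Lemma price_upper : (put_price Pr Fil r X K <= (P K)%:E)%E.
Proof.
have [M [S [aM cM hS eqX sq]]] := ito.
apply: ge_ereal_sup => _ [tau ht <-].
rewrite (expectation_payoff hW r0 K0 aX cX X0 ht) lee_fin.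
(* The capped supersolution exceeds [P K] at [x0] by at most [de * (phi x0 + x0)], and
   [phi x0 = 1]. *)
apply/ler_addgt0Pr => e e0; pose de := e / (1 + x0).
have x1 : 0 < 1 + x0 by rewrite addr_gt0.
have de0 : 0 < de by rewrite divr_gt0.
have [a [b [a0 b0 ab dom]]] := supersolution hx0 hP hphi K0.
have [G [G1 [G2 [Kg [Kk [hG hk k0 domG Gx]]]]]] := capped_supersolution r0 hx0 hP hphi a0 b0 K0 de0 dom.
have sm := price_drift_le0_supermartingale hW r0 (measurable_diffusion r hphi) aX cX X0 aM cM hS eqX sq hG hk k0.
have Gi x : 0 <= G x <= Kg by rewrite (tf_ge0 hG) (tf_le hG).
apply: le_trans (payoff_upper hW r0 K0 aX cX X0 Xx0 ht (tf_cG hG) Gi sm domG) _.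
apply: le_trans Gx _; rewrite (phi_x0 hx0 hP hphi) -ab mulr1 mulrDl.
have : de + de * x0 = e by rewrite /de; field; rewrite gt_eqF.
by lra.
Qed.

Let stop0 : is_stopping_time Fil (fun=> 0%E : \bar R).
Proof.
split => // t t0; rewrite (_ : [set _ | _] = setT); last by apply/seteqP; split => w //= _; rewrite lee_fin.
exact: (@measurableT _ (g_sigma_algebraType (filt_gen Pr W t))).
Qed.

Lemma price_ge_payoff tau : is_stopping_time Fil tau ->
  ('E_Pr[discounted_payoff r K X tau] <= put_price Pr Fil r X K)%E.
Proof. by move=> ht; apply: ereal_sup_ubound; exists tau. Qed.

Let start_lower : ((Num.max (K - x0) 0)%:E <= put_price Pr Fil r X K)%E.
Proof.
apply: le_trans (price_ge_payoff stop0); rewrite (expectation_payoff hW r0 K0 aX cX X0 stop0) lee_fin.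
rewrite -(putE K0 (ltW hx0)) -(Ex_start hW aX Xx0 (measurable_put K0)).
rewrite le_eqVlt; apply/orP; left; apply/eqP; congr Ex; apply/funext => w.
by rewrite /discounted_payoff/= mulr0 oppr0 expR0 mul1r putE// X0.
Qed.

Lemma price_lower : ((P K)%:E <= put_price Pr Fil r X K)%E.
Proof.
have [PE|[z [z0 zx Pz]]] := exercise_boundary hx0 hP hphi K0.
  by apply: le_trans start_lower; rewrite lee_fin PE le_max lexx.
have [M [S [aM cM hS eqX sq]]] := ito.
have P0 : 0 < P K by exact: (price_gt0 hP).
have pz1 : 1 < phi z by rewrite -(phi_x0 hx0 hP hphi); exact: (phi_decreasing hphi z0 zx).
have pz0 : 0 < phi z by exact: lt_trans pz1.
have zK : z <= K by rewrite -subr_ge0 -Pz mulr_ge0// ltW.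
have pz2 : phi z < phi (z / 2).
  by apply: (phi_decreasing hphi); [rewrite divr_gt0|rewrite ltr_pdivrMr// mulr_natr mulr2n ltrDl].
(* The upper bound excludes the value [+oo] and immediate exercise excludes [-oo], so the supremum
   is a real number [y]. *)
move: price_upper start_lower (@price_ge_payoff).
case: (put_price _ _ _ _ _) => [y| |] //= _ _ hy.
(* [1 / 3] keeps [phi x0 = 1] on the linear part of the spread; the other bound fits the flattening
   zone of width [2 w] between [phi z] and [phi (z / 2)]. *)
rewrite lee_fin; pose w0 := Num.min (1 / 3) ((phi (z / 2) - phi z) / 2).
have w00 : 0 < w0 by rewrite lt_min !divr_gt0// subr_gt0.
(* The first passage yields [(K - z) / (phi z - w) * (1 - 2 w)], and [K - z = P K * phi z] makes the
   first factor at least [P K]. *)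
have step w : 0 < w -> w <= w0 -> P K * (1 - 2 * w) <= y.
  move=> wp; rewrite le_min => /andP[w1 w2].
  have w3 : 3 * w <= 1 by move: w1; lra.
  have wz : phi z + 2 * w <= phi (z / 2) by move: w2; lra.
  have C0 : 0 < phi z - w by move: w1 pz1; lra.
  have [G [G1 [G2 [Kg [Kk [Cp [hG hk [Cp0 kC] GC Gx]]]]]]] := capped_spread r0 hx0 hP hphi z0 zx wp w3 wz.
  have := passage_lower_bound hW r0 (measurable_diffusion r hphi) aX cX X0 aM cM hS eqX sq Xx0 hG hk
    K0 zK C0 Cp0 kC GC (fun tau ht => hy tau ht).
  rewrite Gx; apply: le_trans; apply: ler_wpM2r; first by move: w3 wp; lra.
  rewrite -Pz ler_pdivlMr// ler_wpM2l ?(ltW P0)//; by rewrite lerBlDr lerDl ltW.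
apply/ler_addgt0Pr => e e0; pose w := Num.min w0 (e / (2 * P K)).
have wp : 0 < w by rewrite lt_min w00 divr_gt0// mulr_gt0.
have ww : w <= w0 by rewrite ge_min lexx.
have we : w * (2 * P K) <= e by rewrite -ler_pdivlMr ?mulr_gt0// ge_min lexx orbT.
by have := step w wp ww; move: we; lra.
Qed.

End price_process_of_volatility.

Theorem theorem3p4 (R : realType) (r x0 : R) (P phi sigma : R -> R)
    (hr : 0 < r) (hx0 : 0 < x0)
    (hP : regular_put_prices x0 P)
    (hphi : admissible_phi x0 P phi)
    (hsigma : is_volatility r phi sigma)
    (d : measure_display) (Omega : measurableType d)
    (Pr : probability Omega R) (W X : R -> Omega -> R)
    (hW : standard_brownian Pr W)
    (hX : is_price_process Pr (brownian_filtration Pr W) W r x0 sigma X) :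
  forall K : R, 0 < K ->
    put_price Pr (brownian_filtration Pr W) r X K = (P K)%:E.
Proof.
move=> K K0; apply/eqP; rewrite eq_le.
by rewrite (price_upper hW hr hx0 hP hphi hsigma hX K0) (price_lower hW hr hx0 hP hphi hsigma hX K0).
Qed.
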